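(* Let $W\in\{S_n,W^{\mathsf{BC}}_n,W^{\mathsf D}_n\}$ with $n\ge2$, with simple generators $S$, and let $\mathcal G=\mathcal G(W)$. Let $\mathcal M$ and $\mathcal N$ be the free $\mathbb Z[x,x^{-1}]$-modules with bases $\{M_z:z\in\mathcal G\}$ and $\{N_z:z\in\mathcal G\}$. Then $szs\in\mathcal G$ whenever $z\in\mathcal G$ and $s\in\mathrm{Asc}^<(z)\sqcup\mathrm{Des}^<(z)$, and there is a unique left $\mathcal H$-module structure on $\mathcal M$ with $H_sM_z=M_{szs}$ if $s\in\mathrm{Asc}^<(z)$; $H_sM_z=M_{szs}+(x-x^{-1})M_z$ if $s\in\mathrm{Des}^<(z)$; $H_sM_z=-x^{-1}M_z$ if $s\in\mathrm{Asc}^=(z)$; $H_sM_z=xM_z$ if $s\in\mathrm{Des}^=(z)$, and a unique left $\mathcal H$-module structure on $\mathcal N$ with $H_sN_z=N_{szs}$ if $s\in\mathrm{Asc}^<(z)$; $H_sN_z=N_{szs}+(x-x^{-1})N_z$ if $s\in\mathrm{Des}^<(z)$; $H_sN_z=xN_z$ if $s\in\mathrm{Asc}^=(z)$; $H_sN_z=-x^{-1}N_z$ if $s\in\mathrm{Des}^=(z)$, for all $s\in S$, $z\in\mathcal G$. Moreover, if $W$ is not $W^{\mathsf D}_n$ with $n$ even, then $\mathcal M_{\mathbb Q}=\mathbb Q(x)\otimes_{\mathbb Z[x,x^{-1}]}\mathcal M$ and $\mathcal N_{\mathbb Q}=\mathbb Q(x)\otimes_{\mathbb Z[x,x^{-1}]}\mathcal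 N$ are both Gelfand models for $\mathcal H_{\mathbb Q}(W)$.
   Context: For $i>0$ let $s_i=(i,i+1)(-i,-i-1)$, $s_0=(-1,1)$, $s_{-1}=(1,-2)(-1,2)$, permutations of $\mathbb Z$ (or of $\{\pm1,\dots,\pm N\}$). $W^{\mathsf{BC}}_N$ is the group of permutations $w$ of $\{\pm1,\dots,\pm N\}$ with $w(-i)=-w(i)$, a Coxeter group with generators $s_0,\dots,s_{N-1}$; $W^{\mathsf D}_N$ is the subgroup with $|\{i\in[N]:w(i)<0\}|$ even, a Coxeter group with generators $s_{-1},s_1,\dots,s_{N-1}$; $S_N=\langle s_1,\dots,s_{N-1}\rangle\subset W^{\mathsf{BC}}_N$ (the symmetric group on $[N]$). $\ell$ is Coxeter length. Sets: $\mathcal F^{\mathsf A}_{n-1}=\{z\in S_{2n}:z=z^{-1},\ z(i)\ne i\ \forall i\in[2n]\}$; $\mathcal F^{\mathsf{BC}}_n=\{z\in W^{\mathsf{BC}}_{2n}:z=z^{-1},\ |z(i)|\ne i\ \forall i\in[2n]\}$; $\mathcal F^{\mathsf D}_n=\{z\in\mathcal F^{\mathsf{BC}}_n: |\{i\in[n]:z(i)<-i\}|\text{ even}\}$. An integer $i>0$ is a visible descent of $z$ if $z(i+1)<\min\{i,z(i)\}$ or $z(i)<-i$. $\mathcal G^{\mathsf A}_{n-1},\mathcal G^{\mathsf{BC}}_n,\mathcal G^{\mathsf D}_n$ are the subsets of $\mathcal F^{\mathsf A}_{n-1},\mathcal F^{\mathsf{BC}}_n,\mathcal F^{\mathsf D}_n$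 of elements with no visible descent greater than $n$; $\mathcal G(W)$ is $\mathcal G^{\mathsf A}_{n-1},\mathcal G^{\mathsf{BC}}_n,\mathcal G^{\mathsf D}_n$ for $W=S_n,W^{\mathsf{BC}}_n,W^{\mathsf D}_n$ respectively. For $z\in\mathcal G(W)$, $\ell(z)$ denotes length in $S_{2n}$, $W^{\mathsf{BC}}_{2n}$, or $W^{\mathsf D}_{2n}$ respectively. For $z\in\mathcal G$: $\mathrm{Des}^=(z)=\{s\in S:sz=zs\}$, $\mathrm{Asc}^=(z)=\{s\in S:zsz\in\{s_i:i>n\}\}$, $\mathrm{Des}^<(z)=\{s\in S:\ell(sz)<\ell(z)\}\setminus(\mathrm{Des}^=(z)\sqcup\mathrm{Asc}^=(z))$, $\mathrm{Asc}^<(z)=\{s\in S:\ell(sz)>\ell(z)\}\setminus(\mathrm{Des}^=(z)\sqcup\mathrm{Asc}^=(z))$. $\mathcal H=\mathcal H(W)$ is the Iwahori–Hecke algebra: free $\mathbb Z[x,x^{-1}]$-module with basis $\{H_w:w\in W\}$ and the algebra structure with $H_sH_w=H_{sw}$ if $\ell(sw)>\ell(w)$ and $H_sH_w=H_{sw}+(x-x^{-1})H_w$ if $\ell(sw)<\ell(w)$. $\mathcal H_{\mathbb Q}=\mathbb Q(x)\otimes\mathcal H$. A Gelfand model for $\mathcal H_{\mathbb Q}$ is a left module isomorphic to the direct sum of all irreducible $\mathcal H_{\mathbb Q}$-modules, each isomorphism class appearing exactly once. *)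

(* Defs.v *)
From mathcomp Require Import all_ssreflect all_algebra all_fingroup.
From mathcomp Require Import boolp.

Unset Implicit Arguments.
Unset Strict Implicit.
Unset Printing Implicit Defensive.

Import GRing.Theory Num.Theory.
Local Open Scope ring_scope.

(* The point set {-N,...,-1,0,1,...,N} is encoded as 'I_(2N+1):          *)
(* k : 'I_(2N+1) stands for the integer k - N.  A permutation w of this  *)
(* set with w(-i) = -w(i) necessarily fixes 0, so such w are exactly the *)
(* signed permutations of {+-1,...,+-N}.                                 *)

Definition pt (N : nat) := 'I_(N.*2).+1.
Definition toZ {N : nat} (k : pt N) : int := (k : nat)%:Z - N%:Z.
Definition ofZ (N : nat) (a : int) : pt N := inord (absz (a + N%:Z)).

Definition apZ {N : nat} (w : {perm pt N}) (a : int) : int :=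
  if (absz a <= N)%N then toZ (w (ofZ N a)) else a.

(* function composition a o b  (MathComp's product is (a * b) x = b (a x)) *)
Definition permc {T : finType} (a b : {perm T}) : {perm T} := (b * a)%g.

(* simple reflections, as permutations of {-N..N} (meaningful for the   *)
(* indices used below: 1 <= i < N, N >= 2)                               *)
Definition sgen (N i : nat) : {perm pt N} :=
  (tperm (ofZ N i%:Z) (ofZ N (i%:Z + 1)) *
   tperm (ofZ N (- i%:Z)) (ofZ N (- i%:Z - 1)))%g.
Definition s0 (N : nat) : {perm pt N} := tperm (ofZ N (-1)) (ofZ N 1).
Definition sm1 (N : nat) : {perm pt N} :=
  (tperm (ofZ N 1) (ofZ N (-2)) * tperm (ofZ N (-1)) (ofZ N 2))%g.

Inductive CoxType := TA | TBC | TD.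

Definition gens (t : CoxType) (N r : nat) : seq {perm pt N} :=
  let sA := [seq sgen N i | i <- iota 1 r.-1] in
  match t with
  | TA => sA
  | TBC => s0 N :: sA
  | TD => sm1 N :: sA
  end.

Definition words {gT : finGroupType} (S : seq gT) (k : nat) : {set gT} :=
  iter k (fun A : {set gT} => [set (g * a)%g | g in [set:: S], a in A]) [set 1%g].

(* Coxeter length = minimal word length in the generators (for elements *)
(* of the generated group, which have word length < #|gT|)              *)
Definition wordlen {gT : finGroupType} (S : seq gT) (w : gT) : nat :=
  find (fun k => w \in words S k) (iota 0 #|gT|.+1).

Definition isBC {N : nat} (w : {perm pt N}) : bool :=
  [forall k : pt N, apZ w (- toZ k) == - apZ w (toZ k)].
Definition fixBeyond {N : nat} (r : nat) (w : {perm pt N}) : bool :=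
  [forall k : pt N, (r%:Z < `|toZ k|) ==> (apZ w (toZ k) == toZ k)].
Definition evenNeg {N : nat} (r : nat) (w : {perm pt N}) : bool :=
  ~~ odd (count (fun i : nat => apZ w i%:Z < 0) (iota 1 r)).

(* the group W of type t and rank r, inside the signed permutations of  *)
(* {+-1..+-N} (N >= r), acting trivially on +-(r+1),...,+-N             *)
Definition Wgrp (t : CoxType) (N r : nat) : {set {perm pt N}} :=
  match t with
  | TA => <<[set:: gens TA N r]>>%g
  | TBC => [set w | isBC w && fixBeyond r w]
  | TD => [set w | [&& isBC w, fixBeyond r w & evenNeg r w]]
  end.

Notation P n := {perm pt (n.*2)}.

Definition FBCb (n : nat) (z : P n) : bool :=
  [&& z \in Wgrp TBC (n.*2) (n.*2), (z^-1)%g == z &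
      all (fun i : nat => `|apZ z i%:Z| != i%:Z) (iota 1 (n.*2))].

Definition Fb (t : CoxType) (n : nat) (z : P n) : bool :=
  match t with
  | TA => [&& z \in Wgrp TA (n.*2) (n.*2), (z^-1)%g == z &
             all (fun i : nat => apZ z i%:Z != i%:Z) (iota 1 (n.*2))]
  | TBC => FBCb n z
  | TD => FBCb n z && ~~ odd (count (fun i : nat => apZ z i%:Z < - i%:Z) (iota 1 n))
  end.

Definition visDes {N : nat} (z : {perm pt N}) (i : int) : Prop :=
  0 < i /\ (apZ z (i + 1) < Num.min i (apZ z i) \/ apZ z i < - i).

Definition Gset (t : CoxType) (n : nat) : {set P n} :=
  [set z | Fb t n z && `[< forall i : int, n%:Z < i -> ~ visDes z i >]].

Definition Sgen (t : CoxType) (n : nat) : seq (P n) := gens t (n.*2) n.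
Definition WW (t : CoxType) (n : nat) : {set P n} := Wgrp t (n.*2) n.
Definition lenW (t : CoxType) (n : nat) (w : P n) : nat := wordlen (Sgen t n) w.
Definition lenBig (t : CoxType) (n : nat) (w : P n) : nat :=
  wordlen (gens t (n.*2) (n.*2)) w.

Definition DesEq (n : nat) (s z : P n) : Prop := permc s z = permc z s.
Definition AscEq (n : nat) (s z : P n) : Prop :=
  exists i : nat, (n < i < n.*2)%N /\ permc z (permc s z) = sgen (n.*2) i.
Definition DesLt (t : CoxType) (n : nat) (s z : P n) : Prop :=
  (lenBig t n (permc s z) < lenBig t n z)%N /\ ~ DesEq n s z /\ ~ AscEq n s z.
Definition AscLt (t : CoxType) (n : nat) (s z : P n) : Prop :=
  (lenBig t n z < lenBig t n (permc s z))%N /\ ~ DesEq n s z /\ ~ AscEq n s z.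

(* Coefficients: K = Frac(Z[x]) = Q(x); Z[x,x^-1] is a subring of K.     *)

Definition K := {fraction {poly int}}.
Definition xK : K := @FracField.tofrac _ ('X : {poly int}).
Definition isLaurent (f : K) : Prop :=
  exists (k : nat) (p : {poly int}), f = @FracField.tofrac _ p / xK ^+ k.

(* A left H(W)-module structure on an F-module V (q the parameter x) is  *)
(* given by the actions rho w of the basis elements H_w (w in W): linear *)
(* maps with H_1 = id and H_s H_w = H_{sw} if l(sw) > l(w),             *)
(* H_s H_w = H_{sw} + (q - q^-1) H_w otherwise.                          *)

Section Hecke.
Variables (F : fieldType) (T : finType) (W : {set {perm T}})
  (S : seq {perm T}) (len : {perm T} -> nat) (q : F).

Definition heckeRep {V : lmodType F} (rho : {perm T} -> V -> V) : Prop :=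
  (forall w, w \in W -> forall (a : F) (u v : V),
      rho w (a *: u + v) = a *: rho w u + rho w v) /\
  (forall v, rho 1%g v = v) /\
  (forall s w v, s \in S -> w \in W ->
     rho s (rho w v) =
       if (len w < len (permc s w))%N then rho (permc s w) v
       else rho (permc s w) v + (q - q^-1) *: rho w v).

Definition subspace {V : lmodType F} (U : V -> Prop) : Prop :=
  U 0 /\ (forall u v, U u -> U v -> U (u + v)) /\
  (forall (a : F) u, U u -> U (a *: u)).

Definition invariant {V : lmodType F} (rho : {perm T} -> V -> V)
  (U : V -> Prop) : Prop :=
  forall w u, w \in W -> U u -> U (rho w u).

Definition irreducible {V : lmodType F} (rho : {perm T} -> V -> V) : Prop :=
  (exists v : V, v != 0) /\
  forall U : V -> Prop, subspace U -> invariant rho U ->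
    (forall u, U u -> u = 0) \/ (forall u, U u).

Definition intertwiner {V1 V2 : lmodType F} (rho1 : {perm T} -> V1 -> V1)
  (rho2 : {perm T} -> V2 -> V2) (f : V1 -> V2) : Prop :=
  (forall (a : F) u v, f (a *: u + v) = a *: f u + f v) /\
  (forall w v, w \in W -> f (rho1 w v) = rho2 w (f v)).

Definition isoRep {V1 V2 : lmodType F} (rho1 : {perm T} -> V1 -> V1)
  (rho2 : {perm T} -> V2 -> V2) : Prop :=
  exists f : V1 -> V2, intertwiner rho1 rho2 f /\ bijective f.

Definition gelfandModel {V : lmodType F} (rho : {perm T} -> V -> V) : Prop :=
  exists (k : nat) (Vs : 'I_k -> lmodType F)
         (rhos : forall j, {perm T} -> Vs j -> Vs j)
         (iota : forall j, Vs j -> V),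
    (forall j, heckeRep (rhos j) /\ irreducible (rhos j)) /\
    (forall i j, i != j -> ~ isoRep (rhos i) (rhos j)) /\
    (forall (V' : lmodType F) (rho' : {perm T} -> V' -> V'),
        heckeRep rho' -> irreducible rho' -> exists j, isoRep rho' (rhos j)) /\
    (forall j, intertwiner (rhos j) rho (iota j)) /\
    (forall v : V, exists vs : forall j, Vs j,
        v = \sum_(j < k) iota j (vs j) /\
        forall vs' : forall j, Vs j, v = \sum_(j < k) iota j (vs' j) ->
          forall j, vs' j = vs j).
End Hecke.

Arguments heckeRep {F T} W S len q {V} rho.
Arguments subspace {F V} U.
Arguments invariant {F T} W {V} rho U.
Arguments irreducible {F T} W {V} rho.
Arguments intertwiner {F T} W {V1 V2} rho1 rho2 f.
Arguments isoRep {F T} W {V1 V2} rho1 rho2.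
Arguments gelfandModel {F T} W S len q {V} rho.


(* Q(x) (x) M = K^G (functions G -> K, basis M_z = indicator of z); the  *)
(* free Z[x,x^-1]-module M is the lattice of vectors with Laurent        *)
(* coordinates.  A Z[x,x^-1]-linear H-action on M is the same as a       *)
(* K-linear H_Q-action on K^G preserving this lattice.                   *)

Definition Gt (t : CoxType) (n : nat) := {z : P n | z \in Gset t n}.
Definition Vmod (t : CoxType) (n : nat) : lmodType K := {ffun Gt t n -> K^o}.
Definition bM (t : CoxType) (n : nat) (z : P n) : Vmod t n :=
  [ffun y => ((val y == z)%:R : K)].

Definition laurentVec (t : CoxType) (n : nat) (v : Vmod t n) : Prop :=
  forall y, isLaurent (v y).

Definition preservesLattice (t : CoxType) (n : nat)
  (rho : P n -> Vmod t n -> Vmod t n) : Prop :=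
  forall w v, w \in WW t n -> laurentVec t n v -> laurentVec t n (rho w v).

Definition rulesM (t : CoxType) (n : nat) (rho : P n -> Vmod t n -> Vmod t n) : Prop :=
  forall s z, s \in Sgen t n -> z \in Gset t n ->
    (AscLt t n s z -> rho s (bM t n z) = bM t n (permc s (permc z s))) /\
    (DesLt t n s z -> rho s (bM t n z) =
                      bM t n (permc s (permc z s)) + (xK - xK^-1) *: bM t n z) /\
    (AscEq n s z -> rho s (bM t n z) = (- xK^-1) *: bM t n z) /\
    (DesEq n s z -> rho s (bM t n z) = xK *: bM t n z).

Definition rulesN (t : CoxType) (n : nat) (rho : P n -> Vmod t n -> Vmod t n) : Prop :=
  forall s z, s \in Sgen t n -> z \in Gset t n ->
    (AscLt t n s z -> rho s (bM t n z) = bM t n (permc s (permc z s))) /\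
    (DesLt t n s z -> rho s (bM t n z) =
                      bM t n (permc s (permc z s)) + (xK - xK^-1) *: bM t n z) /\
    (AscEq n s z -> rho s (bM t n z) = xK *: bM t n z) /\
    (DesEq n s z -> rho s (bM t n z) = (- xK^-1) *: bM t n z).

Definition isHrep (t : CoxType) (n : nat) (rho : P n -> Vmod t n -> Vmod t n) : Prop :=
  heckeRep (WW t n) (Sgen t n) (lenW t n) xK rho /\ preservesLattice t n rho.

Definition modM (t : CoxType) (n : nat) (rho : P n -> Vmod t n -> Vmod t n) : Prop :=
  isHrep t n rho /\ rulesM t n rho.
Definition modN (t : CoxType) (n : nat) (rho : P n -> Vmod t n -> Vmod t n) : Prop :=
  isHrep t n rho /\ rulesN t n rho.

(* Main.v *)
Require Import Defs.
From HB Require Import structures.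
From mathcomp Require Import all_boot all_order all_algebra all_fingroup.
From mathcomp Require Import boolp zify ring.

(** Each generator acts through a signed transposition [stransp p q], so the quadratic and braid
relations for the operators of the statement are checked pointwise on the values [z p, z q],
and Matsumoto's argument turns them into a module over the Hecke algebra.

For the Gelfand property, specialise at [x = 1], where the generators act by symmetric
matrices.  Faithfulness: a nonzero left ideal [I] killing the module contains, by an induction
that symmetrises over maximal blocks, an involution [zeta] and a vector on which the
centraliser of [zeta] acts by the sign of its action on the fixed points; this vector induces
an equivariant map from the module to [I], nonzero and killed by [I], against positivity of the
dot product.  Multiplicity freeness: the image [A] of the group algebra satisfies
[dim Sym A - dim Alt A = #involutions of W >= #G], and this forces the commutant of [A] to
consist of symmetric matrices.  Both properties lift to [Q(x)] by clearing denominators, and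
there a faithful self-adjoint module without antisymmetric intertwiners is a Gelfand model. *)

Set Implicit Arguments.
Unset Strict Implicit.
Unset Printing Implicit Defensive.

Import GRing.Theory Num.Theory Order.TTheory.
Local Open Scope ring_scope.

(** * Odd functions and parity *)

Lemma odd_fun0 (f : int -> int) : {morph f : x / - x} -> f 0 = 0.
Proof. by move=> fN; have := fN 0; rewrite oppr0; move: (f 0) => y; lia. Qed.

Lemma odd_int_ind (Q : int -> Prop) : (forall x, Q x -> Q (- x)) -> (forall m : nat, Q m%:Z) -> forall x, Q x.
Proof.
move=> QN Q_nat x; case: (leP 0 x) => hx; first by have -> : x = (absz x)%:Z by lia.
by have -> : x = - (absz x)%:Z by [lia]; apply: QN.
Qed.

Lemma even_size_fpf_involution (T : eqType) (f : T -> T) (s : seq T) : uniq s ->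
  {in s, forall x, [/\ f x \in s, f (f x) = x & f x != x]} -> ~~ odd (size s).
Proof.
have [m] := ubnP (size s); elim: m s => // m IH [//|x s] size_lt /andP[x_notin s_uniq] f_s.
have [fx_mem fxK fx_neq] := f_s x (mem_head x s).
have fx_s : f x \in s by move: fx_mem; rewrite inE (negbTE fx_neq).
move: size_lt; rewrite /= (perm_size (perm_to_rem fx_s)) /= negbK => /ltnW size_lt.
apply: IH => [||y]; [exact: size_lt | exact: rem_uniq |].
rewrite !mem_rem_uniq // !inE => /andP[y_neq y_s].
have [fy_mem fyK fy_neq] := f_s y (mem_behead (s := x :: s) y_s).
split=> //; apply/andP; split.
  by apply: contraNneq x_notin => /(congr1 f); rewrite fxK fyK => <-.
by move: fy_mem; rewrite inE => /predU1P[fyx|//]; rewrite -fyx fyK eqxx in y_neq.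
Qed.

Lemma even_card_fpf_involution (T : finType) (A : {set T}) (f : T -> T) :
  {in A, forall x, [/\ f x \in A, f (f x) = x & f x != x]} -> ~~ odd #|A|.
Proof.
move=> f_A; rewrite cardE; apply: (even_size_fpf_involution (f := f)) => [|x]; first exact: enum_uniq.
by rewrite !mem_enum; exact: f_A.
Qed.

Section ParityOfCounts.
Variable T : eqType.
Implicit Types (a b : pred T) (s : seq T) (x y : T).

Lemma odd_count_addb a b s :
  odd (count (fun x => a x (+) b x) s) = odd (count a s) (+) odd (count b s).
Proof. by elim: s => //= x s IH; rewrite !oddD IH !oddb addbACA. Qed.

Lemma odd_count_toggle a x s : uniq s -> x \in s ->
  odd (count (fun y => a y (+) (y == x)) s) = ~~ odd (count a s).
Proof. by move=> s_uniq xs; rewrite (odd_count_addb a (pred1 x)) count_uniq_mem // xs addbT. Qed.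

Lemma even_count_pair a x y s : uniq s -> x \in s -> y \in s -> x != y ->
  {in s, forall z, z != x -> z != y -> ~~ a z} -> a x = a y -> ~~ odd (count a s).
Proof.
move=> s_uniq xs ys xy a_other axy.
rewrite (@eq_in_count _ _ (fun z => (if a x then z == x else false) (+) (if a x then z == y else false))).
  by case: (a x); rewrite odd_count_addb ?addbb // !count_uniq_mem // xs ys.
move=> z zs; case: (eqVneq z x) => [->|zx]; first by rewrite (negbTE xy); case: (a x).
case: (eqVneq z y) => [->|zy]; first by rewrite -axy; case: (a x).
by rewrite (negbTE (a_other z zs zx zy)); case: (a x).
Qed.

End ParityOfCounts.

Lemma ltr_sum_pair (I : finType) (R : numDomainType) (f g : I -> R) (x y : I) : x != y ->
  (forall z, z != x -> z != y -> f z = g z) -> f x + f y < g x + g y -> \sum_z f z < \sum_z g z.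
Proof.
move=> xy fg lt_xy; rewrite eq_sym in xy.
rewrite (bigD1 x) //= (bigD1 y) //= [ltRHS](bigD1 x) //= [X in _ < _ + X](bigD1 y) //=.
by rewrite !addrA (eq_bigr g) ?ltrD2r // => z /andP[zx zy]; exact: fg.
Qed.

Lemma mulr_neg_invr_quadratic (F : fieldType) (x : F) : x != 0 ->
  (- x^-1) * (- x^-1) = 1 + (x - x^-1) * (- x^-1).
Proof. by move=> x0; field. Qed.

Lemma mulr_quadratic (F : fieldType) (x : F) : x != 0 -> x * x = 1 + (x - x^-1) * x.
Proof. by move=> x0; field. Qed.

(** * Symmetric bilinear forms *)

Lemma exists_minimizer (T : Type) (Q : T -> Prop) (m : T -> nat) :
  (exists x, Q x) -> exists2 x, Q x & forall y, Q y -> (m x <= m y)%N.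
Proof.
move=> [x0 Qx0]; pose attained k := `[< exists2 x, Q x & m x = k >].
have ex_attained : exists k, attained k by exists (m x0); apply/asboolP; exists x0.
case: (ex_minnP ex_attained) => k /asboolP[x Qx <-] k_min; exists x => // y Qy.
by apply: k_min; apply/asboolP; exists y.
Qed.

Definition linear_of (R : nzRingType) (U V : lmodType R) (f : U -> V) (fL : linear f) : {linear U -> V} :=
  HB.pack f (GRing.isLinear.Build R U V *:%R f fL).

Section LinearFunctions.
Variables (R : nzRingType) (U V : lmodType R) (f : U -> V).
Hypothesis f_linear : linear f.

Lemma linear_fun0 : f 0 = 0. Proof. exact: linear0 (linear_of f_linear). Qed.

Lemma linear_funD u v : f (u + v) = f u + f v.
Proof. exact: linearD (linear_of f_linear) u v. Qed.

Lemma linear_funB u v : f (u - v) = f u - f v.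
Proof. exact: linearB (linear_of f_linear) u v. Qed.

Lemma linear_funZ a u : f (a *: u) = a *: f u.
Proof. exact: linearZZ (linear_of f_linear) a u. Qed.

Lemma linear_fun_sum (I : Type) (r : seq I) (P : pred I) (E : I -> U) :
  f (\sum_(i <- r | P i) E i) = \sum_(i <- r | P i) f (E i).
Proof. exact: (raddf_sum (linear_of f_linear)). Qed.

End LinearFunctions.

Lemma ffun_delta_expand (R : nzRingType) (I : finType) (v : {ffun I -> R^o}) :
  v = \sum_i (v i : R) *: ([ffun j => (j == i)%:R] : {ffun I -> R^o}).
Proof.
apply/ffunP => j; rewrite sum_ffunE (bigD1 j) //= !ffunE eqxx big1 ?addr0 => [|i ij]; first by rewrite /GRing.scale /= mulr1.
by rewrite !ffunE eq_sym (negbTE ij) scaler0.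
Qed.

Section FfunDot.
Variables (R : comNzRingType) (I : finType).
Implicit Types a b : {ffun I -> R^o}.

Definition ffun_dot a b : R := \sum_i a i * b i.

Lemma ffun_dotC a b : ffun_dot a b = ffun_dot b a.
Proof. by apply: eq_bigr => i _; rewrite mulrC. Qed.

Fact ffun_dot_linear_l b : linear_for *%R (ffun_dot^~ b).
Proof.
move=> k a a'; rewrite /ffun_dot mulr_sumr -big_split; apply: eq_bigr => i _.
by rewrite !ffunE mulrDl -mulrA.
Qed.

Fact ffun_dot_bilinear : bilinear_for *%R (idfun \; *%R) ffun_dot.
Proof.
split=> [b|a k b b']; first exact: ffun_dot_linear_l.
by rewrite !(ffun_dotC a) ffun_dot_linear_l.
Qed.

HB.instance Definition _ := bilinear_isBilinear.Build R _ _ R *%R (idfun \; *%R) ffun_dot ffun_dot_bilinear.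

Fact ffun_dot_symmetric a b : ffun_dot a b = (-1) ^+ false * idfun (ffun_dot b a).
Proof. by rewrite expr0 mul1r ffun_dotC. Qed.

HB.instance Definition _ := isHermitianSesquilinear.Build R _ false idfun ffun_dot ffun_dot_symmetric.
End FfunDot.

Section AnisotropicForms.
Variables (F : fieldType) (V : vectType F) (B : {symmetric V}).
Hypothesis B_anisotropic : forall v, B v v = 0 -> v = 0.
Implicit Types (u v w : V) (U : {vspace V}).

Lemma symm_formC u v : B u v = B v u.
Proof. by rewrite hermC expr0 mul1r. Qed.

Lemma form_interpolation U (c : 'I_(\dim U) -> F) :
  exists2 u, u \in U & forall i : 'I_(\dim U), B u (vbasis U)`_i = c i.
Proof.
pose values u : 'rV_(\dim U) := \row_(i < \dim U) B u (vbasis U)`_i.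
have values_linear : linear values.
  by move=> k u v; apply/rowP=> i; rewrite !mxE linearPl.
pose f := linfun (linear_of values_linear).
have fE u : f u = values u by rewrite lfunE.
suff /subvP/(_ (\row_(i < \dim U) c i)) : (fullv <= f @: U)%VS.
  rewrite memvf => /(_ isT)/memv_imgP[u uU]; rewrite fE => /rowP cE.
  by exists u => // i; have := cE i; rewrite !mxE.
suff ker0 : (U :&: lker f = 0)%VS.
  by rewrite -(geq_leqif (dimv_leqif_sup (subvf _))) limg_dim_eq ?dimvf /dim /= ?mul1n.
apply/eqP; rewrite -subv0; apply/subvP=> u; rewrite memv_cap memv_ker memv0 fE.
case/andP=> uU /eqP u0; apply/eqP/B_anisotropic; rewrite {2}(coord_vbasis uU) linear_sumr big1 // => i _.
by rewrite linearZr /=; move/rowP/(_ i): u0; rewrite !mxE => ->; rewrite mulr0.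
Qed.

Lemma capv_orthov U : (U :&: orthov B U = 0)%VS.
Proof.
apply/eqP; rewrite -subv0; apply/subvP=> u; rewrite memv_cap memv0 => /andP[uU /mem_orthovP uO].
by apply/eqP/B_anisotropic/uO.
Qed.

Lemma addv_orthov U : (U + orthov B U = fullv)%VS.
Proof.
apply/eqP; rewrite eqEsubv subvf; apply/subvP => v _.
have [u uU uE] := form_interpolation (fun i : 'I_(\dim U) => B v (vbasis U)`_i).
rewrite -(subrK u v) addrC memv_add //; apply/mem_orthovP => w wU.
rewrite (coord_vbasis wU) linear_sumr big1 // => i _.
by rewrite linearZr /= linearBl /= uE subrr mulr0.
Qed.

Lemma form_representation (h : {linear V -> F^o}) : exists r, forall u, h u = B r u.
Proof.
have [r _ rE] := form_interpolation (fun i : 'I_(\dim fullv) => h (vbasis fullv)`_i).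
exists r => u; rewrite (coord_vbasis (memvf u)) linear_sumr linear_sum.
by apply: eq_bigr => i _; rewrite linearZr linearZ /= rE.
Qed.

Lemma form_adjoint (c : {linear V -> V}) : exists c' : {linear V -> V}, forall u v, B (c u) v = B u (c' v).
Proof.
have /choice[c' c'E] v : exists r, forall u, B (c u) v = B u r.
  have hL : linear (fun u => B (c u) v : F^o) by move=> k u w; rewrite linearP linearPl.
  have [r rE] := form_representation (linear_of hL); exists r => u.
  by rewrite -[LHS]/(linear_of hL u) rE symm_formC.
have c'L : linear c'.
  move=> k u v; apply/eqP; rewrite -subr_eq0; apply/eqP/B_anisotropic.
  by rewrite linearBr linearPr /= -!c'E linearPr /= subrr.
by exists (linear_of c'L).
Qed.

Definition orth_proj U : 'End(V) := daddv_pi U (orthov B U).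

Lemma orth_proj_mem U v : orth_proj U v \in U.
Proof. exact: memv_pi. Qed.

Lemma orth_proj_id U v : v \in U -> orth_proj U v = v.
Proof. exact: daddv_pi_id (capv_orthov U). Qed.

Lemma sub_orth_proj U v : v - orth_proj U v \in orthov B U.
Proof.
have vUO : v \in (U + orthov B U)%VS by rewrite addv_orthov memvf.
rewrite -{1}(daddv_pi_add (capv_orthov U) vUO) addrC addKr; exact: memv_pi.
Qed.

Lemma orth_proj_eq U u v : u \in U -> v - u \in orthov B U -> orth_proj U v = u.
Proof.
move=> uU vuO; apply/eqP; rewrite -subr_eq0 -memv0 -(capv_orthov U) memv_cap.
rewrite memvB ?orth_proj_mem //=.
have -> : orth_proj U v - u = (v - u) - (v - orth_proj U v).
  by rewrite opprB [RHS]addrC addrA subrK.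
by rewrite memvB ?sub_orth_proj.
Qed.

Lemma orth_proj0 U v : v \in orthov B U -> orth_proj U v = 0.
Proof. by move=> vO; apply: orth_proj_eq; rewrite ?mem0v // subr0. Qed.

Lemma orthov_selfadjoint U (f : {linear V -> V}) : (forall u v, B (f u) v = B u (f v)) ->
  {in U, forall u, f u \in U} -> {in orthov B U, forall v, f v \in orthov B U}.
Proof. by move=> fB fU v /mem_orthovP vO; apply/mem_orthovP => u uU; rewrite fB vO ?fU. Qed.

Lemma orth_proj_selfadjoint U (f : {linear V -> V}) : (forall u v, B (f u) v = B u (f v)) ->
  {in U, forall u, f u \in U} -> forall v, orth_proj U (f v) = f (orth_proj U v).
Proof.
move=> fB fU v; apply: orth_proj_eq; first by rewrite fU ?orth_proj_mem.
by rewrite -linearB (orthov_selfadjoint fB fU) ?sub_orth_proj.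
Qed.

End AnisotropicForms.

Lemma subspace_vspace (F : fieldType) (V : vectType F) (Q : V -> Prop) :
  subspace Q -> exists U : {vspace V}, forall v, v \in U <-> Q v.
Proof.
move=> [Q0 [QD QZ]]; pose inside (U : {vspace V}) := forall v, v \in U -> Q v.
have inside0 : inside 0%VS by move=> v; rewrite memv0 => /eqP->.
have [U UQ U_max] :=
  exists_minimizer (fun U => \dim (fullv : {vspace V}) - \dim U)%N (ex_intro inside 0%VS inside0).
exists U => v; split=> [/UQ //|Qv].
have UvQ : inside (U + <[v]>)%VS.
  by move=> w /memv_addP[u /UQ Qu [x /vlineP[k ->] ->]]; apply: QD => //; exact: QZ.
suff /eqP-> : U == (U + <[v]>)%VS by apply: (subvP (addvSr U <[v]>)); exact: memv_line.
rewrite eqEdim addvSl /=; have := U_max _ UvQ; have := dimvS (subvf (U + <[v]>)).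
by move: (\dim fullv) (\dim (U + <[v]>)) (\dim U) => *; lia.
Qed.

(** * Commutants of symmetric matrices *)

Section Perturbation.
Variable F : numFieldType.

Lemma det_perturbation (k : nat) (Z : 'M[F]_k) :
  exists2 l : F, l != 0 & \det (1%:M + l *: Z) != 0.
Proof.
pose p : {poly F} := \det (1%:M + 'X *: map_mx polyC Z).
have pE l : p.[l] = \det (1%:M + l *: Z).
  rewrite -horner_evalE /p -det_map_mx; congr (\det _); apply/matrixP => i j.
  rewrite !mxE /= ?horner_evalE ?/horner_eval hornerD hornerM hornerX hornerC.
  by case: (i == j); rewrite ?mulr1n ?mulr0n ?hornerE.
have p_neq0 : p != 0.
  apply: contraTneq (oner_neq0 F) => p0; have := pE 0.
  by rewrite p0 horner0 scale0r addr0 det1 => <-; rewrite eqxx.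
have [i ni] : exists i : nat, ~~ root p i.+1%:R.
  apply: contrapT => no_nonroot.
  have all_root : all (root p) [seq i.+1%:R | i <- iota 0 (size p)].
    by apply/allP => r /mapP[i _ ->]; apply: contrapT => /negP ni; apply: no_nonroot; exists i.
  have uniq_points : uniq [seq i.+1%:R : F | i <- iota 0 (size p)].
    by rewrite map_inj_uniq ?iota_uniq // => i j /eqP; rewrite eqr_nat => /eqP[].
  by have := max_poly_roots p_neq0 all_root uniq_points; rewrite size_map size_iota ltnn.
by exists i.+1%:R; [rewrite pnatr_eq0 | rewrite -pE].
Qed.

Lemma free_perturbation (V : vectType F) (k : nat) (X : k.-tuple V) (Y : 'I_k -> V) : free X ->
  exists2 l : F, l != 0 & free [tuple X`_i + l *: Y i | i < k].
Proof.
move=> X_free; pose Z := \matrix_(i < k, j < k) coord X j (Y i).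
have [l l_neq0 det_neq0] := det_perturbation Z; exists l => //; apply/freeP => c c_rel.
pose C := \row_i c i.
suff C0 : C = 0 by move=> i; have /matrixP/(_ 0 i) := C0; rewrite !mxE.
have Z_unit : 1%:M + l *: Z \in unitmx by rewrite unitmxE unitfE.
suff CZ : C *m (1%:M + l *: Z) = 0 by rewrite -[C](mulmxK Z_unit) CZ mul0mx.
apply/rowP => j; rewrite !mxE.
have := congr1 (coord X j) c_rel; rewrite linear0 linear_sum /= => coord_rel.
rewrite -[RHS]coord_rel; apply: eq_bigr => i _; rewrite linearZ /= !mxE; congr (_ * _).
by rewrite nth_mktuple linearD linearZ /= (coord_free _ _ X_free) eq_sym.
Qed.

Lemma limg_perturbation (V V' : vectType F) (f g : 'Hom(V, V')) (U : {vspace V}) (v : V) :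
  v \in U -> f v = 0 -> g v \notin (f @: U)%VS ->
  exists l : F, (\dim (f @: U) < \dim ((f + l *: g)%R @: U))%N.
Proof.
move=> vU fv0 gvN; set I := (f @: U)%VS in gvN *.
have /choice[x xP] (i : 'I_(\dim I)) : exists u, u \in U /\ f u = (vbasis I)`_i.
  have /memv_imgP[u uU ->] : (vbasis I)`_i \in I; last by exists u.
  by apply: vbasis_mem; rewrite mem_nth ?size_tuple.
pose X := [tuple of rcons (vbasis I) (g v)].
have X_free : free X.
  have perm_X : perm_eq X (g v :: vbasis I) by rewrite /X /= perm_rcons.
  rewrite (perm_free perm_X) free_cons.
  by rewrite (span_basis (vbasisP I)) gvN (basis_free (vbasisP I)).
pose Y (i : 'I_(\dim I).+1) : V' := if insub (i : nat) is Some j then g (x j) else 0.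
have [l l_neq0 free_XY] := free_perturbation Y X_free; exists l.
set XY := [tuple X`_i + l *: Y i | i < (\dim I).+1] in free_XY.
suff /dimvS : (<<XY>> <= (f + l *: g)%R @: U)%VS by rewrite (eqP free_XY) size_tuple.
have fgE u : (f + l *: g)%R u = f u + l *: g u by rewrite add_lfunE scale_lfunE.
apply/span_subvP => u /tnthP[i ->]; rewrite tnth_mktuple /X /= nth_rcons size_tuple.
case: ltnP => i_lt.
  have [xU xE] := xP (Ordinal i_lt).
  by rewrite /Y insubT /= -[(vbasis I)`_i]xE -fgE memv_img.
have -> : Y i = 0 by rewrite /Y insubN // -leqNgt.
have -> : nat_of_ord i = \dim I by apply/eqP; rewrite eqn_leq i_lt -ltnS ltn_ord.
rewrite eqxx scaler0 addr0 -[g v](scalerK l_neq0) memvZ //.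
by rewrite -[l *: g v]add0r -fv0 -fgE memv_img.
Qed.

End Perturbation.

Section CommutingSymmetricMatrices.
Variables (F : realFieldType) (d : nat) (Z : {vspace 'M[F]_d}).
Hypothesis Z_symmetric : {in Z, forall a, a^T = a}.
Hypothesis Z_comm : {in Z &, forall a b, a *m b = b *m a}.
Implicit Types (a b c : 'M[F]_d) (x w : 'cV[F]_d).

Lemma mxtrace_sqr_eq0 (p q : nat) (m : 'M[F]_(p, q)) : \tr (m^T *m m) = 0 -> m = 0.
Proof.
move=> /eqP tr0; apply/matrixP => i j; rewrite mxE; apply/eqP; move: tr0.
have -> : \tr (m^T *m m) = \sum_j \sum_i m i j ^+ 2.
  by apply: eq_bigr => k _; rewrite mxE; apply: eq_bigr => l _; rewrite mxE expr2.
rewrite psumr_eq0 => [/allP/(_ j)|k _]; last by apply: sumr_ge0 => l _; exact: sqr_ge0.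
rewrite mem_index_enum => /(_ isT) /=; rewrite psumr_eq0 => [/allP/(_ i)|l _]; last exact: sqr_ge0.
by rewrite mem_index_enum sqrf_eq0 => /(_ isT).
Qed.

Lemma col_sqr_eq0 x : (x^T *m x) 0 0 = 0 -> x = 0.
Proof. by move=> x0; apply: mxtrace_sqr_eq0; rewrite /mxtrace big_ord1. Qed.

Definition eval_at x : 'Hom('M[F]_d, 'cV[F]_d) := linfun (mulmxr x).

Lemma eval_atE x a : eval_at x a = a *m x. Proof. exact: lfunE. Qed.

Definition annihilator x : {vspace 'M[F]_d} := (Z :&: lker (eval_at x))%VS.

Lemma annihilatorP x a : a \in annihilator x = (a \in Z) && (a *m x == 0).
Proof. by rewrite memv_cap memv_ker eval_atE. Qed.

Lemma annihilatorD a x w b : a \in annihilator x ->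
  b \in annihilator (x + a *m w) -> b *m x = 0 /\ b *m (a *m w) = 0.
Proof.
rewrite !annihilatorP mulmxDr => /andP[aZ /eqP ax0] /andP[bZ /eqP bxw0].
have bxE : b *m x = - (b *m (a *m w)) by apply/eqP; rewrite -addr_eq0 bxw0.
suff bx0 : b *m x = 0 by split=> //; move: bxw0; rewrite bx0 add0r.
apply: col_sqr_eq0; rewrite {2}bxE mulmxN trmx_mul Z_symmetric //.
have -> : x^T *m b *m (b *m (a *m w)) = (b *m (b *m (a *m x)))^T *m w.
  rewrite !trmx_mul !Z_symmetric // !mulmxA; congr (_ *m w).
  by rewrite -[LHS]mulmxA (Z_comm bZ aZ) // !mulmxA -[x^T *m b *m a]mulmxA (Z_comm bZ aZ) // !mulmxA.
by rewrite ax0 !mulmx0 trmx0 mul0mx oppr0 mxE.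
Qed.

Lemma exists_separating_vector : exists x, annihilator x = 0%VS.
Proof.
have [x _ x_min] := exists_minimizer (fun x => \dim (annihilator x)) (ex_intro xpredT 0 isT).
exists x; apply/eqP; rewrite -subv0; apply/subvP => a aAnn; rewrite memv0.
have [aZ ax0] : a \in Z /\ a *m x = 0 by move: aAnn; rewrite annihilatorP => /andP[-> /eqP].
apply/eqP/matrixP=> i j; set w : 'cV[F]_d := delta_mx j 0.
suff aw0 : a *m w = 0 by move: aw0; rewrite -colE => /matrixP/(_ i 0); rewrite !mxE.
have sub : (annihilator (x + a *m w) <= annihilator x)%VS.
  apply/subvP => b bAnn; rewrite annihilatorP (annihilatorD aAnn bAnn).1 eqxx andbT.
  by move: bAnn; rewrite annihilatorP => /andP[].
have := x_min (x + a *m w) isT; rewrite (geq_leqif (dimv_leqif_sup sub)) => /subvP/(_ a aAnn) aAnn'.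
apply: col_sqr_eq0; have [_ aaw0] := annihilatorD aAnn aAnn'.
by rewrite trmx_mul Z_symmetric // -mulmxA aaw0 mulmx0 mxE.
Qed.

(* For a separating vector [x], evaluation at [x] identifies [Z] with the whole space;
   if [c x = a x] with [a] in [Z], then [c] and [a] agree on [Z x], that is everywhere. *)
Lemma commutant_of_large_comm_algebra c : (d <= \dim Z)%N ->
  {in Z, forall a, a *m c = c *m a} -> c \in Z.
Proof.
move=> dimZ cZ; have [x ann0] := exists_separating_vector.
have full : (eval_at x @: Z)%VS = fullv.
  apply/eqP; rewrite eqEdim subvf /= dimvf /dim /= muln1.
  by have := limg_ker_dim (eval_at x) Z; rewrite -/(annihilator x) ann0 dimv0 add0n => ->.
have eval_onto w : exists2 a, a \in Z & w = a *m x.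
  have /memv_imgP[a aZ ->] : w \in (eval_at x @: Z)%VS by rewrite full memvf.
  by exists a; rewrite ?eval_atE.
have [a aZ cx] := eval_onto (c *m x); suff -> : c = a by [].
apply/matrixP => i j; have [b bZ bx] := eval_onto (delta_mx j 0).
have : c *m (delta_mx j 0 : 'cV[F]_d) = a *m delta_mx j 0.
  by rewrite bx !mulmxA -(cZ b bZ) -mulmxA cx mulmxA (Z_comm bZ aZ).
by rewrite -!colE => /matrixP/(_ i 0); rewrite !mxE.
Qed.

End CommutingSymmetricMatrices.

Section SymmetricPart.
Variables (F : realFieldType) (d : nat) (A : {vspace 'M[F]_d}).
Hypothesis A_mul : {in A &, forall a b, a *m b \in A}.
Implicit Types (a b c t s v : 'M[F]_d).

Definition sym_part : {vspace 'M[F]_d} := (A :&: lker (linfun (@trmx F d d) - \1%VF)%R)%VS.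
Definition alt_part : {vspace 'M[F]_d} := (A :&: lker (linfun (@trmx F d d) + \1%VF)%R)%VS.

Lemma sym_partP a : a \in sym_part = (a \in A) && (a^T == a).
Proof. by rewrite memv_cap memv_ker add_lfunE opp_lfunE id_lfunE lfunE subr_eq0. Qed.

Lemma alt_partP a : a \in alt_part = (a \in A) && (a^T == - a).
Proof. by rewrite memv_cap memv_ker add_lfunE id_lfunE lfunE addr_eq0. Qed.

Definition ad t : 'End('M[F]_d) := linfun (mulmx t) - linfun (mulmxr t).

Lemma adE t s : ad t s = t *m s - s *m t.
Proof. by rewrite /ad add_lfunE opp_lfunE !lfunE. Qed.

Lemma ad_linear l t s : ad (t + l *: s) = (ad t + l *: ad s)%R.
Proof.
apply/lfunP => u; rewrite add_lfunE scale_lfunE !adE mulmxDl mulmxDr.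
by rewrite -scalemxAl -scalemxAr scalerBr opprD addrACA.
Qed.

Definition sym_cent t : {vspace 'M[F]_d} := (sym_part :&: lker (ad t))%VS.

Lemma sym_centP t s : s \in sym_cent t = (s \in sym_part) && (t *m s == s *m t).
Proof. by rewrite memv_cap memv_ker adE subr_eq0. Qed.

Lemma ad_sym_part t s : t \in sym_part -> s \in sym_part -> ad t s \in alt_part.
Proof.
rewrite !sym_partP alt_partP => /andP[tA /eqP tT] /andP[sA /eqP sT]; rewrite adE.
by rewrite rpredB ?A_mul //= linearB /= !trmx_mul tT sT opprB.
Qed.

Lemma dim_sym_cent t : (\dim (sym_cent t) + \dim (ad t @: sym_part) = \dim sym_part)%N.
Proof. exact: limg_ker_dim. Qed.

Lemma dim_sym_cent_ge t : t \in sym_part -> (\dim sym_part <= \dim (sym_cent t) + \dim alt_part)%N.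
Proof.
move=> tS; rewrite -(dim_sym_cent t) leq_add2l dimvS //.
by apply/subvP => _ /memv_imgP[s sS ->]; exact: ad_sym_part.
Qed.

Lemma minimal_cent_commutator t s v : t \in sym_part ->
  (forall t', t' \in sym_part -> (\dim (sym_cent t) <= \dim (sym_cent t'))%N) ->
  s \in sym_cent t -> v \in sym_cent t -> ad s v \in (ad t @: sym_part)%VS.
Proof.
move=> tS t_min; rewrite !sym_centP => /andP[sS _] /andP[vS /eqP tv].
apply: contraT => /(limg_perturbation vS); rewrite adE tv subrr => /(_ erefl)[l].
rewrite -ad_linear; have t'S : t + l *: s \in sym_part by rewrite rpredD ?rpredZ.
have := t_min _ t'S; rewrite -(leq_add2r (\dim (ad t @: sym_part))) dim_sym_cent.
by rewrite -(dim_sym_cent (t + l *: s)) leq_add2l leqNgt => /negP.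
Qed.

(* A commutator [b = [s, v] = [t, a]] of elements commuting with [t] satisfies
   [tr (b^T b) = - tr (b [t, a]) = 0]. *)
Lemma minimal_cent_comm t : t \in sym_part ->
  (forall t', t' \in sym_part -> (\dim (sym_cent t) <= \dim (sym_cent t'))%N) ->
  {in sym_cent t &, forall s v, s *m v = v *m s}.
Proof.
move=> tS t_min s v sC vC; pose b := ad s v.
have [a aS bE] := memv_imgP (minimal_cent_commutator tS t_min sC vC).
move: (sC) (vC); rewrite !sym_centP => /andP[sS /eqP ts] /andP[vS /eqP tv].
have bt : t *m b = b *m t by rewrite /b adE mulmxBr mulmxBl !mulmxA ts tv -!mulmxA tv ts !mulmxA.
suff b0 : b = 0 by apply/eqP; rewrite -subr_eq0 -adE -/b b0.
have : b \in alt_part by exact: ad_sym_part.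
rewrite alt_partP => /andP[_ /eqP bT]; apply: mxtrace_sqr_eq0; rewrite bT mulNmx linearN /=.
rewrite {2}/b bE adE mulmxBr linearB /= !mulmxA -bt -!mulmxA [X in _ - X]mxtrace_mulC.
by rewrite -!mulmxA mxtrace_mulC -!mulmxA subrr oppr0.
Qed.

Lemma commutant_symmetric c : (\dim alt_part + d <= \dim sym_part)%N ->
  {in A, forall a, a *m c = c *m a} -> c^T = c.
Proof.
move=> dimA cA.
have [t tS t_min] := exists_minimizer (fun t => \dim (sym_cent t)) (ex_intro (fun t => t \in sym_part) 0 (mem0v _)).
have centA a : a \in sym_cent t -> a \in A /\ a^T = a.
  by rewrite sym_centP sym_partP => /andP[/andP[-> /eqP ->]].
have dim_cent : (d <= \dim (sym_cent t))%N.
  have := dim_sym_cent_ge tS; move: dimA.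
  by move: (\dim _) (\dim _) (\dim _) => *; lia.
apply: (centA c _).2; apply: commutant_of_large_comm_algebra dim_cent _ => [a /centA[]||a /centA[aA _]] //.
- exact: minimal_cent_comm.
- exact: cA.
Qed.

End SymmetricPart.

Section SymmetricPartDimension.
Variables (F : realFieldType) (d : nat) (A : {vspace 'M[F]_d}).
Hypothesis A_tr : {in A, forall a, a^T \in A}.

Lemma half_double (a : 'M[F]_d) : a = 2%:R^-1 *: (a + a).
Proof. by rewrite -mulr2n -scaler_nat scalerA mulVf ?pnatr_eq0 // scale1r. Qed.

Lemma dimv_sym_alt : (\dim A <= \dim (sym_part A) + \dim (alt_part A))%N.
Proof.
apply: leq_trans (dimv_add_leqif (sym_part A) (alt_part A)).1; apply: dimvS; apply/subvP => a aA.
have -> : a = 2%:R^-1 *: (a + a^T) + 2%:R^-1 *: (a - a^T).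
  by rewrite -scalerDr addrACA subrr addr0 -half_double.
apply: memv_add; rewrite memvZ //.
  by rewrite sym_partP memvD ?A_tr //= linearD /= trmxK addrC.
by rewrite alt_partP memvB ?A_tr //= linearB /= trmxK opprB.
Qed.

End SymmetricPartDimension.

Section GroupRepresentation.
Variables (F : realFieldType) (gT : finGroupType) (G : {group gT}) (d : nat) (rep : gT -> 'M[F]_d).
Hypothesis rep_mul : {in G &, forall u w, rep (u * w)%g = rep w *m rep u}.
Hypothesis trmx_rep : {in G, forall w, (rep w)^T = rep w^-1%g}.
Hypothesis rep_free : forall a : gT -> F,
  \sum_(w in G) a w *: rep w = 0 -> {in G, forall w, a w = 0}.

Definition rep_span : {vspace 'M[F]_d} := (\sum_(w in G) <[rep w]>)%VS.

Lemma mem_rep_span w : w \in G -> rep w \in rep_span.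
Proof. by move=> wG; rewrite memvE; apply: (sumv_sup w). Qed.

Lemma rep_spanP a : a \in rep_span -> exists k : gT -> F, a = \sum_(w in G) k w *: rep w.
Proof.
move=> /memv_sumP[b b_line ->].
have /choice[k bE] w : exists k, w \in G -> b w = k *: rep w.
  case: (boolP (w \in G)) => [wG|]; last by exists 0.
  by have /vlineP[k bw] := b_line w wG; exists k.
by exists k; apply: eq_bigr.
Qed.

Lemma rep_span_mul : {in rep_span &, forall a b, a *m b \in rep_span}.
Proof.
move=> _ _ /rep_spanP[k ->] /rep_spanP[l ->]; rewrite mulmx_suml; apply: memv_suml => u uG.
rewrite mulmx_sumr; apply: memv_suml => w wG; rewrite -scalemxAl -scalemxAr.
by do 2!apply: memvZ; rewrite -rep_mul // mem_rep_span ?groupM.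
Qed.

Lemma rep_span_tr : {in rep_span, forall a, a^T \in rep_span}.
Proof.
move=> _ /rep_spanP[k ->]; rewrite linear_sum; apply: memv_suml => w wG.
by rewrite linearZ /= memvZ // trmx_rep // mem_rep_span ?groupV.
Qed.

Lemma card_le_dim_rep_span : (#|G| <= \dim rep_span)%N.
Proof.
pose X := [tuple rep (enum_val i) | i < #|G|].
have XE (i : 'I_#|G|) : X`_i = rep (enum_val i) by exact: nth_mktuple.
have /eqP X_dim : free X.
  apply/freeP => k k0 i.
  pose a w := if [pick j : 'I_#|G| | enum_val j == w] is Some j then k j else 0.
  have aE j : a (enum_val j) = k j.
    by rewrite /a; case: pickP => [l /eqP/enum_val_inj->|/(_ j)] //; rewrite eqxx.
  rewrite -aE (rep_free (a := a)) ?enum_valP // -[RHS]k0 big_enum_val.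
  by apply: eq_bigr => j _; rewrite aE XE.
rewrite -{1}(size_tuple X) -X_dim dimvS //; apply/span_subvP => _ /tnthP[i ->].
by rewrite tnth_mktuple mem_rep_span ?enum_valP.
Qed.

Definition noninvolution_reps : {set gT} := [set w in G | (enum_rank w < enum_rank w^-1%g)%N].

Lemma card_group_inverse_pairs :
  #|G| = (#|noninvolution_reps| + #|noninvolution_reps| + #|[set w in G | w^-1%g == w]|)%N.
Proof.
have cardE (c : pred gT) : #|[set w in G | c w]| = (\sum_(w in G) c w)%N.
  by rewrite -sum1dep_card big_mkcondr; apply: eq_bigr => w _; case: (c w).
have cardV : #|noninvolution_reps| = (\sum_(w in G) (enum_rank w^-1%g < enum_rank w))%N.
  rewrite cardE (reindex_inj invg_inj) /=; apply: eq_big => [w|w _]; first by rewrite groupV.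
  by rewrite invgK.
rewrite {2}cardV !cardE -!big_split -sum1_card; apply: eq_bigr => w _ /=.
have -> : (w^-1%g == w) = (enum_rank w == enum_rank w^-1%g :> nat).
  by rewrite (inj_eq val_inj) (inj_eq enum_rank_inj) eq_sym.
by case: ltngtP.
Qed.

Lemma dim_alt_rep_span : (\dim (alt_part rep_span) <= #|noninvolution_reps|)%N.
Proof.
pose Y := [seq rep w - rep w^-1%g | w <- enum noninvolution_reps].
have <- : size Y = #|noninvolution_reps| by rewrite size_map -cardE.
apply: leq_trans (dim_span Y); apply: dimvS; apply/subvP => a; rewrite alt_partP => /andP[aA /eqP aT].
have [k aE] := rep_spanP aA.
have -> : a = 2%:R^-1 *: (a - a^T) by rewrite aT opprK -half_double.
rewrite aE linear_sum /= -sumrN -big_split /=; apply/memvZ/memv_suml => w wG.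
rewrite linearZ /= trmx_rep // -scalerBr; apply: memvZ.
case: (ltngtP (enum_rank w) (enum_rank w^-1%g)) => w_rank.
- by apply: memv_span; apply/mapP; exists w => //; rewrite mem_enum inE wG.
- rewrite -opprB memvN; apply: memv_span; apply/mapP; exists w^-1%g; last by rewrite invgK.
  by rewrite mem_enum inE groupV wG invgK.
- have <- : w = w^-1%g by apply/enum_rank_inj/val_inj.
  by rewrite subrr mem0v.
Qed.

Lemma commutant_rep_symmetric (c : 'M[F]_d) : (d <= #|[set w in G | w^-1%g == w]|)%N ->
  {in G, forall w, rep w *m c = c *m rep w} -> c^T = c.
Proof.
move=> few_dims c_comm; apply: (commutant_symmetric rep_span_mul) => [|_ /rep_spanP[k ->]].
  have := dimv_sym_alt rep_span_tr; have := dim_alt_rep_span; have := card_le_dim_rep_span.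
  by move: card_group_inverse_pairs few_dims; move: (\dim _) (\dim _) (\dim _) => *; lia.
rewrite mulmx_suml mulmx_sumr; apply: eq_bigr => w wG.
by rewrite -scalemxAl -scalemxAr c_comm.
Qed.

End GroupRepresentation.

(** * Self-adjoint Hecke modules *)

Section HeckeModules.
Variables (F : fieldType) (T : finType) (W : {set {perm T}}) (S : seq {perm T})
  (len : {perm T} -> nat) (q : F).
Hypothesis W1 : (1%g : {perm T}) \in W.
Hypothesis W_ind : forall Q : {perm T} -> Prop, Q 1%g ->
  (forall s w, s \in S -> w \in W -> (len w < len (permc s w))%N -> Q w -> Q (permc s w)) ->
  forall w, w \in W -> Q w.
Hypothesis S_sub_W : {subset S <= W}.
Hypothesis S_mulW : forall s w : {perm T}, s \in S -> (permc s w \in W) = (w \in W).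
Hypothesis S_mulK : forall s w : {perm T}, s \in S -> permc s (permc s w) = w.
Hypothesis F_real : forall (I : finType) (a : I -> F), \sum_i a i ^+ 2 = 0 -> forall i, a i = 0.

Notation hecke := (heckeRep W S len q).
Notation algebra := {ffun {perm T} -> F^o}.

Lemma ffun_dot_anisotropic (I : finType) (a : {ffun I -> F^o}) : ffun_dot a a = 0 -> a = 0.
Proof.
move=> aa0; apply/ffunP => i; rewrite ffunE.
apply: (F_real (a := fun i => a i : F)); rewrite -[RHS]aa0.
by apply: eq_bigr => j _; rewrite expr2.
Qed.

Section OneModule.
Variables (V : lmodType F) (rho : {perm T} -> V -> V).
Hypothesis rho_hecke : hecke rho.

Lemma hecke_linear w : w \in W -> linear (rho w).
Proof. exact: rho_hecke.1. Qed.

Lemma hecke_ascent s w v : s \in S -> w \in W -> (len w < len (permc s w))%N ->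
  rho (permc s w) v = rho s (rho w v).
Proof. by move=> sS wW lt; rewrite rho_hecke.2.2 // lt. Qed.

Lemma hecke_invariant (U : V -> Prop) :
  (forall s u, s \in S -> U u -> U (rho s u)) -> Defs.invariant W rho U.
Proof.
move=> US w u wW Uu; move: w wW; apply: W_ind; first by rewrite rho_hecke.2.1.
by move=> s w sS wW lt Uw; rewrite hecke_ascent //; apply: US.
Qed.

Definition algebra_op (a : algebra) v := \sum_(w in W) (a w : F) *: rho w v.

Definition gen_mul (s : {perm T}) (a : algebra) : algebra :=
  [ffun w => (a (permc s w) : F) +
             (if (len w < len (permc s w))%N then 0 else (q - q^-1) * (a w : F)) : F^o].

Lemma algebra_op_linear v : linear (algebra_op^~ v).
Proof.
move=> k a b; rewrite /algebra_op scaler_sumr -big_split; apply: eq_bigr => w _.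
by rewrite !ffunE scalerDl scalerA.
Qed.

Lemma algebra_op_gen_mul s a v : s \in S -> algebra_op (gen_mul s a) v = rho s (algebra_op a v).
Proof.
move=> sS; have sL := hecke_linear (S_sub_W sS); rewrite /algebra_op (linear_fun_sum sL).
rewrite [RHS](eq_bigr (fun w => (a w : F) *: rho (permc s w) v +
   (if (len w < len (permc s w))%N then 0 else (q - q^-1) * a w) *: rho w v)) => [|w wW]; last first.
  rewrite (linear_funZ sL) rho_hecke.2.2 //; case: ifP => _; first by rewrite scale0r addr0.
  by rewrite scalerDr scalerA mulrC.
rewrite [RHS]big_split [X in _ = X + _](reindex_inj (can_inj (fun w => S_mulK w sS))) /=.
rewrite [X in _ = X + _](eq_bigl (mem W)) => [|w]; last by rewrite /= S_mulW.
by rewrite -big_split; apply: eq_bigr => w wW; rewrite !ffunE S_mulK // scalerDl.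
Qed.

Lemma algebra_op_delta1 v : algebra_op [ffun w => (w == 1%g)%:R] v = v.
Proof.
rewrite /algebra_op (bigD1 1%g) //= ffunE eqxx scale1r rho_hecke.2.1.
by rewrite big1 ?addr0 // => w /andP[_ /negbTE w1]; rewrite ffunE w1 scale0r.
Qed.

Lemma gen_mul_selfadjoint s a b : s \in S -> ffun_dot (gen_mul s a) b = ffun_dot a (gen_mul s b).
Proof.
move=> sS; rewrite /ffun_dot.
under eq_bigr do rewrite ffunE mulrDl.
under [RHS]eq_bigr do rewrite ffunE mulrDr.
rewrite !big_split; congr (_ + _); last first.
  by apply: eq_bigr => w _; case: ifP => _; rewrite ?mul0r ?mulr0 // mulrAC mulrC.
rewrite [RHS](reindex_inj (can_inj (fun w => S_mulK w sS))) /=.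
by apply: eq_bigr => w _; rewrite S_mulK // mulrC.
Qed.

Lemma irreducible_cyclic v : irreducible W rho -> v != 0 -> forall u, exists a, algebra_op a v = u.
Proof.
move=> [_ rho_irr] v_neq0; have vL := algebra_op_linear v.
have [||img0|] := rho_irr (fun u => exists a, algebra_op a v = u).
- split; [|split].
  + by exists 0; rewrite (linear_fun0 vL).
  + by move=> _ _ [a <-] [b <-]; exists (a + b); rewrite (linear_funD vL).
  + by move=> k _ [a <-]; exists (k *: a); rewrite (linear_funZ vL).
- by apply: hecke_invariant => s _ sS [a <-]; exists (gen_mul s a); exact: algebra_op_gen_mul.
- by case/eqP: v_neq0; apply: img0; eexists; exact: algebra_op_delta1.
- by [].
Qed.

(* The kernel [N] of [a |-> a v] is a left ideal, so is its orthogonal complement since left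
   multiplication by a generator is self-adjoint, and that complement maps bijectively to [V]. *)
Lemma cyclic_module_section v : (forall u, exists a, algebra_op a v = u) ->
  exists f : V -> algebra, [/\ linear f, forall u, algebra_op (f u) v = u &
    forall s u, s \in S -> f (rho s u) = gen_mul s (f u)].
Proof.
move=> v_cyclic; have vL := algebra_op_linear v.
have aniso := @ffun_dot_anisotropic {perm T}; pose dot : {symmetric algebra} := @ffun_dot F {perm T}.
have [|N NP] := @subspace_vspace _ algebra (fun a => algebra_op a v = 0).
  split; [exact: linear_fun0 vL | split=> [a b ha hb|k a ha]].
    by rewrite (linear_funD vL) ha hb addr0.
  by rewrite (linear_funZ vL) ha scaler0.
have uniq_lift a b : a \in orthov dot N -> b \in orthov dot N ->
    algebra_op a v = algebra_op b v -> a = b.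
  move=> aO bO ab; apply/eqP; rewrite -subr_eq0 -memv0 -(capv_orthov aniso N) memv_cap (memvB aO bO) andbT.
  by apply/NP; rewrite (linear_funB vL) ab subrr.
have /choice[f fP] u : exists b, b \in orthov dot N /\ algebra_op b v = u.
  have [a <-] := v_cyclic u; exists (a - orth_proj dot N a); split; first exact: sub_orth_proj.
  by have /NP p0 := orth_proj_mem dot N a; rewrite (linear_funB vL) p0 subr0.
have fO u : f u \in orthov dot N by case: (fP u).
have fK u : algebra_op (f u) v = u by case: (fP u).
exists f; split=> //.
- move=> k u u'; apply: uniq_lift; rewrite ?memvD ?memvZ //.
  by rewrite (linear_funD vL) (linear_funZ vL) !fK.
- move=> s u sS; apply: uniq_lift => //; last by rewrite algebra_op_gen_mul // !fK.
  apply/mem_orthovP => a /NP a0; rewrite -[LHS]/(ffun_dot _ _) gen_mul_selfadjoint //.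
  move/mem_orthovP: (fO u); apply; apply/NP.
  by rewrite algebra_op_gen_mul // a0 (linear_fun0 (hecke_linear (S_sub_W sS))).
Qed.

End OneModule.

Lemma intertwiner_gen (V1 V2 : lmodType F) (rho1 : {perm T} -> V1 -> V1)
    (rho2 : {perm T} -> V2 -> V2) (f : V1 -> V2) :
  hecke rho1 -> hecke rho2 -> linear f ->
  (forall s v, s \in S -> f (rho1 s v) = rho2 s (f v)) -> intertwiner W rho1 rho2 f.
Proof.
move=> hecke1 hecke2 fL fS; split=> // w v wW; move: w wW v.
apply: W_ind => [v|s w sS wW lt fw v]; first by rewrite hecke1.2.1 hecke2.2.1.
by rewrite (hecke_ascent hecke1) // (hecke_ascent hecke2) // fS // fw.
Qed.

Lemma schur_bijective (V1 V2 : lmodType F) (rho1 : {perm T} -> V1 -> V1)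
    (rho2 : {perm T} -> V2 -> V2) (f : V1 -> V2) :
  hecke rho2 -> irreducible W rho1 -> irreducible W rho2 ->
  intertwiner W rho1 rho2 f -> (exists v, f v != 0) -> bijective f.
Proof.
move=> hecke2 [_ irr1] [_ irr2] [fL fW] [v fv_neq0].
have f_ker u : f u = 0 -> u = 0.
  move: u; have [||//|f0] := irr1 (fun u => f u = 0).
  - split; [exact: linear_fun0 fL | split=> [u u' hu hu'|k u hu]].
      by rewrite (linear_funD fL) hu hu' addr0.
    by rewrite (linear_funZ fL) hu scaler0.
  - by move=> w u wW hu; rewrite fW // hu (linear_fun0 (hecke_linear hecke2 wW)).
  - by case/eqP: fv_neq0.
have f_inj : injective f.
  by move=> u u' fuu'; apply/eqP; rewrite -subr_eq0; apply/eqP/f_ker; rewrite (linear_funB fL) fuu' subrr.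
have f_onto x : exists u, f u = x.
  move: x; have [||f0|//] := irr2 (fun x => exists u, f u = x).
  - split; [by exists 0; exact: linear_fun0 fL | split=> [_ _ [u <-] [u' <-]|k _ [u <-]]].
      by exists (u + u'); rewrite (linear_funD fL).
    by exists (k *: u); rewrite (linear_funZ fL).
  - by move=> w _ wW [u <-]; exists (rho1 w u); rewrite fW.
  - by case/eqP: fv_neq0; apply: f0; exists v.
have /choice[g fK] := f_onto; exists g => // u.
by apply: f_inj; rewrite fK.
Qed.

Section SelfAdjointModel.
Variables (V : vectType F) (rho : {perm T} -> V -> V) (B : {symmetric V}).
Hypothesis rho_hecke : hecke rho.
Hypothesis B_anisotropic : forall v, B v v = 0 -> v = 0.
Hypothesis rho_selfadjoint : forall s u v, s \in S -> B (rho s u) v = B u (rho s v).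
Implicit Types U X : {vspace V}.

Definition invariant_space U := forall s u, s \in S -> u \in U -> rho s u \in U.

Lemma orth_proj_gen U s v : invariant_space U -> s \in S ->
  orth_proj B U (rho s v) = rho s (orth_proj B U v).
Proof.
move=> U_inv sS; pose rho_s := linear_of (hecke_linear rho_hecke (S_sub_W sS)).
by apply: (orth_proj_selfadjoint B_anisotropic (f := rho_s)) => [u u'|u]; [exact: rho_selfadjoint | exact: U_inv].
Qed.

Lemma orthov_invariant U : invariant_space U -> invariant_space (orthov B U).
Proof.
move=> U_inv s u sS; pose rho_s := linear_of (hecke_linear rho_hecke (S_sub_W sS)).
by apply: (orthov_selfadjoint (f := rho_s)) => [v v'|v]; [exact: rho_selfadjoint | exact: U_inv].
Qed.

Definition simple_space U := [/\ invariant_space U, U != 0%VS &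
  forall X, invariant_space X -> (X <= U)%VS -> X = 0%VS \/ X = U].

Lemma exists_simple_subspace U : invariant_space U -> U != 0%VS ->
  exists2 X, simple_space X & (X <= U)%VS.
Proof.
move=> U_inv U_neq0; pose ok X := [/\ invariant_space X, X != 0%VS & (X <= U)%VS].
have [X [X_inv X_neq0 XU] X_min] := exists_minimizer (fun X => \dim X) (ex_intro ok U (And3 U_inv U_neq0 (subvv U))).
exists X => //; split=> // Y Y_inv YX; case: (eqVneq Y 0%VS) => [->|Y_neq0]; [by left | right].
by apply/eqP; rewrite eqEdim YX X_min //; split=> //; exact: subv_trans XU.
Qed.

Lemma orthogonal_decomposition U : invariant_space U -> exists Us : seq {vspace V},
  [/\ forall X, X \in Us -> simple_space X /\ (X <= U)%VS,
      pairwise (fun X Y => X <= orthov B Y)%VS Us & (\sum_(X <- Us) X)%VS = U].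
Proof.
have [m] := ubnP (\dim U); elim: m U => // m IH U; rewrite ltnS => dimU U_inv.
case: (eqVneq U 0%VS) => [->|U_neq0]; first by exists [::]; rewrite big_nil.
have [X X_simple XU] := exists_simple_subspace U_inv U_neq0.
have [X_inv X_neq0 _] := X_simple; pose Y := (U :&: orthov B X)%VS.
have Y_inv : invariant_space Y.
  by move=> s u sS; rewrite !memv_cap => /andP[uU uO]; rewrite U_inv // orthov_invariant.
have XY : (X + Y)%VS = U.
  by rewrite /Y capvC vspace_modl // (addv_orthov B_anisotropic) capfv.
have dimY : (\dim Y < m)%N.
  apply: leq_trans dimU; rewrite -XY dimv_disjoint_sum; last first.
    by apply/eqP; rewrite -subv0 -(capv_orthov B_anisotropic X) capvS ?capvSr.
  by rewrite -[X in (X < _)%N]add0n ltn_add2r lt0n dimv_eq0.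
have [Us [Us_simple Us_orth Us_sum]] := IH Y dimY Y_inv.
exists (X :: Us); split; last by rewrite big_cons Us_sum.
- move=> Z; rewrite inE => /predU1P[->//|/Us_simple[Z_simple ZY]].
  by split=> //; apply: subv_trans ZY (capvSl _ _).
- rewrite /= Us_orth andbT; apply/allP => Z /Us_simple[_ ZY].
  by rewrite orthov_sym; apply: subv_trans ZY (capvSr _ _).
Qed.

Section Subrepresentation.
Variable U : {vspace V}.
Hypothesis U_inv : invariant_space U.

Definition sub_action w (x : subvs_of U) : subvs_of U := vsproj U (rho w (vsval x)).

Lemma sub_actionE w x : w \in W -> vsval (sub_action w x) = rho w (vsval x).
Proof.
move=> wW; rewrite vsprojK //.
exact: (hecke_invariant rho_hecke (U := fun u => u \in U) U_inv wW (subvsP x)).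
Qed.

Lemma vsval_inj : injective (@vsval _ _ U). Proof. exact: val_inj. Qed.

Lemma sub_action_hecke : hecke sub_action.
Proof.
split; [|split].
- move=> w wW k x y; apply: vsval_inj.
  by rewrite sub_actionE // linearP (hecke_linear rho_hecke wW) -!sub_actionE // linearP.
- by move=> x; apply: vsval_inj; rewrite sub_actionE // rho_hecke.2.1.
- move=> s w x sS wW; have swW : permc s w \in W by rewrite S_mulW.
  apply: vsval_inj; rewrite sub_actionE ?S_sub_W // sub_actionE // rho_hecke.2.2 //.
  by case: ifP => _; rewrite ?linearD ?linearZ /= !sub_actionE.
Qed.

Lemma sub_action_irreducible : simple_space U -> irreducible W sub_action.
Proof.
move=> [_ U_neq0 U_min]; split.
  exists (vsproj U (vpick U)); apply/eqP => /(congr1 vsval).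
  by rewrite vsprojK ?memv_pick // linear0 => /eqP; rewrite vpick0 (negbTE U_neq0).
move=> Q [Q0 [QD QZ]] Q_inv.
have [|X XP] := @subspace_vspace _ V (fun v => exists2 x, Q x & v = vsval x).
  split; [by exists 0; rewrite ?linear0 | split].
  - by move=> _ _ [x Qx ->] [y Qy ->]; exists (x + y); rewrite ?linearD //; apply: QD.
  - by move=> k _ [x Qx ->]; exists (k *: x); rewrite ?linearZ //; apply: QZ.
have [||X0|XU] := U_min X.
- move=> s _ sS /XP[x Qx ->]; apply/XP; exists (sub_action s x); last by rewrite sub_actionE ?S_sub_W.
  by apply: Q_inv; rewrite ?S_sub_W.
- by apply/subvP => _ /XP[x _ ->]; exact: subvsP.
- left=> x Qx; have : vsval x \in X by apply/XP; exists x.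
  by rewrite X0 memv0 => /eqP x0; apply: vsval_inj; rewrite x0 linear0.
- right=> x; have : vsval x \in X by rewrite XU subvsP.
  by move=> /XP[y Qy xy]; rewrite (val_inj xy : x = y).
Qed.

End Subrepresentation.

Hypothesis no_antisymmetric_intertwiner : forall k : {linear V -> V},
  (forall s v, s \in S -> k (rho s v) = rho s (k v)) ->
  (forall u v, B (k u) v = - B u (k v)) -> forall v, k v = 0.

Lemma intertwiner_selfadjoint (k : {linear V -> V}) :
  (forall s v, s \in S -> k (rho s v) = rho s (k v)) -> forall u v, B (k u) v = B u (k v).
Proof.
move=> kS; have [k' kE] := form_adjoint B_anisotropic k.
have k'E u v : B (k' u) v = B u (k v) by rewrite symm_formC -kE symm_formC.
have k'S s v : s \in S -> k' (rho s v) = rho s (k' v).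
  move=> sS; apply/eqP; rewrite -subr_eq0; apply/eqP/B_anisotropic.
  by rewrite linearBr /= -kE -!rho_selfadjoint // -kE kS // subrr.
have kk' v : (k \- k') v = 0.
  apply: no_antisymmetric_intertwiner => [s w sS|u w] /=.
    by rewrite kS // k'S // (linear_funB (hecke_linear rho_hecke (S_sub_W sS))).
  by rewrite linearBl linearBr /= k'E kE opprB.
by move=> u v; rewrite kE; congr (B _ _); apply/esym/eqP; rewrite -subr_eq0; apply/eqP/kk'.
Qed.

(* An isomorphism [f : U -> X] extends by the orthogonal projection to an intertwiner [k] of the
   whole space with [k^2 = 0]; it is self-adjoint, hence zero. *)
Lemma orthogonal_spaces_not_iso U X : invariant_space U -> U != 0%VS -> invariant_space X ->
  (X <= orthov B U)%VS -> ~ isoRep W (@sub_action U) (@sub_action X).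
Proof.
move=> U_inv U_neq0 X_inv XU [f [[fL fW] f_bij]].
pose k : {linear V -> V} := vsval \o (linear_of fL \o (vsproj U \o orth_proj B U)).
have kS s v : s \in S -> k (rho s v) = rho s (k v).
  move=> sS; have sW := S_sub_W sS; rewrite /k /= orth_proj_gen // -sub_actionE // -fW //.
  congr (vsval (f _)); apply: vsval_inj.
  by rewrite sub_actionE // !vsprojK ?U_inv ?orth_proj_mem.
have kk v : k (k v) = 0.
  rewrite {1}/k /= (orth_proj0 B_anisotropic) ?linear0 ?(linear_fun0 fL) ?linear0 //.
  exact: subvP XU _ (subvsP _).
have k0 v : k v = 0 by apply: B_anisotropic; rewrite (intertwiner_selfadjoint kS) kk linear0r.
case/eqP: U_neq0; apply/eqP; rewrite -vpick0; apply/eqP.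
have := k0 (vpick U); rewrite /k /= (orth_proj_id B_anisotropic) ?memv_pick //.
rewrite -[RHS](linear0 (vsval : subvs_of X -> V)) -(linear_fun0 fL) => /val_inj/(bij_inj f_bij).
by move/(congr1 vsval); rewrite vsprojK ?memv_pick // linear0.
Qed.

Hypothesis rho_faithful : forall a : {perm T} -> F,
  (forall v, \sum_(w in W) a w *: rho w v = 0) -> forall w, w \in W -> a w = 0.

Lemma irreducible_maps_nontrivially (V' : lmodType F) (rho' : {perm T} -> V' -> V') :
  hecke rho' -> irreducible W rho' -> exists f : V' -> V,
    [/\ linear f, forall s x, s \in S -> f (rho' s x) = rho s (f x) & exists x, f x != 0].
Proof.
move=> hecke' irr'; have [[v v_neq0] _] := irr'.
have [g [gL gK gS]] := cyclic_module_section hecke' (irreducible_cyclic hecke' irr' v_neq0).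
have [v0 gv0_neq0] : exists v0, algebra_op rho (g v) v0 != 0.
  apply: contrapT => no_v0; case/negP: v_neq0; rewrite -(gK v) /algebra_op big1 // => w wW.
  rewrite (rho_faithful (a := g v)) ?scale0r // => u; apply: contrapT => /eqP gvu.
  by apply: no_v0; exists u.
exists (fun u => algebra_op rho (g u) v0); split; last by exists v.
- by move=> k u u'; rewrite gL algebra_op_linear.
- by move=> s u sS; rewrite gS // (algebra_op_gen_mul rho_hecke).
Qed.

Lemma simple_component_iso (V' : lmodType F) (rho' : {perm T} -> V' -> V') (f : V' -> V) U v :
  hecke rho' -> irreducible W rho' -> simple_space U -> linear f ->
  (forall s x, s \in S -> f (rho' s x) = rho s (f x)) -> orth_proj B U (f v) != 0 ->
  isoRep W rho' (@sub_action U).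
Proof.
move=> hecke' irr' U_simple fL fS pfv_neq0; have [U_inv _ _] := U_simple.
pose proj_f u := vsproj U (orth_proj B U (f u)); exists proj_f.
have proj_fE u : vsval (proj_f u) = orth_proj B U (f u) by rewrite vsprojK ?orth_proj_mem.
suff f_int : intertwiner W rho' (@sub_action U) proj_f.
  split=> //; apply: (schur_bijective (sub_action_hecke U_inv) irr' (sub_action_irreducible U_inv U_simple) f_int).
  by exists v; apply: contra pfv_neq0 => /eqP/(congr1 vsval); rewrite proj_fE linear0 => ->.
apply: intertwiner_gen => //; first exact: sub_action_hecke.
  by move=> a u u'; rewrite /proj_f fL !linearP.
by move=> s u sS; apply: vsval_inj; rewrite sub_actionE ?S_sub_W // !proj_fE fS // orth_proj_gen.
Qed.

Section OrthogonalFamily.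
Variables (k : nat) (U : 'I_k -> {vspace V}).
Hypothesis U_simple : forall j, simple_space (U j).
Hypothesis U_orth : forall i j, i != j -> (U i <= orthov B (U j))%VS.
Hypothesis sum_U : (\sum_(j < k) U j)%VS = fullv.

Lemma orth_proj_sum (us : 'I_k -> V) j : (forall i, us i \in U i) -> orth_proj B (U j) (\sum_i us i) = us j.
Proof.
move=> us_mem; rewrite linear_sum (bigD1 j) //= (orth_proj_id B_anisotropic) // big1 ?addr0 // => i ij.
by apply: orth_proj0 => //; apply: subvP (us_mem i); exact: U_orth.
Qed.

Lemma family_decomposition v : exists2 us : 'I_k -> V, forall i, us i \in U i & v = \sum_i us i.
Proof.
have /memv_sumP[us us_mem ->] : v \in (\sum_(j < k) U j)%VS by rewrite sum_U memvf.
by exists us => // i; exact: us_mem.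
Qed.

Lemma exists_nonzero_proj v : v != 0 -> exists j, orth_proj B (U j) v != 0.
Proof.
move=> v_neq0; have [us us_mem vE] := family_decomposition v.
apply: contrapT => no_j; case/eqP: v_neq0; rewrite vE big1 // => j _.
by rewrite -(orth_proj_sum j us_mem) -vE; apply: contrapT => /eqP pj; apply: no_j; exists j.
Qed.

Lemma gelfandModel_orthogonal_family : gelfandModel W S len q rho.
Proof.
have U_inv j : invariant_space (U j) by case: (U_simple j).
exists k, (fun j => subvs_of (U j) : lmodType F), (fun j => @sub_action (U j)), (fun j => vsval).
split; [|split; [|split; [|split]]].
- by move=> j; split; [exact: sub_action_hecke | exact: sub_action_irreducible].
- move=> i j ij; have [_ Ui_neq0 _] := U_simple i.
  by apply: orthogonal_spaces_not_iso => //; apply: U_orth; rewrite eq_sym.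
- move=> V' rho' hecke' irr'; have [f [fL fS [v fv_neq0]]] := irreducible_maps_nontrivially hecke' irr'.
  have [j pfv_neq0] := exists_nonzero_proj fv_neq0.
  by exists j; exact: (simple_component_iso hecke' irr' (U_simple j) fL fS pfv_neq0).
- by move=> j; split=> [a x y|w x wW]; [rewrite linearP | rewrite sub_actionE].
move=> v; have [us us_mem vE] := family_decomposition v; exists (fun j => vsproj (U j) (us j)); split.
  by rewrite vE; apply: eq_bigr => j _; rewrite vsprojK.
move=> us' vE' j; apply: vsval_inj; rewrite vsprojK //.
by rewrite -(orth_proj_sum j (us := fun i => vsval (us' i))) => [|i]; rewrite ?subvsP // -vE' vE orth_proj_sum.
Qed.

End OrthogonalFamily.

Theorem gelfand_criterion : gelfandModel W S len q rho.
Proof.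
have [|Us [Us_simple Us_orth Us_sum]] := @orthogonal_decomposition fullv.
  by move=> s u _ _; exact: memvf.
apply: (@gelfandModel_orthogonal_family (size Us) (fun j => nth 0%VS Us j)) => [j|i j|].
- by have [] := Us_simple _ (mem_nth 0%VS (ltn_ord j)).
- have /pairwiseP-/(_ 0%VS) orth := Us_orth.
  by rewrite -val_eqE neq_ltn => /orP[ij|ji]; [|rewrite orthov_sym]; apply: orth => //; rewrite inE.
by rewrite -Us_sum (big_nth 0%VS) big_mkord.
Qed.

End SelfAdjointModel.
End HeckeModules.

(** * Equivariant matchings *)

Section TranspositionProducts.
Variable T : finType.
Implicit Types (g h z : {perm T}) (X Y R : {set T}) (x y w : T) (l : seq (T * T)).

Lemma tperm_mulr x y g : (tperm x y * g = g * tperm (g x) (g y))%g.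
Proof. by rewrite conjgC tpermJ. Qed.

Lemma perm_on_tperm x y X : x \in X -> y \in X -> perm_on X (tperm x y).
Proof.
by move=> xX yX; apply: subset_trans (tperm_on x y) _; apply/subsetP => w /set2P[] ->.
Qed.

Lemma perm_onS X Y g : X \subset Y -> perm_on X g -> perm_on Y g.
Proof. by move=> XY gX; apply: subset_trans gX XY. Qed.

Lemma disjoint_notin X Y x : [disjoint X & Y] -> x \in X -> x \notin Y.
Proof. by move=> dXY xX; have := disjointFr dXY xX => ->. Qed.

Definition swaps l : {perm T} := (\prod_(p <- l) tperm p.1 p.2)%g.

Lemma swaps_nil : swaps [::] = 1%g. Proof. exact: big_nil. Qed.

Lemma swaps_cons p l : swaps (p :: l) = (tperm p.1 p.2 * swaps l)%g.
Proof. exact: big_cons. Qed.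

Lemma swaps_out l x : x \notin unzip1 l -> x \notin unzip2 l -> swaps l x = x.
Proof.
elim: l => [|[b y] l IH]; first by rewrite swaps_nil perm1.
rewrite /= !inE !negb_or => /andP[xb x1] /andP[xy x2].
by rewrite swaps_cons permM tpermD ?IH //= eq_sym.
Qed.

Lemma perm_on_swaps X l : {subset unzip1 l <= X} -> {subset unzip2 l <= X} -> perm_on X (swaps l).
Proof.
move=> l1 l2; apply/subsetP => x; rewrite inE; apply: contraR => xX.
by rewrite swaps_out //; apply: contra xX; [exact: l1 | exact: l2].
Qed.

Lemma uniq_unzip_cons p l : uniq (unzip1 (p :: l) ++ unzip2 (p :: l)) ->
  [/\ uniq (unzip1 l ++ unzip2 l), p.1 \notin unzip1 l ++ unzip2 l, p.2 \notin unzip1 l ++ unzip2 l & p.1 != p.2].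
Proof.
have -> : uniq (unzip1 (p :: l) ++ unzip2 (p :: l)) = uniq (p.1 :: p.2 :: unzip1 l ++ unzip2 l).
  by apply: perm_uniq; rewrite /= perm_cons -(cat1s p.2) perm_catCA.
by rewrite /= inE negb_or => /and3P[/andP[-> ->] -> ->].
Qed.

Lemma swaps_in l b x : uniq (unzip1 l ++ unzip2 l) -> (b, x) \in l ->
  swaps l b = x /\ swaps l x = b.
Proof.
elim: l => // -[c y] l IH /uniq_unzip_cons[/= l_uniq c_out y_out cy].
rewrite inE swaps_cons => /predU1P[[-> ->]|bxl].
  move: c_out y_out; rewrite !mem_cat !negb_or => /andP[c1 c2] /andP[y1 y2].
  by rewrite !permM tpermL tpermR /= !swaps_out.
have [eb ex] := IH l_uniq bxl.
have b_in : b \in unzip1 l ++ unzip2 l by rewrite mem_cat; apply/orP; left; apply/mapP; exists (b, x).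
have x_in : x \in unzip1 l ++ unzip2 l by rewrite mem_cat; apply/orP; right; apply/mapP; exists (b, x).
have neq u w : u \notin unzip1 l ++ unzip2 l -> w \in unzip1 l ++ unzip2 l -> u != w.
  by move=> u_out w_in; apply: contraNneq u_out => ->.
by rewrite !permM /= !tpermD ?neq.
Qed.

Lemma swaps_unzip1 l x : uniq (unzip1 l ++ unzip2 l) -> x \in unzip1 l -> swaps l x \in unzip2 l.
Proof.
by move=> l_uniq /mapP[[b y] byl ->]; rewrite (swaps_in l_uniq byl).1; apply/mapP; exists (b, y).
Qed.

Lemma swaps_unzip2 l x : uniq (unzip1 l ++ unzip2 l) -> x \in unzip2 l -> swaps l x \in unzip1 l.
Proof.
by move=> l_uniq /mapP[[b y] byl ->]; rewrite (swaps_in l_uniq byl).2; apply/mapP; exists (b, y).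
Qed.

Lemma swapsK l : uniq (unzip1 l ++ unzip2 l) -> involutive (swaps l).
Proof.
move=> l_uniq x; case: (boolP (x \in unzip1 l)) => [/mapP[[c y] cyl ->]|x1].
  by rewrite (swaps_in l_uniq cyl).1 (swaps_in l_uniq cyl).2.
case: (boolP (x \in unzip2 l)) => [/mapP[[c y] cyl ->]|x2].
  by rewrite (swaps_in l_uniq cyl).2 (swaps_in l_uniq cyl).1.
by rewrite !swaps_out.
Qed.

Lemma perm_involutive z : (z * z = 1)%g <-> involutive z.
Proof.
split=> [zz x|zK]; first by rewrite -permM zz perm1.
by apply/permP=> x; rewrite permM zK perm1.
Qed.

Lemma exists_near_perfect_matching X :
  exists z, [/\ involutive z, perm_on X z & (#|[set x in X | z x == x]| <= 1)%N].
Proof.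
have [m] := ubnP #|X|; elim: m X => // m IH X; rewrite ltnS => cardX.
case: (leqP #|X| 1) => [X1|/card_gt1P[x [y [xX yX xy]]]].
  exists 1%g; split; [by move=> x; rewrite !perm1 | exact: perm_on1 |].
  by apply: leq_trans X1; apply: subset_leq_card; apply/subsetP => x; rewrite inE => /andP[].
pose X' := X :\ x :\ y.
have X'X : X' \subset X by apply: subset_trans (subsetDl _ _) (subsetDl _ _).
have cardX' : (#|X'| < m)%N.
  by apply: leq_trans cardX; rewrite [#|X|](cardsD1 x) xX [#|X :\ x|](cardsD1 y) !inE eq_sym xy yX.
have [z [zK zX' z_fix]] := IH X' cardX'.
have dis : [disjoint [set x; y] & X'].
  by rewrite disjoint_subset; apply/subsetP => w /set2P[] ->; rewrite !inE eqxx ?andbF.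
have tz := perm_onC (tperm_on x y) zX' dis.
exists (tperm x y * z)%g; split.
- by move=> w; rewrite -permM {1}tz -mulgA (mulgA (tperm x y)) tperm2 mul1g permM zK.
- by apply: perm_onM; [exact: perm_on_tperm | exact: perm_onS zX'].
apply: leq_trans z_fix; apply: subset_leq_card; apply/subsetP => w; rewrite !inE permM.
case: tpermP => [->|->|/eqP wx /eqP wy] /andP[wX].
- by rewrite (out_perm zX') ?(eq_sym y) ?(negbTE xy) // !inE eqxx.
- by rewrite (out_perm zX') ?(negbTE xy) // !inE eqxx andbF.
- by move=> ->; rewrite wx wy wX.
Qed.

Definition fixed_in R z : {set T} := [set x in R | z x == x].

Definition fixed_sign R z g : bool := odd_perm (restr_perm (fixed_in R z) g).

Lemma fixed_inP R z x : reflect (x \in R /\ z x = x) (x \in fixed_in R z).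
Proof. by rewrite inE; apply: (iffP andP) => -[-> /eqP]. Qed.

Lemma fixed_in_imset z g X : commute g z -> fixed_in (g @: X) z = g @: fixed_in X z.
Proof.
move=> gz; have gzx x : g (z x) = z (g x) by rewrite -!permM gz.
apply/setP => x; apply/fixed_inP/imsetP => [[/imsetP[y yX ->] gyz]|[y /fixed_inP[yX yz] ->]].
  by exists y => //; apply/fixed_inP; split=> //; apply: (@perm_inj _ g); rewrite gzx.
by rewrite -gzx yz imset_f.
Qed.

Lemma fixed_inD X Y z : fixed_in (X :\: Y) z = fixed_in X z :\: fixed_in Y z.
Proof. by apply/setP => x; rewrite !inE; case: (z x == x); rewrite ?andbT ?andbF. Qed.

Lemma mem_astabs_perm X g : (forall x, x \in X -> g x \in X) -> g \in 'N(X | 'P)%g.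
Proof.
move=> gX; rewrite inE; apply/andP; split; first by rewrite inE.
by rewrite inE; apply/subsetP => x xX; rewrite inE /= apermE gX.
Qed.

Lemma fixed_in_stable R z g : perm_on R g -> commute g z -> g \in 'N(fixed_in R z | 'P)%g.
Proof.
move=> gR gz; apply: mem_astabs_perm => x /fixed_inP[xR zx].
by apply/fixed_inP; rewrite perm_closed // -permM gz permM zx.
Qed.

Lemma restr_perm_if X g x : g \in 'N(X | 'P)%g -> restr_perm X g x = if x \in X then g x else x.
Proof.
by move=> gN; case: ifPn => xX; [rewrite restr_permE | rewrite (out_perm (restr_perm_on X g))].
Qed.

Lemma fixed_sign1 R z : fixed_sign R z 1%g = false.
Proof. by rewrite /fixed_sign morph1 odd_perm1. Qed.

Lemma fixed_signM R z g h : perm_on R g -> commute g z -> perm_on R h -> commute h z ->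
  fixed_sign R z (g * h)%g = fixed_sign R z g (+) fixed_sign R z h.
Proof.
move=> gR gz hR hz; rewrite /fixed_sign (morphM (restr_perm_morphism _)) ?fixed_in_stable //.
by rewrite odd_permM.
Qed.

Lemma eq_fixed_sign R R' z z' g g' :
  perm_on R g -> commute g z -> perm_on R' g' -> commute g' z' ->
  (forall x, (if x \in fixed_in R z then g x else x) = (if x \in fixed_in R' z' then g' x else x)) ->
  fixed_sign R z g = fixed_sign R' z' g'.
Proof.
move=> gR gz gR' gz' same; rewrite /fixed_sign; congr odd_perm; apply/permP => x.
by rewrite !restr_perm_if ?fixed_in_stable.
Qed.

Section EquivariantMatchings.
Variables (R : {set T}) (z : {perm T}).
Hypothesis zK : involutive z.

Definition stable X := forall x, x \in X -> z x \in X.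

Definition orbit_del X x := X :\ x :\ z x.

Lemma orbit_del_sub X x : orbit_del X x \subset X.
Proof. exact: subset_trans (subsetDl _ _) (subsetDl _ _). Qed.

Lemma orbit_del_stable X x : stable X -> stable (orbit_del X x).
Proof.
move=> X_stable w; rewrite !inE => /and3P[w_zx w_x wX].
rewrite X_stable // andbT (inj_eq perm_inj) w_x /=.
by apply: contraNneq w_zx => <-; rewrite zK.
Qed.

Lemma card_orbit_del X x : stable X -> x \in X -> z x != x -> #|X| = #|orbit_del X x|.+2.
Proof. by move=> X_stable xX zx; rewrite (cardsD1 x) xX (cardsD1 (z x)) !inE zx X_stable. Qed.

Lemma fixed_in_orbit_del X x : z x != x -> fixed_in (orbit_del X x) z = fixed_in X z.
Proof.
move=> zx; apply/setP => w; rewrite !inE; case: (eqVneq w x) => [->|w_x].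
  by rewrite (negbTE zx) !andbF.
by case: (eqVneq w (z x)) => [->|w_zx] //=; rewrite zK eq_sym (negbTE zx) andbF.
Qed.

Definition equivariant_matching X1 X2 l :=
  [/\ uniq (unzip1 l ++ unzip2 l), unzip1 l =i X1, unzip2 l =i X2,
      commute (swaps l) z & fixed_sign R z (swaps l) = odd (size l)].

Section AddOrbits.
Variables (X1 X2 : {set T}) (x y : T).
Hypotheses (X1_stable : stable X1) (X2_stable : stable X2) (X1R : X1 \subset R) (X2R : X2 \subset R).
Hypothesis X12 : [disjoint X1 & X2].
Hypotheses (xX : x \in X1) (yX : y \in X2) (zx : z x != x) (zy : z y != y).

Lemma orbits_neq : [/\ x != y, x != z y, z x != y & z x != z y].
Proof.
have neq u w : u \in X1 -> w \in X2 -> u != w.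
  by move=> uX wX; apply: contraTneq wX => <-; exact: disjoint_notin uX.
by split; apply: neq; rewrite ?X1_stable ?X2_stable.
Qed.

Lemma commute_swap_orbits : commute (tperm x y * tperm (z x) (z y))%g z.
Proof.
have [xy xzy zxy zxzy] := orbits_neq.
rewrite /commute -mulgA (tperm_mulr (z x)) !zK mulgA (tperm_mulr x y z) -!mulgA; congr (_ * _)%g.
apply: (perm_onC (S1 := [set z x; z y]) (S2 := [set x; y])); try exact: tperm_on.
rewrite disjoint_subset; apply/subsetP => w /set2P[] ->; rewrite !inE negb_or.
  by rewrite zx zxy.
by rewrite eq_sym xzy zy.
Qed.

Variable l : seq (T * T).
Hypothesis l_matching : equivariant_matching (orbit_del X1 x) (orbit_del X2 y) l.

Notation xy_l := ((x, y) :: (z x, z y) :: l).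

Lemma swaps_cons_orbits : swaps xy_l = (tperm x y * tperm (z x) (z y) * swaps l)%g.
Proof. by rewrite !swaps_cons mulgA. Qed.

Lemma commute_swaps_cons_orbits : commute (swaps xy_l) z.
Proof.
have [_ _ _ lz _] := l_matching; rewrite swaps_cons_orbits.
by apply/commute_sym/commuteM; apply: commute_sym => //; exact: commute_swap_orbits.
Qed.

Lemma unzip_cons_orbits : unzip1 xy_l =i X1 /\ unzip2 xy_l =i X2.
Proof.
have [_ l1 l2 _ _] := l_matching; split=> w; rewrite /= !inE ?l1 ?l2 !inE.
  case: (eqVneq w x) => [->|w_x] /=; first by rewrite xX.
  by case: (eqVneq w (z x)) => [->|w_zx] //=; rewrite X1_stable.
case: (eqVneq w y) => [->|w_y] /=; first by rewrite yX.
by case: (eqVneq w (z y)) => [->|w_zy] //=; rewrite X2_stable.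
Qed.

Lemma uniq_cons_orbits : uniq (unzip1 xy_l ++ unzip2 xy_l).
Proof.
have [l_uniq l1 l2 _ _] := l_matching; move: l_uniq; rewrite !cat_uniq => /and3P[uniq1 _ uniq2].
apply/and3P; split.
- by rewrite /= uniq1 inE negb_or eq_sym zx !l1 !inE !eqxx !andbF.
- by have [xy1 xy2] := unzip_cons_orbits; apply/hasPn => w; rewrite xy1 xy2 => wX2; rewrite (disjointFl X12).
- by rewrite /= uniq2 inE negb_or eq_sym zy !l2 !inE !eqxx !andbF.
Qed.

Lemma fixed_sign_cons_orbits : fixed_sign R z (swaps xy_l) = fixed_sign R z (swaps l).
Proof.
have [_ l1 l2 lz _] := l_matching; have [xy1 xy2] := unzip_cons_orbits.
apply: eq_fixed_sign => //; last first.
- move=> w; case: ifP => // /fixed_inP[_ zw].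
  rewrite swaps_cons_orbits !permM; congr (swaps l _).
  have w_neq u : z u != u -> u != w by apply: contraNneq => ->; rewrite zw.
  have w_zneq u : z u != u -> z u != w by move=> zu; rewrite w_neq ?zK // eq_sym.
  by rewrite (@tpermD _ x y w) ?w_neq // tpermD ?w_zneq.
- by apply: perm_on_swaps => w; rewrite ?l1 ?l2 => /(subsetP (orbit_del_sub _ _)) /(subsetP _); apply.
- exact: commute_swaps_cons_orbits.
- by apply: perm_on_swaps => w; rewrite ?xy1 ?xy2 => /(subsetP _); apply.
Qed.

Lemma equivariant_matching_cons : equivariant_matching X1 X2 xy_l.
Proof.
have [xy1 xy2] := unzip_cons_orbits; have [_ _ _ _ l_sign] := l_matching; split=> //.
- exact: uniq_cons_orbits.
- exact: commute_swaps_cons_orbits.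
- by rewrite fixed_sign_cons_orbits l_sign /= negbK.
Qed.

End AddOrbits.

Lemma equivariant_matching0 : equivariant_matching set0 set0 [::].
Proof.
split=> //.
- by move=> x; rewrite !inE.
- by move=> x; rewrite !inE.
- by rewrite swaps_nil; apply: commute_sym; exact: commute1.
- by rewrite swaps_nil fixed_sign1.
Qed.

Lemma equivariant_matching1 x y : x \in R -> y \in R -> x != y -> z x = x -> z y = y ->
  equivariant_matching [set x] [set y] [:: (x, y)].
Proof.
move=> xR yR xy zx zy.
have txy : swaps [:: (x, y)] = tperm x y by rewrite /swaps big_seq1.
have tz : commute (tperm x y) z by rewrite /commute tperm_mulr zx zy.
split; rewrite ?txy //; first by rewrite /= inE xy.
- by move=> w; rewrite !inE.
- by move=> w; rewrite !inE.
have tR : perm_on R (tperm x y) by apply: perm_on_tperm.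
rewrite /= /fixed_sign -(_ : tperm x y = restr_perm (fixed_in R z) (tperm x y)) ?odd_tperm ?xy //.
apply/permP => w; rewrite restr_perm_if ?fixed_in_stable //; case: ifPn => // wF.
by rewrite tpermD //; apply: contraNneq wF => <-; apply/fixed_inP.
Qed.

Lemma exists_equivariant_matching X1 X2 :
  X1 \subset R -> X2 \subset R -> [disjoint X1 & X2] -> stable X1 -> stable X2 -> #|X1| = #|X2| ->
  #|fixed_in X1 z| = #|fixed_in X2 z| -> (#|fixed_in X1 z| <= 1)%N ->
  exists l, equivariant_matching X1 X2 l.
Proof.
have [m] := ubnP #|X1|; elim: m X1 X2 => // m IH X1 X2; rewrite ltnS => card1 X1R X2R X12 X1_stable X2_stable card12 fix12 fix1.
have moved X : (#|fixed_in X z| < #|X|)%N -> exists2 x, x \in X & z x != x.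
  rewrite ltnNge => /negP few; apply: contrapT => none; apply: few; apply: subset_leq_card.
  by apply/subsetP => x xX; apply/fixed_inP; split=> //; apply: contrapT => /eqP zx; apply: none; exists x.
have fixed_sub X : fixed_in X z \subset X by apply/subsetP => w /fixed_inP[].
case: (ltnP #|fixed_in X1 z| #|X1|) => [few1|many1].
  have [x xX zx] := moved _ few1; have [|y yX zy] := moved X2; first by rewrite -fix12 -card12.
  have [| | | | | | | | |l l_matching] := IH (orbit_del X1 x) (orbit_del X2 y).
  - by apply: leq_trans card1; rewrite (card_orbit_del X1_stable xX zx).
  - exact: subset_trans (orbit_del_sub _ _) X1R.
  - exact: subset_trans (orbit_del_sub _ _) X2R.
  - exact: disjointWl (orbit_del_sub _ _) (disjointWr (orbit_del_sub _ _) X12).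
  - exact: orbit_del_stable.
  - exact: orbit_del_stable.
  - by apply/eqP; rewrite -2!eqSS -!card_orbit_del // card12.
  - by rewrite !fixed_in_orbit_del.
  - by rewrite fixed_in_orbit_del.
  by exists ((x, y) :: (z x, z y) :: l); exact: equivariant_matching_cons.
have fixE X : (#|X| <= #|fixed_in X z|)%N -> fixed_in X z = X by move=> many; apply/eqP; rewrite eqEcard fixed_sub.
have fix1E := fixE _ many1; have fix2E : fixed_in X2 z = X2 by apply: fixE; rewrite -fix12 -card12.
move: fix1; rewrite fix1E leq_eqVlt ltnS leqn0 => /orP[/cards1P[x X1E]|/eqP card0].
  have /cards1P[y X2E] : #|X2| == 1%N by rewrite -card12 X1E cards1.
  have [|xR zx] := fixed_inP X1 z x _; first by rewrite fix1E X1E inE.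
  have [|yR zy] := fixed_inP X2 z y _; first by rewrite fix2E X2E inE.
  rewrite X1E X2E; exists [:: (x, y)]; apply: equivariant_matching1 => //.
  - exact: subsetP X1R x xR.
  - exact: subsetP X2R y yR.
  - by apply: contraTneq yR => <-; exact: disjoint_notin X12 xR.
have X1E : X1 = set0 by apply/eqP; rewrite -cards_eq0 card0.
have X2E : X2 = set0 by apply/eqP; rewrite -cards_eq0 -card12 card0.
by rewrite X1E X2E; exists [::]; exact: equivariant_matching0.
Qed.

End EquivariantMatchings.
End TranspositionProducts.

(** * Sign eigenvectors of permutation actions *)

Section UnitaryPermAction.
Variables (F : realFieldType) (T : finType) (V : lmodType F).
Variables (act : {perm T} -> {linear V -> V}) (B : {symmetric V}).
Hypothesis act1 : forall v, act 1%g v = v.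
Hypothesis actM : forall g h v, act (g * h)%g v = act h (act g v).
Hypothesis B_pos : forall v, v != 0 -> 0 < B v v.
Hypothesis B_act : forall g u v, B (act g u) (act g v) = B u v.
Implicit Types (g h s z : {perm T}) (X R : {set T}) (x y : T) (l : seq (T * T)) (u v : V).

Lemma form_act g u v : B (act g u) v = B u (act g^-1%g v).
Proof. by rewrite -{1}[v]act1 -(mulVg g) actM B_act. Qed.

Definition sym_invariant X v := forall h, perm_on X h -> act h v = v.

Definition symmetrize X v := \sum_(s | perm_on X s) act s v.

Lemma symmetrize_invariant X v : sym_invariant X (symmetrize X v).
Proof.
move=> s sX; rewrite /symmetrize linear_sum [RHS](reindex_inj (mulIg s)) /=.
apply: eq_big => [r|r _]; last by rewrite actM.
apply/idP/idP => rX; first exact: perm_onM.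
by rewrite -(mulgK s r) perm_onM ?perm_onV.
Qed.

Lemma form_symmetrize_ge0 X v : 0 <= B v (symmetrize X v).
Proof.
have : 0 <= B (symmetrize X v) (symmetrize X v).
  by case: (eqVneq (symmetrize X v) 0) => [->|/B_pos/ltW //]; rewrite linear0l.
rewrite {1}/symmetrize linear_sumlz /= (eq_bigr (fun=> B v (symmetrize X v))) => [|s sX]; last first.
  by rewrite form_act symmetrize_invariant // perm_onV.
rewrite sumr_const -mulr_natl pmulr_rge0 // ltr0n.
by apply/card_gt0P; exists 1%g; exact: perm_on1.
Qed.

Definition tperm_sum X x v := v + \sum_(y in X) act (tperm x y) v.

Lemma tperm_sumE X x v : x \notin X -> tperm_sum X x v = \sum_(y in x |: X) act (tperm x y) v.
Proof. by move=> xX; rewrite big_setU1 //= tperm1 act1. Qed.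

Lemma symmetrize_setU1 X x v : x \notin X ->
  symmetrize (x |: X) v = symmetrize X (tperm_sum X x v).
Proof.
move=> xX; rewrite tperm_sumE // /symmetrize.
rewrite (partition_big (fun s : {perm T} => (s^-1)%g x) (mem (x |: X))) /=; last first.
  by move=> s sX; rewrite perm_closed ?setU11 // perm_onV.
rewrite (eq_bigr (fun y => \sum_(s | perm_on X s) act s (act (tperm x y) v))) => [|y yX].
  by rewrite exchange_big /=; apply: eq_bigr => s _; rewrite linear_sum.
rewrite (reindex_inj (mulgI (tperm x y))) /=; apply: eq_big => [s|s _]; last by rewrite actM.
have txy : perm_on (x |: X) (tperm x y) by apply: perm_on_tperm => //; rewrite setU11.
have -> : ((tperm x y * s)^-1%g x == y) = (s x == x).
  by rewrite invMg permM tpermV -(inj_eq (@perm_inj _ (tperm x y))) tpermK tpermR -(inj_eq (@perm_inj _ s)) permKV eq_sym.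
apply/andP/idP => [[tsX /eqP sx]|sX].
  have sX : perm_on (x |: X) s by rewrite -[s]mul1g -(tperm2 x y) -mulgA perm_onM.
  apply/subsetP => w ws; have := subsetP sX w ws; rewrite !inE => /orP[/eqP wx|//].
  by move: ws; rewrite inE wx sx eqxx.
by rewrite (out_perm sX) // perm_onM // (perm_onS (subsetUr _ _) sX).
Qed.

Lemma tperm_sum_invariant X x v : x \notin X -> sym_invariant X v ->
  sym_invariant (x |: X) (tperm_sum X x v).
Proof.
move=> xX vX h hX; rewrite tperm_sumE // linear_sum [RHS](reindex_inj (@perm_inj _ h)) /=.
apply: eq_big => [y|y yX]; first by rewrite perm_closed.
rewrite -actM; set t := (tperm x y * h * tperm x (h y))%g.
have tX : perm_on X t.
  have tX' : perm_on (x |: X) t.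
    by do 2?apply: perm_onM => //; apply: perm_on_tperm; rewrite ?perm_closed ?setU11.
  apply/subsetP => w ws; have := subsetP tX' w ws; rewrite !inE => /orP[/eqP wx|//].
  by move: ws; rewrite inE wx /t !permM tpermL tpermR eqxx.
have -> : (tperm x y * h = t * tperm x (h y))%g by rewrite /t -mulgA tperm2 mulg1.
by rewrite actM vX.
Qed.

Section Block.
Variables (X Y : {set T}) (v : V).
Hypothesis XY : [disjoint X & Y].
Hypothesis vX : sym_invariant X v.
Hypothesis Y_rel : forall x, x \in Y -> tperm_sum X x v = 0.

Lemma sum_form_matched l x v' : uniq (unzip1 l ++ unzip2 l) -> x \notin unzip1 l ++ unzip2 l ->
  \sum_(y in unzip1 l) B (act (swaps l) (act (tperm x y) v)) v' =
  \sum_(y in unzip2 l) B (act (swaps l) v) (act (tperm x y) v').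
Proof.
rewrite mem_cat negb_or => l_uniq /andP[x1 x2]; have slK := swapsK l_uniq.
rewrite (reindex_inj (@perm_inj _ (swaps l))) /=; apply: eq_big => [y|y].
  by apply/idP/idP => [/(swaps_unzip1 l_uniq)|/(swaps_unzip2 l_uniq)//]; rewrite slK.
by move=> _; rewrite -actM tperm_mulr slK swaps_out // actM form_act tpermV.
Qed.

Lemma form_unmatched l x b y v' : sym_invariant X v' -> b \in X -> y \in X -> x \notin X ->
  b \notin unzip1 l ++ unzip2 l -> y \notin unzip1 l ++ unzip2 l ->
  B (act (swaps l) (act (tperm x y) v)) v' = B (act (swaps ((b, x) :: l)) v) v'.
Proof.
move=> v'X bX yX xX; rewrite !mem_cat !negb_or => /andP[b1 b2] /andP[y1 y2].
have neq w : w \in X -> w != x by move=> wX; apply: contraNneq xX => <-.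
have tX : perm_on X (tperm y b) by exact: perm_on_tperm.
have tl : (swaps l * tperm y b = tperm y b * swaps l)%g by rewrite tperm_mulr !swaps_out.
have -> : act (swaps ((b, x) :: l)) v = act (tperm y b) (act (swaps l) (act (tperm x y) v)).
  rewrite -[in LHS](vX tX) -!actM tl mulgA (tperm_mulr x y) tpermL tpermD ?neq //.
  by rewrite swaps_cons /= (tpermC x b) mulgA.
by rewrite [RHS]form_act tpermV v'X.
Qed.

Lemma card_unmatched l : uniq (unzip1 l) -> {subset unzip1 l <= X} ->
  #|[pred y in X | y \notin unzip1 l]| = (#|X| - size l)%N.
Proof.
move=> l_uniq l_sub; rewrite -(cardID (mem (unzip1 l)) X).
have -> : #|[predI X & mem (unzip1 l)]| = size l.
  rewrite -(size_map fst l) -(card_uniqP l_uniq); apply: eq_card => w; rewrite !inE /=.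
  by apply: andb_idl; exact: l_sub.
by rewrite addKn; apply: eq_card => w; rewrite !inE andbC.
Qed.

Lemma form_swaps_cons l b x v' : sym_invariant X v' ->
  uniq (unzip1 ((b, x) :: l) ++ unzip2 ((b, x) :: l)) ->
  {subset unzip1 ((b, x) :: l) <= X} -> {subset unzip2 ((b, x) :: l) <= Y} ->
  (#|X| - size l)%:R * B (act (swaps ((b, x) :: l)) v) v' =
  - B (act (swaps l) v) (tperm_sum [set y in unzip2 l] x v').
Proof.
move=> v'X /uniq_unzip_cons[/= l_uniq b_out x_out _] sub1 sub2.
have bX : b \in X by rewrite sub1 // mem_head.
have xY : x \in Y by rewrite sub2 // mem_head.
have l1X : {subset unzip1 l <= X} by move=> w wl; rewrite sub1 // inE wl orbT.
have l2Y : {subset unzip2 l <= Y} by move=> w wl; rewrite sub2 // inE wl orbT.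
have sumX : \sum_(y in X) B (act (swaps l) (act (tperm x y) v)) v' = - B (act (swaps l) v) v'.
  apply/eqP; rewrite -addr_eq0 addrC; apply/eqP.
  have := congr1 (fun u => B (act (swaps l) u) v') (Y_rel xY).
  by rewrite /tperm_sum linear0 linear0l linearD linearDl linear_sum linear_sumlz /=.
rewrite /tperm_sum linearDr linear_sumr /= opprD -sumX (bigID (mem (unzip1 l))) /=.
rewrite (eq_bigl (mem (unzip1 l))) => [|y]; last by apply: andb_idl; exact: l1X.
rewrite sum_form_matched // [X in _ - X](eq_bigl (mem (unzip2 l))) => [|y]; last by rewrite inE.
rewrite addrAC subrr add0r (eq_bigr (fun=> B (act (swaps ((b, x) :: l)) v) v')) => [|y /andP[yX yl]].
  have uniq1 : uniq (unzip1 l) by move: l_uniq; rewrite cat_uniq => /andP[].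
  by rewrite sumr_const mulr_natl -(card_unmatched uniq1 l1X).
rewrite (form_unmatched (b := b)) // ?(disjointFl XY xY) //.
by rewrite mem_cat negb_or yl; apply/negP => /l2Y; rewrite (disjointFr XY yX).
Qed.

Lemma form_swaps_symmetrize l v' : sym_invariant X v' ->
  uniq (unzip1 l ++ unzip2 l) -> {subset unzip1 l <= X} -> {subset unzip2 l <= Y} ->
  exists2 k, 0 < k &
    (-1) ^+ size l * B (act (swaps l) v) v' = k * B v (symmetrize [set x in unzip2 l] v').
Proof.
elim: l v' => [|[b x] l IH] v' v'X l_uniq sub1 sub2.
  exists 1 => //; rewrite expr0 !mul1r swaps_nil act1; congr (B v _).
  rewrite /symmetrize (big_pred1 1%g) ?act1 // => s.
  apply/idP/eqP => [sX|->]; last exact: perm_on1.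
  by apply: (perm_on_id sX); rewrite cardsE card0.
have [/= l_uniq' _ x_out _] := uniq_unzip_cons l_uniq.
have l1X : {subset unzip1 l <= X} by move=> w wl; apply: sub1; rewrite inE wl orbT.
have l2Y : {subset unzip2 l <= Y} by move=> w wl; apply: sub2; rewrite inE wl orbT.
have xY : x \in Y by apply: sub2; rewrite inE eqxx.
have xl2 : x \notin unzip2 l by move: x_out; rewrite mem_cat negb_or => /andP[].
have v''X : sym_invariant X (tperm_sum [set y in unzip2 l] x v').
  move=> h hX; rewrite /tperm_sum linearD v'X // linear_sum; congr (_ + _).
  apply: eq_bigr => y; rewrite inE => /l2Y yY.
  by rewrite -actM -(perm_onC hX (perm_on_tperm xY yY) XY) actM v'X.
have [k k_gt0 kE] := IH _ v''X l_uniq' l1X l2Y.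
have size_lt : (size l < #|X|)%N.
  have /andP[/= b_out _] : uniq (unzip1 ((b, x) :: l)) by move: l_uniq; rewrite cat_uniq => /andP[].
  rewrite -(size_map fst l) -(card_uniqP (_ : uniq (unzip1 l))); last first.
    by move: l_uniq'; rewrite cat_uniq => /andP[].
  apply: proper_card; apply/properP; split; first by apply/subsetP.
  by exists b => //; apply: sub1; rewrite inE eqxx.
have c_gt0 : (0 : F) < (#|X| - size l)%:R by rewrite ltr0n subn_gt0.
exists (k / (#|X| - size l)%:R); first exact: divr_gt0.
have -> : [set w in unzip2 ((b, x) :: l)] = x |: [set w in unzip2 l] by apply/setP => w; rewrite !inE.
rewrite symmetrize_setU1 ?inE // mulrAC -kE.
apply: (mulfI (lt0r_neq0 c_gt0)); rewrite [RHS]mulrC divfK ?lt0r_neq0 // mulrCA.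
by rewrite form_swaps_cons // /= exprS mulrN mulN1r mulNr opprK.
Qed.

Lemma form_swaps_ge0 l : uniq (unzip1 l ++ unzip2 l) ->
  {subset unzip1 l <= X} -> {subset unzip2 l <= Y} -> 0 <= (-1) ^+ size l * B (act (swaps l) v) v.
Proof.
move=> l_uniq l1 l2; have [k k_gt0 ->] := form_swaps_symmetrize vX l_uniq l1 l2.
by rewrite mulr_ge0 ?form_symmetrize_ge0 // ltW.
Qed.

End Block.

Section Colored.
Variables (C : eqType) (col : T -> C).

Definition colored g := [forall x, col (g x) == col x].

Lemma coloredP g : reflect (forall x, col (g x) = col x) (colored g).
Proof. by apply: (iffP forallP) => g_col x; [apply/eqP | rewrite g_col]. Qed.

Lemma colored1 : colored 1%g.
Proof. by apply/coloredP => x; rewrite perm1. Qed.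

Lemma coloredM g h : colored g -> colored h -> colored (g * h)%g.
Proof. by move=> /coloredP gc /coloredP hc; apply/coloredP => x; rewrite permM hc gc. Qed.

Lemma coloredV g : colored g -> colored g^-1%g.
Proof. by move=> /coloredP gc; apply/coloredP => x; rewrite -{2}(permKV g x) gc. Qed.

Lemma colored_on g X c : perm_on X g -> {in X, forall x, col x = c} -> colored g.
Proof.
move=> gX X_col; apply/coloredP => x; case: (boolP (x \in X)) => xX; last by rewrite (out_perm gX).
by rewrite !X_col // perm_closed.
Qed.

Definition colored_cent R z g := [&& perm_on R g, colored g & (g * z == z * g)%g].

Lemma colored_centP R z g : reflect [/\ perm_on R g, colored g & commute g z] (colored_cent R z g).
Proof. by apply: (iffP and3P) => -[gR gc gz]; split=> //; apply/eqP. Qed.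

Lemma colored_cent1 R z : colored_cent R z 1%g.
Proof. by apply/colored_centP; split; [exact: perm_on1 | exact: colored1 | exact/commute_sym/commute1]. Qed.

Lemma colored_centM R z g h : colored_cent R z g -> colored_cent R z h -> colored_cent R z (g * h)%g.
Proof.
move=> /colored_centP[gR gc gz] /colored_centP[hR hc hz]; apply/colored_centP; split.
- exact: perm_onM.
- exact: coloredM.
- by apply/commute_sym/commuteM; exact: commute_sym.
Qed.

Lemma colored_centV R z g : colored_cent R z g -> colored_cent R z g^-1%g.
Proof.
move=> /colored_centP[gR gc gz]; apply/colored_centP; split.
- exact: perm_onV.
- exact: coloredV.
- exact/commute_sym/commuteV/commute_sym.
Qed.

Lemma fixed_sign_centM R z g h : colored_cent R z g -> colored_cent R z h ->
  fixed_sign R z (g * h)%g = fixed_sign R z g (+) fixed_sign R z h.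
Proof. by move=> /colored_centP[gR _ gz] /colored_centP[hR _ hz]; exact: fixed_signM. Qed.

Definition sign_eigenvector R z v :=
  forall g, colored_cent R z g -> act g v = (-1) ^+ fixed_sign R z g *: v.

Definition signed_average R z v :=
  \sum_(g | colored_cent R z g) (-1) ^+ fixed_sign R z g *: act g v.

Lemma signed_average_eigen R z v : sign_eigenvector R z (signed_average R z v).
Proof.
move=> h hC; rewrite /signed_average linear_sum scaler_sumr [RHS](reindex_inj (mulIg h)) /=.
apply: eq_big => [g|g gC].
  apply/idP/idP => gC; first exact: colored_centM.
  by rewrite -(mulgK h g) colored_centM ?colored_centV.
rewrite linearZ actM fixed_sign_centM // signr_addb scalerA [X in _ = X *: _]mulrCA.
by rewrite -expr2 sqrr_sign mulr1.
Qed.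

Lemma signed_average_neq0 R z v : v != 0 ->
  (forall g, colored_cent R z g -> 0 <= (-1) ^+ fixed_sign R z g * B (act g v) v) ->
  signed_average R z v != 0.
Proof.
move=> v_neq0 nonneg; suff : 0 < B (signed_average R z v) v.
  by apply: contraTneq => ->; rewrite linear0l ltxx.
rewrite /signed_average linear_sumlz /= (bigD1 1%g) ?colored_cent1 //= fixed_sign1 scale1r act1.
apply: ltr_wpDr; last exact: B_pos.
by apply: sumr_ge0 => g /andP[gC _]; rewrite linearZl /= nonneg.
Qed.

Section BlockExtension.
Variables (R X : {set T}) (c : C) (zX z' : {perm T}) (v : V).
Let Y := R :\: X.
Hypotheses (XR : X \subset R) (X_col : {in X, forall x, col x = c}).
Hypotheses (zXK : involutive zX) (zX_on : perm_on X zX).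
Hypothesis zX_fixed : (#|[set x in X | zX x == x]| <= 1)%N.
Hypotheses (z'K : involutive z') (z'_on : perm_on Y z') (z'_col : colored z').
Hypotheses (vX : sym_invariant X v) (v_eigen : sign_eigenvector Y z' v).
Hypothesis Y_rel : forall x, x \in Y -> col x = c -> tperm_sum X x v = 0.

Let z := (zX * z')%g.

Let XY : [disjoint X & Y].
Proof. by rewrite disjoint_subset; apply/subsetP => x xX; rewrite !inE xX. Qed.

Let zE_block x : x \in X -> z x = zX x.
Proof. by move=> xX; rewrite permM (out_perm z'_on) // (disjoint_notin XY) // perm_closed. Qed.

Let zE_rest x : x \in Y -> z x = z' x.
Proof. by move=> xY; rewrite permM (out_perm zX_on) // (disjointFl XY). Qed.

Lemma block_extensionK : involutive z.
Proof.
apply/perm_involutive; rewrite /z -mulgA [(z' * _)%g]mulgA -(perm_onC zX_on z'_on XY).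
by rewrite -!mulgA ((perm_involutive _).2 z'K) mulg1 ((perm_involutive _).2 zXK).
Qed.

Lemma block_extension_on : perm_on R z.
Proof. by apply: perm_onM; [exact: perm_onS zX_on | exact: perm_onS (subsetDl _ _) z'_on]. Qed.

Lemma block_extension_colored : colored z.
Proof. by apply: coloredM z'_col; exact: colored_on zX_on X_col. Qed.

Let z_stable_block x : (z x \in X) = (x \in X).
Proof.
apply/idP/idP => [zxX|xX]; last by rewrite zE_block // perm_closed.
by rewrite -(block_extensionK x) zE_block // perm_closed.
Qed.

Let fixed_in_block : (#|fixed_in X z| <= 1)%N.
Proof.
apply: leq_trans zX_fixed; apply: subset_leq_card; apply/subsetP => x /fixed_inP[xX zx].
by rewrite inE xX -zE_block // zx eqxx.
Qed.

Lemma block_stabilizer_eigen g : colored_cent R z g -> (forall x, x \in X -> g x \in X) ->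
  act g v = (-1) ^+ fixed_sign R z g *: v.
Proof.
move=> /colored_centP[gR gc gz] gX.
have gX_eq x : (g x \in X) = (x \in X).
  have gXE : g @: X = X.
    apply/eqP; rewrite eqEcard card_imset ?leqnn ?andbT; last exact: perm_inj.
    by apply/subsetP => _ /imsetP[y yX ->]; exact: gX.
  by rewrite -{1}gXE mem_imset //; exact: perm_inj.
have gY x : x \in Y -> g x \in Y by rewrite !inE gX_eq perm_closed.
pose gX' := restr_perm X g; pose gY' := restr_perm Y g.
have gXE x : gX' x = if x \in X then g x else x by apply: restr_perm_if; exact: mem_astabs_perm.
have gYE x : gY' x = if x \in Y then g x else x by apply: restr_perm_if; exact: mem_astabs_perm.
have gE : g = (gX' * gY')%g.
  apply/permP => x; rewrite permM gXE; case: ifPn => xX; first by rewrite gYE inE gX_eq xX.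
  rewrite gYE; case: ifPn => // xY; rewrite (out_perm gR) //.
  by apply: contra xY => xR; rewrite inE xX.
have gY'C : colored_cent Y z' gY'.
  apply/colored_centP; split; first exact: restr_perm_on.
    by apply/coloredP => x; rewrite gYE; case: ifP => // _; exact: (coloredP _ gc).
  apply/permP => x; rewrite !permM !gYE; case: (boolP (x \in Y)) => xY.
    by rewrite perm_closed // xY -!zE_rest ?gY // -!permM gz.
  by rewrite (out_perm z'_on) // (negbTE xY).
rewrite {1}gE actM vX ?v_eigen //; last exact: restr_perm_on.
have [gY'R _ gY'z'] := colored_centP _ _ _ gY'C.
congr (_ ^+ nat_of_bool _ *: _); apply: eq_fixed_sign => // x; rewrite gYE !inE.
case: (boolP (x \in X)) => xX /=; last by case: (boolP (x \in R)) => //= xR; rewrite zE_rest // inE xX.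
case: ifPn => // /andP[_ /eqP zx]; apply/esym.
have xF : x \in fixed_in X z by apply/fixed_inP.
have gxF : g x \in fixed_in X z by apply/fixed_inP; rewrite gX_eq -permM gz permM zx.
by move/card_le1_eqP: fixed_in_block => /(_ _ _ gxF xF).
Qed.

Lemma exists_block_correction g : colored_cent R z g -> exists l,
  [/\ uniq (unzip1 l ++ unzip2 l), {subset unzip1 l <= X},
      {subset unzip2 l <= [set x in Y | col x == c]}, colored_cent R z (swaps l) &
      fixed_sign R z (swaps l) = odd (size l) /\ forall x, x \in X -> swaps l (g x) \in X].
Proof.
move=> /colored_centP[gR gc gz]; have gzx x : g (z x) = z (g x) by rewrite -!permM gz.
have gXR : g @: X \subset R.
  by apply/subsetP => _ /imsetP[x xX ->]; rewrite perm_closed //; exact: (subsetP XR).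
have z_gX x : (z x \in g @: X) = (x \in g @: X).
  have sub w : w \in g @: X -> z w \in g @: X.
    by move=> /imsetP[y yX ->]; rewrite -gzx imset_f // z_stable_block.
  by apply/idP/idP => [/sub|/sub //]; rewrite block_extensionK.
have card_gX : #|g @: X| = #|X| by rewrite card_imset //; exact: perm_inj.
have card_fixed_gX : #|fixed_in (g @: X) z| = #|fixed_in X z|.
  by rewrite fixed_in_imset // card_imset //; exact: perm_inj.
have cardD_sym (D1 D2 : {set T}) : #|D1| = #|D2| -> #|D1 :\: D2| = #|D2 :\: D1|.
  by move=> card_eq; rewrite !cardsD card_eq setIC.
have [||||||||l [l_uniq l1 l2 lz l_sign]] :=
    @exists_equivariant_matching _ R z block_extensionK (X :\: g @: X) (g @: X :\: X).
- exact: subset_trans (subsetDl _ _) XR.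
- exact: subset_trans (subsetDl _ _) gXR.
- by rewrite disjoint_subset; apply/subsetP => x; rewrite !inE => /andP[_ ->].
- by move=> x; rewrite !inE z_gX z_stable_block.
- by move=> x; rewrite !inE z_gX z_stable_block.
- exact: cardD_sym.
- by rewrite !fixed_inD; exact: cardD_sym.
- by rewrite fixed_inD (leq_trans (subset_leq_card (subsetDl _ _))).
have sub1 : {subset unzip1 l <= X} by move=> x; rewrite l1 inE => /andP[].
have sub2 : {subset unzip2 l <= [set x in Y | col x == c]}.
  move=> x; rewrite l2 !inE => /andP[-> /imsetP[y yX ->]] /=.
  by rewrite perm_closed // (subsetP XR) //= (coloredP _ gc) X_col.
have l_on (D : {set T}) : X \subset D -> [set x in Y | col x == c] \subset D -> perm_on D (swaps l).
  by move=> /subsetP XD /subsetP YD; apply: perm_on_swaps => x; [move/sub1/XD | move/sub2/YD].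
exists l; split=> //.
  apply/colored_centP; split=> //.
    by apply: l_on => //; apply/subsetP => x; rewrite !inE => /andP[/andP[]].
  apply: (@colored_on _ (X :|: [set x in Y | col x == c]) c); first by apply: l_on; rewrite ?subsetUl ?subsetUr.
  by move=> x /setUP[/X_col //|]; rewrite inE => /andP[_ /eqP].
split=> // x xX; have gxX : g x \in g @: X by exact: imset_f.
case: (boolP (g x \in X)) => gx; first by rewrite swaps_out ?l1 ?l2 ?inE ?gx ?gxX.
by apply/sub1/swaps_unzip2; rewrite // l2 inE gx.
Qed.

Lemma form_signed_ge0 g : colored_cent R z g -> 0 <= (-1) ^+ fixed_sign R z g * B (act g v) v.
Proof.
move=> gC; have [l [l_uniq l1 l2 lC [l_sign lgX]]] := exists_block_correction gC.
have glC := colored_centM gC lC.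
have gE : g = (g * swaps l * swaps l)%g.
  by rewrite -mulgA ((perm_involutive _).2 (swapsK l_uniq)) mulg1.
have gl_eigen : act (g * swaps l)%g v = (-1) ^+ fixed_sign R z (g * swaps l)%g *: v.
  by apply: block_stabilizer_eigen => // x xX; rewrite permM lgX.
rewrite {2}gE actM gl_eigen linearZ linearZl /= {1}gE fixed_sign_centM // signr_addb.
rewrite mulrACA -expr2 sqrr_sign mul1r l_sign signr_odd.
apply: (form_swaps_ge0 (X := X) (Y := [set x in Y | col x == c])) => //.
  rewrite disjoint_subset; apply/subsetP => x xX; rewrite !inE xX.
  by [].
by move=> x; rewrite inE => /andP[xY /eqP]; exact: Y_rel.
Qed.

End BlockExtension.

Definition act_stable R (U : V -> Prop) := forall g u, perm_on R g -> colored g -> U u -> U (act g u).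

Definition block R (U : V -> Prop) x0 X := [/\ X \subset R, x0 \in X, {in X, forall x, col x = col x0} &
  exists u, [/\ U u, sym_invariant X u & u != 0]].

Lemma subspace_tperm_sum R (U : V -> Prop) X x v : subspace U -> act_stable R U ->
  x \in R -> X \subset R -> {in X, forall y, col y = col x} -> U v -> U (tperm_sum X x v).
Proof.
move=> [U0 [UD UZ]] U_stable xR XR X_col Uv; apply: (UD) => //.
apply: (big_ind U) => [//||y yX]; first exact: UD.
apply: U_stable => //.
  by apply: perm_on_tperm => //; exact: (subsetP XR).
apply: (@colored_on _ (x |: X) (col x)); last by move=> w /setU1P[->|/X_col].
by apply: perm_on_tperm; rewrite !inE ?eqxx ?yX ?orbT.
Qed.

Lemma exists_maximal_block R (U : V -> Prop) x0 : subspace U -> act_stable R U ->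
  x0 \in R -> (exists2 u, U u & u != 0) ->
  exists2 X, block R U x0 X & forall x v, x \in R :\: X -> col x = col x0 -> U v ->
    sym_invariant X v -> tperm_sum X x v = 0.
Proof.
move=> U_sub U_stable x0R [u0 Uu0 u0_neq0].
have block0 : block R U x0 [set x0].
  split; [by rewrite sub1set | exact: set11 | by move=> x /set1P-> | exists u0; split=> // h hx0].
  by have -> : h = 1%g by apply: (perm_on_id hx0); rewrite cards1.
have [X X_block X_max] := exists_minimizer (fun X => #|R| - #|X|)%N (ex_intro _ _ block0).
have [XR x0X X_col _] := X_block; exists X => // x v; rewrite inE => /andP[xX xR] x_col Uv vX.
apply: contrapT => /eqP sum_neq0.
have xXR : x |: X \subset R by apply/subsetP => y /setU1P[->|/(subsetP XR)].
have block_xX : block R U x0 (x |: X).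
  split=> //; first by rewrite inE x0X orbT.
    by move=> y /setU1P[->|/X_col].
  exists (tperm_sum X x v); split=> //; last exact: tperm_sum_invariant.
  by apply: (subspace_tperm_sum U_sub U_stable) => // y yX; rewrite x_col X_col.
have := X_max _ block_xX; have := subset_leq_card xXR; rewrite cardsU1 xX /=.
by move: #|R| #|X| => *; lia.
Qed.

(* Induction on [#|R|]: split off a maximal block [X] on which some vector of [U] is symmetric,
   take a near-perfect matching of [X], and an involution of [R :\: X] provided by the induction. *)
Lemma exists_sign_eigenvector R (U : V -> Prop) : subspace U -> act_stable R U ->
  (exists2 u, U u & u != 0) -> exists z, [/\ involutive z, perm_on R z, colored z &
    exists v, [/\ U v, v != 0 & sign_eigenvector R z v]].
Proof.
have [m] := ubnP #|R|; elim: m R U => // m IH R U; rewrite ltnS => cardR U_sub U_stable U_neq0.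
case: (set_0Vmem R) => [R0|[x0 x0R]].
  have [u Uu u_neq0] := U_neq0; exists 1%g; split; [|exact: perm_on1|exact: colored1|].
    by move=> x; rewrite !perm1.
  exists u; split=> // g /colored_centP[gR _ _].
  have -> : g = 1%g by apply: (perm_on_id gR); rewrite R0 cards0.
  by rewrite act1 fixed_sign1 scale1r.
have [X [XR x0X X_col [u [Uu uX u_neq0]]] X_rel] := exists_maximal_block U_sub U_stable x0R U_neq0.
pose Y := R :\: X; pose U' w := U w /\ sym_invariant X w.
have XY : [disjoint X & Y] by rewrite disjoint_subset; apply/subsetP => x xX; rewrite !inE xX.
have cardY : (#|Y| < m)%N.
  apply: leq_trans cardR; apply: proper_card; apply/properP; split; first exact: subsetDl.
  by exists x0; rewrite // inE x0X.
have [U0 [UD UZ]] := U_sub.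
have U'_sub : subspace U'.
  split; first by split=> // h _; rewrite linear0.
  split=> [w w' [Uw wX] [Uw' w'X]|k w [Uw wX]].
    by split=> [|h hX]; [exact: UD | rewrite linearD wX ?w'X].
  by split=> [|h hX]; [exact: UZ | rewrite linearZ wX].
have U'_stable : act_stable Y U'.
  move=> g w gY gc [Uw wX]; split; first by apply: U_stable => //; exact: perm_onS (subsetDl _ _) gY.
  by move=> h hX; rewrite -actM -(perm_onC hX gY XY) actM wX.
have [|z' [z'K z'_on z'_col [v [[Uv vX] v_neq0 v_eigen]]]] := IH Y U' cardY U'_sub U'_stable.
  by exists u.
have [zX [zXK zX_on zX_fixed]] := exists_near_perfect_matching X.
have Y_rel x : x \in Y -> col x = col x0 -> tperm_sum X x v = 0 by move=> *; exact: X_rel.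
exists (zX * z')%g; split.
- exact: block_extensionK zXK zX_on z'K z'_on.
- exact: block_extension_on XR zX_on z'_on.
- exact: block_extension_colored X_col zX_on z'_col.
exists (signed_average R (zX * z')%g v); split; last exact: signed_average_eigen.
- by apply: (big_ind U) => [//||g /colored_centP[gR gc _]]; [exact: UD | exact/UZ/U_stable].
- apply: signed_average_neq0 => // g.
  exact: (form_signed_ge0 XR X_col zXK zX_on zX_fixed z'K z'_on vX v_eigen Y_rel).
Qed.

End Colored.
End UnitaryPermAction.

(** * Signed transpositions and word length *)

Definition stransp (p q x : int) : int :=
  if x == p then q else if x == q then p else
  if x == - p then - q else if x == - q then - p else x.

Ltac stransp_cases := rewrite /stransp; repeat (case: eqP => ?); lia.
Ltac stransp_cases_at x := rewrite /stransp; repeat (case: (x =P _) => ?); repeat (case: eqP => ?); lia.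

Section SignedTranspositions.
Implicit Types p q x : int.

Lemma stransp_l p q : stransp p q p = q.
Proof. by rewrite /stransp eqxx. Qed.

Lemma stransp_r p q : stransp p q q = p.
Proof. by rewrite /stransp eqxx; case: eqP => // ->. Qed.

Lemma stranspC p q x : stransp q p x = stransp p q x.
Proof. by stransp_cases_at x. Qed.

Lemma stransp_id p q x : `|x| != `|p| -> `|x| != `|q| -> stransp p q x = x.
Proof. by stransp_cases. Qed.

Lemma stranspK p q : p != 0 /\ q != 0 -> involutive (stransp p q).
Proof. move=> [p0 q0] x; stransp_cases_at x. Qed.

Lemma stranspN p q x : p != 0 /\ q != 0 -> stransp p q (- x) = - stransp p q x.
Proof. move=> [p0 q0]; stransp_cases. Qed.

Lemma stransp_opp p q x : p != 0 /\ q != 0 -> stransp (- q) (- p) x = stransp p q x.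
Proof. by move=> [p0 q0]; rewrite /stransp !opprK; repeat (case: eqP => ?); lia. Qed.

Lemma stransp_neq0 p q x : p != 0 /\ q != 0 -> x != 0 -> stransp p q x != 0.
Proof. by move=> [p0 q0] x0; rewrite /stransp; repeat case: ifP => _ //; rewrite oppr_eq0. Qed.

Definition maps_root (u : int -> int) p q p' q' : Prop := (u p = p' /\ u q = q') \/ (u p = - q' /\ u q = - p').

Lemma maps_root_sym (u : int -> int) p q p' q' : involutive u -> {morph u : x / - x} ->
  maps_root u p q p' q' -> maps_root u p' q' p q.
Proof. by move=> uK uN [[<- <-]|[up uq]]; [left; rewrite !uK | right; rewrite -[p']opprK -[q']opprK -up -uq !uN !uK]. Qed.

Lemma stransp_conj (u : int -> int) p q p' q' : injective u -> {morph u : x / - x} ->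
  p' != 0 /\ q' != 0 -> maps_root u p q p' q' ->
  forall x, u (stransp p q x) = stransp p' q' (u x).
Proof.
move=> u_inj uN neq0; case=> -[up uq] x.
  by rewrite -up -uq /stransp -!uN !(inj_eq u_inj); repeat case: eqP => _.
by rewrite -(stransp_opp _ neq0) -up -uq /stransp -!uN !(inj_eq u_inj); repeat case: eqP => _.
Qed.

Lemma stransp_comm p q p' q' x : p != 0 /\ q != 0 -> p' != 0 /\ q' != 0 ->
  `|p| != `|p'| -> `|p| != `|q'| -> `|q| != `|p'| -> `|q| != `|q'| ->
  stransp p q (stransp p' q' x) = stransp p' q' (stransp p q x).
Proof.
move=> neq0 neq0' pp' pq' qp' qq'.
apply: (stransp_conj (can_inj (stranspK neq0)) (fun y => stranspN y neq0)) => //.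
by left; rewrite !stransp_id // eq_sym.
Qed.

Lemma stransp_comm_opp p q x : p != 0 /\ q != 0 -> `|p| != `|q| ->
  stransp (- p) q (stransp p q x) = stransp p q (stransp (- p) q x).
Proof.
move=> neq0 pq; have [p0 q0] := neq0; have neq0' : - p != 0 /\ q != 0 by rewrite oppr_eq0.
apply/esym/(stransp_conj (can_inj (stranspK neq0)) (fun y => stranspN y neq0)) => //.
by right; rewrite (stranspN _ neq0) stransp_l stransp_r opprK.
Qed.

(* Both sides are [stransp p r], the conjugate of each reflection by the other one. *)
Lemma stransp_braid3 p q r x : [/\ p != 0, q != 0 & r != 0] -> [/\ `|p| != `|q|, `|p| != `|r| & `|q| != `|r|] ->
  stransp p q (stransp q r (stransp p q x)) = stransp q r (stransp p q (stransp q r x)).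
Proof.
move=> [p0 q0 r0] [pq pr qr].
have pq0 := conj p0 q0; have qr0 := conj q0 r0; have pr0 := conj p0 r0.
have conj_pq y : stransp p q (stransp q r y) = stransp p r (stransp p q y).
  apply: (stransp_conj (can_inj (stranspK pq0)) (fun y => stranspN y pq0) pr0).
  by left; rewrite stransp_r stransp_id // eq_sym.
have conj_qr y : stransp q r (stransp p q y) = stransp p r (stransp q r y).
  apply: (stransp_conj (can_inj (stranspK qr0)) (fun y => stranspN y qr0) pr0).
  by left; rewrite stransp_l stransp_id.
by rewrite conj_pq conj_qr !stranspK.
Qed.

Lemma stransp_braid4 p q x : p != 0 /\ q != 0 -> `|p| != `|q| ->
  stransp (- p) p (stransp p q (stransp (- p) p (stransp p q x))) =
  stransp p q (stransp (- p) p (stransp p q (stransp (- p) p x))).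
Proof.
move=> pq0 pq; have [p0 q0] := pq0.
have pp0 : - p != 0 /\ p != 0 by rewrite oppr_eq0.
have qq0 : - q != 0 /\ q != 0 by rewrite oppr_eq0.
have conj_pq y : stransp p q (stransp (- p) p (stransp p q y)) = stransp (- q) q y.
  rewrite -{2}(stranspK pq0 y).
  apply: (stransp_conj (can_inj (stranspK pq0)) (fun y => stranspN y pq0) qq0).
  by left; rewrite (stranspN _ pq0) stransp_l.
by rewrite !conj_pq stransp_comm ?normrN.
Qed.

Definition conj_fun p q (f : int -> int) (x : int) : int := stransp p q (f (stransp p q x)).

Lemma conj_funN p q f : p != 0 /\ q != 0 -> {morph f : x / - x} -> {morph conj_fun p q f : x / - x}.
Proof. by move=> neq0 fN x; rewrite /conj_fun stranspN // fN stranspN. Qed.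

Lemma conj_fun_involutive p q f : p != 0 /\ q != 0 -> involutive f -> involutive (conj_fun p q f).
Proof. by move=> neq0 fK x; rewrite /conj_fun !(stranspK neq0) fK stranspK. Qed.

End SignedTranspositions.

Section Points.
Variable N : nat.
Implicit Types (k : pt N) (a b w : {perm pt N}) (x y p q : int).

Lemma toZ_bound k : (absz (toZ k) <= N)%N.
Proof. have := ltn_ord k; rewrite /toZ; lia. Qed.

Lemma ofZK x : (absz x <= N)%N -> toZ (ofZ N x) = x.
Proof. by move=> hx; rewrite /toZ /ofZ inordK; lia. Qed.

Lemma toZK k : ofZ N (toZ k) = k.
Proof.
apply: val_inj; rewrite /ofZ /= inordK /toZ; have := ltn_ord k; lia.
Qed.

Lemma apZ_toZ w k : apZ w (toZ k) = toZ (w k).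
Proof. by rewrite /apZ toZ_bound toZK. Qed.

Lemma apZ_out w x : (N < absz x)%N -> apZ w x = x.
Proof. by rewrite /apZ ltnNge => /negbTE->. Qed.

Lemma apZ_bound w x : (absz (apZ w x) <= N)%N = (absz x <= N)%N.
Proof.
by rewrite /apZ; case: ifP => // _; exact: toZ_bound.
Qed.

Lemma apZ_permc a b x : apZ (permc a b) x = apZ a (apZ b x).
Proof.
case: (leqP (absz x) N) => hx; last by rewrite !apZ_out // apZ_out.
by rewrite -(ofZK hx) !apZ_toZ /permc permM.
Qed.

Lemma apZ1 x : apZ (1 : {perm pt N})%g x = x.
Proof.
case: (leqP (absz x) N) => hx; last by rewrite apZ_out.
by rewrite -(ofZK hx) apZ_toZ perm1.
Qed.

Lemma apZVK w x : apZ w^-1%g (apZ w x) = x.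
Proof. by rewrite -apZ_permc /permc mulgV apZ1. Qed.

Lemma apZKV w x : apZ w (apZ w^-1%g x) = x.
Proof. by rewrite -apZ_permc /permc mulVg apZ1. Qed.

Lemma apZ_inj w : injective (apZ w).
Proof. exact: can_inj (apZVK w). Qed.

Lemma eq_apZ a b : apZ a =1 apZ b -> a = b.
Proof.
move=> ab; apply/permP => k; apply: (can_inj toZK).
by rewrite -!apZ_toZ ab.
Qed.

Lemma isBCP w : reflect (forall x, apZ w (- x) = - apZ w x) (isBC w).
Proof.
apply: (iffP forallP) => [wN x|wN k]; last by rewrite wN.
case: (leqP (absz x) N) => hx; last by rewrite !apZ_out // abszN.
by rewrite -(ofZK hx); apply/eqP.
Qed.

Lemma apZ_tperm p q x : (absz p <= N)%N -> (absz q <= N)%N ->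
  apZ (tperm (ofZ N p) (ofZ N q)) x = if x == p then q else if x == q then p else x.
Proof.
move=> hp hq; case: (leqP (absz x) N) => hx; last first.
  by rewrite apZ_out //; case: eqP => [?|_]; [lia | case: eqP => //; lia].
rewrite -{1}(ofZK hx) apZ_toZ.
have ofZ_eq y : (absz y <= N)%N -> (ofZ N x == ofZ N y) = (x == y).
  by move=> hy; apply/eqP/eqP => [/(congr1 toZ)|->//]; rewrite !ofZK.
rewrite permE /= !ofZ_eq //; case: eqP => _; first by rewrite ofZK.
by case: eqP => _; rewrite ofZK.
Qed.

Lemma apZ_sgen i x : (0 < i < N)%N -> apZ (sgen N i) x = stransp i%:Z (i%:Z + 1) x.
Proof.
by move=> hi; rewrite /sgen -[(_ * _)%g]/(permc _ _) apZ_permc !apZ_tperm; try lia; stransp_cases_at x.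
Qed.

Lemma apZ_s0 x : (0 < N)%N -> apZ (s0 N) x = stransp (-1) 1 x.
Proof.
by move=> hN; rewrite /s0 apZ_tperm; try lia; stransp_cases_at x.
Qed.

Lemma apZ_sm1 x : (1 < N)%N -> apZ (sm1 N) x = stransp (-1) 2 x.
Proof.
by move=> hN; rewrite /sm1 -[(_ * _)%g]/(permc _ _) apZ_permc !apZ_tperm; try lia; stransp_cases_at x.
Qed.

Definition simple_root (t : CoxType) (r : nat) p q : bool :=
  [|| [&& 1 <= p, p < r%:Z & q == p + 1],
      [&& (if t is TBC then true else false), p == -1 & q == 1] |
      [&& (if t is TD then true else false), p == -1 & q == 2]].

Lemma gen_simple_root (t : CoxType) (r : nat) (s : {perm pt N}) : (2 <= r <= N)%N ->
  s \in gens t N r -> exists p q, simple_root t r p q /\ apZ s =1 stransp p q.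
Proof.
move=> hr.
have sgen_root : s \in [seq sgen N i | i <- iota 1 r.-1] ->
    exists p q, simple_root t r p q /\ apZ s =1 stransp p q.
  move=> /mapP[i]; rewrite mem_iota => hi ->.
  exists i%:Z, (i%:Z + 1); split; first by rewrite /simple_root; apply/orP; left; lia.
  by move=> x; rewrite apZ_sgen; lia.
case: t sgen_root => //= sgen_root; rewrite inE => /orP[/eqP->|//].
- exists (-1), 1; split; first by rewrite /simple_root; lia.
  by move=> x; rewrite apZ_s0 //; lia.
- exists (-1), 2; split; first by rewrite /simple_root; lia.
  by move=> x; rewrite apZ_sm1 //; lia.
Qed.

Lemma simple_root_gen (t : CoxType) (r : nat) p q : (2 <= r <= N)%N ->
  simple_root t r p q -> exists2 s, s \in gens t N r & apZ s =1 stransp p q.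
Proof.
move=> hr /or3P[/and3P[p1 pr /eqP->]|/and3P[tE /eqP-> /eqP->]|/and3P[tE /eqP-> /eqP->]].
- exists (sgen N (absz p)); last by move=> x; rewrite apZ_sgen; [congr stransp; lia | lia].
  have : sgen N (absz p) \in [seq sgen N i | i <- iota 1 r.-1].
    by apply: map_f; rewrite mem_iota; lia.
  by case: t => //= sS; rewrite inE sS orbT.
- by case: t tE => // _; exists (s0 N); [rewrite inE eqxx | move=> x; rewrite apZ_s0 //; lia].
- by case: t tE => // _; exists (sm1 N); [rewrite inE eqxx | move=> x; rewrite apZ_sm1 //; lia].
Qed.

End Points.

Section Words.
Variables (gT : finGroupType) (S : seq gT).
Implicit Types (s a w : gT).

Lemma words_consP k w : w \in words S k.+1 ->
  exists g a, [/\ g \in S, a \in words S k & w = (g * a)%g].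
Proof. by rewrite /words iterS => /imset2P[g a]; rewrite inE => gS aw ->; exists g, a. Qed.

Lemma words_mull k g a : g \in S -> a \in words S k -> (g * a)%g \in words S k.+1.
Proof. by move=> gS aw; rewrite /words iterS; apply: imset2_f; rewrite ?inE. Qed.

Lemma words0 w : (w \in words S 0) = (w == 1%g).
Proof. by rewrite /words /= inE. Qed.

Lemma words_mulr k w s : s \in S -> w \in words S k -> (w * s)%g \in words S k.+1.
Proof.
move=> sS; elim: k w => [|k IH] w; last first.
  by move=> /words_consP[g [a [gS aw ->]]]; rewrite -mulgA; apply/words_mull/IH.
rewrite words0 => /eqP->; rewrite mul1g -[s]mulg1.
by apply: words_mull; rewrite ?words0.
Qed.

Lemma words_rconsP k w : w \in words S k.+1 ->
  exists s a, [/\ s \in S, a \in words S k & w = (a * s)%g].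
Proof.
elim: k w => [|k IH] w /words_consP[g [a [gS aw ->]]].
  move: aw; rewrite words0 => /eqP->; exists g, 1%g.
  by rewrite words0 mulg1 mul1g.
have [s [b [sS bw ->]]] := IH _ aw.
by exists s, (g * b)%g; split=> //; [exact: words_mull | rewrite mulgA].
Qed.

Lemma mem_gen_words w : w \in <<[set:: S]>>%g <-> exists k, w \in words S k.
Proof.
split=> [/gen_prodgP[k [c cS ->{w}]]|[k]].
  exists k; elim: k c cS => [|k IH] c cS; first by rewrite big_ord0 words0.
  rewrite big_ord_recl; apply: words_mull; last exact: IH.
  by have := cS ord0; rewrite inE.
elim: k w => [|k IH] w; first by rewrite words0 => /eqP->; exact: group1.
move=> /words_consP[g [a [gS aw ->]]]; apply: groupM; last exact: IH.
by apply: mem_gen; rewrite inE.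
Qed.

Lemma gen_rind (Q : gT -> Prop) : Q 1%g ->
  (forall s a, s \in S -> a \in <<[set:: S]>>%g -> Q a -> Q (a * s)%g) ->
  forall w, w \in <<[set:: S]>>%g -> Q w.
Proof.
move=> Q1 QS w /mem_gen_words[k]; elim: k w => [|k IH] w.
  by rewrite words0 => /eqP->.
move=> /words_rconsP[s [a [sS aw ->]]]; apply: QS => //; last exact: IH.
by apply/mem_gen_words; exists k.
Qed.

(* The balls in the Cayley graph grow strictly until they fill the group. *)
Lemma gen_words_short w : w \in <<[set:: S]>>%g ->
  exists2 k, (k <= #|gT|)%N & w \in words S k.
Proof.
pose A k : {set gT} := [set a | [exists i : 'I_k.+1, a \in words S i]].
have AP k a : reflect (exists2 i, (i <= k)%N & a \in words S i) (a \in A k).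
  rewrite inE; apply: (iffP existsP) => [[i ai]|[i ik ai]].
    by exists i => //; rewrite -ltnS.
  by exists (Ordinal (ik : (i < k.+1)%N)).
have closed k : A k.+1 \subset A k -> <<[set:: S]>>%g \subset A k.
  move=> hk; apply/subsetP => a /mem_gen_words[m]; elim: m a => [|m IH] a.
    by move=> am; apply/AP; exists 0%N.
  move=> /words_consP[g [b [gS bw ->]]].
  have /AP[i ik bi] := IH _ bw.
  by apply: (subsetP hk); apply/AP; exists i.+1; rewrite // words_mull.
have grow k : <<[set:: S]>>%g \subset A k \/ (k < #|A k|)%N.
  elim: k => [|k [IH|IH]].
  - by right; apply/card_gt0P; exists 1%g; apply/AP; exists 0%N; rewrite ?words0.
  - left; apply: (subset_trans IH); apply/subsetP => a /AP[i ik ai].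
    by apply/AP; exists i => //; exact: leqW.
  have sub : A k \subset A k.+1.
    by apply/subsetP => a /AP[i ik ai]; apply/AP; exists i => //; exact: leqW.
  case: (boolP (A k.+1 \subset A k)) => stable.
    by left; apply: (subset_trans (closed _ stable)).
  by right; apply: (leq_ltn_trans IH); apply: proper_card; rewrite properE sub.
case: (grow #|gT|) => [/subsetP full /full /AP[i ik wi]|]; first by exists i.
by rewrite ltnNge max_card.
Qed.

Lemma mem_words_wordlen w : w \in <<[set:: S]>>%g -> w \in words S (wordlen S w).
Proof.
move=> /gen_words_short[k kle wk].
have short : has (fun k => w \in words S k) (iota 0 #|gT|.+1).
  by apply/hasP; exists k; rewrite ?mem_iota.
have := nth_find 0%N short; rewrite nth_iota ?add0n //.
by move: short; rewrite has_find size_iota.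
Qed.

Lemma wordlen_le w k : w \in words S k -> (wordlen S w <= k)%N.
Proof.
move=> wk; rewrite leqNgt; apply/negP => k_lt.
have klt : (k < #|gT|.+1)%N.
  apply: (leq_trans k_lt); rewrite /wordlen.
  by have := find_size (fun k => w \in words S k) (iota 0 #|gT|.+1); rewrite size_iota.
have := before_find 0%N k_lt; rewrite nth_iota // add0n.
by rewrite wk.
Qed.

Lemma wordlen1 : wordlen S 1%g = 0%N.
Proof. by apply/eqP; rewrite -leqn0; apply: wordlen_le; rewrite words0. Qed.

Hypothesis S_mulK : {in S, forall s, (s * s)%g = 1%g}.

Lemma wordlen_invg w : w \in <<[set:: S]>>%g -> wordlen S w^-1%g = wordlen S w.
Proof.
have words_inv k u : u \in words S k -> u^-1%g \in words S k.
  elim: k u => [|k IH] u; first by rewrite !words0 => /eqP->; rewrite invg1.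
  move=> /words_consP[g [a [gS aw ->]]]; rewrite invMg.
  have -> : g^-1%g = g by apply/eqP; rewrite eq_invg_mul S_mulK.
  by apply: words_mulr => //; exact: IH.
have inv_le u : u \in <<[set:: S]>>%g -> (wordlen S u^-1%g <= wordlen S u)%N.
  by move=> uG; apply: wordlen_le; apply: words_inv; exact: mem_words_wordlen.
by move=> wG; apply/eqP; rewrite eqn_leq inv_le //= -{1}[w]invgK inv_le ?groupV.
Qed.

Variable ascent : gT -> gT -> bool.
Hypothesis ascent1 : forall s, s \in S -> ascent s 1%g.
Hypothesis ascent_mul : forall s w, s \in S -> w \in <<[set:: S]>>%g ->
  ascent s w -> ~~ ascent s (w * s)%g.
Hypothesis ascent_exchange : forall s t w, s \in S -> t \in S -> w \in <<[set:: S]>>%g ->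
  ascent s w -> ~~ ascent s (t * w)%g -> (w * s = t * w)%g.

Lemma words_exchange k s w : s \in S -> w \in words S k -> ~~ ascent s w ->
  (0 < k)%N /\ (w * s)%g \in words S k.-1.
Proof.
move=> sS; elim: k w => [|k IH] w.
  by rewrite words0 => /eqP->; rewrite ascent1.
move=> /words_consP[g [a [gS aw ->]]] desc; split=> //=.
have aG : a \in <<[set:: S]>>%g by apply/mem_gen_words; exists k.
case: (boolP (ascent s a)) => asc_a.
  by rewrite -(ascent_exchange sS gS aG asc_a desc) -mulgA S_mulK // mulg1.
have [k0 as_word] := IH _ aw asc_a.
by rewrite -mulgA -(prednK k0); exact: words_mull.
Qed.

Lemma wordlen_desc s w : s \in S -> w \in <<[set:: S]>>%g -> ~~ ascent s w ->
  wordlen S w = (wordlen S (w * s)%g).+1.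
Proof.
move=> sS wG desc; have ww := mem_words_wordlen wG.
have [k0 ws_word] := words_exchange sS ww desc.
apply/eqP; rewrite eqn_leq; apply/andP; split; last first.
  by rewrite -(prednK k0) ltnS; exact: wordlen_le.
have wsG : (w * s)%g \in <<[set:: S]>>%g by apply: groupM => //; apply: mem_gen; rewrite inE.
have wE : w = (w * s * s)%g by rewrite -mulgA S_mulK // mulg1.
by rewrite {1}wE; apply: wordlen_le; apply: words_mulr => //; apply: mem_words_wordlen.
Qed.

Lemma wordlen_asc s w : s \in S -> w \in <<[set:: S]>>%g -> ascent s w ->
  wordlen S (w * s)%g = (wordlen S w).+1.
Proof.
move=> sS wG asc.
have wsG : (w * s)%g \in <<[set:: S]>>%g by apply: groupM => //; apply: mem_gen; rewrite inE.
by rewrite (wordlen_desc sS wsG (ascent_mul sS wG asc)) -mulgA S_mulK // mulg1.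
Qed.

Lemma wordlen_lt s w : s \in S -> w \in <<[set:: S]>>%g ->
  (wordlen S w < wordlen S (w * s)%g)%N = ascent s w.
Proof.
move=> sS wG; case: (boolP (ascent s w)) => asc; first by rewrite (wordlen_asc sS wG asc) ltnSn.
by rewrite (wordlen_desc sS wG asc) ltnNge leqnSn.
Qed.

Lemma wordlen_gt s w : s \in S -> w \in <<[set:: S]>>%g ->
  (wordlen S (w * s)%g < wordlen S w)%N = ~~ ascent s w.
Proof.
move=> sS wG; case: (boolP (ascent s w)) => asc; first by rewrite (wordlen_asc sS wG asc) ltnNge leqnSn.
by rewrite (wordlen_desc sS wG asc) ltnSn.
Qed.

Lemma exists_descent w : w \in <<[set:: S]>>%g -> w != 1%g ->
  exists2 s, s \in S & ~~ ascent s w.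
Proof.
move=> wG wn1; have ww := mem_words_wordlen wG.
case len_w : (wordlen S w) ww => [|k]; first by rewrite words0 (negbTE wn1).
move=> /words_rconsP[s [a [sS aw wE]]]; exists s => //.
rewrite -(wordlen_gt sS wG) len_w wE -mulgA S_mulK // mulg1 ltnS.
exact: wordlen_le.
Qed.
End Words.

Section Roots.
Variables (t : CoxType) (r : nat).
Implicit Types (p q x : int).

Lemma simple_rootP p q : simple_root t r p q ->
  [/\ 1 <= p, p < r%:Z & q = p + 1] \/
  ([/\ t = TBC, p = -1 & q = 1] \/ [/\ t = TD, p = -1 & q = 2]).
Proof.
rewrite /simple_root => /or3P[/and3P[? ? /eqP?]|/and3P[tE /eqP? /eqP?]|/and3P[tE /eqP? /eqP?]].
- by left.
- by right; left; case: t tE.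
- by right; right; case: t tE.
Qed.

Lemma simple_root_neq0 p q : simple_root t r p q -> p != 0 /\ q != 0.
Proof. by rewrite /simple_root; case: t => /=; lia. Qed.

Lemma simple_root_inj p q p' q' : simple_root t r p q -> simple_root t r p' q' ->
  stransp p q =1 stransp p' q' -> p = p' /\ q = q'.
Proof.
move=> /simple_rootP root /simple_rootP root' same; have := same p; rewrite stransp_l /stransp.
case: root => [[? ? ?]|[[? ? ?]|[? ? ?]]]; case: root' => [[? ? ?]|[[? ? ?]|[? ? ?]]];
  repeat (case: eqP => ?); lia.
Qed.

Lemma simple_root_lt p q : simple_root t r p q -> p < q.
Proof. by rewrite /simple_root; case: t => /=; lia. Qed.

Lemma stransp_reversal p q x y : simple_root t r p q -> x != 0 -> y != 0 ->
  x < y -> x != - y -> stransp p q y <= stransp p q x ->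
  (x = p /\ y = q) \/ (x = - q /\ y = - p).
Proof.
move=> /simple_rootP root; rewrite /stransp.
case: root => [[? ? ->]|[[_ -> ->]|[_ -> ->]]]; repeat (case: eqP => ?); lia.
Qed.

Lemma stransp_reversal_opp p q x y : simple_root t r p q -> x < y -> x = - y -> stransp p q y <= stransp p q x ->
  (x = p /\ y = q) \/ (p = -1 /\ q = 2).
Proof.
move=> /simple_rootP root; rewrite /stransp.
case: root => [[? ? ->]|[[_ -> ->]|[_ -> ->]]]; repeat (case: eqP => ?); lia.
Qed.

End Roots.

Section Group.
Variables (N : nat) (t : CoxType) (r : nat).
Hypothesis hr : (2 <= r <= N)%N.
Implicit Types (s w : {perm pt N}) (p q x : int).

Notation S := (gens t N r).
Notation GG := (<<[set:: S]>>%g).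

Lemma gens_invol s : s \in S -> (s * s)%g = 1%g.
Proof.
move=> /(gen_simple_root hr)[p [q [/simple_root_neq0 neq0 sE]]]; apply: eq_apZ => x.
by rewrite -[(s * s)%g]/(permc s s) apZ_permc !sE (stranspK neq0) apZ1.
Qed.

Lemma gensV s : s \in S -> (s^-1)%g = s.
Proof. by move=> /gens_invol ss; apply: (mulgI s); rewrite mulgV ss. Qed.

Lemma gens_isBC s : s \in S -> isBC s.
Proof. by move=> /(gen_simple_root hr)[p [q [/simple_root_neq0 neq0 sE]]]; apply/isBCP => x; rewrite !sE (stranspN _ neq0). Qed.

Lemma isBC1 : isBC (1%g : {perm pt N}).
Proof. by apply/isBCP => x; rewrite !apZ1. Qed.

Lemma isBCM (a b : {perm pt N}) : isBC a -> isBC b -> isBC (a * b)%g.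
Proof.
move=> /isBCP aN /isBCP bN; apply/isBCP => x.
by rewrite -[(a * b)%g]/(permc b a) !apZ_permc aN bN.
Qed.

Lemma isBCV w : isBC w -> isBC w^-1%g.
Proof.
move=> /isBCP wN; apply/isBCP => x; apply: (@apZ_inj _ w).
by rewrite wN !apZKV.
Qed.

Lemma isBC_neq0 w x : isBC w -> x != 0 -> apZ w x != 0.
Proof.
move=> /isBCP wN; apply: contraNneq => wx0; apply/eqP/(@apZ_inj _ w).
by rewrite wx0 (odd_fun0 wN).
Qed.

Lemma gen_isBC w : w \in GG -> isBC w.
Proof.
move: w; apply: gen_rind => [|s a sS _ aB]; first exact: isBC1.
by apply: isBCM => //; exact: gens_isBC.
Qed.

Definition left_ascent s w : bool :=
  `[< exists p q, [/\ simple_root t r p q, apZ s =1 stransp p q & apZ w^-1%g p < apZ w^-1%g q] >].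

Lemma left_ascentE s w p q : simple_root t r p q -> apZ s =1 stransp p q ->
  left_ascent s w = (apZ w^-1%g p < apZ w^-1%g q).
Proof.
move=> root sE; apply/asboolP/idP => [[p' [q' [root' sE' lt]]]|lt]; last by exists p, q.
have same : stransp p q =1 stransp p' q' by move=> x; rewrite -sE -sE'.
by have [-> ->] := simple_root_inj root root' same.
Qed.

Lemma left_ascent1 s : s \in S -> left_ascent s 1%g.
Proof.
move=> /(gen_simple_root hr)[p [q [root sE]]]; rewrite (left_ascentE _ root sE) invg1 !apZ1.
exact: simple_root_lt root.
Qed.

Lemma apZV_mul_gen w s p q x : s \in S -> apZ s =1 stransp p q ->
  apZ (w * s)^-1%g x = apZ w^-1%g (stransp p q x).
Proof.
by move=> sS sE; rewrite invMg (gensV sS) -[(s * _)%g]/(permc w^-1%g s) apZ_permc sE.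
Qed.

Lemma left_ascent_mul s w : s \in S -> w \in GG -> left_ascent s w -> ~~ left_ascent s (w * s)%g.
Proof.
move=> sS wG; have [p [q [root sE]]] := gen_simple_root hr sS.
rewrite !(left_ascentE _ root sE) !(apZV_mul_gen _ _ sS sE) stransp_l stransp_r => lt.
by rewrite -leNgt ltW.
Qed.

Lemma left_ascent_exchange s t' w : s \in S -> t' \in S -> w \in GG ->
  left_ascent s w -> ~~ left_ascent s (t' * w)%g -> (w * s = t' * w)%g.
Proof.
move=> sS tS wG; have [p [q [root sE]]] := gen_simple_root hr sS.
have [p' [q' [root' tE]]] := gen_simple_root hr tS.
rewrite !(left_ascentE _ root sE) invMg (gensV tS) -[(_ * t')%g]/(permc t' _) !apZ_permc !tE -leNgt => lt le.
have w_invB := isBCV (gen_isBC wG); have /isBCP w_invN := w_invB; have w_inv_inj := @apZ_inj _ w^-1%g.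
suff maps_pq : maps_root (apZ w^-1%g) p q p' q'.
  have : (permc w^-1 s = permc t' w^-1)%g.
    apply: eq_apZ => x; rewrite !apZ_permc sE tE.
    exact: (stransp_conj w_inv_inj w_invN (simple_root_neq0 root') maps_pq).
  by rewrite /permc => /(congr1 (@invg _)); rewrite !invMg invgK (gensV sS) (gensV tS).
have [p0 q0] := simple_root_neq0 root.
case: (eqVneq (apZ w^-1%g p) (- apZ w^-1%g q)) => [opp|not_opp]; last first.
  exact: stransp_reversal root' (isBC_neq0 w_invB p0) (isBC_neq0 w_invB q0) lt not_opp le.
have pq : p = - q by apply: w_inv_inj; rewrite opp w_invN.
case: (stransp_reversal_opp root' lt opp le) => [|[? ?]]; first by left.
case: (simple_rootP root) => [[]|[[tE1 ? ?]|[tE1 ? ?]]]; case: (simple_rootP root') => [[]|[[tE2 ? ?]|[tE2 ? ?]]]; try lia.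
by rewrite tE1 in tE2.
Qed.

Lemma wordlen_gen_lt s w : s \in S -> w \in GG ->
  (wordlen S w < wordlen S (permc s w))%N = left_ascent s w.
Proof. exact: (wordlen_lt gens_invol left_ascent1 left_ascent_mul left_ascent_exchange). Qed.

Lemma wordlen_gen_gt s w : s \in S -> w \in GG ->
  (wordlen S (permc s w) < wordlen S w)%N = ~~ left_ascent s w.
Proof. exact: (wordlen_gt gens_invol left_ascent1 left_ascent_mul left_ascent_exchange). Qed.

Lemma wordlen_gen_descent s w : s \in S -> w \in GG -> ~~ left_ascent s w ->
  wordlen S w = (wordlen S (permc s w)).+1.
Proof. exact: (wordlen_desc gens_invol left_ascent1 left_ascent_exchange). Qed.

Lemma exists_left_descent w : w \in GG -> w != 1%g -> exists2 s, s \in S & ~~ left_ascent s w.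
Proof. exact: (exists_descent gens_invol left_ascent1 left_ascent_mul left_ascent_exchange). Qed.

End Group.

Section Generation.
Variables (N : nat) (t : CoxType) (r : nat).
Hypothesis hr : (2 <= r <= N)%N.
Implicit Types (s w : {perm pt N}) (p q x : int).

Notation S := (gens t N r).
Notation GG := (<<[set:: S]>>%g).

Lemma fixBeyondP w : reflect (forall x, r%:Z < `|x| -> apZ w x = x) (fixBeyond r w).
Proof.
apply: (iffP forallP) => [fix_w x hx|fix_w k]; last by apply/implyP => /fix_w ->.
case: (leqP (absz x) N) => xN; last by rewrite apZ_out.
have := fix_w (ofZ N x); rewrite ofZK // hx /= => /eqP; exact.
Qed.

Lemma fixBeyond_absz_le w x : fixBeyond r w -> (absz x <= r)%N -> (absz (apZ w x) <= r)%N.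
Proof.
move=> /fixBeyondP fix_w hx; rewrite leqNgt; apply/negP => lt.
have /(@apZ_inj N w) wx : apZ w (apZ w x) = apZ w x by apply: fix_w; lia.
by rewrite wx in lt; lia.
Qed.

Lemma stransp_beyond p q x : simple_root t r p q -> r%:Z < `|x| -> stransp p q x = x.
Proof.
move=> /simple_rootP root hx; rewrite /stransp.
case: root => [[? ? ->]|[[_ -> ->]|[_ -> ->]]]; repeat (case: eqP => ?); lia.
Qed.

Lemma fixBeyond_mul_gen w s : fixBeyond r w -> s \in S -> fixBeyond r (w * s)%g.
Proof.
move=> /fixBeyondP fix_w /(gen_simple_root hr)[p [q [root sE]]]; apply/fixBeyondP => x hx.
by rewrite -[(w * s)%g]/(permc s w) apZ_permc fix_w // sE (stransp_beyond root hx).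
Qed.

Lemma absz_apZ_inj w : isBC w -> {in [pred i : nat | (0 < i)%N] &,
  injective (fun i : nat => absz (apZ w i%:Z))}.
Proof.
move=> /isBCP wN i j; rewrite !inE => hi hj same_abs.
have [/(@apZ_inj N w)|] : apZ w i = apZ w j \/ apZ w i = - apZ w j by lia.
  by lia.
by rewrite -wN => /(@apZ_inj N w); lia.
Qed.

Lemma absz_apZ_perm w : isBC w -> fixBeyond r w ->
  perm_eq [seq absz (apZ w i%:Z) | i : nat <- iota 1 r] (iota 1 r).
Proof.
move=> wB w_fix; have abs_uniq : uniq [seq absz (apZ w i%:Z) | i : nat <- iota 1 r].
  rewrite map_inj_in_uniq ?iota_uniq // => i j; rewrite !mem_iota => hi hj.
  by apply: (absz_apZ_inj wB); rewrite inE; lia.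
apply: uniq_perm => //; first exact: iota_uniq.
have sub : {subset [seq absz (apZ w i%:Z) | i : nat <- iota 1 r] <= iota 1 r}.
  move=> k /mapP[i]; rewrite !mem_iota => hi ->.
  have := @fixBeyond_absz_le w i%:Z w_fix; have := @isBC_neq0 _ w i%:Z wB; move: (apZ w i) => x; lia.
by have [|_ //] := uniq_min_size abs_uniq sub; rewrite size_map.
Qed.

Lemma even_count_stransp_neg p q : simple_root t r p q -> t = TD ->
  ~~ odd (count (fun j : nat => stransp p q j < 0) (iota 1 r)).
Proof.
have no_neg m k : (forall j : nat, (m <= j)%N -> 0 <= stransp p q j) ->
    count (fun j : nat => stransp p q j < 0) (iota m k) = 0%N.
  move=> pos; apply/eqP; rewrite -leqn0 leqNgt -has_count; apply/hasPn => j; rewrite mem_iota => /andP[mj _].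
  by rewrite -leNgt; exact: pos.
move=> /simple_rootP[[? ? qE]|[[-> //]|[_ pE qE]]] _.
  by rewrite no_neg // => j hj; rewrite qE /stransp; repeat (case: eqP => ?); lia.
case: r hr => [|[|r']] // _; rewrite -[iota 1 _]/([:: 1; 2]%N ++ iota 3 r') count_cat no_neg; first by rewrite /= pE qE.
by move=> j hj; rewrite pE qE; stransp_cases.
Qed.

Lemma evenNeg_mul_gen w s : t = TD -> isBC w -> fixBeyond r w -> s \in S ->
  evenNeg r (w * s)%g = evenNeg r w.
Proof.
move=> tD wB w_fix /(gen_simple_root hr)[p [q [root sE]]]; rewrite /evenNeg; congr (~~ _).
have [p0 q0] := simple_root_neq0 root; pose s_neg (j : nat) := stransp p q j < 0.
rewrite (@eq_in_count _ _ (fun i : nat => (apZ w i < 0) (+) s_neg (absz (apZ w i)))); last first.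
  move=> i; rewrite mem_iota => hi; rewrite -[(w * s)%g]/(permc s w) apZ_permc sE /s_neg.
  have : apZ w i != 0 by apply: isBC_neq0 => //; lia.
  move: (apZ w i) => x x0; case: (ltrP x 0) => hx /=; last by have {1}-> : x = (absz x)%:Z by lia.
  have -> : x = - (absz x)%:Z by lia.
  rewrite abszN absz_nat (stranspN _ (conj p0 q0)) oppr_lt0 lt_neqAle eq_sym -leNgt.
  by rewrite (stransp_neq0 (conj p0 q0)) //; lia.
rewrite odd_count_addb -[X in _ (+) X]/(odd (count (preim (fun i : nat => absz (apZ w i)) s_neg) _)).
rewrite -count_map (seq.permP (absz_apZ_perm wB w_fix)).
by rewrite (negbTE (even_count_stransp_neg root tD)) addbF.
Qed.

Definition signed_group : {set {perm pt N}} :=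
  match t with
  | TA => [set w | [&& isBC w, fixBeyond r w & all (fun i : nat => 0 < apZ w i%:Z) (iota 1 r)]]
  | _ => Wgrp t N r
  end.

Lemma signed_group_BC w : w \in signed_group -> isBC w /\ fixBeyond r w.
Proof.
by rewrite /signed_group; case: t => /=; rewrite !inE; [move=> /and3P[-> -> _] | move=> /andP[-> ->] | move=> /and3P[-> -> _]].
Qed.

Lemma signed_group_mul_gen w s : w \in signed_group -> s \in S -> (w * s)%g \in signed_group.
Proof.
move=> wW sS; have sB := gens_isBC hr sS; have [p [q [root sE]]] := gen_simple_root hr sS.
move: wW; rewrite /signed_group; case tE : t => /=; rewrite !inE.
- move=> /and3P[wB wF wp]; rewrite isBCM //= fixBeyond_mul_gen //=.
  apply/allP => i hi; have := allP wp _ hi; rewrite -[(w * s)%g]/(permc s w) apZ_permc sE.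
  move: (apZ w i) => v hv; rewrite /stransp.
  case: (simple_rootP root) => [[? ? ->]|[[tE' _ _]|[tE' _ _]]]; last 2 first.
  + by rewrite tE' in tE.
  + by rewrite tE' in tE.
  by repeat (case: eqP => ?); lia.
- by move=> /andP[wB wF]; rewrite isBCM //= fixBeyond_mul_gen.
- by move=> /and3P[wB wF wE]; rewrite isBCM //= fixBeyond_mul_gen //= evenNeg_mul_gen.
Qed.

Lemma fixBeyondV w : fixBeyond r w -> fixBeyond r w^-1%g.
Proof.
move=> /fixBeyondP fix_w; apply/fixBeyondP => x hx.
by apply: (@apZ_inj _ w); rewrite apZKV fix_w.
Qed.

Lemma increasing_bounded_id (u : int -> int) : (forall i : nat, (0 < i < r)%N -> u i%:Z < u i.+1%:Z) ->
  (forall i : nat, (i <= r)%N -> `|u i%:Z| <= r%:Z) -> u 1 != 0 -> `|u 1| < u 2 ->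
  (forall i : nat, (2 <= i <= r)%N -> u i%:Z = i%:Z) /\ `|u 1| = 1.
Proof.
move=> u_incr u_le u1 u2.
have u_ge k : (k.+2 <= r)%N -> k.+2%:Z <= u k.+2%:Z.
  elim: k => [|k IH] hk; first by move: u1 u2; move: (u 1) (u 2) => a b; lia.
  have := IH (ltnW hk); have := u_incr k.+2; rewrite hk => /(_ isT).
  by move: (u _) (u _) => a b; lia.
have u_le_id k : (k < r)%N -> u (r - k)%N%:Z <= (r - k)%N%:Z.
  elim: k => [|k IH] hk; first by have := u_le (r - 0)%N; move: (u _) => a; lia.
  have := IH (ltnW hk); have := u_incr (r - k.+1)%N.
  have -> : (r - k.+1).+1 = (r - k)%N by lia.
  by move: (u _) (u _) => a b; lia.
have u_id (i : nat) : (2 <= i <= r)%N -> u i%:Z = i%:Z.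
  move=> hi; have := u_ge (i - 2)%N; have := u_le_id (r - i)%N.
  have -> : (i - 2).+2 = i by lia.
  have -> : (r - (r - i))%N = i by lia.
  by move: (u _) => a; lia.
split=> //; have := u_id 2%N; move: u1 u2; move: (u 1) (u 2) => a b; lia.
Qed.

Section NoLeftDescent.
Variable w : {perm pt N}.
Hypotheses (wW : w \in signed_group) (w_asc : forall s, s \in S -> left_ascent t r s w).
Let wB : isBC w := (signed_group_BC wW).1.
Let uN : {morph apZ w^-1%g : x / - x}. Proof. exact/isBCP/isBCV. Qed.
Let u0 : apZ w^-1%g 0 = 0. Proof. exact: odd_fun0 uN. Qed.
Let uF : fixBeyond r w^-1%g := fixBeyondV (signed_group_BC wW).2.

Lemma no_descent_root p q : simple_root t r p q -> apZ w^-1%g p < apZ w^-1%g q.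
Proof. by move=> root; have [s sS sE] := simple_root_gen hr root; rewrite -(left_ascentE w root sE) w_asc. Qed.

Lemma no_descent_increasing (i : nat) : (0 < i < r)%N -> apZ w^-1%g i%:Z < apZ w^-1%g i.+1%:Z.
Proof.
move=> hi; have -> : i.+1%:Z = i%:Z + 1 by lia.
by apply: no_descent_root; rewrite /simple_root; apply/orP; left; lia.
Qed.

Lemma no_descent_pos1 : t = TA -> 0 < apZ w^-1%g 1.
Proof.
move=> tE; move: wW; rewrite /signed_group tE inE => /and3P[_ _ /allP w_pos].
rewrite ltNge; apply/negP => le; have /isBCP wN := wB.
have u1_neq0 : apZ w^-1%g 1 != 0 by apply/eqP; rewrite -u0 => /(@apZ_inj _ w^-1%g).
have u1_le : (absz (apZ w^-1%g 1) <= r)%N by apply: fixBeyond_absz_le uF _; lia.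
have := w_pos (absz (apZ w^-1%g 1)); rewrite mem_iota.
have -> : (absz (apZ w^-1%g 1))%:Z = - apZ w^-1%g 1 by lia.
rewrite wN apZKV => pos; suff : (0 : int) < -1 by [].
by apply: pos; move: u1_neq0 u1_le; move: (apZ _ _) => a; lia.
Qed.

Lemma no_descent_norm1 : `|apZ w^-1%g 1| < apZ w^-1%g 2.
Proof.
have u12 : apZ w^-1%g 1 < apZ w^-1%g 2 by apply: (@no_descent_increasing 1%N); lia.
case tE : t.
- by have := no_descent_pos1 tE; move: u12; move: (apZ _ 1) (apZ _ 2) => a b; lia.
- have := @no_descent_root (-1) 1; rewrite /simple_root tE uN => /(_ isT).
  by move: u12; move: (apZ _ 1) (apZ _ 2) => a b; lia.
have := @no_descent_root (-1) 2; rewrite /simple_root tE uN => /(_ isT).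
by move: u12; move: (apZ _ 1) (apZ _ 2) => a b; lia.
Qed.

Lemma no_descent_id : (forall i : nat, (2 <= i <= r)%N -> apZ w^-1%g i%:Z = i%:Z) /\ `|apZ w^-1%g 1| = 1.
Proof.
apply: increasing_bounded_id no_descent_norm1; first exact: no_descent_increasing.
  by move=> i hi; have := fixBeyond_absz_le (x := i%:Z) uF; lia.
by apply/eqP; rewrite -u0 => /(@apZ_inj _ w^-1%g).
Qed.

Lemma no_descent_id1 : apZ w^-1%g 1 = 1.
Proof.
have [u_id u1_norm] := no_descent_id.
have [//|u1] : apZ w^-1%g 1 = 1 \/ apZ w^-1%g 1 = -1 by move: u1_norm; move: (apZ _ 1) => a; lia.
case tE : t.
- by have := no_descent_pos1 tE; rewrite u1.
- by have := @no_descent_root (-1) 1; rewrite /simple_root tE uN u1 => /(_ isT).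
move: wW; rewrite /signed_group tE /= inE => /and3P[_ _]; rewrite /evenNeg.
have w1 : apZ w 1 = -1 by rewrite -[1 in LHS]opprK -[- 1]u1 -uN apZKV.
rewrite (_ : iota 1 r = [:: 1%N] ++ iota 2 r.-1); last by case: r hr.
rewrite count_cat [count _ [:: _]]/= w1.
suff -> : count (fun i : nat => apZ w i < 0) (iota 2 r.-1) = 0%N by [].
apply/eqP; rewrite -leqn0 leqNgt -has_count; apply/hasPn => j; rewrite mem_iota => hj.
by rewrite -(u_id j) ?apZKV; lia.
Qed.

Lemma signed_group_no_descent : w = 1%g.
Proof.
apply: (can_inj (@invgK _)); apply: eq_apZ => x; rewrite invg1 apZ1.
move: x; apply: odd_int_ind => [x xE|[|[|i]]]; [by rewrite uN xE | exact: u0 | exact: no_descent_id1 |].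
case: (leqP i.+2 r) => hi; first by apply: no_descent_id.1; lia.
by have /fixBeyondP := uF; apply; lia.
Qed.

End NoLeftDescent.

Definition energy w : int := \sum_(i < r) i.+1%:Z * apZ w^-1%g i.+1%:Z.

Lemma energy_le w : w \in signed_group -> energy w <= (r * (r * r))%N%:Z.
Proof.
move=> wW; have [_ wF] := signed_group_BC wW.
have -> : (r * (r * r))%N%:Z = \sum_(i < r) (r * r)%N%:Z.
  by rewrite sumr_const card_ord -mulr_natl PoszM; lia.
apply: ler_sum => i _; have := fixBeyond_absz_le (x := i.+1%:Z) (fixBeyondV wF).
by have := ltn_ord i; move: (apZ _ _) => a; nia.
Qed.

Lemma energy_mul_gen s w : w \in signed_group -> s \in S -> ~~ left_ascent t r s w -> energy w < energy (w * s)%g.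
Proof.
move=> wW sS desc; have [p [q [root sE]]] := gen_simple_root hr sS; have [wB _] := signed_group_BC wW.
have /isBCP uN := isBCV wB.
move: desc; rewrite (left_ascentE w root sE) -leNgt le_eqVlt => /orP[/eqP/(@apZ_inj N w^-1%g) pq|lt].
  by have := simple_root_lt root; lia.
have -> : energy (w * s)%g = \sum_(i < r) i.+1%:Z * apZ w^-1%g (stransp p q i.+1%:Z).
  by apply: eq_bigr => i _; rewrite (apZV_mul_gen hr _ _ sS sE).
have swapped (a b : nat) (ar : (a < r)%N) (br : (b < r)%N) : (a < b)%N ->
    `|p| = a.+1%:Z \/ `|p| = b.+1%:Z -> `|q| = a.+1%:Z \/ `|q| = b.+1%:Z ->
    a.+1%:Z * apZ w^-1%g a.+1%:Z + b.+1%:Z * apZ w^-1%g b.+1%:Z <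
      a.+1%:Z * apZ w^-1%g (stransp p q a.+1%:Z) + b.+1%:Z * apZ w^-1%g (stransp p q b.+1%:Z) ->
    energy w < \sum_(i < r) i.+1%:Z * apZ w^-1%g (stransp p q i.+1%:Z).
  move=> ab pE qE; apply: (ltr_sum_pair (x := Ordinal ar) (y := Ordinal br)).
    by rewrite -val_eqE /= neq_ltn ab.
  move=> i ia ib; rewrite stransp_id //; move: pE qE ia ib; rewrite -!val_eqE /=; lia.
case: (simple_rootP root) => [[p1 pr qE]|[[tE pE qE]|[tE pE qE]]].
- apply: (swapped (absz (p - 1)) (absz p)); try lia.
  have -> : (absz (p - 1)).+1%:Z = p by lia.
  have -> : (absz p).+1%:Z = q by lia.
  by rewrite stransp_l stransp_r; move: lt; move: (apZ _ p) (apZ _ q) => a b; nia.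
- apply: (swapped 0 1); try lia.
  by rewrite pE qE /stransp /=; move: lt; rewrite pE qE uN; move: (apZ _ 1) (apZ _ 2) => a b; nia.
- apply: (swapped 0 1); try lia.
  rewrite pE qE /stransp /= -[- 2]/(- (2 : int)) !uN.
  by move: lt; rewrite pE qE uN; move: (apZ _ 1) (apZ _ 2) => a b; nia.
Qed.

Lemma signed_group_sub_gen w : w \in signed_group -> w \in GG.
Proof.
have [m] := ubnP (absz ((r * (r * r))%N%:Z - energy w)); elim: m w => // m IH w hm wW.
case: (pselect (forall s, s \in S -> left_ascent t r s w)) => [asc|].
  by rewrite (signed_group_no_descent wW asc) group1.
move=> /existsNP[s /not_implyP[sS /negP desc]].
have wsW := signed_group_mul_gen wW sS; have lt := energy_mul_gen wW sS desc.
have wsG : (w * s)%g \in GG.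
  by apply: IH => //; have := energy_le wsW; have := energy_le wW; lia.
by rewrite -(mulgK s w) groupM // groupV mem_gen // inE.
Qed.

Lemma signed_groupE : signed_group = GG.
Proof.
apply/setP => w; apply/idP/idP; first exact: signed_group_sub_gen.
move: w; apply: gen_rind => [|s a sS _ aW]; last exact: signed_group_mul_gen.
have fix1 : fixBeyond r (1%g : {perm pt N}) by apply/fixBeyondP => x _; rewrite apZ1.
rewrite /signed_group; case: t => /=; rewrite inE isBC1 fix1 //=.
  by apply/allP => i; rewrite mem_iota apZ1; lia.
rewrite /evenNeg.
suff -> : count (fun i : nat => apZ (1%g : {perm pt N}) i < 0) (iota 1 r) = 0%N by [].
apply/eqP; rewrite -leqn0 leqNgt -has_count; apply/hasPn => j; rewrite mem_iota => hj.
by rewrite apZ1; lia.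
Qed.

Lemma WgrpE : Wgrp t N r = GG.
Proof. by have := signed_groupE; rewrite /signed_group; case: t. Qed.

End Generation.

(** * Fixed-point-free involutions without large visible descents *)

Section Gelements.
Variables (n : nat).
Hypothesis hn : (2 <= n)%N.
Implicit Types (t : CoxType) (z s : P n) (p q x : int) (f : int -> int).

(* The conditions defining [Gset], other than the type-dependent one, on the underlying function;
   the last one excludes visible descents greater than [n]. *)
Definition Gfun f : Prop :=
  [/\ {morph f : x / - x}, involutive f,
      forall x, x != 0 -> `|x| <= n.*2%:Z -> `|f x| != `|x|,
      forall x, n.*2%:Z < `|x| -> f x = x &
      forall i, n%:Z < i -> (i <= f (i + 1) \/ f i <= f (i + 1)) /\ - i <= f i].

Definition type_cond t z : Prop :=
  match t with
  | TA => forall x, 0 < x -> 0 < apZ z x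
  | TBC => True
  | TD => ~~ odd (count (fun i : nat => apZ z i%:Z < - i%:Z) (iota 1 n))
  end.

Let hN : (2 <= n.*2 <= n.*2)%N. Proof. lia. Qed.
Let hnN : (2 <= n <= n.*2)%N. Proof. lia. Qed.

Section GfunFacts.
Variable f : int -> int.
Hypothesis fG : Gfun f.

Lemma Gfun0 : f 0 = 0.
Proof. by case: fG => fN _ _ _ _; exact: odd_fun0. Qed.

Lemma Gfun_inj : injective f.
Proof. by case: fG => _ fK _ _ _; exact: can_inj fK. Qed.

Lemma Gfun_neq0 x : x != 0 -> f x != 0.
Proof. by apply: contraNneq => fx0; apply/eqP/Gfun_inj; rewrite fx0 Gfun0. Qed.

Lemma Gfun_neq x : x != 0 -> `|x| <= n.*2%:Z -> f x != x /\ f x != - x.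
Proof. by case: fG => _ _ f_neq _ _ x0 /(f_neq x x0); clear; lia. Qed.

Lemma Gfun_eqK x y : f x = y -> f y = x.
Proof. by case: fG => _ fK _ _ _ <-. Qed.

Lemma Gfun_oppK x y : f x = - y -> f y = - x.
Proof. by case: fG => fN fK _ _ _ fx; rewrite -[y]opprK -fx fN fK. Qed.

Lemma Gfun_abs_sym x y : `|f x| = `|y| -> `|f y| = `|x|.
Proof.
move=> fx; have [/Gfun_eqK->|/Gfun_oppK->] : f x = y \/ f x = - y by clear - fx; lia.
  by [].
by rewrite normrN.
Qed.

End GfunFacts.

Lemma no_visDesP z : (forall i : int, n%:Z < i -> ~ visDes z i) <->
  (forall i : int, n%:Z < i ->
     (i <= apZ z (i + 1) \/ apZ z i <= apZ z (i + 1)) /\ - i <= apZ z i).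
Proof.
split=> no_des i hi; last first.
  by move=> [_]; rewrite lt_min; have := no_des i hi; move: (apZ _ _) (apZ _ _) => a b; lia.
have : ~ (apZ z (i + 1) < Num.min i (apZ z i) \/ apZ z i < - i).
  by move=> des; apply: (no_des i hi); split=> //; lia.
by rewrite lt_min; move: (apZ _ _) (apZ _ _) => a b; lia.
Qed.

Lemma fixBeyond_full z : fixBeyond n.*2 z.
Proof. by apply/fixBeyondP => x hx; apply: apZ_out; lia. Qed.

Lemma apZ_involutive z : ((z^-1)%g == z) <-> involutive (apZ z).
Proof.
split=> [/eqP zV x|zK]; first by rewrite -{1}zV apZVK.
by apply/eqP/eq_apZ => x; apply: (@apZ_inj _ z); rewrite apZKV zK.
Qed.

Lemma norm_fpfP z : isBC z -> all (fun i : nat => `|apZ z i%:Z| != i%:Z) (iota 1 n.*2) <->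
  (forall x, x != 0 -> `|x| <= n.*2%:Z -> `|apZ z x| != `|x|).
Proof.
move=> /isBCP zN; split=> [/allP fpf|fpf]; last first.
  by apply/allP => i; rewrite mem_iota => hi; have := fpf i%:Z; move: (apZ _ _) => a; lia.
apply: odd_int_ind => [x fpf_x|m m0 mb]; first by rewrite zN oppr_eq0 !normrN.
by apply: fpf; rewrite mem_iota; lia.
Qed.

Lemma FBCbP z : FBCb n z <-> [/\ {morph apZ z : x / - x}, involutive (apZ z) &
  forall x, x != 0 -> `|x| <= n.*2%:Z -> `|apZ z x| != `|x|].
Proof.
rewrite /FBCb /= inE fixBeyond_full andbT.
split=> [/and3P[zB /apZ_involutive zK /(norm_fpfP zB) fpf]|[zN zK fpf]]; first by split=> //; exact/isBCP.
have zB : isBC z by exact/isBCP.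
by rewrite zB (apZ_involutive z).2 //=; apply/norm_fpfP.
Qed.

Lemma FbP t z : Fb t n z <-> [/\ {morph apZ z : x / - x}, involutive (apZ z),
  forall x, x != 0 -> `|x| <= n.*2%:Z -> `|apZ z x| != `|x| & type_cond t z].
Proof.
case: t; rewrite /Fb /type_cond.
- have memA : (z \in Wgrp TA n.*2 n.*2) <-> isBC z /\ forall x, 0 < x -> 0 < apZ z x.
    rewrite (WgrpE TA hN) -signed_groupE // /signed_group inE fixBeyond_full /=.
    split=> [/andP[-> /allP pos]|[-> pos]]; last by apply/allP => i; rewrite mem_iota => hi; apply: pos; lia.
    split=> // x x0; case: (leqP (absz x) n.*2) => xb; last by rewrite apZ_out.
    by have := pos (absz x); rewrite mem_iota; have -> : (absz x)%:Z = x by [lia]; apply; lia.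
  split=> [/and3P[/memA[zB pos] /apZ_involutive zK /allP fpf]|[zN zK fpf pos]].
    split=> //; [exact/isBCP | apply/norm_fpfP => //].
    apply/allP => i hi; have := fpf i hi; have := pos i.
    by move: hi; rewrite mem_iota; move: (apZ _ _) => a; lia.
  have zB : isBC z by exact/isBCP.
  apply/and3P; split; [exact/memA | exact/apZ_involutive |].
  by apply/allP => i /(allP ((norm_fpfP zB).2 fpf)); move: (apZ _ _) => a; lia.
- by split=> [/FBCbP[]|[zN zK fpf _]] //; apply/FBCbP.
- by split=> [/andP[/FBCbP[]]|[zN zK fpf tc]] //; apply/andP; split=> //; apply/FBCbP.
Qed.

Lemma GsetP t z : z \in Gset t n <-> Gfun (apZ z) /\ type_cond t z.
Proof.
rewrite inE; split=> [/andP[/FbP[zN zK fpf tc] /asboolP/no_visDesP asc]|[[zN zK fpf _ asc] tc]].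
  by split=> //; split=> // x hx; rewrite apZ_out //; lia.
by apply/andP; split; [exact/FbP | exact/asboolP/no_visDesP].
Qed.

Lemma Gset_Gfun t z : z \in Gset t n -> Gfun (apZ z).
Proof. by move=> /GsetP[]. Qed.

Lemma Gset_invg t z : z \in Gset t n -> (z^-1)%g = z.
Proof. by move=> /Gset_Gfun[_ zK _ _ _]; exact/eqP/apZ_involutive. Qed.

(* [i |-> - z i] is a fixed-point-free involution of the negative entries. *)
Lemma Gfun_evenNeg z : Gfun (apZ z) -> evenNeg n.*2 z.
Proof.
move=> zG; have [zN zK z_neq _ _] := zG; rewrite /evenNeg -size_filter.
apply: (even_size_fpf_involution (f := fun i : nat => absz (apZ z i%:Z))).
  by rewrite filter_uniq // iota_uniq.
move=> i; rewrite !mem_filter !mem_iota => /andP[zi_neg hi].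
have abs_zi : (absz (apZ z i%:Z))%:Z = - apZ z i%:Z by move: zi_neg; move: (apZ z i%:Z) => a; lia.
have zi_bound : (absz (apZ z i%:Z) <= n.*2)%N by rewrite apZ_bound; lia.
rewrite abs_zi zN zK; have := z_neq i%:Z; move: zi_neg zi_bound; move: (apZ z i%:Z) => a.
by move=> a_neg a_bound a_neq; split; lia.
Qed.

Lemma Gset_gens t z : z \in Gset t n -> z \in <<[set:: gens t n.*2 n.*2]>>%g.
Proof.
move=> /GsetP[zG tc]; rewrite -signed_groupE //.
have zB : isBC z by case: zG => zN _ _ _ _; exact/isBCP.
rewrite /signed_group; case: t tc => /= tc; rewrite inE zB fixBeyond_full //=; last exact: Gfun_evenNeg.
by apply/allP => i; rewrite mem_iota => hi; apply: tc; lia.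
Qed.

Lemma simple_root_widen t p q : simple_root t n p q -> simple_root t n.*2 p q.
Proof.
move=> /simple_rootP[[? ? ->]|[[-> -> ->]|[-> -> ->]]] //.
by rewrite /simple_root; apply/orP; left; lia.
Qed.

Lemma Sgen_widen t s : s \in Sgen t n -> s \in gens t n.*2 n.*2.
Proof.
have sub : {subset [seq sgen n.*2 i | i <- iota 1 n.-1] <= [seq sgen n.*2 i | i <- iota 1 n.*2.-1]}.
  by move=> x /mapP[i hi ->]; apply: map_f; move: hi; rewrite !mem_iota; lia.
rewrite /Sgen; case: t => /=; first exact: sub.
  by rewrite !inE => /orP[->//|/sub ->]; rewrite orbT.
by rewrite !inE => /orP[->//|/sub ->]; rewrite orbT.
Qed.

Definition is_desEq p q f : bool := `|f p| == `|q|.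
Definition outer_consecutive x y : bool := [&& y == x + 1, n%:Z < `|x| & n%:Z < `|y|].
Definition is_ascEq p q f : bool := outer_consecutive (f p) (f q).

Lemma simple_root_le t p q : simple_root t n p q -> `|p| <= n%:Z /\ `|q| <= n%:Z.
Proof. by move=> /simple_rootP[[? ? ->]|[[_ -> ->]|[_ -> ->]]]; lia. Qed.

Section RootConditions.
Variables (t : CoxType) (s z : P n) (p q : int).
Hypotheses (zG : z \in Gset t n) (root : simple_root t n p q) (sE : apZ s =1 stransp p q).
Let zF : Gfun (apZ z) := Gset_Gfun zG.
Let neq0 : p != 0 /\ q != 0 := simple_root_neq0 root.

Lemma Gset_stransp_conj p' q' : p' != 0 /\ q' != 0 ->
  maps_root (apZ z) p q p' q' ->
  forall x, apZ z (stransp p q x) = stransp p' q' (apZ z x).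
Proof. by move=> neq0'; case: zF => zN _ _ _ _; exact: stransp_conj (Gfun_inj zF) zN neq0'. Qed.

Lemma DesEqP : DesEq n s z <-> is_desEq p q (apZ z).
Proof.
have [zN zK z_neq _ _] := zF; have [p0 q0] := neq0; have [pn qn] := simple_root_le root.
split=> [s_comm|/eqP zp].
  apply: contraT => zp_neq; have : apZ (permc s z) p = apZ (permc z s) p by rewrite s_comm.
  rewrite !apZ_permc !sE stransp_l stransp_id //; last by apply: z_neq => //; lia.
  by move=> /(Gfun_inj zF); have := simple_root_lt root; lia.
apply: eq_apZ => x; rewrite !apZ_permc !sE; symmetry.
have [zpq|zpq] : apZ z p = q \/ apZ z p = - q by move: zp; move: (apZ z p) => a; lia.
  by rewrite (Gset_stransp_conj (conj q0 p0)) 1?stranspC //; left; rewrite (Gfun_eqK zF zpq).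
by rewrite (Gset_stransp_conj neq0) //; right; rewrite (Gfun_oppK zF zpq).
Qed.

Lemma AscEq_is_ascEq : AscEq n s z -> is_ascEq p q (apZ z).
Proof.
have [zN zK _ _ z_asc] := zF; have [p0 q0] := neq0; have pq := simple_root_lt root.
move=> [i [hi zsz]]; have : apZ (permc z (permc s z)) i = apZ (sgen n.*2 i) i by rewrite zsz.
rewrite 2!apZ_permc sE apZ_sgen ?stransp_l; last lia.
move=> /(congr1 (apZ z)); rewrite zK => stransp_zi.
have [z_asc_i _] := z_asc i ltac:(lia); have [pn qn] := simple_root_le root; move: z_asc_i; rewrite -stransp_zi.
have zi_neq : apZ z i != apZ z (i%:Z + 1) by apply/eqP => /(Gfun_inj zF); lia.
have zi := zK i; have zi1 := zK (i%:Z + 1).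
move: stransp_zi zi_neq zi zi1; set a := apZ z i; set b := apZ z (i%:Z + 1) => stransp_a ab_neq za zb.
have [aE|[aE|[aE|aE]]] : a = p \/ a = q \/ a = - p \/ a = - q.
- by move: stransp_a ab_neq; stransp_cases.
- rewrite aE stransp_l in stransp_a; have zp : apZ z p = i by rewrite -aE.
  by move=> _; rewrite /is_ascEq /outer_consecutive zp (_ : apZ z q = i%:Z + 1) ?stransp_a //; lia.
- by rewrite aE stransp_r; lia.
- by rewrite aE stranspN // stransp_l; lia.
rewrite aE (stranspN _ neq0) stransp_r in stransp_a.
have zq : apZ z q = - i%:Z by rewrite -[q]opprK -aE zN za.
have zp : apZ z p = - (i%:Z + 1) by rewrite -[p]opprK stransp_a zN zb.
by move=> _; rewrite /is_ascEq /outer_consecutive zp zq; lia.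
Qed.

Lemma AscEqP : AscEq n s z <-> is_ascEq p q (apZ z).
Proof.
split=> [|/and3P[/eqP zq zp_out zq_out]]; first exact: AscEq_is_ascEq.
have [_ zK _ _ _] := zF; have [pn qn] := simple_root_le root.
have zp_le : (absz (apZ z p) <= n.*2)%N by rewrite apZ_bound; lia.
have zq_le : (absz (apZ z q) <= n.*2)%N by rewrite apZ_bound; lia.
have conj_sgen (i : nat) : (n < i < n.*2)%N ->
    maps_root (apZ z) p q i%:Z (i%:Z + 1) -> AscEq n s z.
  move=> hi zpq; exists i; split=> //; apply: eq_apZ => x.
  rewrite 2!apZ_permc sE apZ_sgen; last by lia.
  by rewrite (@Gset_stransp_conj i%:Z (i%:Z + 1)) ?zK //; lia.
by case: (ltrP 0 (apZ z p)) => zp; [apply: (conj_sgen (absz (apZ z p))) | apply: (conj_sgen (absz (apZ z q)))]; rewrite /maps_root; lia.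
Qed.

Lemma left_ascent_Gset : left_ascent t n.*2 s z = (apZ z p < apZ z q).
Proof. by rewrite (left_ascentE _ (simple_root_widen root) sE) (Gset_invg zG). Qed.

Hypothesis sS : s \in Sgen t n.

Lemma AscLtP : AscLt t n s z <-> [/\ apZ z p < apZ z q, ~~ is_desEq p q (apZ z) & ~~ is_ascEq p q (apZ z)].
Proof.
rewrite /AscLt /lenBig wordlen_gen_lt ?(Gset_gens zG) ?Sgen_widen // left_ascent_Gset.
rewrite (propext DesEqP) (propext AscEqP).
by split=> [[-> [/negP-> /negP->]]|[-> /negP ? /negP ?]].
Qed.

Lemma DesLtP : DesLt t n s z <-> [/\ apZ z q < apZ z p, ~~ is_desEq p q (apZ z) & ~~ is_ascEq p q (apZ z)].
Proof.
rewrite /DesLt /lenBig wordlen_gen_gt ?(Gset_gens zG) ?Sgen_widen // left_ascent_Gset.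
rewrite (propext DesEqP) (propext AscEqP) -leNgt le_eqVlt.
have -> : (apZ z q == apZ z p) = false.
  by apply/eqP => /(@apZ_inj _ z); have := simple_root_lt root; lia.
by rewrite orFb; split=> [[-> [/negP-> /negP->]]|[-> /negP ? /negP ?]].
Qed.

End RootConditions.

Section Conjugation.
Variables (t : CoxType) (p q : int) (f : int -> int).
Hypotheses (fG : Gfun f) (root : simple_root t n p q).
Let neq0 : p != 0 /\ q != 0 := simple_root_neq0 root.

Lemma stransp_out x : n%:Z < `|x| -> stransp p q x = x.
Proof. by move=> hx; have [pn qn] := simple_root_le root; apply: stransp_id; lia. Qed.

Lemma stransp_norm_le m x : (n <= m)%N -> `|x| <= m%:Z -> `|stransp p q x| <= m%:Z.
Proof. by have [pn qn] := simple_root_le root; stransp_cases. Qed.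

Lemma conj_fun_fpf x : x != 0 -> `|x| <= n.*2%:Z -> `|conj_fun p q f x| != `|x|.
Proof.
have [_ _ f_neq _ _] := fG; move=> x0 xb.
have sx0 := stransp_neq0 neq0 x0; have sxb := @stransp_norm_le n.*2 x ltac:(lia) xb.
apply: contraNneq (f_neq _ sx0 sxb) => fx; apply/eqP.
have [fx'|fx'] : conj_fun p q f x = x \/ conj_fun p q f x = - x by lia.
  by rewrite -{2}fx' /conj_fun stranspK.
have -> : f (stransp p q x) = - stransp p q x; last by rewrite normrN.
by apply: (can_inj (stranspK neq0)); rewrite -[LHS]/(conj_fun p q f x) fx' stranspN // stranspK.
Qed.

Lemma conj_fun_ascends i : ~~ is_ascEq p q f -> n%:Z < i ->
  (i <= conj_fun p q f (i + 1) \/ conj_fun p q f i <= conj_fun p q f (i + 1)) /\ - i <= conj_fun p q f i.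
Proof.
have [fN fK _ _ f_asc] := fG; move=> nA hi; have [f_asc_i fi_ge] := f_asc i hi.
rewrite /conj_fun (stransp_out (x := i)) ?(stransp_out (x := i + 1)); try lia.
have i0 : i != 0 by lia.
have i10 : i + 1 != 0 by lia.
split; last first.
  case: (lerP `|f i| n%:Z) => fi; last by rewrite stransp_out.
  by have := @stransp_norm_le n (f i) (leqnn n) fi; move: (stransp _ _ _) => y; lia.
case: f_asc_i => [fi1|le_f]; first by left; rewrite stransp_out //; lia.
have f_neq : f i != f (i + 1) by apply/eqP => /(Gfun_inj fG); lia.
have f_neqN : f i != - f (i + 1) by rewrite -fN; apply/eqP => /(Gfun_inj fG); lia.
right; rewrite leNgt; apply/negP => /ltW reversed.
have lt_f : f i < f (i + 1) by lia.
case: (stransp_reversal root (Gfun_neq0 fG i0) (Gfun_neq0 fG i10) lt_f f_neqN reversed) => -[fi fi1]; move/negP: nA; apply.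
  by rewrite /is_ascEq /outer_consecutive -fi -fi1 !fK; lia.
have fq : f q = - i by rewrite -[q]opprK -fi fN fK.
have fp : f p = - (i + 1) by rewrite -[p]opprK -fi1 fN fK.
by rewrite /is_ascEq /outer_consecutive fp fq; lia.
Qed.

Lemma Gfun_conj : ~~ is_ascEq p q f -> Gfun (conj_fun p q f).
Proof.
have [fN fK _ f_out _] := fG; move=> nA.
split; [exact: conj_funN | exact: conj_fun_involutive | exact: conj_fun_fpf | | by move=> i; exact: conj_fun_ascends].
by move=> x xb; rewrite /conj_fun (stransp_out (x := x)) ?f_out ?stransp_out //; lia.
Qed.

Lemma Gfun_root_values : ~~ is_desEq p q f -> [/\ `|f p| != `|p|, `|f q| != `|p| & `|f q| != `|q|].
Proof.
have [_ _ f_neq _ _] := fG; have [p0 q0] := neq0; have [pn qn] := simple_root_le root.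
move=> nD; split; [by apply: f_neq => //; lia | | by apply: f_neq => //; lia].
by apply: contraNneq nD => /(Gfun_abs_sym fG) fp; rewrite /is_desEq fp.
Qed.

End Conjugation.

Lemma apZ_conj s z p q : apZ s =1 stransp p q -> apZ (permc s (permc z s)) = conj_fun p q (apZ z).
Proof. by move=> sE; apply/funext => x; rewrite !apZ_permc !sE. Qed.

Lemma stransp_lt_opp p q (i : nat) x : simple_root TD n p q -> `|i%:Z| != `|p| -> `|i%:Z| != `|q| ->
  x != - i%:Z -> (0 < i)%N -> (stransp p q x < - i%:Z) = (x < - i%:Z).
Proof.
move=> /simple_rootP root ip iq x_neq i0; rewrite /stransp.
by case: root => [[? ? ?]|[[//]|[_ ? ?]]]; do 4![case: eqP => [?|_]; first lia].
Qed.

(* The conjugation alters the condition [z i < - i] at [i = |p|] and [i = q] only. *)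
Lemma type_cond_conj_D s z p q : Gfun (apZ z) -> simple_root TD n p q -> apZ s =1 stransp p q ->
  ~~ is_desEq p q (apZ z) -> type_cond TD z -> type_cond TD (permc s (permc z s)).
Proof.
move=> zG root sE nD; have [zN _ _ _ _] := zG; rewrite /type_cond (apZ_conj _ sE) => tc.
rewrite -[odd _]addbF -(negbTE tc) -odd_count_addb.
have neq0 := simple_root_neq0 root; have [p0 q0] := neq0; have [pn qn] := simple_root_le root.
have [zpp zqp zqq] := Gfun_root_values zG root nD.
have q_gt : `|p| < q by case: (simple_rootP root) => [[? ? ?]|[[]|[_ ? ?]]] //; lia.
apply: (@even_count_pair _ _ (absz p) (absz q)); rewrite ?iota_uniq ?mem_iota //; try by [lia | clear - p0 q0 pn qn q_gt; lia].
- move=> i; rewrite mem_iota => hi ip iq.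
  have [{}ip {}iq] : `|i%:Z| != `|p| /\ `|i%:Z| != `|q| by clear - ip iq; lia.
  have [_ zi_neq] : apZ z i != i /\ apZ z i != - i%:Z by apply: (Gfun_neq zG); clear - hi; lia.
  by rewrite /conj_fun (stransp_id ip iq) (stransp_lt_opp root ip iq zi_neq) ?addbb //; clear - hi; lia.
have sq : stransp p q (apZ z q) = apZ z q by exact: stransp_id.
have sp : stransp p q (apZ z p) = apZ z p by exact: stransp_id.
have zp0 := Gfun_neq0 zG p0; have zq0 := Gfun_neq0 zG q0; rewrite /conj_fun.
have -> : (absz q)%:Z = q by clear - q_gt; lia.
rewrite stransp_r sp; case: (simple_rootP root) => [[p1 _ qE]|[[]|[_ pE qE]]] //.
  have -> : (absz p)%:Z = p by clear - p1; lia.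
  rewrite stransp_l sq; move: zpp zqq nD zqp; rewrite /is_desEq; clear - p1 qE.
  by move: (apZ z p) (apZ z q) => a b; lia.
have -> : (absz p)%:Z = - p by clear - pE; lia.
rewrite (stranspN _ neq0) stransp_l !zN (stranspN _ neq0) sq.
move: zpp zqq nD zqp zp0 zq0; rewrite /is_desEq; clear - pE qE.
by move: (apZ z p) (apZ z q) => a b; lia.
Qed.

Lemma Gset_conj t s z p q : z \in Gset t n -> simple_root t n p q -> apZ s =1 stransp p q ->
  ~~ is_desEq p q (apZ z) -> ~~ is_ascEq p q (apZ z) -> permc s (permc z s) \in Gset t n.
Proof.
move=> /GsetP[zG tc] root sE nD nA; apply/GsetP; split; first by rewrite (apZ_conj _ sE); exact: (Gfun_conj zG root).
case: t root tc => // root tc; last exact: (type_cond_conj_D zG root sE nD tc).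
move=> x hx; rewrite (apZ_conj _ sE); case: (simple_rootP root) => [[p1 _ ->]|[[]|[]]] //.
have pos y : 0 < y -> 0 < stransp p (p + 1) y by stransp_cases.
exact/pos/tc/pos.
Qed.

End Gelements.

(** * Braid relations *)

Inductive step_kind := DesEqK | AscEqK | AscLtK | DesLtK.

Section Kinds.
Variables (n : nat).
Hypothesis hn : (2 <= n)%N.
Implicit Types (t : CoxType) (p q x y : int) (f : int -> int).

Notation Gfun := (Gfun n).
Notation outer_consecutive := (outer_consecutive n).

Definition value_kind q x y : step_kind :=
  if `|x| == `|q| then DesEqK else if outer_consecutive x y then AscEqK
  else if x < y then AscLtK else DesLtK.

Definition fun_kind p q f := value_kind q (f p) (f q).

Lemma fun_kindP p q f : match fun_kind p q f with
  | DesEqK => `|f p| = `|q|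
  | AscEqK => `|f p| != `|q| /\ outer_consecutive (f p) (f q)
  | AscLtK => [/\ `|f p| != `|q|, f p < f q & ~~ outer_consecutive (f p) (f q)]
  | DesLtK => [/\ `|f p| != `|q|, f q <= f p & ~~ outer_consecutive (f p) (f q)]
  end.
Proof.
rewrite /fun_kind /value_kind; case: eqP => // _; case: ifP => [//|/negbT nA].
by case: ltrP.
Qed.

Lemma fun_kind_increasing p q f : fun_kind p q f <> DesLtK -> `|f p| = `|q| \/ (`|f p| != `|q| /\ f p < f q).
Proof.
have := fun_kindP p q f; case: (fun_kind p q f) => // [? _|[fpq /and3P[/eqP-> _ _]] _|[? ? _] _]; first by left.
  by right; rewrite ltrDl.
by right.
Qed.

Lemma value_kind_desEq q x y : `|x| = `|q| -> value_kind q x y = DesEqK.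
Proof. by rewrite /value_kind => ->; rewrite eqxx. Qed.

Lemma value_kind_ascEq q x y : `|x| != `|q| -> outer_consecutive x y -> value_kind q x y = AscEqK.
Proof. by rewrite /value_kind => /negbTE-> ->. Qed.

Lemma value_kind_ascLt q x y : `|x| != `|q| -> x < y -> ~~ outer_consecutive x y -> value_kind q x y = AscLtK.
Proof. by rewrite /value_kind => /negbTE-> -> /negbTE->. Qed.

Lemma value_kind_desLt q x y : `|x| != `|q| -> y < x -> value_kind q x y = DesLtK.
Proof.
move=> xq lt; rewrite /value_kind (negbTE xq) ltNge (ltW lt) /= /outer_consecutive.
by case: eqP => // yE; move: lt; rewrite yE; lia.
Qed.

Lemma value_kind_opp q x y : `|x| != `|q| -> `|y| != `|q| -> value_kind q (- y) (- x) = value_kind q x y.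
Proof.
move=> xq yq; rewrite /value_kind /outer_consecutive !normrN (negbTE xq) (negbTE yq) ltrN2.
have -> : (- x == - y + 1) = (y == x + 1) by lia.
by rewrite [X in _ && X]andbC.
Qed.

Lemma Gfun_no_reversal f x y : Gfun f -> x < y -> `|x| <= n%:Z -> `|y| <= n%:Z ->
  ~~ outer_consecutive (f y) (f x).
Proof.
move=> [fN fK _ _ f_asc] xy xn yn; apply/negP => /and3P[/eqP fxE fy_out fx_out].
case: (ltrP 0 (f y)) => fy_sign.
  by have := f_asc (f y); rewrite -fxE !fK; lia.
have fyE : - f x + 1 = - f y by lia.
by have := f_asc (- f x); rewrite fyE !fN !fK; lia.
Qed.

Lemma conj_fun_l p q f : `|f q| != `|p| -> `|f q| != `|q| -> conj_fun p q f p = f q.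
Proof. by move=> fqp fqq; rewrite /conj_fun stransp_l stransp_id. Qed.

Lemma conj_fun_r p q f : `|f p| != `|p| -> `|f p| != `|q| -> conj_fun p q f q = f p.
Proof. by move=> fpp fpq; rewrite /conj_fun stransp_r stransp_id. Qed.

Lemma conj_fun_other p q f x : `|x| != `|p| -> `|x| != `|q| -> conj_fun p q f x = stransp p q (f x).
Proof. by move=> xp xq; rewrite /conj_fun (stransp_id xp xq). Qed.

Lemma conj_funK t p q f : simple_root t n p q -> conj_fun p q (conj_fun p q f) = f.
Proof. by move=> /simple_root_neq0 neq0; apply/funext => x; rewrite /conj_fun !(stranspK neq0). Qed.

Lemma fun_kind_conj t p q f : Gfun f -> simple_root t n p q ->
  (fun_kind p q f = AscLtK -> fun_kind p q (conj_fun p q f) = DesLtK) /\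
  (fun_kind p q f = DesLtK -> fun_kind p q (conj_fun p q f) = AscLtK).
Proof.
move=> fG root; have [pn qn] := simple_root_le hn root; have pq := simple_root_lt root.
have f_neq : f p != f q by apply/eqP => /(Gfun_inj fG); lia.
split=> kf; have := fun_kindP p q f; rewrite kf => -[nD le_f nA];
  have [fpp fqp fqq] := Gfun_root_values hn fG root nD; rewrite /fun_kind conj_fun_l // conj_fun_r //.
  exact: value_kind_desLt.
by apply: value_kind_ascLt => //; [rewrite lt_neqAle eq_sym f_neq | exact: Gfun_no_reversal].
Qed.

Lemma Gfun_conj_kind t p q f : Gfun f -> simple_root t n p q ->
  fun_kind p q f = AscLtK \/ fun_kind p q f = DesLtK -> Gfun (conj_fun p q f).
Proof.
move=> fG root kf; apply: (Gfun_conj hn fG root).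
by have := fun_kindP p q f; case: kf => -> [].
Qed.

Definition is_root p q := exists t, simple_root t n p q.

Section DihedralInduction.
Variables (p q p' q' : int) (inversions : (int -> int) -> nat) (Q : (int -> int) -> Prop).
Hypotheses (root : is_root p q) (root' : is_root p' q').
Hypothesis inversions_l : forall f, Gfun f -> fun_kind p q f = DesLtK -> (inversions (conj_fun p q f) < inversions f)%N.
Hypothesis inversions_r : forall f, Gfun f -> fun_kind p' q' f = DesLtK -> (inversions (conj_fun p' q' f) < inversions f)%N.
Hypothesis Q_conj_l : forall f, Gfun f -> fun_kind p q f = AscLtK -> Q f -> Q (conj_fun p q f).
Hypothesis Q_conj_r : forall f, Gfun f -> fun_kind p' q' f = AscLtK -> Q f -> Q (conj_fun p' q' f).
Hypothesis Q_minimal : forall f, Gfun f -> fun_kind p q f <> DesLtK -> fun_kind p' q' f <> DesLtK -> Q f.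

Lemma dihedral_Gfun_ind f : Gfun f -> Q f.
Proof.
have [m] := ubnP (inversions f); elim: m f => // m IH f inv_f fG.
have descend u v : is_root u v -> (forall g, Gfun g -> fun_kind u v g = AscLtK -> Q g -> Q (conj_fun u v g)) ->
    fun_kind u v f = DesLtK -> (inversions (conj_fun u v f) < inversions f)%N -> Q f.
  move=> [t uv] Q_conj kf inv_lt; have cfG := Gfun_conj_kind fG uv (or_intror kf).
  rewrite -(conj_funK f uv); apply: Q_conj => //; first exact: (fun_kind_conj fG uv).2.
  by apply: IH => //; exact: leq_trans inv_lt _.
case: (pselect (fun_kind p q f = DesLtK)) => [kf|nDs]; first exact: (descend p q root) (inversions_l _ _).
case: (pselect (fun_kind p' q' f = DesLtK)) => [kf|nDt]; first exact: (descend p' q' root') (inversions_r _ _).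
exact: Q_minimal.
Qed.

End DihedralInduction.
End Kinds.

Section RootOperators.
Variables (n : nat).
Hypothesis hn : (2 <= n)%N.
Variables (R : comNzRingType) (a eA eD : R).
Hypotheses (eA_quad : eA * eA = 1 + a * eA) (eD_quad : eD * eD = 1 + a * eD).
Implicit Types (t : CoxType) (p q x y : int) (f : int -> int) (F G : (int -> int) -> R).

Notation fun_kind := (fun_kind n).
Notation Gfun := (Gfun n).
Notation is_root := (is_root n).

(* The transpose of the action of [H_s], on functions of the elements of [Gset]. *)
Definition root_op p q F f : R :=
  match fun_kind p q f with
  | DesEqK => eD * F f
  | AscEqK => eA * F f
  | AscLtK => F (conj_fun p q f)
  | DesLtK => F (conj_fun p q f) + a * F f
  end.

Definition eigenvalue_of (k : step_kind) : option R :=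
  match k with DesEqK => Some eD | AscEqK => Some eA | _ => None end.

Lemma root_op_eigen p q F f e : eigenvalue_of (fun_kind p q f) = Some e -> root_op p q F f = e * F f.
Proof. by rewrite /root_op; case: (fun_kind p q f) => // -[->]. Qed.

Lemma root_op_ascLt p q F f : fun_kind p q f = AscLtK -> root_op p q F f = F (conj_fun p q f).
Proof. by rewrite /root_op => ->. Qed.

Lemma root_op_ext p q F G : is_root p q -> (forall f, Gfun f -> F f = G f) ->
  forall f, Gfun f -> root_op p q F f = root_op p q G f.
Proof.
move=> [t root] FG f fG; rewrite /root_op; case kf : (fun_kind p q f); rewrite ?FG //.
- by apply: (Gfun_conj_kind hn fG root); left.
- by apply: (Gfun_conj_kind hn fG root); right.
Qed.

Lemma root_op_linear p q F G b f : root_op p q (fun f => F f + b * G f) f = root_op p q F f + b * root_op p q G f.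
Proof. by rewrite /root_op; case: (fun_kind _ _ _); ring. Qed.

Lemma root_op_quad p q F f : is_root p q -> Gfun f -> root_op p q (root_op p q F) f = F f + a * root_op p q F f.
Proof.
move=> [t root] fG; rewrite {1 3}/root_op; case kf : (fun_kind p q f).
- by rewrite /root_op kf mulrA eD_quad; ring.
- by rewrite /root_op kf mulrA eA_quad; ring.
- by rewrite /root_op (fun_kind_conj hn fG root).1 // (conj_funK _ root).
- by rewrite /root_op kf (fun_kind_conj hn fG root).2 // (conj_funK _ root).
Qed.

Section Pair.
Variables (p q p' q' : int).
Hypotheses (root : is_root p q) (root' : is_root p' q').
Notation s := (root_op p q).
Notation t := (root_op p' q').
Notation cs := (conj_fun p q).
Notation ct := (conj_fun p' q').

Definition braid2_at f := forall F, s (t F) f = t (s F) f.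
Definition braid3_at f := forall F, s (t (s F)) f = t (s (t F)) f.
Definition braid4_at f := forall F, s (t (s (t F))) f = t (s (t (s F))) f.

Lemma braid3_at_conj f : Gfun f -> fun_kind p q f = AscLtK -> braid3_at f -> braid3_at (cs f).
Proof.
move=> fG kf braid_f F.
rewrite -(root_op_ascLt (s (t (s F))) kf) -(root_op_ascLt (t (s (t F))) kf) root_op_quad // (braid_f (t F)) (braid_f F).
have -> : t (s (t (t F))) f = t (s (fun f => F f + a * t F f)) f.
  by apply: root_op_ext => // g gG; apply: root_op_ext => // h hG; exact: root_op_quad.
have -> : t (s (fun f => F f + a * t F f)) f = t (fun f => s F f + a * s (t F) f) f.
  by apply: root_op_ext => // g gG; exact: root_op_linear.
by rewrite root_op_linear.
Qed.

Lemma braid4_at_conj f : Gfun f -> fun_kind p q f = AscLtK -> braid4_at f -> braid4_at (cs f).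
Proof.
move=> fG kf braid_f F.
rewrite -(root_op_ascLt (s (t (s (t F)))) kf) -(root_op_ascLt (t (s (t (s F)))) kf) root_op_quad // (braid_f F) (braid_f (s F)).
have -> : t (s (t (s (s F)))) f = t (s (t (fun f => F f + a * s F f))) f.
  by do 3![apply: root_op_ext => // ? ?]; exact: root_op_quad.
have -> : t (s (t (fun f => F f + a * s F f))) f = t (s (fun f => t F f + a * t (s F) f)) f.
  by do 2![apply: root_op_ext => // ? ?]; exact: root_op_linear.
have -> : t (s (fun f => t F f + a * t (s F) f)) f = t (fun f => s (t F) f + a * s (t (s F)) f) f.
  by apply: root_op_ext => // g gG; exact: root_op_linear.
by rewrite root_op_linear.
Qed.

Lemma braid3_at_hexagon f : fun_kind p q f = AscLtK -> fun_kind p' q' f = AscLtK ->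
  fun_kind p' q' (cs f) = AscLtK -> fun_kind p q (ct f) = AscLtK ->
  fun_kind p q (ct (cs f)) = AscLtK -> fun_kind p' q' (cs (ct f)) = AscLtK ->
  cs (ct (cs f)) = ct (cs (ct f)) -> braid3_at f.
Proof.
move=> s_f t_f t_sf s_tf s_tsf t_stf ends F.
rewrite (root_op_ascLt _ s_f) (root_op_ascLt _ t_sf) (root_op_ascLt _ s_tsf) ends.
by rewrite (root_op_ascLt _ t_f) (root_op_ascLt _ s_tf) (root_op_ascLt _ t_stf).
Qed.

Lemma braid3_at_chain f e : eigenvalue_of (fun_kind p q f) = Some e ->
  fun_kind p' q' f = AscLtK -> fun_kind p q (ct f) = AscLtK ->
  eigenvalue_of (fun_kind p' q' (cs (ct f))) = Some e -> braid3_at f.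
Proof.
move=> s_f t_f s_tf t_stf F; rewrite (root_op_eigen _ s_f) (root_op_ascLt (s F) t_f) (root_op_ascLt F s_tf).
by rewrite (root_op_ascLt (s (t F)) t_f) (root_op_ascLt (t F) s_tf) (root_op_eigen _ t_stf).
Qed.

Lemma braid3_at_scalar f e : eigenvalue_of (fun_kind p q f) = Some e ->
  eigenvalue_of (fun_kind p' q' f) = Some e -> braid3_at f.
Proof.
move=> s_f t_f F; rewrite (root_op_eigen (t (s F)) s_f) (root_op_eigen (s F) t_f) (root_op_eigen F s_f).
by rewrite (root_op_eigen (s (t F)) t_f) (root_op_eigen (t F) s_f) (root_op_eigen F t_f).
Qed.

Lemma braid4_at_octagon f : fun_kind p q f = AscLtK -> fun_kind p' q' f = AscLtK ->
  fun_kind p' q' (cs f) = AscLtK -> fun_kind p q (ct f) = AscLtK ->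
  fun_kind p q (ct (cs f)) = AscLtK -> fun_kind p' q' (cs (ct f)) = AscLtK ->
  fun_kind p' q' (cs (ct (cs f))) = AscLtK -> fun_kind p q (ct (cs (ct f))) = AscLtK ->
  cs (ct (cs (ct f))) = ct (cs (ct (cs f))) -> braid4_at f.
Proof.
move=> s_f t_f t_sf s_tf s_tsf t_stf t_stsf s_tstf ends F.
rewrite (root_op_ascLt _ s_f) (root_op_ascLt _ t_sf) (root_op_ascLt _ s_tsf) (root_op_ascLt _ t_stsf) -ends.
by rewrite (root_op_ascLt _ t_f) (root_op_ascLt _ s_tf) (root_op_ascLt _ t_stf) (root_op_ascLt _ s_tstf).
Qed.

Lemma braid4_at_long_chain f e : eigenvalue_of (fun_kind p' q' f) = Some e ->
  fun_kind p q f = AscLtK -> fun_kind p' q' (cs f) = AscLtK -> fun_kind p q (ct (cs f)) = AscLtK ->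
  eigenvalue_of (fun_kind p' q' (cs (ct (cs f)))) = Some e -> braid4_at f.
Proof.
move=> t_f s_f t_sf s_tsf t_stsf F.
rewrite (root_op_eigen (s (t (s F))) t_f) (root_op_ascLt (t (s F)) s_f) (root_op_ascLt (s F) t_sf) (root_op_ascLt F s_tsf).
by rewrite (root_op_ascLt (t (s (t F))) s_f) (root_op_ascLt (s (t F)) t_sf) (root_op_ascLt (t F) s_tsf) (root_op_eigen F t_stsf).
Qed.

Lemma braid4_at_short_chain f e : Gfun f -> eigenvalue_of (fun_kind p' q' f) = Some e ->
  fun_kind p q f = AscLtK -> eigenvalue_of (fun_kind p' q' (cs f)) = Some e -> braid4_at f.
Proof.
move=> fG t_f s_f t_sf F; case: root => r simple; have s_sf := (fun_kind_conj hn fG simple).1 s_f.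
have s_at_sf G : s G (cs f) = G f + a * G (cs f) by rewrite /root_op s_sf (conj_funK _ simple).
rewrite (root_op_eigen (s (t (s F))) t_f) (root_op_ascLt (t (s F)) s_f) (root_op_eigen (s F) t_sf) s_at_sf.
by rewrite (root_op_ascLt (t (s (t F))) s_f) (root_op_eigen (s (t F)) t_sf) s_at_sf (root_op_eigen F t_f) (root_op_eigen F t_sf); ring.
Qed.

Lemma braid2_at_commute f : fun_kind p q (ct f) = fun_kind p q f -> fun_kind p' q' (cs f) = fun_kind p' q' f ->
  cs (ct f) = ct (cs f) -> braid2_at f.
Proof.
move=> s_tf t_sf ends F; rewrite /root_op s_tf t_sf ends.
by case: (fun_kind p q f); case: (fun_kind p' q' f); ring.
Qed.

Lemma braid2_at_coincide f : fun_kind p q f = fun_kind p' q' f -> cs f = ct f ->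
  fun_kind p q (cs f) = fun_kind p' q' (cs f) -> cs (cs f) = ct (cs f) -> braid2_at f.
Proof.
move=> kf ends k_sf ends_sf F; rewrite /root_op -kf -ends -k_sf -ends_sf.
by case: (fun_kind p q f).
Qed.

End Pair.

Lemma braid3_at_sym p q p' q' f : braid3_at p q p' q' f -> braid3_at p' q' p q f.
Proof. by move=> braid F; exact/esym/braid. Qed.

Lemma braid4_at_sym p q p' q' f : braid4_at p q p' q' f -> braid4_at p' q' p q f.
Proof. by move=> braid F; exact/esym/braid. Qed.

Lemma braid3_at_ind p q p' q' (inversions : (int -> int) -> nat) : is_root p q -> is_root p' q' ->
  (forall f, Gfun f -> fun_kind p q f = DesLtK -> (inversions (conj_fun p q f) < inversions f)%N) ->
  (forall f, Gfun f -> fun_kind p' q' f = DesLtK -> (inversions (conj_fun p' q' f) < inversions f)%N) ->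
  (forall f, Gfun f -> fun_kind p q f <> DesLtK -> fun_kind p' q' f <> DesLtK -> braid3_at p q p' q' f) ->
  forall f, Gfun f -> braid3_at p q p' q' f.
Proof.
move=> root root' inv_l inv_r minimal.
apply: (dihedral_Gfun_ind hn (Q := braid3_at p q p' q') root root' inv_l inv_r _ _ minimal) => f fG kf braid_f.
  exact: braid3_at_conj.
exact/braid3_at_sym/(braid3_at_conj root' root fG kf)/braid3_at_sym.
Qed.

Lemma braid4_at_ind p q p' q' (inversions : (int -> int) -> nat) : is_root p q -> is_root p' q' ->
  (forall f, Gfun f -> fun_kind p q f = DesLtK -> (inversions (conj_fun p q f) < inversions f)%N) ->
  (forall f, Gfun f -> fun_kind p' q' f = DesLtK -> (inversions (conj_fun p' q' f) < inversions f)%N) ->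
  (forall f, Gfun f -> fun_kind p q f <> DesLtK -> fun_kind p' q' f <> DesLtK -> braid4_at p q p' q' f) ->
  forall f, Gfun f -> braid4_at p q p' q' f.
Proof.
move=> root root' inv_l inv_r minimal.
apply: (dihedral_Gfun_ind hn (Q := braid4_at p q p' q') root root' inv_l inv_r _ _ minimal) => f fG kf braid_f.
  exact: braid4_at_conj.
exact/braid4_at_sym/(braid4_at_conj root' root fG kf)/braid4_at_sym.
Qed.

End RootOperators.

Lemma stransp_compare t m p q x y : simple_root t m p q -> `|y| != `|p| -> `|y| != `|q| -> y != 0 ->
  (stransp p q x < y) = (x < y) /\ (y < stransp p q x) = (y < x).
Proof.
move=> /simple_rootP root yp yq y0; rewrite /stransp.
by case: root => [[? ? ?]|[[_ ? ?]|[_ ? ?]]]; do 4![case: eqP => [?|_]; first lia].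
Qed.

Section TripleBraid.
Variables (n : nat).
Variables (R : comNzRingType) (a eA eD : R).
Implicit Types (x y z : int) (f : int -> int).

Notation fun_kind := (fun_kind n).
Notation Gfun := (Gfun n).
Notation braid3_at := (braid3_at n a eA eD).
Notation outer_consecutive := (outer_consecutive n).

Definition root_triple p q r : Prop :=
  [/\ 1 <= p, q = p + 1, r = p + 2 & r <= n%:Z] \/ [/\ p = -1, q = 2, r = 3 & r <= n%:Z].

Variables (p q r : int).
Hypothesis triple : root_triple p q r.

Lemma root_triple_neq0 : [/\ p != 0, q != 0 & r != 0].
Proof. by case: triple => [[? ? ? ?]|[? ? ? ?]]; split; lia. Qed.

Lemma root_triple_le : [/\ `|p| <= n%:Z, `|q| <= n%:Z & `|r| <= n%:Z].
Proof. by case: triple => [[? ? ? ?]|[? ? ? ?]]; split; lia. Qed.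

Lemma root_triple_norm_neq : [/\ `|p| != `|q|, `|p| != `|r| & `|q| != `|r|].
Proof. by case: triple => [[? ? ? ?]|[? ? ? ?]]; split; lia. Qed.

Lemma root_triple_simple_l : exists t, simple_root t n p q.
Proof.
case: triple => [[? ? ? ?]|[pE qE ? ?]]; [exists TA | exists TD]; rewrite /simple_root; first lia.
by rewrite pE qE !orbT.
Qed.

Lemma root_triple_simple_r : simple_root TA n q r.
Proof. by rewrite /simple_root; case: triple => [[? ? ? ?]|[? ? ? ?]]; lia. Qed.

Lemma conj_fun_braid3 f :
  conj_fun p q (conj_fun q r (conj_fun p q f)) = conj_fun q r (conj_fun p q (conj_fun q r f)).
Proof.
by apply/funext => x; rewrite /conj_fun !(stransp_braid3 _ root_triple_neq0 root_triple_norm_neq).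
Qed.

Definition avoids_triple x := [/\ `|x| != `|p|, `|x| != `|q| & `|x| != `|r|].

Definition triple_values f x y z :=
  [/\ avoids_triple x, avoids_triple y & avoids_triple z] /\ [/\ f p = x, f q = y & f r = z].

Lemma triple_values_conj_l f x y z : triple_values f x y z -> triple_values (conj_fun p q f) y x z.
Proof.
move=> [[x_out y_out z_out] [fp fq fr]]; have [_ pr qr] := root_triple_norm_neq; split=> //.
have [xp xq _] := x_out; have [yp yq _] := y_out; have [zp zq _] := z_out.
split; [by rewrite conj_fun_l fq | by rewrite conj_fun_r fp |].
by rewrite conj_fun_other 1?eq_sym // fr stransp_id.
Qed.

Lemma triple_values_conj_r f x y z : triple_values f x y z -> triple_values (conj_fun q r f) x z y.
Proof.
move=> [[x_out y_out z_out] [fp fq fr]]; have [pq pr _] := root_triple_norm_neq; split=> //.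
have [_ xq xr] := x_out; have [_ yq yr] := y_out; have [_ zq zr] := z_out.
split; [|by rewrite conj_fun_l fr | by rewrite conj_fun_r fq].
by rewrite conj_fun_other // fp stransp_id.
Qed.

Lemma triple_values_ascLt_l f x y z : triple_values f x y z -> x < y -> ~~ outer_consecutive x y -> fun_kind p q f = AscLtK.
Proof. by rewrite /fun_kind => -[[[_ xq _] _ _] [-> -> _]]; exact: value_kind_ascLt. Qed.

Lemma triple_values_ascLt_r f x y z : triple_values f x y z -> y < z -> ~~ outer_consecutive y z -> fun_kind q r f = AscLtK.
Proof. by rewrite /fun_kind => -[[_ [_ _ yr] _] [_ -> ->]]; exact: value_kind_ascLt. Qed.

Lemma triple_values_ascEq_l f x y z : triple_values f x y z -> outer_consecutive x y -> fun_kind p q f = AscEqK.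
Proof. by rewrite /fun_kind => -[[[_ xq _] _ _] [-> -> _]]; exact: value_kind_ascEq. Qed.

Lemma triple_values_ascEq_r f x y z : triple_values f x y z -> outer_consecutive y z -> fun_kind q r f = AscEqK.
Proof. by rewrite /fun_kind => -[[_ [_ _ yr] _] [_ -> ->]]; exact: value_kind_ascEq. Qed.

Section MinimalElement.
Variable f : int -> int.
Hypothesis fG : Gfun f.

Lemma root_triple_fpf : [/\ `|f p| != `|p|, `|f q| != `|q| & `|f r| != `|r|].
Proof.
have [p0 q0 r0] := root_triple_neq0; have [pn qn rn] := root_triple_le; case: fG => _ _ f_neq _ _.
by split; apply: f_neq => //; [clear - pn | clear - qn | clear - rn]; lia.
Qed.

Lemma root_triple_values : `|f p| != `|q| -> `|f q| != `|r| -> f p < f q -> f q < f r ->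
  triple_values f (f p) (f q) (f r).
Proof.
move=> fpq fqr lt_pq lt_qr; have [fpp fqq frr] := root_triple_fpf.
have [_ q0 _] := root_triple_neq0; have fq0 := Gfun_neq0 fG q0.
have fqp : `|f q| != `|p| by apply: contraNneq fpq => /(Gfun_abs_sym fG) ->.
have frq : `|f r| != `|q| by apply: contraNneq fqr => /(Gfun_abs_sym fG) ->.
have fpr : `|f p| != `|r|.
  apply/eqP => fp; have [fpE|fpE] : f p = r \/ f p = - r by clear - fp; lia.
    have := Gfun_eqK fG fpE; clear - lt_pq lt_qr triple fpE; case: triple => [[? ? ? ?]|[? ? ? ?]]; lia.
  have := Gfun_oppK fG fpE; clear - lt_pq lt_qr triple fpE fqq fqp fq0.
  by case: triple => [[? ? ? ?]|[? ? ? ?]]; lia.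
have frp : `|f r| != `|p| by apply: contraNneq fpr => /(Gfun_abs_sym fG) ->.
by split; split; try split.
Qed.

Lemma conj_fun_desEq_l : `|f p| = `|q| -> f q < f r ->
  [/\ `|conj_fun q r f p| = `|r|, conj_fun q r f p < f r & conj_fun q r f q = f r].
Proof.
move=> fp lt; have [_ _ frr] := root_triple_fpf; have fq := Gfun_abs_sym fG fp.
have [_ q0 r0] := root_triple_neq0; have [pq pr qr] := root_triple_norm_neq.
have fr0 := Gfun_neq0 fG r0.
have frp : `|f r| != `|p| by apply: contraNneq qr => /(Gfun_abs_sym fG) fpr; rewrite -fp fpr.
have frq : `|f r| != `|q| by apply: contraNneq pr => /(Gfun_abs_sym fG) fqr; rewrite -fq fqr.
rewrite conj_fun_l // conj_fun_other //.
have [fpE|fpE] : f p = q \/ f p = - q by clear - fp; lia.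
  rewrite fpE stransp_l; split=> //; move: lt; rewrite (Gfun_eqK fG fpE).
  by clear - frp frq frr triple fr0; case: triple => [[? ? ? ?]|[? ? ? ?]]; lia.
rewrite fpE stranspN // stransp_l normrN; split=> //; move: lt; rewrite (Gfun_oppK fG fpE).
by clear - frp frq frr triple fr0; case: triple => [[? ? ? ?]|[? ? ? ?]]; lia.
Qed.

Lemma braid3_at_desEq_l : `|f p| = `|q| -> f q < f r -> braid3_at p q q r f.
Proof.
move=> fp lt; have [tfp tf_lt tfq] := conj_fun_desEq_l fp lt.
have [pq pr qr] := root_triple_norm_neq; have [pn _ rn] := root_triple_le; have fq := Gfun_abs_sym fG fp.
apply: (braid3_at_chain a (e := eD)).
- by rewrite /fun_kind value_kind_desEq.
- apply: value_kind_ascLt => //; first by rewrite fq.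
  by rewrite /outer_consecutive fq ltNge pn andbF.
- rewrite /fun_kind tfq; apply: value_kind_ascLt => //; first by rewrite tfp eq_sym.
  by rewrite /outer_consecutive tfp ltNge rn andbF.
rewrite /fun_kind value_kind_desEq // {1}/conj_fun stransp_r stransp_id // tfp eq_sym //.
Qed.

Lemma conj_fun_desEq_r : `|f q| = `|r| -> f p < f q ->
  [/\ `|conj_fun p q f r| = `|p|, f p < conj_fun p q f r, conj_fun p q f q = f p & `|conj_fun p q f p| = `|r|].
Proof.
move=> fq lt; have [fpp _ _] := root_triple_fpf; have fr := Gfun_abs_sym fG fq.
have [p0 q0 _] := root_triple_neq0; have [pq pr qr] := root_triple_norm_neq.
have fp0 := Gfun_neq0 fG p0.
have fpq : `|f p| != `|q| by apply: contraNneq pr => /(Gfun_abs_sym fG) fqp; rewrite -fqp fq.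
have fpr : `|f p| != `|r| by apply: contraNneq pq => /(Gfun_abs_sym fG) frp; rewrite -frp fr.
rewrite conj_fun_r // conj_fun_l ?fq 1?eq_sym // conj_fun_other 1?eq_sym //.
have [fqE|fqE] : f q = r \/ f q = - r by clear - fq; lia.
  rewrite (Gfun_eqK fG fqE) stransp_r; split=> //; move: lt; rewrite fqE.
  by clear - fpq fpr fpp triple fp0; case: triple => [[? ? ? ?]|[? ? ? ?]]; lia.
rewrite (Gfun_oppK fG fqE) stranspN // stransp_r normrN; split=> //; move: lt; rewrite fqE.
by clear - fpq fpr fpp triple fp0; case: triple => [[? ? ? ?]|[? ? ? ?]]; lia.
Qed.

Lemma braid3_at_desEq_r : `|f q| = `|r| -> f p < f q -> braid3_at p q q r f.
Proof.
move=> fq lt; have [sfr sf_lt sfq sfp] := conj_fun_desEq_r fq lt.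
have [_ q0 r0] := root_triple_neq0; have [pq pr qr] := root_triple_norm_neq; have [pn _ rn] := root_triple_le.
have fpq : `|f p| != `|q| by apply: contraNneq pr => /(Gfun_abs_sym fG) fqp; rewrite -fqp fq.
apply/braid3_at_sym/(braid3_at_chain a (e := eD)).
- by rewrite /fun_kind value_kind_desEq.
- by apply: value_kind_ascLt => //; rewrite /outer_consecutive fq [_ < `|r|]ltNge rn !andbF.
- rewrite /fun_kind sfq; apply: value_kind_ascLt => //.
    by apply: contraNneq pq => /(Gfun_abs_sym fG) frp; rewrite -frp (Gfun_abs_sym fG fq).
  by rewrite /outer_consecutive sfr [_ < `|p|]ltNge pn !andbF.
rewrite /fun_kind value_kind_desEq // [conj_fun q r _ p]conj_fun_other //.
have [->|->] : conj_fun p q f p = r \/ conj_fun p q f p = - r by clear - sfp; lia.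
  by rewrite stransp_r.
by rewrite stranspN // stransp_r normrN.
Qed.

Lemma braid3_at_increasing : `|f p| != `|q| -> `|f q| != `|r| -> f p < f q -> f q < f r -> braid3_at p q q r f.
Proof.
move=> fpq fqr lt_pq lt_qr; have f_values := root_triple_values fpq fqr lt_pq lt_qr.
have tf_values := triple_values_conj_r f_values; have stf_values := triple_values_conj_l tf_values.
have sf_values := triple_values_conj_l f_values; have tsf_values := triple_values_conj_r sf_values.
have lt_pr := lt_trans lt_pq lt_qr.
have not_outer : ~~ outer_consecutive (f p) (f r) by rewrite /outer_consecutive; clear - lt_pq lt_qr; lia.
have t_sf := triple_values_ascLt_r sf_values lt_pr not_outer.
have s_tf := triple_values_ascLt_l tf_values lt_pr not_outer.
case: (boolP (outer_consecutive (f p) (f q))) => [s_out|s_not];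
case: (boolP (outer_consecutive (f q) (f r))) => [t_out|t_not].
- apply: (braid3_at_scalar a (e := eA)); first by rewrite (triple_values_ascEq_l f_values s_out).
  by rewrite (triple_values_ascEq_r f_values t_out).
- apply: (braid3_at_chain a (e := eA)) => //; first by rewrite (triple_values_ascEq_l f_values s_out).
    exact: triple_values_ascLt_r f_values lt_qr t_not.
  by rewrite (triple_values_ascEq_r stf_values s_out).
- apply/braid3_at_sym/(braid3_at_chain a (e := eA)) => //; first by rewrite (triple_values_ascEq_r f_values t_out).
    exact: triple_values_ascLt_l f_values lt_pq s_not.
  by rewrite (triple_values_ascEq_l tsf_values t_out).
have s_f := triple_values_ascLt_l f_values lt_pq s_not; have t_f := triple_values_ascLt_r f_values lt_qr t_not.
have s_tsf := triple_values_ascLt_l tsf_values lt_qr t_not; have t_stf := triple_values_ascLt_r stf_values lt_pq s_not.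
exact: (braid3_at_hexagon a eA eD s_f t_f t_sf s_tf s_tsf t_stf (conj_fun_braid3 f)).
Qed.

Lemma braid3_at_minimal : fun_kind p q f <> DesLtK -> fun_kind q r f <> DesLtK -> braid3_at p q q r f.
Proof.
have [_ pr _] := root_triple_norm_neq.
move=> /fun_kind_increasing[fp|[fpq lt_pq]] /fun_kind_increasing[fq|[fqr lt_qr]].
- by have := Gfun_abs_sym fG fp; rewrite fq => rp; rewrite rp eqxx in pr.
- exact: braid3_at_desEq_l.
- exact: braid3_at_desEq_r.
exact: braid3_at_increasing.
Qed.

End MinimalElement.

Definition triple_inversions f : nat := ((f q < f p)%R + (f r < f q)%R + (f r < f p)%R)%N.

Hypothesis hn : (2 <= n)%N.

Lemma triple_inversions_conj_l f : Gfun f -> fun_kind p q f = DesLtK ->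
  (triple_inversions (conj_fun p q f) < triple_inversions f)%N.
Proof.
move=> fG s_f; have [t root] := root_triple_simple_l; have [p0 q0 _] := root_triple_neq0.
have [_ pr qr] := root_triple_norm_neq; have pq := simple_root_lt root.
have := fun_kindP n p q f; rewrite s_f => -[fpq le_f _].
have [fpp fqp fqq] := Gfun_root_values hn fG root fpq.
have [ltr_p _] := stransp_compare (f r) root fpp fpq (Gfun_neq0 fG p0).
have [ltr_q _] := stransp_compare (f r) root fqp fqq (Gfun_neq0 fG q0).
have f_neq : f p <> f q by move=> /(Gfun_inj fG); clear - pq; lia.
rewrite /triple_inversions conj_fun_l // conj_fun_r // conj_fun_other 1?eq_sym // ltr_p ltr_q.
have -> : (f p < f q) = false by clear - le_f; lia.
have -> : (f q < f p) = true by clear - le_f f_neq; lia.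
by clear; lia.
Qed.

Lemma triple_inversions_conj_r f : Gfun f -> fun_kind q r f = DesLtK ->
  (triple_inversions (conj_fun q r f) < triple_inversions f)%N.
Proof.
move=> fG t_f; have root := root_triple_simple_r; have [_ q0 r0] := root_triple_neq0.
have [pq pr _] := root_triple_norm_neq; have qr := simple_root_lt root.
have := fun_kindP n q r f; rewrite t_f => -[fqr le_f _].
have [fqq frq frr] := Gfun_root_values hn fG root fqr.
have [_ ltp_q] := stransp_compare (f p) root fqq fqr (Gfun_neq0 fG q0).
have [_ ltp_r] := stransp_compare (f p) root frq frr (Gfun_neq0 fG r0).
have f_neq : f q <> f r by move=> /(Gfun_inj fG); clear - qr; lia.
rewrite /triple_inversions conj_fun_l // conj_fun_r // conj_fun_other // ltp_q ltp_r.
have -> : (f q < f r) = false by clear - le_f; lia.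
have -> : (f r < f q) = true by clear - le_f f_neq; lia.
by clear; lia.
Qed.

Hypotheses (eA_quad : eA * eA = 1 + a * eA) (eD_quad : eD * eD = 1 + a * eD).

Lemma braid3_triple f : Gfun f -> braid3_at p q q r f.
Proof.
apply: (braid3_at_ind hn eA_quad eD_quad root_triple_simple_l _ triple_inversions_conj_l triple_inversions_conj_r).
  by exists TA; exact: root_triple_simple_r.
exact: braid3_at_minimal.
Qed.

End TripleBraid.

Section SignedPairBraid.
Variables (n : nat).
Hypothesis hn : (2 <= n)%N.
Implicit Types (t : CoxType) (x y : int) (f : int -> int).
Notation fun_kind := (fun_kind n).
Notation Gfun := (Gfun n).
Notation outer_consecutive := (outer_consecutive n).

Lemma simple_root_B : simple_root TBC n (-1) 1.
Proof. by rewrite /simple_root !eqxx orbT. Qed.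

Lemma simple_root_12 t : simple_root t n 1 2.
Proof. by rewrite /simple_root; apply/orP; left; lia. Qed.

Definition pair_values f x y := [/\ {morph f : z / - z}, 2 < `|x|, 2 < `|y|, f 1 = x & f 2 = y].

Lemma norm_gt2_neq x : 2 < `|x| -> `|x| != `|1 : int| /\ `|x| != `|2 : int|.
Proof. by clear; lia. Qed.

Lemma pair_values_conj_B f x y : pair_values f x y -> pair_values (conj_fun (-1) 1 f) (- x) y.
Proof.
move=> [fN x2 y2 f1 f2]; have [x_neq1 _] := norm_gt2_neq x2; have [y_neq1 _] := norm_gt2_neq y2.
have fm1 : f (-1) = - x by rewrite -[-1]/(- (1 : int)) fN f1.
split=> //; [exact: conj_funN | by rewrite normrN | by rewrite conj_fun_r fm1 ?normrN |].
by rewrite conj_fun_other // f2 stransp_id.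
Qed.

Lemma pair_values_conj_12 f x y : pair_values f x y -> pair_values (conj_fun 1 2 f) y x.
Proof.
move=> [fN x2 y2 f1 f2]; have [x_neq1 x_neq2] := norm_gt2_neq x2; have [y_neq1 y_neq2] := norm_gt2_neq y2.
by split=> //; [exact: conj_funN | rewrite conj_fun_l f2 | rewrite conj_fun_r f1].
Qed.

Lemma pair_values_conj_D f x y : pair_values f x y -> pair_values (conj_fun (-1) 2 f) (- y) (- x).
Proof.
move=> [fN x2 y2 f1 f2]; have [x_neq1 x_neq2] := norm_gt2_neq x2; have [y_neq1 y_neq2] := norm_gt2_neq y2.
have fm1 : f (-1) = - x by rewrite -[-1]/(- (1 : int)) fN f1.
have cfN : {morph conj_fun (-1) 2 f : z / - z} by exact: conj_funN.
split=> //; rewrite ?normrN //; last by rewrite conj_fun_r fm1 ?normrN.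
by rewrite -[1]opprK cfN -[- 1]/(-1 : int) conj_fun_l f2.
Qed.

Lemma pair_values_kind_12 f x y : pair_values f x y -> fun_kind 1 2 f = value_kind n 2 x y.
Proof. by rewrite /fun_kind => -[_ _ _ -> ->]. Qed.

Lemma pair_values_kind_D f x y : pair_values f x y -> fun_kind (-1) 2 f = value_kind n 2 (- x) y.
Proof. by rewrite /fun_kind -[-1]/(- (1 : int)) => -[-> _ _ -> ->]. Qed.

Lemma fun_kind_B f : {morph f : z / - z} -> `|f 1| != 1 -> fun_kind (-1) 1 f = if 0 < f 1 then AscLtK else DesLtK.
Proof.
move=> fN f1; rewrite /fun_kind -[-1]/(- (1 : int)) fN /value_kind /outer_consecutive normrN (negbTE f1).
have -> : [&& f 1 == - f 1 + 1, n%:Z < `|f 1| & n%:Z < `|f 1|] = false by clear - f1 hn; lia.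
by congr (if _ then _ else _); clear; lia.
Qed.

Lemma pair_values_ascLt_B f x y : pair_values f x y -> 0 < x -> fun_kind (-1) 1 f = AscLtK.
Proof.
by move=> [fN x2 _ f1 _] x0; have [x_neq1 _] := norm_gt2_neq x2; rewrite fun_kind_B ?f1 ?x0.
Qed.

Lemma pair_values_ascLt_12 f x y : pair_values f x y -> x < y -> ~~ outer_consecutive x y -> fun_kind 1 2 f = AscLtK.
Proof.
move=> f_values lt nA; rewrite (pair_values_kind_12 f_values); case: f_values => _ x2 _ _ _.
by apply: value_kind_ascLt => //; have [] := norm_gt2_neq x2.
Qed.

Lemma pair_values_ascEq_12 f x y : pair_values f x y -> outer_consecutive x y -> fun_kind 1 2 f = AscEqK.
Proof.
move=> f_values out; rewrite (pair_values_kind_12 f_values); case: f_values => _ x2 _ _ _.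
by apply: value_kind_ascEq => //; have [] := norm_gt2_neq x2.
Qed.

Lemma Gfun_fpf12 f : Gfun f -> `|f 1| != 1 /\ `|f 2| != 2.
Proof. by move=> [_ _ f_neq _ _]; split; apply: f_neq => //; clear - hn; lia. Qed.

Lemma Gfun_pair_values f : Gfun f -> `|f 1| != 2 -> pair_values f (f 1) (f 2).
Proof.
move=> fG f12; have [f11 f21 f22] := Gfun_root_values hn fG (simple_root_12 TA) f12.
have f1_neq0 := Gfun_neq0 fG (isT : (1 : int) != 0); have f2_neq0 := Gfun_neq0 fG (isT : (2 : int) != 0).
split=> //; first by case: fG.
  by clear - f12 f11 f1_neq0; lia.
by clear - f21 f22 f2_neq0; lia.
Qed.

Variables (R : comNzRingType) (a eA eD : R).

Notation braid2_at := (braid2_at n a eA eD).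
Notation braid4_at := (braid4_at n a eA eD).

Lemma braid4_at_desEq f : Gfun f -> `|f 1| = 2 -> 0 < f 1 -> braid4_at (-1) 1 1 2 f.
Proof.
move=> fG f1 pos; have [fN _ _ _ _] := fG; have [f_neq1 _] := Gfun_fpf12 fG.
have root : is_root n (-1) 1 by exists TBC; exact: simple_root_B.
have s_f : fun_kind (-1) 1 f = AscLtK by rewrite fun_kind_B // pos.
apply: (braid4_at_short_chain hn a root (e := eD) fG _ s_f); first by rewrite /fun_kind value_kind_desEq.
by rewrite /fun_kind value_kind_desEq // conj_fun_r -[-1]/(- (1 : int)) fN normrN.
Qed.

Lemma braid4_at_increasing f : pair_values f (f 1) (f 2) -> 0 < f 1 -> f 1 < f 2 -> braid4_at (-1) 1 1 2 f.
Proof.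
move=> f_values pos lt; move: (f 1) (f 2) f_values pos lt => x y f_values x0 lt.
have y0 := lt_trans x0 lt.
have s_values := pair_values_conj_B f_values; have ts_values := pair_values_conj_12 s_values.
have sts_values := pair_values_conj_B ts_values.
have t_values := pair_values_conj_12 f_values; have st_values := pair_values_conj_B t_values.
have tst_values := pair_values_conj_12 st_values.
have s_f := pair_values_ascLt_B f_values x0; have s_tsf := pair_values_ascLt_B ts_values y0.
have t_sf : fun_kind 1 2 (conj_fun (-1) 1 f) = AscLtK.
  by apply: (pair_values_ascLt_12 s_values); rewrite /outer_consecutive; clear - x0 y0 lt; lia.
case: (boolP (outer_consecutive x y)) => [out|not_out].
  apply: (braid4_at_long_chain a (e := eA)) => //; first by rewrite (pair_values_ascEq_12 f_values out).
  rewrite (pair_values_ascEq_12 sts_values) //; move: out; rewrite /outer_consecutive !normrN.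
  by clear; lia.
have t_f := pair_values_ascLt_12 f_values lt not_out; have s_tf := pair_values_ascLt_B t_values y0.
have t_stf : fun_kind 1 2 (conj_fun (-1) 1 (conj_fun 1 2 f)) = AscLtK.
  by apply: (pair_values_ascLt_12 st_values); rewrite /outer_consecutive; clear - x0 y0 lt; lia.
have t_stsf : fun_kind 1 2 (conj_fun (-1) 1 (conj_fun 1 2 (conj_fun (-1) 1 f))) = AscLtK.
  apply: (pair_values_ascLt_12 sts_values); first by rewrite ltrN2.
  by move: not_out; rewrite /outer_consecutive !normrN; clear; lia.
have s_tstf := pair_values_ascLt_B tst_values x0.
apply: (braid4_at_octagon a eA eD s_f t_f t_sf s_tf s_tsf t_stf t_stsf s_tstf).
have braid := @stransp_braid4 1 2 _ (conj isT isT) isT.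
by apply/funext => z; rewrite /conj_fun -braid braid.
Qed.

Lemma braid4_at_minimal f : Gfun f -> fun_kind (-1) 1 f <> DesLtK -> fun_kind 1 2 f <> DesLtK ->
  braid4_at (-1) 1 1 2 f.
Proof.
move=> fG; have [fN _ _ _ _] := fG; have [f_neq1 _] := Gfun_fpf12 fG; rewrite (fun_kind_B fN f_neq1).
case: ltrP => pos nD; last by case: nD.
move=> /fun_kind_increasing[f1|[f1 lt]]; first exact: braid4_at_desEq.
exact: braid4_at_increasing (Gfun_pair_values fG f1) pos lt.
Qed.

Definition signed_pair_inversions f : nat :=
  ((f 1 < 0)%R + (f 2 < 0)%R + (f 2 < f 1)%R + (f 1 + f 2 < 0)%R)%N.

Lemma signed_pair_inversions_conj_B f : Gfun f -> fun_kind (-1) 1 f = DesLtK ->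
  (signed_pair_inversions (conj_fun (-1) 1 f) < signed_pair_inversions f)%N.
Proof.
move=> fG; have [fN fK _ _ _] := fG; have [f_neq1 _] := Gfun_fpf12 fG; rewrite fun_kind_B //.
have f10 := Gfun_neq0 fG (isT : (1 : int) != 0); case: ltrP => // neg _.
case: (`|f 1| =P 2) => [f1|/eqP f1].
  have f1E : f 1 = - 2 by clear - f1 neg; lia.
  have f2E : f 2 = -1 by rewrite -[2]opprK -f1E fN fK.
  have sf1 : conj_fun (-1) 1 f 1 = 2 by rewrite conj_fun_r -[-1]/(- (1 : int)) fN f1E.
  have sf2 : conj_fun (-1) 1 f 2 = 1 by rewrite conj_fun_other // f2E stransp_l.
  by rewrite /signed_pair_inversions sf1 sf2 f1E f2E.
have f_values := Gfun_pair_values fG f1; have [_ _ _ sf1 sf2] := pair_values_conj_B f_values.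
case: f_values => _ x2 y2 _ _; rewrite /signed_pair_inversions sf1 sf2; move: neg f10 x2 y2; clear.
by move: (f 1) (f 2) => x y; lia.
Qed.

Lemma signed_pair_inversions_conj_12 f : Gfun f -> fun_kind 1 2 f = DesLtK ->
  (signed_pair_inversions (conj_fun 1 2 f) < signed_pair_inversions f)%N.
Proof.
move=> fG t_f; have := fun_kindP n 1 2 f; rewrite t_f => -[f1 le_f _].
have [_ _ _ tf1 tf2] := pair_values_conj_12 (Gfun_pair_values fG f1).
have f_neq : f 1 <> f 2 by move=> /(Gfun_inj fG).
rewrite /signed_pair_inversions tf1 tf2; move: le_f f_neq; clear.
by move: (f 1) (f 2) => x y; lia.
Qed.

Lemma braid4_B (eA_quad : eA * eA = 1 + a * eA) (eD_quad : eD * eD = 1 + a * eD) f :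
  Gfun f -> braid4_at (-1) 1 1 2 f.
Proof.
apply: (braid4_at_ind hn eA_quad eD_quad _ _ signed_pair_inversions_conj_B signed_pair_inversions_conj_12).
- by exists TBC; exact: simple_root_B.
- by exists TA; exact: simple_root_12.
exact: braid4_at_minimal.
Qed.

Lemma braid2_D f : Gfun f -> braid2_at (-1) 2 1 2 f.
Proof.
move=> fG; have [fN _ _ _ _] := fG; case: (`|f 1| =P 2) => [f1|/eqP f1].
  have s_f : fun_kind (-1) 2 f = DesEqK by rewrite /fun_kind value_kind_desEq // -[-1]/(- (1 : int)) fN normrN.
  have t_f : fun_kind 1 2 f = DesEqK by rewrite /fun_kind value_kind_desEq.
  by move=> F; rewrite /root_op s_f t_f.
have f_values := Gfun_pair_values fG f1; have [_ x2 y2 _ _] := f_values.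
have [_ x_neq2] := norm_gt2_neq x2; have [_ y_neq2] := norm_gt2_neq y2.
have s_values := pair_values_conj_D f_values; have t_values := pair_values_conj_12 f_values.
apply: braid2_at_commute.
- rewrite (pair_values_kind_D t_values) (pair_values_kind_D f_values).
  by rewrite -[X in value_kind n 2 _ X = _]opprK value_kind_opp // normrN.
- by rewrite (pair_values_kind_12 s_values) (pair_values_kind_12 f_values) value_kind_opp.
by apply/funext => x; rewrite /conj_fun !(@stransp_comm_opp 1 2 _ (conj isT isT) isT).
Qed.

End SignedPairBraid.

Section DisjointRoots.
Variables (n : nat).
Hypothesis hn : (2 <= n)%N.
Implicit Types (p q x y : int) (f : int -> int).

Notation fun_kind := (fun_kind n).
Notation value_kind := (value_kind n).
Notation Gfun := (Gfun n).
Notation outer_consecutive := (outer_consecutive n).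

Definition disjoint_roots (p q p' q' : int) : Prop :=
  [/\ `|p| != `|p'|, `|p| != `|q'|, `|q| != `|p'| & `|q| != `|q'|].

Lemma disjoint_roots_sym p q p' q' : disjoint_roots p q p' q' -> disjoint_roots p' q' p q.
Proof. by move=> [pp' pq' qp' qq']; split; rewrite eq_sym. Qed.

Definition aligned (p q p' q' : int) f : Prop := maps_root f p q p' q' \/ maps_root f p q q' p'.

Section DisjointPair.
Variables (t : CoxType) (p q p' q' : int).
Hypotheses (root : simple_root t n p q) (root' : simple_root t n p' q') (disj : disjoint_roots p q p' q').

Lemma stransp_comm_disjoint x : stransp p q (stransp p' q' x) = stransp p' q' (stransp p q x).
Proof. by case: disj => *; apply: stransp_comm => //; exact: (simple_root_neq0 (t := t) (r := n)). Qed.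

Lemma maps_root_fun_kind f : maps_root f p q p' q' -> fun_kind p q f = AscLtK.
Proof.
have [pp' pq' qp' qq'] := disj; have [pn' qn'] := simple_root_le hn root'; have lt' := simple_root_lt root'.
rewrite /fun_kind => -[[-> ->]|[-> ->]]; apply: value_kind_ascLt; rewrite ?ltrN2 ?normrN 1?eq_sym //.
  by rewrite /outer_consecutive [_ < `|p'|]ltNge pn' andbF.
by rewrite /outer_consecutive !normrN [_ < `|q'|]ltNge qn' andbF.
Qed.

Lemma maps_root_opp_fun_kind f : maps_root f p q q' p' -> fun_kind p q f = DesLtK.
Proof.
have [pp' pq' qp' qq'] := disj; have lt' := simple_root_lt root'.
by rewrite /fun_kind => -[[-> ->]|[-> ->]]; apply: value_kind_desLt; rewrite ?ltrN2 ?normrN 1?eq_sym.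
Qed.

End DisjointPair.

Lemma aligned_sym p q p' q' f : Gfun f -> aligned p q p' q' f -> aligned p' q' p q f.
Proof.
move=> [fN fK _ _ _] [] /(maps_root_sym fK fN); first by left.
by move=> f_maps; right; case: f_maps => -[? ?]; [left | right].
Qed.

Section AlignedPair.
Variables (t : CoxType) (p q p' q' : int).
Hypotheses (root : simple_root t n p q) (root' : simple_root t n p' q') (disj : disjoint_roots p q p' q').
Variable f : int -> int.
Hypotheses (fG : Gfun f) (f_aligned : aligned p q p' q' f).

Lemma aligned_fun_kind : fun_kind p q f = fun_kind p' q' f.
Proof.
have [fN fK _ _ _] := fG; have disj' := disjoint_roots_sym disj.
case: f_aligned => f_maps.
  by rewrite (maps_root_fun_kind root' disj f_maps) (maps_root_fun_kind root disj' (maps_root_sym fK fN f_maps)).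
rewrite (maps_root_opp_fun_kind root' disj f_maps) (maps_root_opp_fun_kind root disj') //.
by case: (maps_root_sym fK fN f_maps) => -[? ?]; [left | right].
Qed.

Lemma aligned_conj_fun : conj_fun p q f = conj_fun p' q' f.
Proof.
have [fN fK _ _ _] := fG; have [p0' q0'] := simple_root_neq0 root'.
have f_conj x : f (stransp p q x) = stransp p' q' (f x).
  case: f_aligned => f_maps; first exact: (stransp_conj (Gfun_inj fG) fN _ f_maps).
  by rewrite [RHS]stranspC; exact: (stransp_conj (Gfun_inj fG) fN _ f_maps).
have f_conj' x : f (stransp p' q' x) = stransp p q (f x) by apply: (Gfun_inj fG); rewrite fK f_conj fK.
by apply/funext => x; rewrite /conj_fun f_conj f_conj' (stransp_comm_disjoint root root' disj).
Qed.

Lemma conj_fun_aligned : aligned p q p' q' (conj_fun p q f).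
Proof.
have [pp' pq' qp' qq'] := disj.
have [sf_p sf_q] : conj_fun p q f p = f q /\ conj_fun p q f q = f p.
  by split; [apply: conj_fun_l | apply: conj_fun_r]; case: f_aligned => -[] [fp fq];
    rewrite ?fp ?fq ?normrN eq_sym.
rewrite /aligned /maps_root sf_p sf_q.
by case: f_aligned => -[] [-> ->]; tauto.
Qed.

Lemma Gfun_conj_aligned : Gfun (conj_fun p q f).
Proof.
have [pn' qn'] := simple_root_le hn root'; apply: (Gfun_conj hn fG root).
apply/negP => /and3P[_ fp_out _]; suff : `|f p| <= n%:Z by rewrite leNgt fp_out.
by case: f_aligned => -[] [-> _]; rewrite ?normrN.
Qed.

End AlignedPair.

Section UnalignedPair.
Variables (t : CoxType) (p q p' q' : int).
Hypotheses (root : simple_root t n p q) (root' : simple_root t n p' q') (disj : disjoint_roots p q p' q').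

Lemma stransp_homo x y : x != 0 -> y != 0 -> x < y -> (x = - y -> p = - q) ->
  ~ (x = p' /\ y = q') -> ~ (x = - q' /\ y = - p') -> stransp p' q' x < stransp p' q' y.
Proof.
move=> x0 y0 lt xN not_root not_opp; rewrite ltNge; apply/negP => le.
case: (eqVneq x (- y)) => xyE; last by case: (stransp_reversal root' x0 y0 lt xyE le).
have pE := xN xyE.
case: (stransp_reversal_opp root' lt xyE le) => [//|[pE' qE']].
have := simple_rootP root; have := simple_rootP root'; rewrite pE' qE' pE => rootP' rootP.
case: rootP => [[? ? ?]|[[tE _ _]|[_ ? ?]]]; [by lia | | by lia].
by case: rootP' => [[//]|[[_ _ //]|[tE' _ _]]]; rewrite tE' in tE.
Qed.

Lemma outer_consecutive_stransp x y :
  outer_consecutive (stransp p' q' x) (stransp p' q' y) = outer_consecutive x y.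
Proof.
have [pn' qn'] := simple_root_le hn root'.
have norm_gt z : (n%:Z < `|stransp p' q' z|) = (n%:Z < `|z|) by clear - pn' qn'; stransp_cases.
have out_id z : n%:Z < `|z| -> stransp p' q' z = z by move=> z_out; apply: stransp_id; lia.
rewrite /outer_consecutive !norm_gt; case: (boolP (n%:Z < `|x|)) => x_out; last by rewrite !andbF.
by case: (boolP (n%:Z < `|y|)) => y_out; rewrite ?andbF // !out_id.
Qed.

Lemma fun_kind_conj_disjoint f : Gfun f -> ~ aligned p q p' q' f -> fun_kind p q (conj_fun p' q' f) = fun_kind p q f.
Proof.
move=> fG not_aligned; have [fN _ _ _ _] := fG; have [pp' pq' qp' qq'] := disj.
have [p0 q0] := simple_root_neq0 root; have pq := simple_root_lt root.
have fp0 := Gfun_neq0 fG p0; have fq0 := Gfun_neq0 fG q0.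
have f_neq : f p <> f q by move=> /(Gfun_inj fG); clear - pq; lia.
have fpN : f p = - f q -> p = - q by rewrite -fN => /(Gfun_inj fG).
have norm_q x : (`|stransp p' q' x| == `|q|) = (`|x| == `|q|).
  by rewrite /stransp; clear - qp' qq'; do 4?[case: ifPn => ?]; lia.
rewrite /fun_kind !conj_fun_other // /value_kind norm_q outer_consecutive_stransp.
suff -> : (stransp p' q' (f p) < stransp p' q' (f q)) = (f p < f q) by [].
case: (ltrP (f p) (f q)) => [lt|le].
  by apply: stransp_homo => // f_maps; apply: not_aligned; left; [left | right].
apply/negbTE; rewrite -leNgt; apply/ltW/stransp_homo => //.
- by clear - le f_neq; lia.
- by move=> fqN; apply: fpN; rewrite fqN opprK.
- by move=> [fq fp]; apply: not_aligned; right; left.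
by move=> [fq fp]; apply: not_aligned; right; right.
Qed.

End UnalignedPair.

Lemma braid2_disjoint (R : comNzRingType) (a eA eD : R) t p q p' q' f :
  simple_root t n p q -> simple_root t n p' q' -> disjoint_roots p q p' q' ->
  Gfun f -> braid2_at n a eA eD p q p' q' f.
Proof.
move=> root root' disj fG; case: (pselect (aligned p q p' q' f)) => [f_aligned|not_aligned].
  have cfG := Gfun_conj_aligned root root' fG f_aligned.
  have cf_aligned := conj_fun_aligned disj f_aligned.
  have kinds := aligned_fun_kind root root' disj fG f_aligned.
  have ends := aligned_conj_fun root root' disj fG f_aligned.
  have kinds_conj := aligned_fun_kind root root' disj cfG cf_aligned.
  exact: braid2_at_coincide kinds ends kinds_conj (aligned_conj_fun root root' disj cfG cf_aligned).
apply: braid2_at_commute; first exact: (fun_kind_conj_disjoint root root' disj fG).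
  apply: (fun_kind_conj_disjoint root' root (disjoint_roots_sym disj) fG).
  by move=> /(aligned_sym fG).
by apply/funext => x; rewrite /conj_fun !(stransp_comm_disjoint root root' disj).
Qed.

End DisjointRoots.

(** * Matsumoto's argument *)

Section Matsumoto.
Variables (t : CoxType) (n : nat).
Hypothesis hn : (2 <= n)%N.
Let hnN : (2 <= n <= n.*2)%N. Proof. lia. Qed.
Implicit Types (s w u : P n) (p q x : int).

Notation S := (Sgen t n).
Notation W := (WW t n).
Notation len := (lenW t n).
Notation left_ascent := (left_ascent t n).

Lemma WWE : W = <<[set:: S]>>%g.
Proof. exact: WgrpE. Qed.

Lemma WW1 : (1%g : P n) \in W. Proof. by rewrite WWE group1. Qed.

Lemma gen_WW s : s \in S -> s \in W.
Proof. by rewrite WWE => sS; rewrite mem_gen // inE. Qed.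

Lemma WW_permc u w : u \in W -> w \in W -> permc u w \in W.
Proof. by rewrite WWE => uW wW; rewrite /permc groupM. Qed.

Lemma WW_mul_gen s w : s \in S -> w \in W -> permc s w \in W.
Proof. by move=> /gen_WW; exact: WW_permc. Qed.

Lemma WW_inv u : u \in W -> u^-1%g \in W.
Proof. by rewrite WWE => uW; rewrite groupV. Qed.

Lemma WW_permcE u w : u \in W -> (permc u w \in W) = (w \in W).
Proof.
move=> uW; apply/idP/idP => [uwW|]; last exact: WW_permc.
by have := WW_permc (WW_inv uW) uwW; rewrite /permc mulgK.
Qed.

Lemma gen_mulK s w : s \in S -> permc s (permc s w) = w.
Proof. by move=> sS; rewrite /permc -mulgA (gens_invol hnN sS) mulg1. Qed.

Lemma left_ascent_gen s w : s \in S -> w \in W -> left_ascent s w -> ~~ left_ascent s (permc s w).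
Proof. by rewrite WWE => sS wW; exact: left_ascent_mul. Qed.

Lemma left_descentE s w p q : simple_root t n p q -> apZ s =1 stransp p q ->
  ~~ left_ascent s w = (apZ w^-1%g q < apZ w^-1%g p).
Proof.
move=> root sE; rewrite (left_ascentE _ root sE) -leNgt lt_neqAle; case: eqP => // /(@apZ_inj _ w^-1%g) qp.
by have := simple_root_lt root; rewrite qp ltxx.
Qed.

Lemma left_descent_gen s w : s \in S -> w \in W -> ~~ left_ascent s w -> left_ascent s (permc s w).
Proof.
move=> sS wW; have [p [q [root sE]]] := gen_simple_root hnN sS.
by rewrite (left_descentE _ root sE) (left_ascentE _ root sE) !(apZV_mul_gen hnN _ _ sS sE) stransp_l stransp_r.
Qed.

Lemma left_descent_neq1 s w : s \in S -> ~~ left_ascent s w -> w != 1%g.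
Proof. by move=> sS; apply: contraNneq => ->; exact: (left_ascent1 hnN). Qed.

Lemma lenW_ascent s w : s \in S -> w \in W -> (len w < len (permc s w))%N = left_ascent s w.
Proof. by rewrite WWE => sS wW; exact: wordlen_gen_lt. Qed.

Lemma lenW_descent s w : s \in S -> w \in W -> ~~ left_ascent s w -> len w = (len (permc s w)).+1.
Proof. by rewrite WWE => sS wW; exact: wordlen_gen_descent. Qed.

Lemma WW_left_descent w : w \in W -> w != 1%g -> exists2 s, s \in S & ~~ left_ascent s w.
Proof. by rewrite WWE; exact: exists_left_descent. Qed.

Lemma WW_ind (Q : P n -> Prop) : Q 1%g ->
  (forall s w, s \in S -> w \in W -> ~~ left_ascent s w -> Q (permc s w) -> Q w) ->
  forall w, w \in W -> Q w.
Proof.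
move=> Q1 QS w; have [m] := ubnP (len w); elim: m w => // m IH w len_lt wW.
case: (eqVneq w 1%g) => [->//|w1]; have [s sS desc] := WW_left_descent wW w1.
apply: (QS s) => //; apply: IH; last exact: WW_mul_gen.
by move: len_lt; rewrite (lenW_descent sS wW desc).
Qed.

Definition commuting_roots p q p' q' : Prop :=
  disjoint_roots p q p' q' \/ [/\ p = -1, q = 2, p' = 1 & q' = 2].
Definition braid3_roots p q p' q' : Prop := p' = q /\ root_triple n p q q'.
Definition braid4_roots p q p' q' : Prop := [/\ p = -1, q = 1, p' = 1 & q' = 2].

Lemma simple_roots_classify_lt p q p' q' : simple_root t n p q -> simple_root t n p' q' -> p < p' ->
  commuting_roots p q p' q' \/ commuting_roots p' q' p q \/ braid3_roots p q p' q' \/ braid4_roots p q p' q'.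
Proof.
rewrite /commuting_roots /disjoint_roots /braid3_roots /braid4_roots /root_triple.
move=> /simple_rootP root /simple_rootP root' lt.
case: root' => [[? ? ?]|[[? ? ?]|[? ? ?]]]; case: root => [[? ? ?]|[[? ? ?]|[? ? ?]]]; try (by exfalso; lia).
- case: (eqVneq p' (p + 1)) => ?; last by left; left; split; lia.
  by right; right; left; split; [lia | left; split; lia].
- case: (eqVneq p' 1) => ?; last by left; left; split; lia.
  by right; right; right; split; lia.
case: (eqVneq p' 1) => ?; first by left; right; split; lia.
case: (eqVneq p' 2) => ?; last by left; left; split; lia.
by right; right; left; split; [lia | right; split; lia].
Qed.

Lemma simple_root_eq p q p' q' : simple_root t n p q -> simple_root t n p' q' -> p = p' -> q = q'.
Proof.
move=> /simple_rootP root /simple_rootP root'.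
case: root => [[? ? ?]|[[tE ? ?]|[tE ? ?]]]; case: root' => [[? ? ?]|[[tE' ? ?]|[tE' ? ?]]]; try lia.
- by rewrite tE in tE'.
- by rewrite tE in tE'.
Qed.

Lemma simple_roots_classify p q p' q' : simple_root t n p q -> simple_root t n p' q' -> p <> p' ->
  [\/ commuting_roots p q p' q' \/ commuting_roots p' q' p q, braid3_roots p q p' q' \/ braid3_roots p' q' p q |
      braid4_roots p q p' q' \/ braid4_roots p' q' p q].
Proof.
move=> root root' pp'; case: (ltgtP p p') => lt //.
  by case: (simple_roots_classify_lt root root' lt) => [|[|[|]]] roots; [apply: Or31 | apply: Or31 | apply: Or32 | apply: Or33]; auto.
by case: (simple_roots_classify_lt root' root lt) => [|[|[|]]] roots; [apply: Or31 | apply: Or31 | apply: Or32 | apply: Or33]; auto.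
Qed.

Variables (F : fieldType) (c : F) (V : lmodType F) (op : P n -> V -> V).
Hypothesis op_linear : forall s, s \in S -> forall (a : F) (u v : V), op s (a *: u + v) = a *: op s u + op s v.
Hypothesis op_quad : forall s, s \in S -> forall v, op s (op s v) = v + c *: op s v.
Hypothesis op_braid : forall s s' p q p' q', s \in S -> s' \in S ->
  simple_root t n p q -> simple_root t n p' q' -> apZ s =1 stransp p q -> apZ s' =1 stransp p' q' ->
  [/\ commuting_roots p q p' q' -> forall v, op s (op s' v) = op s' (op s v),
      braid3_roots p q p' q' -> forall v, op s (op s' (op s v)) = op s' (op s (op s' v)) &
      braid4_roots p q p' q' -> forall v, op s (op s' (op s (op s' v))) = op s' (op s (op s' (op s v)))].

Definition left_descent_of w : P n := head 1%g [seq s <- S | ~~ left_ascent s w].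

Lemma left_descent_ofP w : w \in W -> w != 1%g ->
  left_descent_of w \in S /\ ~~ left_ascent (left_descent_of w) w.
Proof.
move=> wW w1; have [s sS desc] := WW_left_descent wW w1; rewrite /left_descent_of.
have : s \in [seq s <- S | ~~ left_ascent s w] by rewrite mem_filter desc.
case descents : [seq s <- S | ~~ left_ascent s w] => [|x l] //= _.
have : x \in [seq s <- S | ~~ left_ascent s w] by rewrite descents mem_head.
by rewrite mem_filter => /andP[].
Qed.

Fixpoint descent_word_op (k : nat) w (v : V) : V :=
  if k is k'.+1 then op (left_descent_of w) (descent_word_op k' (permc (left_descent_of w) w) v) else v.

Definition hecke_action w v := descent_word_op (len w) w v.

Lemma hecke_action1 v : hecke_action 1%g v = v.
Proof. by rewrite /hecke_action /lenW wordlen1. Qed.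

Lemma hecke_action_descent_of w v : w \in W -> w != 1%g ->
  hecke_action w v = op (left_descent_of w) (hecke_action (permc (left_descent_of w) w) v).
Proof.
move=> wW w1; have [dS desc] := left_descent_ofP wW w1.
by rewrite {1}/hecke_action (lenW_descent dS wW desc).
Qed.

Section Dihedral.
Variables (w s d : P n) (v : V) (p q p' q' : int).
Hypotheses (wW : w \in W) (sS : s \in S) (dS : d \in S).
Hypotheses (root : simple_root t n p q) (root' : simple_root t n p' q').
Hypotheses (sE : apZ s =1 stransp p q) (dE : apZ d =1 stransp p' q').
Hypotheses (s_desc : ~~ left_ascent s w) (d_desc : ~~ left_ascent d w).
Hypothesis action_shorter : forall u e, (len u < len w)%N -> u \in W -> e \in S -> ~~ left_ascent e u ->
  hecke_action u v = op e (hecke_action (permc e u) v).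

Fixpoint left_descents (l : seq (P n)) u : bool :=
  if l is e :: l' then ~~ left_ascent e u && left_descents l' (permc e u) else true.

Lemma hecke_action_left_descents l u : {subset l <= S} -> u \in W -> (len u < len w)%N -> left_descents l u ->
  hecke_action u v = foldr op (hecke_action (foldl (fun u e => permc e u) u l) v) l.
Proof.
elim: l u => //= e l IH u lS uW u_lt /andP[desc descs]; have eS := lS e (mem_head e l).
have len_u := lenW_descent eS uW desc.
rewrite (action_shorter u_lt uW eS desc) (IH (permc e u)) ?WW_mul_gen //.
  by move=> x xl; apply: lS; rewrite inE xl orbT.
by apply: leq_trans u_lt; rewrite len_u.
Qed.

(* Both factorisations of [w] start with a reduced word of the longest element of the
   dihedral group generated by [s] and [d]. *)
Lemma hecke_action_compare l l' : {subset l <= S} -> {subset l' <= S} ->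
  left_descents (s :: l) w -> left_descents (d :: l') w ->
  foldl (fun u e => permc e u) w (s :: l) = foldl (fun u e => permc e u) w (d :: l') ->
  (forall u : V, foldr op u (s :: l) = foldr op u (d :: l')) ->
  op s (hecke_action (permc s w) v) = op d (hecke_action (permc d w) v).
Proof.
move=> /= lS lS' /andP[_ descs] /andP[_ descs'] same_element braid.
have shorter e : e \in S -> ~~ left_ascent e w -> (len (permc e w) < len w)%N.
  by move=> eS desc; rewrite (lenW_descent eS wW desc).
rewrite (hecke_action_left_descents lS (WW_mul_gen sS wW) (shorter s sS s_desc) descs).
rewrite (hecke_action_left_descents lS' (WW_mul_gen dS wW) (shorter d dS d_desc) descs').
by rewrite same_element braid.
Qed.

Let w_inv x := apZ w^-1%g x.

Let w_invN x : w_inv (- x) = - w_inv x.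
Proof.
by move: x; apply/isBCP; apply: isBCV; move: wW; rewrite WWE; exact: gen_isBC.
Qed.

Let w_inv_s : w_inv q < w_inv p. Proof. by rewrite -(left_descentE _ root sE). Qed.
Let w_inv_d : w_inv q' < w_inv p'. Proof. by rewrite -(left_descentE _ root' dE). Qed.

Let descentE := (fun u => left_descentE u root sE, fun u => left_descentE u root' dE,
  fun u x => @apZV_mul_gen _ _ _ hnN u s p q x sS sE, fun u x => @apZV_mul_gen _ _ _ hnN u d p' q' x dS dE).

Lemma hecke_action_commuting : commuting_roots p q p' q' ->
  op s (hecke_action (permc s w) v) = op d (hecke_action (permc d w) v).
Proof.
move=> roots; have [commute _ _] := op_braid sS dS root root' sE dE.
have [comm desc_d desc_s] : [/\ forall x, stransp p q (stransp p' q' x) = stransp p' q' (stransp p q x),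
    w_inv (stransp p q q') < w_inv (stransp p q p') & w_inv (stransp p' q' q) < w_inv (stransp p' q' p)].
  case: roots => [disj|[pE qE pE' qE']].
    have [pp' pq' qp' qq'] := disj; split; first exact: (stransp_comm_disjoint root root' disj).
      by rewrite !stransp_id // eq_sym.
    by rewrite !stransp_id.
  move: w_inv_s w_inv_d; rewrite pE qE pE' qE' => lt_s lt_d; split.
  - by move=> x; exact: (@stransp_comm_opp 1 2).
  - by rewrite stransp_r -[stransp _ _ 1]/(- (2 : int)) -[-1]/(- (1 : int)) !w_invN ltrN2.
  by rewrite stransp_r -[stransp _ _ _]/(- (2 : int)) w_invN; move: lt_s; rewrite -[-1]/(- (1 : int)) w_invN ltrNr.
apply: (@hecke_action_compare [:: d] [:: s]) => /=; rewrite ?s_desc ?d_desc ?andbT ?descentE //.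
- by move=> x; rewrite inE => /eqP->.
- by move=> x; rewrite inE => /eqP->.
- by apply: eq_apZ => x; rewrite !apZ_permc !(sE, dE) comm.
exact: commute.
Qed.

Lemma hecke_action_braid3 : braid3_roots p q p' q' ->
  op s (hecke_action (permc s w) v) = op d (hecke_action (permc d w) v).
Proof.
move=> roots; have [_ braid _] := op_braid sS dS root root' sE dE.
case: (roots) => pE' triple; have norm_neq := root_triple_norm_neq triple; have neq0 := root_triple_neq0 triple.
have [pq pr qr] := norm_neq; have s_q' : stransp p q q' = q' by rewrite stransp_id // eq_sym.
have d_p : stransp q q' p = p by rewrite stransp_id.
have lt_q'p : w_inv q' < w_inv p by apply: lt_trans w_inv_d _; rewrite pE'.
apply: (@hecke_action_compare [:: d; s] [:: s; d]) => /=; rewrite ?s_desc ?d_desc ?andbT ?descentE //.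
- by move=> x; rewrite !inE => /orP[] /eqP->.
- by move=> x; rewrite !inE => /orP[] /eqP->.
- rewrite !(pE', s_q', d_p, stransp_l, stransp_r) /=; apply/andP; split; first exact: lt_q'p.
  by rewrite -pE'; exact: w_inv_d.
- rewrite !(pE', s_q', d_p, stransp_l, stransp_r) /=; apply/andP; split; first exact: lt_q'p.
  exact: w_inv_s.
- by apply: eq_apZ => x; rewrite !apZ_permc !(sE, dE) pE' (stransp_braid3 _ neq0 norm_neq).
exact: braid.
Qed.

Lemma hecke_action_braid4 : braid4_roots p q p' q' ->
  op s (hecke_action (permc s w) v) = op d (hecke_action (permc d w) v).
Proof.
move=> roots; have [_ _ braid] := op_braid sS dS root root' sE dE; have [pE qE pE' qE'] := roots.
have lt1 : w_inv 1 < 0 by move: w_inv_s; rewrite pE qE -[-1]/(- (1 : int)) w_invN; move: (w_inv 1) => x; lia.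
have lt2 : w_inv 2 < w_inv 1 by move: w_inv_d; rewrite pE' qE'.
apply: (@hecke_action_compare [:: d; s; d] [:: s; d; s]) => /=; rewrite ?s_desc ?d_desc ?andbT ?descentE //.
- by move=> x; rewrite !inE => /or3P[] /eqP->.
- by move=> x; rewrite !inE => /or3P[] /eqP->.
- rewrite pE qE pE' qE'; suff : [&& w_inv 2 < w_inv (- (1 : int)), w_inv 2 < w_inv (- (2 : int)) & w_inv (- (1 : int)) < w_inv (- (2 : int))] by [].
  by rewrite !w_invN; move: lt1 lt2; move: (w_inv 1) (w_inv 2) => x y; lia.
- rewrite pE qE pE' qE'; suff : [&& w_inv 2 < w_inv (- (2 : int)), w_inv 1 < w_inv (- (2 : int)) & w_inv 1 < w_inv (- (1 : int))] by [].
  by rewrite !w_invN; move: lt1 lt2; move: (w_inv 1) (w_inv 2) => x y; lia.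
- by apply: eq_apZ => x; rewrite !apZ_permc !(sE, dE) pE qE pE' qE' (@stransp_braid4 1 2).
exact: braid.
Qed.
End Dihedral.

Lemma hecke_action_left_descent w s v : w \in W -> s \in S -> ~~ left_ascent s w ->
  hecke_action w v = op s (hecke_action (permc s w) v).
Proof.
have [m] := ubnP (len w); elim: m w s v => // m IH w s v len_lt wW sS s_desc.
have w1 := left_descent_neq1 sS s_desc; have [dS d_desc] := left_descent_ofP wW w1.
rewrite hecke_action_descent_of //; move: (left_descent_of w) dS d_desc => d dS d_desc.
have shorter u e : (len u < len w)%N -> u \in W -> e \in S -> ~~ left_ascent e u ->
    hecke_action u v = op e (hecke_action (permc e u) v).
  by move=> lt; apply: IH; exact: leq_trans lt len_lt.
have [p [q [root sE]]] := gen_simple_root hnN sS; have [p' [q' [root' dE]]] := gen_simple_root hnN dS.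
case: (p =P p') => [pp'|pp'].
  by have -> : s = d by apply: eq_apZ => x; rewrite sE dE -pp' -(simple_root_eq root root' pp').
case: (simple_roots_classify root root' pp') => -[roots|roots].
- exact/esym/(hecke_action_commuting wW sS dS root root' sE dE s_desc d_desc shorter roots).
- exact: (hecke_action_commuting wW dS sS root' root dE sE d_desc s_desc shorter roots).
- exact/esym/(hecke_action_braid3 wW sS dS root root' sE dE s_desc d_desc shorter roots).
- exact: (hecke_action_braid3 wW dS sS root' root dE sE d_desc s_desc shorter roots).
- exact/esym/(hecke_action_braid4 wW sS dS root root' sE dE s_desc d_desc shorter roots).
- exact: (hecke_action_braid4 wW dS sS root' root dE sE d_desc s_desc shorter roots).
Qed.

Lemma hecke_action_left_ascent w s v : w \in W -> s \in S -> left_ascent s w ->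
  hecke_action (permc s w) v = op s (hecke_action w v).
Proof.
move=> wW sS asc; rewrite (@hecke_action_left_descent (permc s w) s v) ?WW_mul_gen ?gen_mulK //.
exact: left_ascent_gen.
Qed.

Lemma hecke_action_gen s v : s \in S -> hecke_action s v = op s v.
Proof.
move=> sS; have := @hecke_action_left_ascent 1%g s v WW1 sS (left_ascent1 hnN sS).
by rewrite /permc mul1g hecke_action1.
Qed.

Lemma hecke_action_heckeRep (x : F) : c = x - x^-1 -> heckeRep W S len x hecke_action.
Proof.
move=> cE; split; last split.
- move=> w wW a u v; move: w wW a u v; apply: WW_ind => [a u v|s w sS wW desc IH a u v].
    by rewrite !hecke_action1.
  by rewrite !(hecke_action_left_descent _ wW sS desc) IH op_linear.
- exact: hecke_action1.
move=> s w v sS wW; rewrite (hecke_action_gen _ sS) lenW_ascent //; case: ifPn => asc.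
  by rewrite hecke_action_left_ascent.
by rewrite (hecke_action_left_descent _ wW sS asc) op_quad // cE.
Qed.

Lemma hecke_action_closed (L : V -> Prop) : (forall s v, s \in S -> L v -> L (op s v)) ->
  forall w v, w \in W -> L v -> L (hecke_action w v).
Proof.
move=> L_op w v wW Lv; move: w wW; apply: WW_ind => [|s w sS wW desc IH]; first by rewrite hecke_action1.
by rewrite (hecke_action_left_descent _ wW sS desc); exact: L_op.
Qed.

End Matsumoto.

Lemma heckeRep_eq (t : CoxType) (n : nat) (hn : (2 <= n)%N) (F : fieldType) (x : F) (V : lmodType F)
    (rho1 rho2 : P n -> V -> V) :
  heckeRep (WW t n) (Sgen t n) (lenW t n) x rho1 ->
  heckeRep (WW t n) (Sgen t n) (lenW t n) x rho2 ->
  (forall s, s \in Sgen t n -> rho1 s =1 rho2 s) ->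
  forall w, w \in WW t n -> rho1 w =1 rho2 w.
Proof.
move=> [_ [rho1_id rho1_mul]] [_ [rho2_id rho2_mul]] rho_gen; apply: (WW_ind hn) => [v|s w sS wW desc IH v].
  by rewrite rho1_id rho2_id.
have asc := left_descent_gen hn sS wW desc; have swW := WW_mul_gen hn sS wW.
have := rho1_mul s (permc s w) v sS swW; have := rho2_mul s (permc s w) v sS swW.
by rewrite (lenW_ascent hn sS swW) asc (gen_mulK hn _ sS) => <- <-; rewrite rho_gen // IH.
Qed.

(** * The modules M and N *)

Lemma xK_neq0 : xK != 0.
Proof. by rewrite /xK tofrac_eq0 polyX_eq0. Qed.

Lemma laurent_poly (p : {poly int}) : isLaurent (FracField.tofrac p).
Proof. by exists 0%N, p; rewrite expr0 divr1. Qed.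

Lemma laurentD f g : isLaurent f -> isLaurent g -> isLaurent (f + g).
Proof.
move=> [k [p ->]] [l [r ->]]; exists (k + l)%N, (p * 'X^l + r * 'X^k).
rewrite addf_div ?expf_neq0 ?xK_neq0 // exprD.
by rewrite tofracD !tofracM !tofracXn.
Qed.

Lemma laurentM f g : isLaurent f -> isLaurent g -> isLaurent (f * g).
Proof.
move=> [k [p ->]] [l [r ->]]; exists (k + l)%N, (p * r).
by rewrite mulf_div tofracM exprD.
Qed.

Lemma laurentN f : isLaurent f -> isLaurent (- f).
Proof.
move=> f_laurent; rewrite -mulN1r; apply: laurentM => //.
by have := laurent_poly (-1); rewrite tofracN tofrac1.
Qed.

Lemma laurent_bool (b : bool) : isLaurent b%:R.
Proof. by have := laurent_poly b%:R; case: b; rewrite ?tofrac1 ?tofrac0. Qed.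

Lemma laurent_xK : isLaurent xK. Proof. exact: laurent_poly. Qed.

Lemma laurent_xKV : isLaurent xK^-1.
Proof. by exists 1%N, 1; rewrite tofrac1 mul1r expr1. Qed.

Lemma laurent_xK_subV : isLaurent (xK - xK^-1).
Proof. by apply: laurentD; [exact: laurent_xK | exact: laurentN laurent_xKV]. Qed.

Section GeneratorKinds.
Variables (t : CoxType) (n : nat).
Hypothesis hn : (2 <= n)%N.
Let hnN : (2 <= n <= n.*2)%N. Proof. lia. Qed.

Notation SG := (Sgen t n).
Notation cj s z := (permc s (permc z s)).
Implicit Types (s z : P n) (p q : int).

Definition gen_kind s z : step_kind :=
  if `[< DesEq n s z >] then DesEqK else if `[< AscEq n s z >] then AscEqK
  else if `[< AscLt t n s z >] then AscLtK else DesLtK.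

Lemma gen_kindE s z p q : s \in SG -> z \in Gset t n -> simple_root t n p q -> apZ s =1 stransp p q ->
  gen_kind s z = fun_kind n p q (apZ z).
Proof.
move=> sS zG r sE; rewrite /gen_kind /fun_kind /value_kind.
rewrite (propext (DesEqP hn zG r sE)) (propext (AscEqP hn zG r sE)).
rewrite (propext (AscLtP hn zG r sE sS)) !asboolb /is_desEq /is_ascEq.
case: ifP => // kd; case: ifP => // ka.
rewrite (_ : asbool _ = (apZ z p < apZ z q)) //.
apply/asboolP/idP => [[]|lt] //; split; [exact: lt | exact: negbT kd | exact: negbT ka].
Qed.

Lemma gen_kindP s z : s \in SG -> z \in Gset t n ->
  match gen_kind s z with
  | DesEqK => DesEq n s z
  | AscEqK => AscEq n s z
  | AscLtK => AscLt t n s z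
  | DesLtK => DesLt t n s z
  end.
Proof.
move=> sS zG; have [p [q [r sE]]] := gen_simple_root hnN sS.
rewrite /gen_kind; case: asboolP => // nD; case: asboolP => // nA; case: asboolP => // nU.
apply/(DesLtP hn zG r sE sS).
move: nD nA nU; rewrite (propext (DesEqP hn zG r sE)) (propext (AscEqP hn zG r sE)).
rewrite (propext (AscLtP hn zG r sE sS)) => /negP nD /negP nA nU.
split=> //; rewrite ltNge le_eqVlt negb_or; apply/andP; split.
  by apply/eqP => /(@apZ_inj _ z) e; have := simple_root_lt r; rewrite e ltxx.
by apply/negP => lt; apply: nU.
Qed.

Lemma gen_kind_desEq s z : DesEq n s z -> gen_kind s z = DesEqK.
Proof. by rewrite /gen_kind; case: asboolP. Qed.

Lemma gen_kind_ascEq s z : s \in SG -> z \in Gset t n -> AscEq n s z -> gen_kind s z = AscEqK.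
Proof.
move=> sS zG; have [p [q [r sE]]] := gen_simple_root hnN sS; rewrite (gen_kindE sS zG r sE).
move=> /(AscEqP hn zG r sE) ascEq; rewrite /fun_kind /value_kind -/(is_ascEq n p q (apZ z)) ascEq.
have [_ qn] := simple_root_le hn r; case: eqP => // zp; move: ascEq => /and3P[_]; rewrite zp.
by move=> /lt_geF; rewrite qn.
Qed.

Lemma gen_kind_ascLt s z : AscLt t n s z -> gen_kind s z = AscLtK.
Proof. by move=> asc; have [_ [nD nA]] := asc; rewrite /gen_kind (asboolF nD) (asboolF nA) (asboolT asc). Qed.

Lemma gen_kind_desLt s z : DesLt t n s z -> gen_kind s z = DesLtK.
Proof.
move=> [lt [nD nA]]; rewrite /gen_kind (asboolF nD) (asboolF nA) asboolF // => -[lt' _].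
by have := ltn_trans lt lt'; rewrite ltnn.
Qed.

Definition moves s z := gen_kind s z = AscLtK \/ gen_kind s z = DesLtK.

Lemma conj_in_Gset s z : s \in SG -> z \in Gset t n -> moves s z -> cj s z \in Gset t n.
Proof.
move=> sS zG k; have [p [q [r sE]]] := gen_simple_root hnN sS.
have := gen_kindP sS zG; case: k => ->.
  by move=> /(AscLtP hn zG r sE sS)[_ nD nA]; exact: (Gset_conj hn zG r sE).
by move=> /(DesLtP hn zG r sE sS)[_ nD nA]; exact: (Gset_conj hn zG r sE).
Qed.

Lemma conj_genK s z : s \in SG -> cj s (cj s z) = z.
Proof. by move=> sS; rewrite /permc -!mulgA (gens_invol hnN sS) mulg1 mulgA (gens_invol hnN sS) mul1g. Qed.

Lemma gen_kind_conj s z : s \in SG -> z \in Gset t n ->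
  (gen_kind s z = AscLtK -> gen_kind s (cj s z) = DesLtK) /\ (gen_kind s z = DesLtK -> gen_kind s (cj s z) = AscLtK).
Proof.
move=> sS zG; have [p [q [r sE]]] := gen_simple_root hnN sS.
have [asc_conj des_conj] := fun_kind_conj hn (Gset_Gfun hn zG) r; have kE := gen_kindE sS zG r sE.
split=> k; have cG : cj s z \in Gset t n by apply: conj_in_Gset => //; rewrite /moves k; [left + right].
  by rewrite (gen_kindE sS cG r sE) (apZ_conj _ sE) asc_conj // -kE.
by rewrite (gen_kindE sS cG r sE) (apZ_conj _ sE) des_conj // -kE.
Qed.

Section MatrixCoefficients.
Variables (eA eD : K).
Notation a := (xK - xK^-1).

(* The coefficient of [M_y] in [H_s M_z]. *)
Definition gen_coef s z y : K :=
  match gen_kind s z with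
  | DesEqK => eD * (y == z)%:R
  | AscEqK => eA * (y == z)%:R
  | AscLtK => (y == cj s z)%:R
  | DesLtK => (y == cj s z)%:R + a * (y == z)%:R
  end.

Lemma gen_coefC s z y : s \in SG -> z \in Gset t n -> y \in Gset t n -> gen_coef s z y = gen_coef s y z.
Proof.
move=> sS zG yG; case: (eqVneq y z) => [->//|yz]; have zy : (z == y) = false by rewrite eq_sym (negbTE yz).
have cj_sym : (y == cj s z) = (z == cj s y) by apply/eqP/eqP => ->; rewrite conj_genK.
rewrite /gen_coef zy (negbTE yz) cj_sym !mulr0.
have [yU yL] := gen_kind_conj sS yG; have [zU zL] := gen_kind_conj sS zG.
case: (eqVneq z (cj s y)) => [zE|_]; last by case: (gen_kind s z); case: (gen_kind s y); rewrite ?addr0.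
have yE : y = cj s z by rewrite zE conj_genK.
case kz : (gen_kind s z) zU zL => zU zL; case ky : (gen_kind s y) yU yL => yU yL; rewrite ?addr0 //;
  solve [ have := yU erefl; rewrite -zE kz // | have := yL erefl; rewrite -zE kz //
        | have := zU erefl; rewrite -yE ky // | have := zL erefl; rewrite -yE ky // ].
Qed.

Lemma laurent_gen_coef s z y : isLaurent eA -> isLaurent eD -> isLaurent (gen_coef s z y).
Proof.
move=> lA lD; rewrite /gen_coef; have lb := laurent_bool; have la := laurent_xK_subV.
by case: (gen_kind s z); [exact: laurentM | exact: laurentM | exact: lb | apply: laurentD => //; exact: laurentM].
Qed.

(* The common form of the rules for [M] and [N], which differ in the scalars [eA] and [eD]. *)
Definition eigen_rules (rho : P n -> Vmod t n -> Vmod t n) : Prop :=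
  forall s z, s \in SG -> z \in Gset t n ->
    (AscLt t n s z -> rho s (bM t n z) = bM t n (cj s z)) /\
    (DesLt t n s z -> rho s (bM t n z) = bM t n (cj s z) + a *: bM t n z) /\
    (AscEq n s z -> rho s (bM t n z) = eA *: bM t n z) /\
    (DesEq n s z -> rho s (bM t n z) = eD *: bM t n z).

Lemma eigen_rulesP rho : eigen_rules rho <-> forall s z (y : Gt t n), s \in SG -> z \in Gset t n ->
  rho s (bM t n z) y = gen_coef s z (val y).
Proof.
split=> [rules s z y sS zG|coefE s z sS zG].
  have [U [L [A D]]] := rules s z sS zG; have := gen_kindP sS zG; rewrite /gen_coef.
  by case: (gen_kind s z) => k; [rewrite D | rewrite A | rewrite U | rewrite L]; rewrite // !ffunE.
split; [|split; [|split]] => k; apply/ffunP => y; rewrite coefE // !ffunE /gen_coef.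
- by rewrite gen_kind_ascLt.
- by rewrite gen_kind_desLt.
- by rewrite gen_kind_ascEq.
- by rewrite gen_kind_desEq.
Qed.

End MatrixCoefficients.
End GeneratorKinds.

Definition Gset_elt t n z (zG : z \in Gset t n) : Gt t n := exist _ z zG.

Lemma bM_expand t n (v : Vmod t n) : v = \sum_(y : Gt t n) (v y : K) *: bM t n (val y).
Proof. by rewrite [LHS]ffun_delta_expand; apply: eq_bigr => y _; congr (_ *: _). Qed.

Section Module.
Variables (t : CoxType) (n : nat).
Hypothesis hn : (2 <= n)%N.
Let hnN : (2 <= n <= n.*2)%N. Proof. lia. Qed.
Variables (eA eD : K).
Let a : K := xK - xK^-1.
Hypotheses (eA_quad : eA * eA = 1 + a * eA) (eD_quad : eD * eD = 1 + a * eD).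

Notation V := (Vmod t n).
Notation SG := (Sgen t n).
Notation cj s z := (permc s (permc z s)).
Implicit Types (s z : P n) (p q : int) (v : V) (f : int -> int) (F : (int -> int) -> K).

Definition extend_ffun v f : K :=
  if [pick y : Gt t n | `[< apZ (val y) = f >]] is Some y then v y else 0.

Lemma extend_ffunE v y : extend_ffun v (apZ (val y)) = v y.
Proof.
rewrite /extend_ffun; case: pickP => [x /asboolP xy|/(_ y)]; last by move=> /asboolP.
by congr (v _); apply: val_inj; apply: eq_apZ => i; rewrite xy.
Qed.

Definition is_Gset_fun f := exists y : Gt t n, apZ (val y) = f.

Lemma Gset_fun_Gfun f : is_Gset_fun f -> Gfun n f.
Proof. by move=> [y <-]; exact: (Gset_Gfun hn (valP y)). Qed.

Lemma Gset_fun_conj p q f : simple_root t n p q -> is_Gset_fun f ->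
  fun_kind n p q f = AscLtK \/ fun_kind n p q f = DesLtK -> is_Gset_fun (conj_fun p q f).
Proof.
move=> r [y <-] k; have [s sS sE] := simple_root_gen hnN r.
have cG : cj s (val y) \in Gset t n.
  by apply: (conj_in_Gset hn) => //; [exact: valP | rewrite /moves (gen_kindE hn sS (valP y) r sE)].
by exists (Gset_elt cG); rewrite /= (apZ_conj _ sE).
Qed.

Lemma root_op_ext_Gset p q F G : simple_root t n p q -> (forall f, is_Gset_fun f -> F f = G f) ->
  forall f, is_Gset_fun f -> root_op n a eA eD p q F f = root_op n a eA eD p q G f.
Proof.
move=> root FG f fG; rewrite /root_op; case kf : (fun_kind n p q f); rewrite ?FG //.
- by apply: Gset_fun_conj => //; left.
- by apply: Gset_fun_conj => //; right.
Qed.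

Definition root_of (s : P n) : int * int :=
  match pselect (exists pq : int * int, simple_root t n pq.1 pq.2 /\ apZ s =1 stransp pq.1 pq.2) with
  | left ex => projT1 (cid ex)
  | right _ => (0, 0)
  end.

Lemma root_ofE s p q : simple_root t n p q -> apZ s =1 stransp p q -> root_of s = (p, q).
Proof.
move=> r sE; rewrite /root_of; case: pselect => [ex|[]]; last by exists (p, q).
case: (cid ex) => -[p' q'] /= [r' sE'].
have [-> ->] : p = p' /\ q = q'; last by [].
by apply: (simple_root_inj r r') => x; rewrite -sE -sE'.
Qed.

Definition gen_op s v : V :=
  [ffun y : Gt t n => root_op n a eA eD (root_of s).1 (root_of s).2 (extend_ffun v) (apZ (val y)) : K^o].

Definition represents v F := forall f, is_Gset_fun f -> extend_ffun v f = F f.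

Lemma represents_extend v : represents v (extend_ffun v). Proof. by []. Qed.

Lemma represents_gen_op s p q v F : simple_root t n p q -> apZ s =1 stransp p q ->
  represents v F -> represents (gen_op s v) (root_op n a eA eD p q F).
Proof.
move=> r sE vF _ [y <-]; rewrite extend_ffunE ffunE (root_ofE r sE).
by apply: (root_op_ext_Gset r vF); exists y.
Qed.

Lemma represents_eq v w F G : represents v F -> represents w G ->
  (forall f, Gfun n f -> F f = G f) -> v = w.
Proof.
move=> vF wG FG; apply/ffunP => y; have yG : is_Gset_fun (apZ (val y)) by exists y.
by rewrite -!extend_ffunE vF // wG // FG //; exact: Gset_fun_Gfun.
Qed.

Lemma gen_op_linear s : linear (gen_op s).
Proof.
move=> b u v; apply/ffunP => y; rewrite !ffunE.
have -> : extend_ffun (b *: u + v) = (fun f => extend_ffun v f + b * extend_ffun u f).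
  apply/funext => f; rewrite /extend_ffun; case: pickP => [x _|_]; first by rewrite !ffunE addrC.
  by rewrite mulr0 addr0.
by rewrite root_op_linear addrC.
Qed.

Lemma gen_op_quad s v : s \in SG -> gen_op s (gen_op s v) = v + a *: gen_op s v.
Proof.
move=> sS; have [p [q [r sE]]] := gen_simple_root hnN sS; apply/ffunP => y.
have yG : is_Gset_fun (apZ (val y)) by exists y.
have vF := represents_gen_op r sE (represents_extend v).
rewrite -extend_ffunE (represents_gen_op r sE vF yG) root_op_quad //; last exact: Gset_fun_Gfun.
  by rewrite !ffunE (root_ofE r sE) extend_ffunE.
by exists t.
Qed.

Lemma gen_op_braid s s' p q p' q' : simple_root t n p q -> simple_root t n p' q' ->
  apZ s =1 stransp p q -> apZ s' =1 stransp p' q' ->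
  [/\ commuting_roots p q p' q' -> forall v, gen_op s (gen_op s' v) = gen_op s' (gen_op s v),
      braid3_roots n p q p' q' -> forall v, gen_op s (gen_op s' (gen_op s v)) = gen_op s' (gen_op s (gen_op s' v)) &
      braid4_roots p q p' q' -> forall v, gen_op s (gen_op s' (gen_op s (gen_op s' v))) = gen_op s' (gen_op s (gen_op s' (gen_op s v)))].
Proof.
move=> r r' sE sE'.
have op v F := @represents_gen_op s p q v F r sE; have op' v F := @represents_gen_op s' p' q' v F r' sE'.
split=> roots v; have v_ext := represents_extend v.
- apply: (represents_eq (op _ _ (op' _ _ v_ext)) (op' _ _ (op _ _ v_ext))) => f f_G.
  case: roots => [disj|[-> -> -> ->]]; last exact: (braid2_D hn).
  exact: (braid2_disjoint hn a eA eD r r' disj f_G).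
- apply: (represents_eq (op _ _ (op' _ _ (op _ _ v_ext))) (op' _ _ (op _ _ (op' _ _ v_ext)))) => f f_G.
  by case: roots => -> triple; exact: (braid3_triple triple hn eA_quad eD_quad f_G).
- apply: (represents_eq (op _ _ (op' _ _ (op _ _ (op' _ _ v_ext)))) (op' _ _ (op _ _ (op' _ _ (op _ _ v_ext))))) => f f_G.
  by case: roots => -> -> -> ->; exact: (braid4_B hn eA_quad eD_quad f_G).
Qed.

Lemma gen_op_coef s z (y : Gt t n) : s \in SG -> z \in Gset t n ->
  gen_op s (bM t n z) y = gen_coef t eA eD s z (val y).
Proof.
move=> sS zG; rewrite (gen_coefC hn) //; last exact: valP.
have [p [q [r sE]]] := gen_simple_root hnN sS.
have kE := gen_kindE hn sS (valP y) r sE.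
have bM_conj : moves t s (val y) -> extend_ffun (bM t n z) (conj_fun p q (apZ (val y))) = (z == cj s (val y))%:R.
  move=> k; have cG := conj_in_Gset hn sS (valP y) k.
  by rewrite -(apZ_conj _ sE) -[cj s (val y)]/(val (Gset_elt cG)) extend_ffunE ffunE eq_sym.
rewrite ffunE (root_ofE r sE) /root_op /= -kE /gen_coef extend_ffunE ffunE eq_sym.
by move: bM_conj; rewrite /moves; case: (gen_kind t s (val y)) => // ->; auto.
Qed.

Hypotheses (lA : isLaurent eA) (lD : isLaurent eD).

Lemma laurent_gen_op s v : s \in SG -> laurentVec t n v -> laurentVec t n (gen_op s v).
Proof.
move=> sS v_laurent y; rewrite (bM_expand v) (linear_fun_sum (gen_op_linear s)) sum_ffunE.
elim/big_rec: _ => [|z w _ w_laurent]; first exact: (laurent_bool false).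
apply: laurentD => //; rewrite (linear_funZ (gen_op_linear s)) ffunE gen_op_coef //; last exact: valP.
by apply: laurentM; [exact: v_laurent | exact: laurent_gen_coef].
Qed.

Theorem module_exists : exists rho, isHrep t n rho /\ eigen_rules eA eD rho.
Proof.
have op_linear s : s \in SG -> forall (b : K) (u v : V), gen_op s (b *: u + v) = b *: gen_op s u + gen_op s v.
  by move=> _; exact: gen_op_linear.
have op_quad s : s \in SG -> forall v, gen_op s (gen_op s v) = v + a *: gen_op s v.
  by move=> sS v; exact: gen_op_quad.
have op_braid s s' p q p' q' (_ : s \in SG) (_ : s' \in SG) := @gen_op_braid s s' p q p' q'.
exists (hecke_action t gen_op); split; first split.
- exact: (hecke_action_heckeRep hn op_linear op_quad op_braid).
- by apply: (hecke_action_closed hn op_braid) => s v; exact: laurent_gen_op.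
- apply/(eigen_rulesP hn) => s z y sS zG.
  by rewrite (hecke_action_gen hn op_braid) // gen_op_coef.
Qed.

Theorem module_unique rho1 rho2 : isHrep t n rho1 -> eigen_rules eA eD rho1 ->
  isHrep t n rho2 -> eigen_rules eA eD rho2 -> forall w, w \in WW t n -> rho1 w =1 rho2 w.
Proof.
move=> [hecke1 _] /(eigen_rulesP hn) rules1 [hecke2 _] /(eigen_rulesP hn) rules2; apply: (heckeRep_eq hn hecke1 hecke2) => s sS v.
have sW := gen_WW hn sS; have rho1L : linear (rho1 s) := hecke1.1 s sW; have rho2L : linear (rho2 s) := hecke2.1 s sW.
rewrite (bM_expand v) (linear_fun_sum rho1L) (linear_fun_sum rho2L); apply: eq_bigr => z _.
rewrite (linear_funZ rho1L) (linear_funZ rho2L); congr (_ *: _); apply/ffunP => y.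
by rewrite rules1 ?rules2 //; exact: valP.
Qed.

End Module.

(** * Signed permutations *)

Section PermOfFun.
Variable N : nat.

Definition perm_of_fun (f : int -> int) : {perm pt N} :=
  if [pick w : {perm pt N} | `[< apZ w =1 f >]] is Some w then w else 1%g.

Lemma perm_of_funE f : injective f -> (forall x, (N < absz x)%N -> f x = x) -> apZ (perm_of_fun f) =1 f.
Proof.
move=> f_inj f_out; have f_bound x : (absz x <= N)%N -> (absz (f x) <= N)%N.
  by apply: contraLR; rewrite -!ltnNge => fx; have /f_inj <- := f_out _ fx.
rewrite /perm_of_fun; case: pickP => [w /asboolP //|no_perm].
have pt_inj : injective (fun k : pt N => ofZ N (f (toZ k))).
  move=> k l /(congr1 toZ); rewrite !ofZK ?f_bound ?toZ_bound // => /f_inj.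
  exact: (can_inj (@toZK N)).
have /asboolP[] := no_perm (perm pt_inj) => x.
case: (leqP (absz x) N) => hx; last by rewrite apZ_out // f_out.
by rewrite -{1}(ofZK hx) apZ_toZ permE ofZK // ?ofZK // f_bound.
Qed.
End PermOfFun.

Section SignedPermutations.
Variable n : nat.
Implicit Types (pi : {perm 'I_n}) (e : 'I_n -> bool).

Definition signed_fun pi e (x : int) : int :=
  if insub (absz x).-1 is Some i then
    if x == 0 then 0 else
    if (0 < x) (+) e i then (pi i).+1%:Z else - (pi i).+1%:Z
  else x.

Lemma signed_fun_pos pi e (i : 'I_n) : signed_fun pi e i.+1%:Z = if e i then - (pi i).+1%:Z else (pi i).+1%:Z.
Proof. by rewrite /signed_fun /= valK /=; case: (e i). Qed.

Lemma signed_funN pi e x : signed_fun pi e (- x) = - signed_fun pi e x.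
Proof.
rewrite /signed_fun abszN; case: insubP => // i _ _; rewrite oppr_eq0; case: eqP => [_|x0]; first by rewrite oppr0.
have -> : (0 < - x) = ~~ (0 < x) by lia.
by case: (0 < x); case: (e i) => //=; rewrite opprK.
Qed.

Lemma signed_fun_out pi e x : (n < absz x)%N -> signed_fun pi e x = x.
Proof. by move=> x_out; rewrite /signed_fun insubN //; lia. Qed.

Lemma int_cases x : [\/ x = 0, (n < absz x)%N | exists i : 'I_n, x = i.+1%:Z \/ x = - i.+1%:Z].
Proof.
case: (eqVneq x 0) => [|x0]; first by constructor 1.
case: (leqP (absz x) n) => x_le; last by constructor 2.
have pred_lt : ((absz x).-1 < n)%N by lia.
by constructor 3; exists (Ordinal pred_lt) => /=; lia.
Qed.

Lemma signed_fun0 pi e : signed_fun pi e 0 = 0.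
Proof. by rewrite /signed_fun; case: insubP. Qed.

Definition signed_perm pi e : P n := perm_of_fun n.*2 (signed_fun pi e).

Lemma signed_permE pi e : apZ (signed_perm pi e) =1 signed_fun pi e.
Proof.
apply: perm_of_funE.
- suff signed_funK : cancel (signed_fun pi e) (signed_fun (pi^-1)%g (fun i => e ((pi^-1)%g i))).
    exact: can_inj signed_funK.
  have signed_funK_pos (i : 'I_n) : signed_fun (pi^-1)%g (fun i => e ((pi^-1)%g i)) (signed_fun pi e i.+1%:Z) = i.+1%:Z.
    by rewrite signed_fun_pos; case ei : (e i); rewrite ?signed_funN signed_fun_pos permK ei // opprK.
  move=> x; case: (int_cases x) => [->|x_out|[i [->|->]]]; first by rewrite !signed_fun0.
  + by rewrite !signed_fun_out // signed_fun_out.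
  + exact: signed_funK_pos.
  + by rewrite !signed_funN signed_funK_pos.
- by move=> x hx; rewrite signed_fun_out //; lia.
Qed.

Lemma eq_signed_perm (w : P n) pi e : (forall x, apZ w (- x) = - apZ w x) -> (forall x, (n < absz x)%N -> apZ w x = x) ->
  (forall i : 'I_n, apZ w i.+1%:Z = if e i then - (pi i).+1%:Z else (pi i).+1%:Z) -> w = signed_perm pi e.
Proof.
move=> wN w_out w_pos; apply: eq_apZ => x; rewrite signed_permE.
case: (int_cases x) => [->|x_out|[i [->|->]]].
- by rewrite signed_fun0 odd_fun0.
- by rewrite signed_fun_out // w_out.
- by rewrite signed_fun_pos w_pos.
- by rewrite signed_funN wN signed_fun_pos w_pos.
Qed.

Lemma signed_permM pi e pi' e' :
  permc (signed_perm pi e) (signed_perm pi' e') = signed_perm (pi' * pi)%g (fun i => e' i (+) e (pi' i)).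
Proof.
apply: eq_signed_perm => [x|x x_out|i]; rewrite !apZ_permc !signed_permE ?signed_funN //.
  by rewrite !signed_fun_out // signed_fun_out.
by rewrite signed_fun_pos; case: (e' i); rewrite ?signed_funN signed_fun_pos permM; case: (e _); rewrite ?opprK.
Qed.

Lemma signed_perm1 : signed_perm 1%g (fun=> false) = 1%g.
Proof. by apply/esym/eq_signed_perm => [x|x x_out|i]; rewrite !apZ1 ?perm1. Qed.

Lemma eq_signed_perm_sign pi e e' : e =1 e' -> signed_perm pi e = signed_perm pi e'.
Proof. by move=> /funext ->. Qed.

Lemma signed_perm_isBC pi e : isBC (signed_perm pi e).
Proof. by apply/isBCP => x; rewrite !signed_permE signed_funN. Qed.

Lemma signed_perm_fixBeyond pi e : fixBeyond n (signed_perm pi e).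
Proof. by apply/fixBeyondP => x x_out; rewrite signed_permE signed_fun_out //; lia. Qed.

Hypothesis hn : (2 <= n)%N.

Lemma WW_signed_group t : WW t n = signed_group n.*2 t n.
Proof. by rewrite /WW WgrpE ?signed_groupE //; lia. Qed.

Lemma count_iota_card (c : pred nat) : count c (iota 1 n) = #|[set i : 'I_n | c i.+1]|.
Proof.
rewrite cardsE cardE /enum_mem size_filter -(addn0 1%N) iotaDl count_map.
rewrite -val_enum_ord count_map enumT; apply: eq_count => i.
by rewrite /= add1n.
Qed.

Lemma signed_perm_WW t pi e : (signed_perm pi e \in WW t n) =
  match t with TA => [forall i, ~~ e i] | TBC => true | TD => ~~ odd #|[set i | e i]| end.
Proof.
rewrite WW_signed_group /signed_group; case: t => /=; rewrite !inE signed_perm_isBC signed_perm_fixBeyond //=.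
- apply/allP/forallP => [pos i|no_sign j].
    have := pos i.+1; rewrite mem_iota signed_permE signed_fun_pos; have := ltn_ord i; case: (e i) => //; lia.
  rewrite mem_iota => hj; have j_lt : (j.-1 < n)%N by lia.
  have := no_sign (Ordinal j_lt); have := signed_fun_pos pi e (Ordinal j_lt); rewrite /= prednK; last by lia.
  by rewrite signed_permE => ->; case: (e _).
- rewrite /evenNeg count_iota_card; congr (~~ odd #|pred_of_set _|); apply/setP => i.
  by rewrite !inE signed_permE signed_fun_pos; case: (e i).
Qed.

Lemma WW_signed_perm t g : g \in WW t n -> exists pi e, g = signed_perm pi e.
Proof.
rewrite WW_signed_group => /signed_group_BC[/isBCP gN /fixBeyondP g_out].
have g_inj := @apZ_inj _ g; have g0 : apZ g 0 = 0 by exact: odd_fun0.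
have g_neq0 (i : 'I_n) : apZ g i.+1%:Z != 0 by apply/eqP; rewrite -g0 => /g_inj.
have g_lt (i : 'I_n) : ((absz (apZ g i.+1%:Z)).-1 < n)%N.
  have := ltn_ord i; case: (leqP (absz (apZ g i.+1%:Z)) n) => gi_le; first by lia.
  by have := g_out (apZ g i.+1%:Z); rewrite (_ : _ < _); [move=> /(_ isT)/g_inj | ]; lia.
pose f (i : 'I_n) := Ordinal (g_lt i).
have f_inj : injective f.
  move=> i j /(congr1 val) /= abs_eq.
  have : apZ g i.+1%:Z = apZ g j.+1%:Z \/ apZ g i.+1%:Z = apZ g (- j.+1%:Z).
    by rewrite gN; move: (g_neq0 i) (g_neq0 j) abs_eq; move: (apZ g _) (apZ g _) => x y; lia.
  by move=> [] /g_inj ij; apply: val_inj => /=; lia.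
exists (perm f_inj), (fun i => apZ g i.+1%:Z < 0); apply: eq_signed_perm; [exact: gN | by move=> x x_out; apply: g_out; lia | move=> i].
by rewrite permE /=; have := g_neq0 i; move: (apZ g _) => y; case: ifP; lia.
Qed.

End SignedPermutations.

Section VandermondeDeterminant.
Variables (n : nat).

Definition vandermonde_det (y : 'I_n -> rat) : rat := \det (Vandermonde n (\row_i y i)).

Lemma vandermonde_det_perm y (s : {perm 'I_n}) : vandermonde_det (fun i => y (s i)) = (-1) ^+ s * vandermonde_det y.
Proof.
rewrite /vandermonde_det.
have -> : Vandermonde n (\row_i y (s i)) = col_perm s (Vandermonde n (\row_i y i)).
  by apply/matrixP => i j; rewrite !mxE.
by rewrite col_permE det_mulmx det_perm odd_permV mulrC.
Qed.

Lemma vandermonde_det_neq0 y : injective y -> vandermonde_det y != 0.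
Proof.
move=> y_inj; rewrite /vandermonde_det det_Vandermonde; apply/prodf_neq0 => i _; apply/prodf_neq0 => j ij.
by rewrite !mxE subr_eq0; apply: contraTneq ij => /y_inj->; rewrite ltnn.
Qed.
End VandermondeDeterminant.

Section ExtendInvolution.
Variables (t : CoxType) (n : nat).
Hypothesis hn : (2 <= n)%N.
Variable zeta : {perm 'I_n}.
Hypothesis zetaK : involutive zeta.

Definition fixed_pts : seq 'I_n := enum (fixed_in setT zeta).
Definition nfix := size fixed_pts.

Lemma mem_fixed_pts i : (i \in fixed_pts) = (zeta i == i).
Proof. by rewrite mem_enum !inE. Qed.

Lemma nfix_le : (nfix <= n)%N.
Proof. by rewrite /nfix -cardE -[X in (_ <= X)%N](card_ord n) max_card. Qed.

Lemma even_sub_nfix : ~~ odd (n - nfix).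
Proof.
have -> : (n - nfix)%N = #|~: fixed_in setT zeta|.
  by rewrite cardsCs setCK card_ord /nfix -cardE.
apply: (even_card_fpf_involution (f := zeta)) => i; rewrite !inE /= => zi.
by rewrite zetaK eq_sym zi; split.
Qed.

Definition outer_partner (i : 'I_n) : nat := (n.+1 + index i fixed_pts)%N.

Definition extend_nat (m : nat) : nat :=
  if m == 0 then 0 else
  if insub m.-1 is Some i then (if zeta i == i then outer_partner i else (zeta i).+1) else
  if (m <= n + nfix)%N then (nth 0 (map val fixed_pts) (m - n.+1)).+1 else
  if (m <= n.*2)%N then (if odd (m - (n + nfix)) then m.+1 else m.-1) else m.

Lemma extend_nat_inner (i : 'I_n) : extend_nat i.+1 = if zeta i == i then outer_partner i else (zeta i).+1.
Proof. by rewrite /extend_nat /= valK. Qed.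

Lemma outer_partner_bounds i : zeta i = i -> (n < outer_partner i <= n + nfix)%N.
Proof.
by move=> zi; rewrite /outer_partner leq_addr addSnnS leq_add2l index_mem mem_fixed_pts zi eqxx.
Qed.

Lemma outer_partner_lt i j : zeta i = i -> zeta j = j ->
  (outer_partner i < outer_partner j)%N -> (i < j)%N.
Proof.
move=> zi zj; rewrite /outer_partner ltn_add2l; apply: (@sorted_ltn_index _ (relpre val ltn)); rewrite ?mem_fixed_pts ?zi ?zj //.
  by move=> x y z /=; exact: ltn_trans.
apply: sorted_filter; first by move=> x y z /=; exact: ltn_trans.
by rewrite -enumT -sorted_map val_enum_ord iota_ltn_sorted.
Qed.

Lemma extend_nat_outer i : zeta i = i -> extend_nat (outer_partner i) = i.+1.
Proof.
move=> zi; have bounds := outer_partner_bounds zi.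
rewrite /extend_nat insubN; last by rewrite -leqNgt; lia.
have -> : (outer_partner i == 0)%N = false by lia.
have -> : (outer_partner i <= n + nfix)%N by lia.
by rewrite addKn (nth_map i) ?nth_index ?index_mem // mem_fixed_pts zi.
Qed.

Lemma extend_nat_tail m : (n + nfix < m <= n.*2)%N -> extend_nat m = if odd (m - (n + nfix)) then m.+1 else m.-1.
Proof.
move=> /andP[m_gt m_le]; rewrite /extend_nat insubN; last by rewrite -leqNgt; lia.
have -> : (m == 0)%N = false by lia.
have -> : (m <= n + nfix)%N = false by lia.
by rewrite m_le.
Qed.

Lemma extend_nat_beyond m : (n.*2 < m)%N -> extend_nat m = m.
Proof.
move=> m_gt; have k_le := nfix_le; rewrite /extend_nat insubN; last by rewrite -leqNgt; lia.
have -> : (m == 0)%N = false by lia.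
have -> : (m <= n + nfix)%N = false by lia.
by have -> : (m <= n.*2)%N = false by lia.
Qed.

Lemma extend_nat_cases m : (0 < m <= n.*2)%N -> [\/ exists i : 'I_n, m = i.+1,
  exists2 i : 'I_n, zeta i = i & m = outer_partner i | (n + nfix < m)%N].
Proof.
move=> hm; case: (leqP m n) => mn.
  by have i_lt : (m.-1 < n)%N by [lia]; constructor 1; exists (Ordinal i_lt) => /=; lia.
case: (leqP m (n + nfix)) => mk; last by constructor 3.
have n0 : (0 < n)%N by lia.
have k_lt : (m - n.+1 < size fixed_pts)%N by rewrite -/nfix; lia.
constructor 2; exists (nth (Ordinal n0) fixed_pts (m - n.+1)).
  by apply/eqP; rewrite -mem_fixed_pts mem_nth.
by rewrite /outer_partner index_uniq ?enum_uniq //; lia.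
Qed.

Lemma extend_nat_matching m : (0 < m <= n.*2)%N -> [/\ (0 < extend_nat m <= n.*2)%N, extend_nat (extend_nat m) = m & extend_nat m != m].
Proof.
move=> hm; have k_le := nfix_le; case: (extend_nat_cases hm) => [[i ->]|[i zi ->]|mk].
- rewrite extend_nat_inner; case: (eqVneq (zeta i) i) => zi.
    rewrite extend_nat_outer //; have := outer_partner_bounds zi; have := ltn_ord i; split; lia.
  rewrite extend_nat_inner zetaK eq_sym (negbTE zi).
  split; [by have := ltn_ord (zeta i); lia | by [] | by rewrite eqSS (inj_eq val_inj)].
- rewrite extend_nat_outer // extend_nat_inner zi eqxx.
  by have := outer_partner_bounds zi; have := ltn_ord i; split; lia.
rewrite extend_nat_tail ?mk ?(proj2 (andP hm)) //; have := even_sub_nfix; case odd_m : (odd (m - (n + nfix))) => even_k.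
  have m_lt : (m < n.*2)%N by lia.
  by split; [lia | rewrite extend_nat_tail; [|lia]; have -> : odd (m.+1 - (n + nfix)) = false by [lia]; lia | lia].
by split; [lia | rewrite extend_nat_tail; [|lia]; have -> : odd (m.-1 - (n + nfix)) by [lia]; lia | lia].
Qed.

Lemma extend_nat_ascends m : (n < m)%N -> (m <= extend_nat m.+1)%N || (extend_nat m <= extend_nat m.+1)%N.
Proof.
move=> nm; case: (leqP m.+1 n.*2) => h2n; last by rewrite (@extend_nat_beyond m.+1) // leqnSn.
have m_bounds : (0 < m <= n.*2)%N by lia.
have m1_bounds : (0 < m.+1 <= n.*2)%N by lia.
case: (extend_nat_cases m1_bounds) => [[j]|[j zj m1E]|mk]; first by have := ltn_ord j; lia.
  have := outer_partner_bounds zj; case: (extend_nat_cases m_bounds) => [[i]|[i zi mE]|]; [by have := ltn_ord i; lia | | lia].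
  by have := outer_partner_lt zi zj; rewrite m1E mE !extend_nat_outer //; lia.
by rewrite (@extend_nat_tail m.+1) ?mk //; case: (odd _); lia.
Qed.

Definition extend_int (x : int) : int := if 0 < x then (extend_nat (absz x))%:Z else - (extend_nat (absz x))%:Z.

Lemma extend_int_nat m : extend_int m%:Z = (extend_nat m)%:Z.
Proof. by rewrite /extend_int; case: m. Qed.

Lemma extend_intN x : extend_int (- x) = - extend_int x.
Proof.
rewrite /extend_int abszN; case: (ltrgtP 0 x) => hx; last by rewrite -hx.
  by have -> : (0 < - x) = false by lia.
by have -> : (0 < - x) by [lia]; rewrite opprK.
Qed.

Lemma extend_int_ascends i : n%:Z < i ->
  (i <= extend_int (i + 1) \/ extend_int i <= extend_int (i + 1)) /\ - i <= extend_int i.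
Proof.
case: i => // m nm; have -> : m%:Z + 1 = m.+1%:Z by lia.
by rewrite !extend_int_nat; have := @extend_nat_ascends m nm; split; lia.
Qed.

Lemma extend_int_Gfun : Gfun n extend_int.
Proof.
split.
- exact: extend_intN.
- apply: odd_int_ind => [x e|m]; first by rewrite !extend_intN e.
  rewrite !extend_int_nat; case: (posnP m) => [->|m0] //.
  case: (leqP m n.*2) => hm; last by rewrite !extend_nat_beyond.
  by have [] := @extend_nat_matching m; rewrite ?m0 // => _ ->.
- apply: odd_int_ind => [x e|m]; first by rewrite extend_intN oppr_eq0 !normrN.
  move=> m0 hm; have hm' : (0 < m <= n.*2)%N by lia.
  by rewrite extend_int_nat; have [_ _] := extend_nat_matching hm'; lia.
- apply: odd_int_ind => [x e|m]; first by rewrite extend_intN normrN => /e->.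
  by rewrite extend_int_nat => hm; rewrite extend_nat_beyond //; lia.
exact: extend_int_ascends.
Qed.

Lemma exists_Gset_extending : exists2 z : P n, z \in Gset t n &
  (forall i : 'I_n, zeta i != i -> apZ z i.+1%:Z = (zeta i).+1%:Z) /\
  (forall i : 'I_n, zeta i = i -> n%:Z < apZ z i.+1%:Z).
Proof.
have [fN fK f_neq f_out f_asc] := extend_int_Gfun.
pose z := perm_of_fun n.*2 extend_int.
have zE : apZ z = extend_int.
  apply/funext/perm_of_funE => [|x hx]; [exact: can_inj fK | by apply: f_out; lia].
exists z; first apply/(GsetP hn).
  rewrite zE; split=> //; rewrite /type_cond; case: t => // [x x0|].
    rewrite zE; have -> : x = (absz x)%:Z by lia.
    rewrite extend_int_nat; case: (leqP (absz x) n.*2) => hx; last by rewrite extend_nat_beyond //; lia.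
    by have [|bounds _ _] := @extend_nat_matching (absz x); lia.
  by rewrite zE (eq_count (a2 := pred0)) ?count_pred0 // => i /=; rewrite extend_int_nat; lia.
split=> i zi; rewrite zE extend_int_nat extend_nat_inner; first by rewrite (negbTE zi).
by rewrite zi eqxx; have := outer_partner_bounds zi; lia.
Qed.
End ExtendInvolution.

(** * Faithfulness at x = 1 *)

Section GroupTranslations.
Variables (R : comNzRingType) (gT : finGroupType).
Implicit Types (g h w : gT) (u v : {ffun gT -> R^o}).

Definition translate g v : {ffun gT -> R^o} := [ffun w => v (w * g^-1)%g].

Fact translate_linear g : linear (translate g).
Proof. by move=> k u v; apply/ffunP => w; rewrite !ffunE. Qed.

HB.instance Definition _ g := GRing.isLinear.Build R _ _ *:%R (translate g) (translate_linear g).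

Lemma translate1 v : translate 1%g v = v.
Proof. by apply/ffunP => w; rewrite ffunE invg1 mulg1. Qed.

Lemma translateM g h v : translate (g * h)%g v = translate h (translate g v).
Proof. by apply/ffunP => w; rewrite !ffunE invMg mulgA. Qed.

Lemma ffun_dot_translate g u v : ffun_dot (translate g u) (translate g v) = ffun_dot u v.
Proof.
rewrite /ffun_dot [RHS](reindex_inj (mulIg g^-1%g)) /=.
by apply: eq_bigr => w _; rewrite !ffunE.
Qed.

End GroupTranslations.

Lemma ffun_dot_gt0 (R : realDomainType) (I : finType) (v : {ffun I -> R^o}) : v != 0 -> 0 < ffun_dot v v.
Proof.
move=> v_neq0; rewrite lt_neqAle sumr_ge0 ?andbT => [|i _]; last by rewrite -expr2 sqr_ge0.
apply: contra v_neq0; rewrite eq_sym psumr_eq0 => [/allP v0|i _]; last by rewrite -expr2 sqr_ge0.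
by apply/eqP/ffunP => i; have := v0 i (mem_index_enum i); rewrite mulf_eq0 orbb ffunE => /eqP.
Qed.

Section CompatibleSums.
Variables (t : CoxType) (n : nat).
Hypothesis hn : (2 <= n)%N.
Let hnN : (2 <= n <= n.*2)%N. Proof. lia. Qed.

Notation W := (WW t n).
Notation SG := (Sgen t n).
Notation cj s z := (permc s (permc z s)).

Lemma WW_odd g : g \in W -> {morph apZ g : x / - x}.
Proof. by rewrite (WW_signed_group hn) => /signed_group_BC[/isBCP]. Qed.

Lemma WW_out g x : g \in W -> n%:Z < `|x| -> apZ g x = x.
Proof. by rewrite (WW_signed_group hn) => /signed_group_BC[_ /fixBeyondP]; apply. Qed.

Lemma WW_norm_le g x : g \in W -> `|x| <= n%:Z -> `|apZ g x| <= n%:Z.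
Proof.
rewrite (WW_signed_group hn) => /signed_group_BC[_ g_out] hx.
by have := fixBeyond_absz_le hnN (x := x) g_out; lia.
Qed.

Lemma WW_gt g x : g \in W -> (n%:Z < apZ g x) = (n%:Z < x).
Proof.
move=> gW; case: (leP `|x| n%:Z) => hx; last by rewrite WW_out.
by have := WW_norm_le gW hx; lia.
Qed.

Lemma WW_onto g p : g \in W -> p != 0 -> `|p| <= n%:Z ->
  exists i : 'I_n, apZ g i.+1%:Z = p \/ apZ g i.+1%:Z = - p.
Proof.
move=> gW p_neq0 p_le; have gN := WW_odd gW; have := apZKV g p; move: (apZ g^-1%g p) => x xE.
case: (int_cases n x) => [x0|x_out|[i [xi|xi]]].
- by rewrite -xE x0 (odd_fun0 gN) eqxx in p_neq0.
- by have := @WW_out g x gW; lia.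
- by exists i; left; rewrite -xE xi.
- by exists i; right; rewrite -xE xi gN opprK.
Qed.

Lemma gen_apZK s : s \in SG -> involutive (apZ s).
Proof. by move=> sS x; rewrite -apZ_permc /permc (gens_invol hnN sS) apZ1. Qed.

Section FixedInvolution.
Variables (zeta : {perm 'I_n}) (v : {ffun P n -> rat^o}).
Hypothesis zetaK : involutive zeta.
Implicit Types (g z s : P n) (i : 'I_n) (p q r : int).

Definition compatible g z := [forall i : 'I_n,
  if zeta i == i then n%:Z < apZ z (apZ g i.+1%:Z)
  else apZ z (apZ g i.+1%:Z) == apZ g (zeta i).+1%:Z].

Definition outer_values g z i : rat :=
  if zeta i == i then (apZ z (apZ g i.+1%:Z))%:~R else (i : nat)%:R.

Definition compatible_sum z : {ffun P n -> rat^o} :=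
  \sum_(g in W | compatible g z) vandermonde_det (outer_values g z) *: translate g v.

Lemma compatible_fixed g z i : compatible g z -> zeta i = i -> n%:Z < apZ z (apZ g i.+1%:Z).
Proof. by move=> /forallP/(_ i) + zi; rewrite zi eqxx. Qed.

Lemma compatible_paired g z i : compatible g z -> zeta i != i ->
  apZ z (apZ g i.+1%:Z) = apZ g (zeta i).+1%:Z.
Proof. by move=> /forallP/(_ i) + zi; rewrite (negbTE zi) => /eqP. Qed.

Lemma translate_compatible_sum s z : s \in SG -> translate s (compatible_sum z) =
  \sum_(g in W | compatible (permc s g) z) vandermonde_det (outer_values (permc s g) z) *: translate g v.
Proof.
move=> sS; rewrite linear_sum (reindex_inj (can_inj (fun w => gen_mulK hn w sS))) /=.
apply: eq_big => [g|g _]; first by rewrite WW_permcE // gen_WW.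
by rewrite linearZ /= -translateM -[(_ * s)%g]/(permc s (permc s g)) (gen_mulK hn _ sS).
Qed.

Lemma compatible_sum_conj s z : s \in SG -> translate s (compatible_sum z) = compatible_sum (cj s z).
Proof.
move=> sS; have sW := gen_WW hn sS; rewrite translate_compatible_sum //; apply: eq_big => g.
  congr andb; apply: eq_forallb => i; rewrite !apZ_permc (WW_gt _ sW).
  by rewrite -(inj_eq (@apZ_inj _ s)) gen_apZK.
move=> /andP[_ c]; congr (vandermonde_det _ *: _); apply/funext => i; rewrite /outer_values !apZ_permc.
case: eqP => // zi; have := compatible_fixed c zi; rewrite apZ_permc => out.
by rewrite [apZ s (apZ z _)]WW_out //; lia.
Qed.

Definition outer_point z p := [/\ p != 0, `|p| <= n%:Z & n%:Z < apZ z p].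

Lemma ascEq_outer_points s z : s \in SG -> z \in Gset t n -> gen_kind t s z = AscEqK ->
  exists p q, [/\ apZ s =1 stransp p q, outer_point z p, outer_point z q & `|p| != `|q|].
Proof.
move=> sS zG k; have [zN _ _ _ _] := Gset_Gfun hn zG; have [p [q [r sE]]] := gen_simple_root hnN sS.
have := gen_kindP hn sS zG; rewrite k => /(AscEqP hn zG r sE) /and3P[/eqP zq p_out q_out].
have [p0 q0] := simple_root_neq0 r; have [pn qn] := simple_root_le hn r; have pq := simple_root_lt r.
have norm_pq : `|p| != `|q|.
  have : q = - p -> apZ z q = - apZ z p by move=> ->.
  by move: zq pq p_out; move: (apZ z p) (apZ z q) => a b; clear; lia.
case: (ltrP n%:Z (apZ z p)) => zp; [exists p, q | exists (- q), (- p)]; split=> //.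
- by split=> //; rewrite zq; move: zp; move: (apZ z p) => a; clear; lia.
- by move=> x; rewrite stransp_opp.
- split; rewrite ?oppr_eq0 ?normrN // zN.
  by move: zp zq p_out q_out; move: (apZ z p) (apZ z q) => a b; clear; lia.
- by split; rewrite ?oppr_eq0 ?normrN // zN; move: zp p_out; move: (apZ z p) => a; clear; lia.
- by rewrite !normrN eq_sym.
Qed.

Section OuterPoints.
Variables (z g : P n).
Hypotheses (zN : {morph apZ z : x / - x}) (gW : g \in W) (g_compat : compatible g z).

Lemma compatible_paired_neq i r : zeta i != i -> outer_point z r -> `|apZ g i.+1%:Z| != `|r|.
Proof.
move=> zi [_ _ zr]; apply/eqP => gi; have i_le : `|(zeta i).+1%:Z| <= n%:Z by have := ltn_ord (zeta i); lia.
have := WW_norm_le gW i_le; rewrite -(compatible_paired g_compat zi).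
have [->|->] : apZ g i.+1%:Z = r \/ apZ g i.+1%:Z = - r by move: gi; clear; lia.
  by move: zr; move: (apZ z r) => a; clear; lia.
by rewrite zN; move: zr; move: (apZ z r) => a; clear; lia.
Qed.

Lemma compatible_fixed_neq i r : zeta i = i -> outer_point z r -> apZ g i.+1%:Z != r -> `|apZ g i.+1%:Z| != `|r|.
Proof.
move=> zi [_ _ zr] neq; apply/eqP => gi; have := compatible_fixed g_compat zi.
have -> : apZ g i.+1%:Z = - r by move: gi neq; clear; lia.
by rewrite zN; move: zr; move: (apZ z r) => a; clear; lia.
Qed.

Lemma compatible_preimage r : outer_point z r -> exists2 i, zeta i = i & apZ g i.+1%:Z = r.
Proof.
move=> r_out; have [r0 r_le _] := r_out; have [i gi] := WW_onto gW r0 r_le.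
have norm_gi : `|apZ g i.+1%:Z| = `|r| by case: gi => ->; rewrite ?normrN.
have zi : zeta i = i by apply: contrapT => /eqP /(compatible_paired_neq)/(_ r_out); rewrite norm_gi eqxx.
by exists i => //; apply: contrapT => /eqP /(compatible_fixed_neq zi r_out); rewrite norm_gi eqxx.
Qed.

End OuterPoints.

Section OuterTransposition.
Variables (s z : P n) (p q : int).
Hypotheses (sW : s \in W) (sE : apZ s =1 stransp p q) (zN : {morph apZ z : x / - x}).
Hypotheses (p_out : outer_point z p) (q_out : outer_point z q) (norm_pq : `|p| != `|q|).

Lemma outer_transposition_paired g i : g \in W -> compatible g z -> zeta i != i ->
  apZ (permc s g) i.+1%:Z = apZ g i.+1%:Z.
Proof.
move=> gW c zi; rewrite apZ_permc sE stransp_id //.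
  exact: (compatible_paired_neq zN gW c zi p_out).
exact: (compatible_paired_neq zN gW c zi q_out).
Qed.

Lemma outer_transposition_fixed g i : compatible g z -> zeta i = i ->
  apZ g i.+1%:Z != p -> apZ g i.+1%:Z != q -> apZ (permc s g) i.+1%:Z = apZ g i.+1%:Z.
Proof.
move=> c zi neq_p neq_q; rewrite apZ_permc sE stransp_id //.
  exact: (compatible_fixed_neq zN c zi p_out).
exact: (compatible_fixed_neq zN c zi q_out).
Qed.

Lemma compatible_outer_transposition g : g \in W -> compatible g z -> compatible (permc s g) z.
Proof.
move=> gW c; have [[_ _ zp] [_ _ zq]] := (p_out, q_out).
apply/forallP => i; case: eqP => [zi|/eqP zi]; last first.
  have zi' : zeta (zeta i) != zeta i by rewrite zetaK eq_sym.
  by rewrite !outer_transposition_paired // (compatible_paired c zi).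
case: (eqVneq (apZ g i.+1%:Z) p) => [gi|neq_p]; first by rewrite apZ_permc gi sE stransp_l.
case: (eqVneq (apZ g i.+1%:Z) q) => [gi|neq_q]; first by rewrite apZ_permc gi sE stransp_r.
by rewrite outer_transposition_fixed // compatible_fixed.
Qed.

Lemma vandermonde_outer_transposition g : g \in W -> compatible g z ->
  vandermonde_det (outer_values (permc s g) z) = - vandermonde_det (outer_values g z).
Proof.
move=> gW c; have [i zi gi] := compatible_preimage zN gW c p_out; have [j zj gj] := compatible_preimage zN gW c q_out.
have ij : i != j by apply: contraNneq norm_pq => ij; rewrite -gi -gj ij.
suff -> : outer_values (permc s g) z = fun k => outer_values g z (tperm i j k).
  by rewrite vandermonde_det_perm odd_tperm ij expr1 mulN1r.
apply/funext => k; rewrite /outer_values; case: (tpermP i j k) => [->|->|/eqP ki /eqP kj].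
- by rewrite apZ_permc zi zj !eqxx gi sE stransp_l gj.
- by rewrite apZ_permc zi zj !eqxx gj sE stransp_r gi.
case: eqP => // zk; rewrite outer_transposition_fixed //.
  by apply: contra ki => /eqP; rewrite -gi => /(@apZ_inj _ g)[] /val_inj ->.
by apply: contra kj => /eqP; rewrite -gj => /(@apZ_inj _ g)[] /val_inj ->.
Qed.

End OuterTransposition.

Lemma compatible_sum_ascEq s z : s \in SG -> z \in Gset t n -> gen_kind t s z = AscEqK ->
  translate s (compatible_sum z) = - compatible_sum z.
Proof.
move=> sS zG k; have [p [q [sE p_out q_out pq]]] := ascEq_outer_points sS zG k.
have [zN _ _ _ _] := Gset_Gfun hn zG; have sW := gen_WW hn sS.
have compat g : g \in W -> compatible g z -> compatible (permc s g) z.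
  exact: (compatible_outer_transposition sE zN p_out q_out).
have compat_iff g : g \in W -> compatible (permc s g) z = compatible g z.
  move=> gW; apply/idP/idP; last exact: compat.
  by rewrite -{2}(gen_mulK hn g sS); apply: compat; exact: WW_permc.
rewrite translate_compatible_sum // -sumrN; apply: eq_big => g.
  by case gW : (g \in W) => //=; exact: compat_iff.
move=> /andP[gW]; rewrite compat_iff // => c.
by rewrite (vandermonde_outer_transposition sE zN p_out q_out pq gW c) scaleNr.
Qed.

End FixedInvolution.
End CompatibleSums.

Section PermutationAction.
Variable n : nat.
Implicit Types (g h : {perm 'I_n}) (v : {ffun P n -> rat^o}).

Definition perm_translate g : {linear {ffun P n -> rat^o} -> {ffun P n -> rat^o}} :=
  @translate rat _ (signed_perm g (fun=> false)).

Lemma perm_translate1 v : perm_translate 1%g v = v.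
Proof. by rewrite /perm_translate /= signed_perm1 translate1. Qed.

Lemma perm_translateM g h v : perm_translate (g * h)%g v = perm_translate h (perm_translate g v).
Proof.
rewrite /perm_translate /= -translateM -[(_ * _)%g in RHS]/(permc _ _) signed_permM.
by congr translate; apply: eq_signed_perm_sign.
Qed.

End PermutationAction.

Section SignChanges.
Variables (t : CoxType) (n : nat).
Hypothesis hn : (2 <= n)%N.
Hypothesis tn : t = TD -> odd n.

Notation W := (WW t n).
Implicit Types (a b i : 'I_n) (pi : {perm 'I_n}) (e : 'I_n -> bool) (l : seq 'I_n).

(* In type D, negating the even number of entries other than [a] replaces negating [a] alone. *)
Definition sign_pattern a i : bool := match t with TA => false | TBC => i == a | TD => i != a end.
Definition sign_change a : P n := signed_perm 1%g (sign_pattern a).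

Lemma sign_change_WW a : sign_change a \in W.
Proof.
rewrite signed_perm_WW // /sign_pattern; case tE : t => //; first by apply/forallP.
have -> : [set i : 'I_n | i != a] = ~: [set a] by apply/setP => i; rewrite !inE.
have card_n := cardsC [set a]; rewrite cards1 card_ord in card_n.
by have : odd (1 + #|~: [set a]|) by [rewrite card_n; exact: tn]; rewrite add1n /=.
Qed.

Lemma sign_change_signed_perm a pi e :
  permc (sign_change (pi a)) (signed_perm pi e) = permc (signed_perm pi e) (sign_change a).
Proof.
rewrite /sign_change !signed_permM mulg1 mul1g; apply: eq_signed_perm_sign => i; rewrite perm1 addbC; congr (_ (+) _).
by rewrite /sign_pattern; case: t => //; rewrite (inj_eq perm_inj).
Qed.

Lemma sign_changeC a b : permc (sign_change a) (sign_change b) = permc (sign_change b) (sign_change a).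
Proof. by have := sign_change_signed_perm a 1%g (sign_pattern b); rewrite perm1. Qed.

Lemma sign_changeK a : permc (sign_change a) (sign_change a) = 1%g.
Proof.
by rewrite /sign_change signed_permM mulg1 -(signed_perm1 n); apply: eq_signed_perm_sign => i; rewrite perm1 addbb.
Qed.

Lemma unsigned_perm_WW pi : signed_perm pi (fun=> false) \in W.
Proof.
rewrite signed_perm_WW //; case: (t) => //; first by apply/forallP.
by rewrite (_ : [set _ | _] = set0) ?cards0 //; apply/setP => i; rewrite !inE.
Qed.

Definition sign_change_product l : P n :=
  signed_perm 1%g (fun i => odd (count (sign_pattern^~ i) l)).

Lemma signed_perm_sign_changes pi e : signed_perm pi e \in W ->
  signed_perm pi e = permc (signed_perm pi (fun=> false)) (sign_change_product (enum [set i | e i])).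
Proof.
move=> eW; rewrite signed_permM mul1g; apply: eq_signed_perm_sign => i; rewrite addbF.
rewrite /sign_pattern; move: eW; rewrite signed_perm_WW //; case: t => [/forallP e_none|_|e_even].
- by rewrite count_pred0 (negbTE (e_none i)).
- rewrite (eq_count (a2 := pred1 i)) => [|a]; last by rewrite /= eq_sym.
  by rewrite count_uniq_mem ?enum_uniq // mem_enum inE oddb.
rewrite (eq_count (a2 := predC (pred1 i))) => [|a]; last by rewrite /= eq_sym.
have := count_predC (pred1 i) (enum [set i | e i]); rewrite count_uniq_mem ?enum_uniq // mem_enum inE -cardE.
by move=> /(congr1 odd); rewrite oddD oddb (negbTE e_even); case: (e i); case: (odd _).
Qed.

Section Eigenvectors.
Variables (col : 'I_n -> bool) (v : {ffun P n -> rat^o}).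
Hypothesis v_eigen : forall a, translate (sign_change a) v = (-1) ^+ col a *: v.

Lemma sign_change_product_eigen l : translate (sign_change_product l) v = (-1) ^+ count col l *: v.
Proof.
elim: l => [|a l IH]; first by rewrite /sign_change_product /= signed_perm1 translate1 scale1r.
have -> : sign_change_product (a :: l) = permc (sign_change_product l) (sign_change a).
  by rewrite /sign_change signed_permM mulg1; apply: eq_signed_perm_sign => i; rewrite perm1 /= oddD oddb.
by rewrite /permc translateM v_eigen linearZ /= IH scalerA exprD.
Qed.

Lemma sign_change_translate_eigen pi e a :
  translate (sign_change (pi a)) (translate (signed_perm pi e) v) = (-1) ^+ col a *: translate (signed_perm pi e) v.
Proof. by rewrite -translateM -[(_ * _)%g]/(permc _ _) sign_change_signed_perm /permc translateM v_eigen linearZ. Qed.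

(* [v] and its translate are eigenvectors of [sign_change (pi a)] for opposite eigenvalues. *)
Lemma dot_translate_eq0 pi e a : col (pi a) != col a -> ffun_dot (translate (signed_perm pi e) v) v = 0.
Proof.
move=> col_neq; have := ffun_dot_translate (sign_change (pi a)) (translate (signed_perm pi e) v) v.
rewrite sign_change_translate_eigen v_eigen linearZl linearZr /= mulrA -signr_addb.
have -> : col a (+) col (pi a) by move: col_neq; case: (col a); case: (col (pi a)).
by rewrite expr1 mulN1r => /eqP; rewrite eq_sym -addr_eq0 -mulr2n mulrn_eq0 => /eqP.
Qed.

End Eigenvectors.

Lemma exists_sign_change_eigenvector (U : {ffun P n -> rat^o} -> Prop) : subspace U ->
  (forall a v, U v -> U (translate (sign_change a) v)) -> (exists2 v, U v & v != 0) ->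
  exists v (col : 'I_n -> bool), [/\ U v, v != 0 & forall a, translate (sign_change a) v = (-1) ^+ col a *: v].
Proof.
move=> [_ [UD UZ]] U_stable [v0 Uv0 v0_neq0].
suff [v [col [Uv v_neq0 v_eigen]]] : exists v (col : 'I_n -> bool), [/\ U v, v != 0 &
    {in enum 'I_n, forall a, translate (sign_change a) v = (-1) ^+ col a *: v}].
  by exists v, col; split=> // a; rewrite v_eigen ?mem_enum.
elim: (enum 'I_n) => [|a l [v [col [Uv v_neq0 v_eigen]]]]; first by exists v0, (fun=> false).
suff [b vb_neq0] : exists b : bool, v + (-1) ^+ b *: translate (sign_change a) v != 0.
  exists (v + (-1) ^+ b *: translate (sign_change a) v), (fun x => if x == a then b else col x); split=> //.
    by apply: UD => //; apply/UZ/U_stable.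
  move=> x; rewrite inE linearD linearZ /= -translateM; case: (eqVneq x a) => [->|xa] /= xl.
    rewrite -[(_ * _)%g]/(permc _ _) sign_changeK translate1 scalerDr scalerA -expr2 sqrr_sign scale1r.
    by rewrite addrC.
  rewrite -[(_ * _)%g]/(permc _ _) sign_changeC /permc translateM v_eigen // linearZ /= scalerDr !scalerA.
  by rewrite mulrC.
case: (eqVneq (v + translate (sign_change a) v) 0) => [vN|vD]; last by exists false; rewrite expr0 scale1r.
exists true; rewrite expr1 scaleN1r; apply: contra v_neq0 => /eqP vB.
have : v + v = 0 by rewrite -[RHS](addr0 0) -{1}vN -vB addrACA addrN addr0.
by rewrite -mulr2n -scaler_nat => /eqP; rewrite scaler_eq0.
Qed.

End SignChanges.

Section LeadingCoefficient.
Variables (t : CoxType) (n : nat).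
Hypothesis hn : (2 <= n)%N.
Variables (zeta : {perm 'I_n}) (col : 'I_n -> bool) (v : {ffun P n -> rat^o}) (z0 : P n).
Hypothesis zetaK : involutive zeta.
Hypothesis zeta_colored : colored col zeta.
Hypothesis v_eigen : forall a, translate (sign_change t a) v = (-1) ^+ col a *: v.
Hypothesis v_sign : sign_eigenvector (@perm_translate n) col setT zeta v.
Hypothesis v_neq0 : v != 0.
Hypothesis z0N : {morph apZ z0 : x / - x}.
Hypothesis z0_paired : forall i : 'I_n, zeta i != i -> apZ z0 i.+1%:Z = (zeta i).+1%:Z.
Hypothesis z0_fixed : forall i : 'I_n, zeta i = i -> n%:Z < apZ z0 i.+1%:Z.

Notation W := (WW t n).
Implicit Types (i : 'I_n) (pi : {perm 'I_n}) (e : 'I_n -> bool) (g : P n).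

Lemma compatible1 : compatible zeta 1%g z0.
Proof.
apply/forallP => i; rewrite !apZ1; case: eqP => [|/eqP] zi; first exact: z0_fixed.
by rewrite z0_paired.
Qed.

Lemma vandermonde_outer_values_neq0 : vandermonde_det (outer_values zeta 1%g z0) != 0.
Proof.
have outer_neq i (j : 'I_n) : zeta i = i -> (apZ z0 i.+1%:Z)%:~R != j%:R :> rat.
  move=> zi; rewrite -[j%:R]/(j%:Z%:~R) eqr_int; have := z0_fixed zi; have := ltn_ord j.
  by move: (apZ z0 _) => x; lia.
apply: vandermonde_det_neq0 => i j; rewrite /outer_values !apZ1; case: eqP => zi; case: eqP => zj.
- by move=> /eqP; rewrite eqr_int => /eqP/(@apZ_inj _ z0)[] /val_inj.
- by move/eqP; rewrite (negbTE (outer_neq i j zi)).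
- by move/esym/eqP; rewrite (negbTE (outer_neq j i zj)).
- by move=> /eqP; rewrite eqr_nat => /eqP/val_inj.
Qed.

Section CompatibleSignedPerm.
Variables (pi : {perm 'I_n}) (e : 'I_n -> bool).
Hypothesis pe_compat : compatible zeta (signed_perm pi e) z0.

Let gE i : apZ (signed_perm pi e) i.+1%:Z = if e i then - (pi i).+1%:Z else (pi i).+1%:Z.
Proof. by rewrite signed_permE signed_fun_pos. Qed.

Lemma compatible_signed_perm_fixed i : zeta i = i -> zeta (pi i) = pi i /\ e i = false.
Proof.
move=> zi; have := compatible_fixed pe_compat zi; rewrite gE; have pi_lt := ltn_ord (zeta (pi i)).
case: (eqVneq (zeta (pi i)) (pi i)) => [z_pi|z_pi]; case: (e i) => //; rewrite ?z0N.
- by have := z0_fixed z_pi; move: (apZ _ _) => x; lia.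
- by rewrite z0_paired //; lia.
- by rewrite z0_paired //; lia.
Qed.

Lemma compatible_signed_perm_paired i : zeta i != i -> zeta (pi i) = pi (zeta i) /\ e (zeta i) = e i.
Proof.
move=> zi; have := compatible_paired pe_compat zi; rewrite !gE; have pi_lt := ltn_ord (pi (zeta i)).
case: (eqVneq (zeta (pi i)) (pi i)) => [z_pi|z_pi].
  have := z0_fixed z_pi; case: (e i); case: (e (zeta i)); rewrite ?z0N; move: (apZ _ _) => x; lia.
case: (e i); case: (e (zeta i)); rewrite ?z0N z0_paired // => same;
  by [exfalso; lia | split=> //; apply: val_inj; move: same => /=; lia].
Qed.

Lemma compatible_signed_perm_commute : commute pi zeta.
Proof.
apply/permP => i; rewrite !permM; case: (eqVneq (zeta i) i) => zi.
  by rewrite zi; case: (compatible_signed_perm_fixed zi).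
by case: (compatible_signed_perm_paired zi).
Qed.

Lemma even_compatible_signs (c : pred 'I_n) : (forall i, c (zeta i) = c i) -> ~~ odd #|[set i | e i && c i]|.
Proof.
move=> c_zeta; apply: (even_card_fpf_involution (f := zeta)) => i; rewrite !inE => /andP[ei ci].
have zi : zeta i != i by apply/eqP => /compatible_signed_perm_fixed[_]; rewrite ei.
by have [_ ->] := compatible_signed_perm_paired zi; rewrite ei c_zeta ci zetaK.
Qed.

Hypothesis pe_W : signed_perm pi e \in W.
Hypothesis pi_colored : colored col pi.

Lemma colored_cent_compatible : colored_cent col setT zeta pi.
Proof.
by apply/colored_centP; split; [exact/subsetP | exact: pi_colored | exact: compatible_signed_perm_commute].
Qed.

Lemma translate_compatible : translate (signed_perm pi e) v = (-1) ^+ fixed_sign setT zeta pi *: v.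
Proof.
rewrite (signed_perm_sign_changes hn pe_W) /permc translateM (sign_change_product_eigen v_eigen) linearZ /=.
rewrite (_ : count col _ = #|[set i | e i && col i]|); last first.
  rewrite -size_filter cardE; congr size; rewrite /enum_mem -filter_predI; apply: eq_filter => i.
  by rewrite /= !inE andbC.
have /negbTE col_even := even_compatible_signs (coloredP _ _ zeta_colored).
by rewrite (v_sign colored_cent_compatible) -signr_odd col_even scale1r.
Qed.

Lemma vandermonde_compatible : vandermonde_det (outer_values zeta (signed_perm pi e) z0) =
  (-1) ^+ fixed_sign setT zeta pi * vandermonde_det (outer_values zeta 1%g z0).
Proof.
rewrite -vandermonde_det_perm; congr vandermonde_det; apply/funext => i; rewrite /outer_values.
have pi_stable : pi \in 'N(fixed_in setT zeta | 'P)%g.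
  by apply: fixed_in_stable; [exact/subsetP | exact: compatible_signed_perm_commute].
rewrite restr_perm_if // !inE /=; case: (eqVneq (zeta i) i) => zi; last by rewrite (negbTE zi).
by have [-> ei] := compatible_signed_perm_fixed zi; rewrite eqxx gE ei apZ1.
Qed.

End CompatibleSignedPerm.

Notation leading_coef := (vandermonde_det (outer_values zeta 1%g z0) * ffun_dot v v).

Lemma compatible_term g : g \in W -> compatible zeta g z0 ->
  vandermonde_det (outer_values zeta g z0) * ffun_dot (translate g v) v \in [:: 0; leading_coef].
Proof.
move=> gW; have [pi [e gE]] := WW_signed_perm hn gW; rewrite gE in gW * => g_compat; rewrite !inE.
case: (boolP (colored col pi)) => [pi_col|/forallPn[a col_neq]]; last first.
  by rewrite (dot_translate_eq0 v_eigen _ col_neq) mulr0 eqxx.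
rewrite translate_compatible // vandermonde_compatible // linearZl /= mulrACA -signr_addb addbb expr0 mul1r.
by rewrite eqxx orbT.
Qed.

Lemma compatible_sum_neq0 : compatible_sum t zeta v z0 != 0.
Proof.
apply/eqP => /(congr1 (fun u => leading_coef * ffun_dot u v)); rewrite linear0l mulr0 => /eqP.
apply/negP; rewrite gt_eqF // linear_sumlz /= mulr_sumr.
have coef_neq0 : leading_coef != 0.
  by rewrite mulf_neq0 ?vandermonde_outer_values_neq0 // gt_eqF // ffun_dot_gt0.
have term_ge0 g : (g \in W) && compatible zeta g z0 ->
    0 <= leading_coef * ffun_dot (vandermonde_det (outer_values zeta g z0) *: translate g v) v.
  move=> /andP[gW g_compat]; rewrite linearZl /=; have := compatible_term gW g_compat; rewrite !inE.
  by case/orP => /eqP->; rewrite ?mulr0 // -expr2 sqr_ge0.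
rewrite (bigD1 1%g) ?(WW1 t hn) ?compatible1 //= ltr_wpDr //.
  by apply: sumr_ge0 => g /andP[/term_ge0].
by rewrite linearZl /= translate1 -expr2 lt_neqAle sqr_ge0 andbT eq_sym sqrf_eq0.
Qed.

End LeadingCoefficient.

Section SpecializedFaithfulness.
Variables (t : CoxType) (n : nat).
Hypothesis hn : (2 <= n)%N.
Hypothesis tn : t = TD -> odd n.
Let hnN : (2 <= n <= n.*2)%N. Proof. lia. Qed.

Notation W := (WW t n).
Notation SG := (Sgen t n).
Notation cj s z := (permc s (permc z s)).
Notation d := #|{: Gt t n}|.
Implicit Types (s w z : P n) (zeta : {perm 'I_n}) (v : {ffun P n -> rat^o}).

Definition Gset_enum (j : 'I_d) : P n := val (enum_val j).
Definition Gset_row (Phi : P n -> rat) : 'rV[rat]_d := \row_j Phi (Gset_enum j).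

Variable rep : P n -> 'M[rat]_d.
Hypothesis rep1 : rep 1%g = 1%:M.
Hypothesis repM : forall u w, u \in W -> w \in W -> rep (permc u w) = rep u *m rep w.
Hypothesis trmx_rep : forall w, w \in W -> (rep w)^T = rep w^-1%g.
Hypothesis rep_gen : forall s Phi j, s \in SG -> (Gset_row Phi *m rep s) 0 j =
  match gen_kind t s (Gset_enum j) with
  | DesEqK => Phi (Gset_enum j)
  | AscEqK => - Phi (Gset_enum j)
  | _ => Phi (cj s (Gset_enum j))
  end.

Definition annihilating (v : {ffun P n -> rat^o}) : Prop :=
  (forall w, w \notin W -> v w = 0) /\ \sum_(w in W) (v w : rat) *: rep w = 0.

Lemma annihilating_subspace : subspace annihilating.
Proof.
split; first by split=> [w _|]; [rewrite ffunE | rewrite big1 // => w _; rewrite ffunE scale0r].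
split=> [u v [u_out u_sum] [v_out v_sum]|a u [u_out u_sum]]; split=> [w wW|].
- by rewrite ffunE u_out // v_out // addr0.
- by under eq_bigr do rewrite ffunE scalerDl; rewrite big_split /= u_sum v_sum addr0.
- by rewrite ffunE u_out // scaler0.
by under eq_bigr do rewrite ffunE -scalerA; rewrite -scaler_sumr u_sum scaler0.
Qed.

Lemma annihilating_translate g v : g \in W -> annihilating v -> annihilating (translate g v).
Proof.
move=> gW [v_out v_sum]; split=> [w wW|].
  by rewrite ffunE v_out // -[(w * _)%g]/(permc g^-1%g w) (WW_permcE hn) ?(WW_inv hn).
rewrite (reindex_inj (mulIg g)) /= (eq_bigl (mem W)) => [|w]; last by rewrite -[(w * g)%g]/(permc g w) (WW_permcE hn).
rewrite (eq_bigr (fun w => rep g *m ((v w : rat) *: rep w))) => [|w wW].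
  by rewrite -mulmx_sumr v_sum mulmx0.
by rewrite ffunE mulgK -[(w * g)%g]/(permc g w) repM // scalemxAr.
Qed.

Section Equivariant.
Variables (Phi : P n -> {ffun P n -> rat^o}) (z0 : P n).
Hypothesis z0G : z0 \in Gset t n.
Hypothesis Phi_gen : forall s z, s \in SG -> z \in Gset t n -> translate s (Phi z) =
  match gen_kind t s z with DesEqK => Phi z | AscEqK => - Phi z | _ => Phi (cj s z) end.

Lemma equivariant_row w : w \in W ->
  Gset_row (fun z => Phi z w) = Gset_row (fun z => Phi z 1%g) *m rep w^-1%g.
Proof.
have row_gen s u : s \in SG -> Gset_row (fun z => Phi z (permc s u)) = Gset_row (fun z => Phi z u) *m rep s.
  move=> sS; apply/rowP => j; rewrite rep_gen // mxE.
  have := congr1 (fun f : {ffun P n -> rat^o} => f u) (Phi_gen sS (valP (enum_val j))).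
  rewrite ffunE (gensV hnN sS) -/(Gset_enum j) => ->; case: (gen_kind t s (Gset_enum j)) => //.
  by rewrite ffunE.
move: w; apply: (WW_ind hn) => [|s w sS wW _ IH]; first by rewrite invg1 rep1 mulmx1.
have swW := WW_mul_gen hn sS wW; have sW := gen_WW hn sS.
rewrite -{1}(gen_mulK hn w sS) row_gen // IH -mulmxA -(repM (WW_inv hn swW) sW).
by congr (_ *m rep _); rewrite /permc invMg (gensV hnN sS) mulgA (gens_invol hnN sS) mul1g.
Qed.

(* Pairing the annihilating relation [Phi z0] with [w |-> Phi z0 w] itself. *)
Lemma equivariant_annihilating_eq0 : annihilating (Phi z0) -> Phi z0 = 0.
Proof.
move=> [Phi_out Phi_sum].
have sumT : \sum_(w in W) (Phi z0 w : rat) *: rep w^-1%g = 0.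
  transitivity (\sum_(w in W) (Phi z0 w : rat) *: rep w)^T; last by rewrite Phi_sum trmx0.
  by rewrite linear_sum; apply: eq_bigr => w wW; rewrite linearZ /= trmx_rep.
have : \sum_(w in W) (Phi z0 w : rat) *: Gset_row (fun z => Phi z w) = 0.
  rewrite -[RHS](mulmx0 _ (Gset_row (fun z => Phi z 1%g))) -sumT mulmx_sumr; apply: eq_bigr => w wW.
  by rewrite equivariant_row // -scalemxAr.
move/rowP/(_ (enum_rank (exist _ z0 z0G : Gt t n))); rewrite summxE mxE.
rewrite (eq_bigr (fun w => (Phi z0 w : rat) ^+ 2)) => [sqr0|w _]; last by rewrite !mxE /Gset_enum enum_rankK.
apply/ffunP => w; rewrite ffunE; case: (boolP (w \in W)) => wW; last exact: Phi_out.
by have := psumr_eq0P (fun w _ => sqr_ge0 (Phi z0 w : rat)) sqr0; move=> /(_ w wW)/eqP; rewrite sqrf_eq0 => /eqP.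
Qed.

End Equivariant.

Lemma annihilating_compatible_sum zeta v z : annihilating v -> annihilating (compatible_sum t zeta v z).
Proof.
move=> v_ann; have [ann0 [annD annZ]] := annihilating_subspace.
by apply: (big_ind annihilating) => // g /andP[gW _]; apply/annZ/annihilating_translate.
Qed.

Lemma compatible_sum_gen zeta v s z : involutive zeta -> s \in SG -> z \in Gset t n ->
  translate s (compatible_sum t zeta v z) = match gen_kind t s z with
    | DesEqK => compatible_sum t zeta v z
    | AscEqK => - compatible_sum t zeta v z
    | _ => compatible_sum t zeta v (cj s z)
    end.
Proof.
move=> zetaK sS zG; case k : (gen_kind t s z); try exact: compatible_sum_conj; last exact: compatible_sum_ascEq.
rewrite compatible_sum_conj //; congr compatible_sum.
by have := gen_kindP hn sS zG; rewrite k /DesEq => <-; rewrite (gen_mulK hn _ sS).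
Qed.

Theorem specialized_faithful v : annihilating v -> v = 0.
Proof.
move=> v_ann; apply: contrapT => /eqP v_neq0.
have sign_stable a u : annihilating u -> annihilating (translate (sign_change t a) u).
  by apply: annihilating_translate; exact: sign_change_WW.
have [v1 [col [v1_ann v1_neq0 v1_eigen]]] :=
  exists_sign_change_eigenvector annihilating_subspace sign_stable (ex_intro2 _ _ v v_ann v_neq0).
pose U u := annihilating u /\ forall a, translate (sign_change t a) u = (-1) ^+ col a *: u.
have U_sub : subspace U.
  have [ann0 [annD annZ]] := annihilating_subspace; split; [|split].
  - by split=> // a; rewrite linear0 scaler0.
  - by move=> u u' [u_ann u_eigen] [u'_ann u'_eigen]; split=> [|a]; [exact: annD | rewrite linearD /= u_eigen u'_eigen scalerDr].
  - by move=> k u [u_ann u_eigen]; split=> [|a]; [exact: annZ | rewrite linearZ /= u_eigen scalerA mulrC -scalerA].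
have U_act : act_stable (@perm_translate n) col setT U.
  move=> g u _ /coloredP g_col [u_ann u_eigen]; split; first by apply: annihilating_translate => //; exact: unsigned_perm_WW.
  by move=> a; rewrite -(permKV g a) g_col (sign_change_translate_eigen u_eigen).
have [zeta [zetaK _ zeta_col [u [[u_ann u_eigen] u_neq0 u_sign]]]] :=
  exists_sign_eigenvector (@perm_translate1 n) (@perm_translateM n) (@ffun_dot_gt0 _ _) (fun g => @ffun_dot_translate _ _ _) U_sub U_act
    (ex_intro2 _ _ v1 (conj v1_ann v1_eigen) v1_neq0).
have [z0 z0G [z0_paired z0_fixed]] := exists_Gset_extending t hn zetaK.
have [z0N _ _ _ _] := Gset_Gfun hn z0G.
have := compatible_sum_neq0 hn zetaK zeta_col u_eigen u_sign u_neq0 z0N z0_paired z0_fixed.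
rewrite (equivariant_annihilating_eq0 z0G) ?eqxx // => [s z|]; first exact: compatible_sum_gen.
exact: annihilating_compatible_sum.
Qed.

End SpecializedFaithfulness.

(** * Specialization of Laurent polynomials *)

Local Notation tf := (@FracField.tofrac _).

Lemma xK_expE k : xK ^+ k = tf ('X^k : {poly int}).
Proof. by rewrite tofracXn. Qed.

Lemma xK_exp_neq0 k : xK ^+ k != 0.
Proof. exact: expf_neq0 xK_neq0. Qed.

Definition specializes (f : K) (a : rat) :=
  exists k (p : {poly int}), f = tf p / xK ^+ k /\ a = (p.[1])%:~R.

Lemma specializes_uniq f a b : specializes f a -> specializes f b -> a = b.
Proof.
move=> [k [p [-> ->]]] [l [r [frac_eq ->]]].
have poly_eq : tf (p * 'X^l) = tf (r * 'X^k).
  rewrite !tofracM -!xK_expE; have := congr1 (fun u => u * (xK ^+ k * xK ^+ l)) frac_eq.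
  rewrite /= mulrA divfK ?xK_exp_neq0 // => ->.
  by rewrite [xK ^+ k * _]mulrC mulrA divfK ?xK_exp_neq0.
move/eqP: poly_eq; rewrite tofrac_eq => /eqP/(congr1 (fun u => u.[1])).
by rewrite !hornerM !hornerXn !expr1n !mulr1 => ->.
Qed.

Lemma specializesD f g a b : specializes f a -> specializes g b -> specializes (f + g) (a + b).
Proof.
move=> [k [p [-> ->]]] [l [r [-> ->]]]; exists (k + l)%N, (p * 'X^l + r * 'X^k); split.
  by rewrite tofracD !tofracM -!xK_expE exprD addf_div ?xK_exp_neq0.
by rewrite hornerD !hornerM !hornerXn !expr1n !mulr1 rmorphD.
Qed.

Lemma specializesM f g a b : specializes f a -> specializes g b -> specializes (f * g) (a * b).
Proof.
move=> [k [p [-> ->]]] [l [r [-> ->]]]; exists (k + l)%N, (p * r); split.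
  by rewrite tofracM exprD mulf_div.
by rewrite hornerM rmorphM.
Qed.

Lemma specializesN f a : specializes f a -> specializes (- f) (- a).
Proof.
by move=> [k [p [-> ->]]]; exists k, (- p); rewrite tofracN mulNr hornerN rmorphN.
Qed.

Lemma specializes_poly (p : {poly int}) : specializes (tf p) (p.[1])%:~R.
Proof. by exists 0%N, p; rewrite expr0 divr1. Qed.

Definition specialize (f : K) : rat :=
  if pselect (exists a, specializes f a) is left ex then projT1 (cid ex) else 0.

Lemma specialize_eq f a : specializes f a -> specialize f = a.
Proof.
move=> fa; rewrite /specialize; case: pselect => [ex|[]]; last by exists a.
by apply: specializes_uniq fa; case: (cid ex).
Qed.

Lemma specializeP f : isLaurent f -> specializes f (specialize f).
Proof.
move=> [k [p fE]]; have fp : specializes f (p.[1])%:~R by exists k, p.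
by rewrite (specialize_eq fp).
Qed.

Lemma specialize_poly (p : {poly int}) : specialize (tf p) = (p.[1])%:~R.
Proof. exact: specialize_eq (specializes_poly p). Qed.

Lemma specialize_bool (b : bool) : specialize b%:R = b%:R.
Proof. by have := specialize_poly b%:R; case: b; rewrite ?tofrac1 ?tofrac0 hornerC. Qed.

Lemma specialize_xK : specialize xK = 1.
Proof. by rewrite specialize_poly hornerX. Qed.

Lemma specialize_xKV : specialize xK^-1 = 1.
Proof. by apply: specialize_eq; exists 1%N, 1; rewrite tofrac1 hornerC div1r expr1. Qed.

Lemma specializeD f g : isLaurent f -> isLaurent g -> specialize (f + g) = specialize f + specialize g.
Proof. by move=> /specializeP fa /specializeP gb; exact: specialize_eq (specializesD fa gb). Qed.

Lemma specializeM f g : isLaurent f -> isLaurent g -> specialize (f * g) = specialize f * specialize g.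
Proof. by move=> /specializeP fa /specializeP gb; exact: specialize_eq (specializesM fa gb). Qed.

Lemma specializeN f : isLaurent f -> specialize (- f) = - specialize f.
Proof. by move=> /specializeP fa; exact: specialize_eq (specializesN fa). Qed.

Lemma specialize_xK_subV : specialize (xK - xK^-1) = 0.
Proof.
rewrite specializeD ?specializeN ?specialize_xK ?specialize_xKV ?subrr //; [exact: laurent_xKV | exact: laurent_xK |].
exact: laurentN laurent_xKV.
Qed.

Lemma specialize_sum (I : finType) (Q : pred I) (f : I -> K) :
  (forall i, Q i -> isLaurent (f i)) -> specialize (\sum_(i | Q i) f i) = \sum_(i | Q i) specialize (f i).
Proof.
move=> f_laurent.
suff [] : isLaurent (\sum_(i | Q i) f i) /\ specialize (\sum_(i | Q i) f i) = \sum_(i | Q i) specialize (f i) by [].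
elim/big_rec2: _ => [|i y x Qi [x_laurent <-]].
  by split; [exact: (laurent_bool false) | exact: (specialize_bool false)].
by split; [apply: laurentD => //; exact: f_laurent | rewrite specializeD //; exact: f_laurent].
Qed.

Lemma exists_fraction (f : K) : exists p d : {poly int}, d != 0 /\ f * tf d = tf p.
Proof.
elim/quotW: f => r; exists (frac r).1, (frac r).2; split; first exact: denom_ratioP.
rewrite /FracField.tofrac; unlock; rewrite -[LHS]FracField.pi_mul.
apply/eqmodP; rewrite /= FracField.equivfE /FracField.mulf.
by rewrite !numden_Ratio ?(oner_eq0, mulf_neq0, denom_ratioP) // !mulr1 mulrC.
Qed.

Section PrimitiveScaling.
Variables (I : finType) (a : I -> K).

Definition numerators (p : I -> {poly int}) := exists2 c : K, c != 0 & forall i, c * a i = tf (p i).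

Lemma exists_numerators : exists p, numerators p.
Proof.
have /choice[pd pdE] i : exists pd : {poly int} * {poly int}, pd.2 != 0 /\ a i * tf pd.2 = tf pd.1.
  by have [p [d pd]] := exists_fraction (a i); exists (p, d).
exists (fun i => (pd i).1 * \prod_(j | j != i) (pd j).2), (tf (\prod_j (pd j).2)).
  by rewrite tofrac_eq0; apply/prodf_neq0 => j _; case: (pdE j).
by move=> i; rewrite (bigD1 i) //= !tofracM -(pdE i).2 mulrC mulrA.
Qed.

Lemma numerators_div_root p q : numerators p -> (forall i, p i = q i * ('X - 1%:P)) -> numerators q.
Proof.
move=> [c c_neq0 pE] qE; have x_neq0 : tf ('X - 1%:P : {poly int}) != 0 by rewrite tofrac_eq0 polyXsubC_eq0.
exists (c / tf ('X - 1%:P)) => [|i]; first by apply: mulf_neq0 c_neq0 _; rewrite invr_eq0.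
by rewrite mulrAC pE qE tofracM; apply: mulfK.
Qed.

Lemma sum_size_div_root (p q : I -> {poly int}) i0 : (forall i, p i = q i * ('X - 1%:P)) -> p i0 != 0 ->
  (\sum_i size (q i) < \sum_i size (p i))%N.
Proof.
move=> qE p_neq0.
have size_p i : q i != 0 -> size (p i) = (size (q i)).+1.
  by move=> qi_neq0; rewrite qE size_Mmonic ?monicXsubC // size_XsubC addn2.
have q_neq0 : q i0 != 0 by apply: contraNneq p_neq0 => q0; rewrite qE q0 mul0r.
rewrite (bigD1 i0) //= [X in (_ < X)%N](bigD1 i0) //= size_p // addSn ltnS leq_add2l.
apply: leq_sum => i _; case: (eqVneq (q i) 0) => [->|qi_neq0]; first by rewrite size_poly0.
by rewrite size_p.
Qed.

(* Common numerators of minimal total size are not all divisible by [X - 1]. *)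
Lemma exists_primitive_scaling i0 : a i0 != 0 ->
  exists c : K, [/\ c != 0, forall i, isLaurent (c * a i) & exists i, specialize (c * a i) != 0].
Proof.
move=> ai0_neq0.
have [p p_num p_min] := exists_minimizer (fun p : I -> {poly int} => \sum_i size (p i))%N exists_numerators.
have [c c_neq0 pE] := p_num; exists c; split=> //; first by move=> i; rewrite pE; exact: laurent_poly.
apply: contrapT => all_eq0.
have /choice[q qE] i : exists q, p i = q * ('X - 1%:P).
  apply/factor_theorem/rootP/eqP; apply: contrapT => /negP pi1; apply: all_eq0; exists i.
  by rewrite pE specialize_poly intr_eq0.
have p_neq0 : p i0 != 0 by rewrite -tofrac_eq0 -pE; exact: mulf_neq0 c_neq0 ai0_neq0.
by have := p_min q (numerators_div_root p_num qE); rewrite leqNgt (sum_size_div_root qE p_neq0).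
Qed.

End PrimitiveScaling.

Lemma K_sum_sqr_eq0 (I : finType) (a : I -> K) : \sum_i a i ^+ 2 = 0 -> forall i, a i = 0.
Proof.
move=> sum0 i0; apply: contrapT => /eqP /exists_primitive_scaling[c [_ ca_laurent [i ca_neq0]]].
have : \sum_i (c * a i) ^+ 2 = 0.
  by under eq_bigr do rewrite exprMn; rewrite -mulr_sumr sum0 mulr0.
move/(congr1 specialize); rewrite (specialize_bool false) specialize_sum; last first.
  by move=> j _; rewrite expr2; exact: laurentM.
rewrite (eq_bigr (fun j => specialize (c * a j) ^+ 2)) => [|j _]; last by rewrite expr2 specializeM.
move/psumr_eq0P => /(_ (fun j _ => sqr_ge0 _) i isT)/eqP.
by rewrite sqrf_eq0 (negbTE ca_neq0).
Qed.

(** * Counting involutions *)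

Section InnerInvolution.
Variable n : nat.
Hypothesis hn : (2 <= n)%N.
Implicit Types (f g : int -> int) (x i : int).

(* Entries matched outside [-n, n] become fixed points, signed according to the side of their partner. *)
Definition inner_fun f x : int :=
  if n%:Z < `|x| then x else if `|f x| <= n%:Z then f x else if 0 < f x then `|x| else - `|x|.

Lemma inner_funN f x : Gfun n f -> inner_fun f (- x) = - inner_fun f x.
Proof.
move=> fG; have [fN _ _ _ _] := fG; rewrite /inner_fun normrN fN normrN; case: ifP => // _; case: ifP => // fx_out.
have : f x != 0 by move: fx_out; move: (f x) => y; clear; lia.
by move: (f x) => y; clear; case: ifP; case: ifP; lia.
Qed.

Lemma inner_fun_fixed f x : Gfun n f -> `|x| <= n%:Z -> x != 0 ->
  (`|inner_fun f x| == `|x|) = (n%:Z < `|f x|).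
Proof.
move=> [_ _ f_neq _ _] xn x0; have := f_neq x x0; rewrite /inner_fun; move: xn x0; move: (f x) => y; clear -hn.
by move=> *; repeat (case: ifP => ?); lia.
Qed.

Lemma inner_funK f : Gfun n f -> involutive (inner_fun f).
Proof.
move=> fG x; have [_ fK _ _ _] := fG; case: (leP `|x| n%:Z) => xn; last by rewrite /inner_fun xn xn.
case: (leP `|f x| n%:Z) => fx.
  have -> : inner_fun f x = f x by rewrite /inner_fun ltNge xn fx.
  by rewrite /inner_fun ltNge fx /= fK xn.
have [fixed|flipped] : inner_fun f x = x \/ inner_fun f x = - x.
- by rewrite /inner_fun; move: xn fx; move: (f x) => y; clear; repeat (case: ifP => ?); lia.
- by rewrite fixed fixed.
- by rewrite flipped inner_funN // flipped opprK.
Qed.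

Lemma Gfun_outer_cases f i : Gfun n f -> n%:Z < i -> i <= n.*2%:Z -> n%:Z < f i \/ `|f i| <= n%:Z.
Proof.
move=> [fN fK f_neq _ f_asc] n_lt le_2n; have [_ fi_ge] := f_asc i n_lt; have i0 : i != 0 by lia.
have i_le : `|i| <= n.*2%:Z by lia.
have fi_neq := f_neq i i0 i_le; case: (leP `|f i| n%:Z) => fi_out; first by right.
left; case: (ltP n%:Z (f i)) => // fi_le.
have n_lt_opp : n%:Z < - f i by move: fi_out fi_le; clear; lia.
have [_] := f_asc _ n_lt_opp; rewrite fN fK.
by move: fi_neq fi_ge n_lt_opp i_le n_lt; move: (f i) => y; clear; lia.
Qed.

Lemma Gfun_outer_le f (k : nat) i : Gfun n f -> n%:Z < i -> `|f (i + k%:Z)| <= n%:Z -> f i <= f (i + k%:Z).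
Proof.
move=> fG; elim: k i => [|k IH] i n_lt; first by rewrite addr0.
have -> : i + k.+1%:Z = i + k%:Z + 1 by lia.
move=> inner; have [_ _ _ f_out f_asc] := fG; have n_lt_ik : n%:Z < i + k%:Z by lia.
have [asc _] := f_asc _ n_lt_ik.
have le_succ : f (i + k%:Z) <= f (i + k%:Z + 1).
  by move: asc inner n_lt_ik; move: (f (i + k%:Z)) (f (i + k%:Z + 1)) => y y'; clear; lia.
apply: (le_trans _ le_succ); apply: IH => //.
have le_2n : i + k%:Z <= n.*2%:Z.
  by case: (leP (i + k%:Z) n.*2%:Z) => // lt_2n; move: inner; rewrite f_out; clear -lt_2n n_lt_ik; lia.
case: (Gfun_outer_cases fG n_lt_ik le_2n) => // outer; exfalso.
by have := lt_le_trans outer (le_trans le_succ (le_trans (ler_norm _) inner)); rewrite ltxx.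
Qed.

Lemma Gfun_outer_succ f i : Gfun n f -> n%:Z < i -> i < f i -> f i = i + 1.
Proof.
move=> fG n_lt lt_f; have [_ fK _ _ f_asc] := fG; apply: contrapT => neq_succ.
have stays_above (k : nat) : i + k%:Z < f i -> i < f (i + k%:Z).
  elim: k => [|k IH]; first by rewrite addr0.
  move=> lt_fi; have [asc _] := f_asc (i + k%:Z) ltac:(lia).
  have succE : i + k%:Z + 1 = i + k.+1%:Z by lia.
  have above := IH ltac:(lia); rewrite succE in asc.
  have neq_i : f (i + k.+1%:Z) <> i by move=> fixed; have := fK (i + k.+1%:Z); rewrite fixed; lia.
  by move: asc above neq_i; move: (f (i + k%:Z)) (f (i + k.+1%:Z)) => y y'; clear; lia.
pose k := absz (f i - 1 - i)%R.
have kE : i + k%:Z + 1 = f i by rewrite /k; move: lt_f neq_succ; move: (f i) => y; clear; lia.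
have [asc _] := f_asc (i + k%:Z) ltac:(lia); rewrite kE fK in asc.
have := stays_above k ltac:(lia); have : k != 0%N by move: kE lt_f neq_succ; move: (f i) => y; clear; lia.
by move: asc; move: (f (i + k%:Z)) => y; clear; lia.
Qed.

Lemma inner_fun_determines_le f g i : Gfun n f -> Gfun n g -> inner_fun f =1 inner_fun g ->
  (forall j : int, n%:Z < j -> j < i -> f j = g j) -> n%:Z < i -> `|f i| <= n%:Z -> g i <= f i.
Proof.
move=> fG gG inner_eq IH n_lt fi_le; have [_ fK _ _ _] := fG; have [_ gK _ _ _] := gG.
have fi_neq0 : f i != 0 by apply: (Gfun_neq0 fG); move: n_lt; clear; lia.
have gfi_out : n%:Z < `|g (f i)|.
  have := inner_fun_fixed gG fi_le fi_neq0; rewrite -inner_eq (inner_fun_fixed fG fi_le fi_neq0) fK => <-.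
  by move: n_lt; clear; lia.
have gfi_gt : n%:Z < g (f i).
  have := inner_eq (f i); rewrite /inner_fun ltNge fi_le /= fK.
  have -> : (`|i| <= n%:Z) = false by move: n_lt; clear; lia.
  have -> : 0 < i by move: n_lt; clear; lia.
  have -> : (`|g (f i)| <= n%:Z) = false by move: gfi_out; clear; lia.
  by move: gfi_out fi_neq0; move: (g (f i)) (f i) => y u; clear; case: ifP; lia.
case: (ltrgtP (g (f i)) i) => gfi.
- by have := IH _ gfi_gt gfi; rewrite gK => /(congr1 f); rewrite !fK => fixed; move: gfi; rewrite fixed ltxx.
- have [k kE] : exists k : nat, g (f i) = i + k%:Z by exists (absz (g (f i) - i)); move: gfi; clear; lia.
  by have := Gfun_outer_le (k := k) gG n_lt; rewrite -kE gK; apply.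
- by rewrite -{1}gfi gK.
Qed.

Lemma inner_fun_determines_outer f g i : Gfun n f -> Gfun n g -> inner_fun f =1 inner_fun g -> n%:Z < i -> f i = g i.
Proof.
move=> fG gG inner_eq n_lt; have [_ fK _ f_out _] := fG; have [_ gK _ g_out _] := gG.
have [k] : exists k : nat, i <= n%:Z + k%:Z by exists (absz (i - n%:Z)); lia.
elim: k i n_lt => [|k IH] i n_lt i_le; first by exfalso; move: n_lt i_le; clear; lia.
have {}IH j : n%:Z < j -> j < i -> f j = g j by move=> n_ltj ji; apply: IH => //; move: ji i_le; clear; lia.
case: (leP i n.*2%:Z) => i2; last by rewrite f_out ?g_out //; move: i2; clear; lia.
have g_le := inner_fun_determines_le fG gG inner_eq IH n_lt.
have f_le : `|g i| <= n%:Z -> f i <= g i.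
  by apply: (inner_fun_determines_le gG fG) => // j n_ltj ji; rewrite IH.
have g_cases := Gfun_outer_cases gG n_lt i2.
case: (Gfun_outer_cases fG n_lt i2) => fi; last first.
  by have := g_le fi; move: f_le fi g_cases; move: (f i) (g i) => y y'; clear; lia.
case: g_cases => gi; last by have := f_le gi; move: fi gi; move: (f i) (g i) => y y'; clear; lia.
have [i_neq0 i_le2] : i != 0 /\ `|i| <= n.*2%:Z by move: n_lt i2; clear; split; lia.
have [/eqP f_neq _] := Gfun_neq fG i_neq0 i_le2; have [/eqP g_neq _] := Gfun_neq gG i_neq0 i_le2.
case: (ltrgtP (f i) i) => // f_cmp.
  by have := IH _ fi f_cmp; rewrite fK => gfi; rewrite -[f i]gK -gfi.
case: (ltrgtP (g i) i) => // g_cmp.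
  by have := IH _ gi g_cmp; rewrite gK => fgi; rewrite -[g i]fK fgi.
by rewrite (Gfun_outer_succ fG n_lt f_cmp) (Gfun_outer_succ gG n_lt g_cmp).
Qed.

Lemma inner_fun_inj f g : Gfun n f -> Gfun n g -> inner_fun f =1 inner_fun g -> f =1 g.
Proof.
move=> fG gG inner_eq; have [fN fK _ _ _] := fG; have [gN gK _ _ _] := gG.
have outer i : n%:Z < `|i| -> f i = g i.
  move=> i_out; case: (leP 0 i) => i_sign; first by apply: inner_fun_determines_outer => //; lia.
  have /oppr_inj // : - f i = - g i; rewrite -fN -gN; apply: inner_fun_determines_outer => //; lia.
move=> x; case: (leP `|x| n%:Z) => xn; last exact: outer.
case: (eqVneq x 0) => [->|x0]; first by rewrite (Gfun0 fG) (Gfun0 gG).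
case: (ltP n%:Z `|f x|) => fx; first by have := outer _ fx; rewrite fK => gfx; rewrite -[f x]gK -gfx.
have := inner_fun_fixed gG xn x0; rewrite -inner_eq inner_fun_fixed // ltNge fx /= => /esym/negbT.
by rewrite -leNgt => gx; have := inner_eq x; rewrite /inner_fun ltNge xn /= fx gx.
Qed.

Lemma inner_fun_lt_opp f i : Gfun n f -> 0 < i -> i <= n%:Z -> (f i < - i) = (inner_fun f i <= - i).
Proof.
move=> [_ _ f_neq _ _] i_gt0 i_le; have i_neq0 : i != 0 by lia.
have i_le2 : `|i| <= n.*2%:Z by lia.
have := f_neq i i_neq0 i_le2; rewrite /inner_fun; move: i_gt0 i_le; move: (f i) => y; clear.
by repeat (case: ifP => ?); lia.
Qed.

Definition flip_sign (a : nat) x : int := if `|x| == a.+1%:Z then - x else x.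

Lemma flip_signN a x : flip_sign a (- x) = - flip_sign a x.
Proof. by rewrite /flip_sign normrN; case: ifP. Qed.

Lemma flip_sign_abs a x : `|flip_sign a x| = `|x|.
Proof. by rewrite /flip_sign; case: ifP => //; rewrite normrN. Qed.

Lemma flip_signK a : involutive (flip_sign a).
Proof. by move=> x; rewrite {1}/flip_sign flip_sign_abs /flip_sign; case: eqP => _; rewrite ?opprK. Qed.

Variable t : CoxType.
Hypothesis tn : t = TD -> odd n.
Notation W := (WW t n).
Implicit Type z : P n.

Definition outer_index z : nat := find (fun i : nat => n%:Z < `|apZ z i.+1%:Z|) (iota 0 n).

(* Otherwise [i |-> |z i|] would be a fixed-point-free involution of [1 .. n]. *)
Lemma outer_indexP z : t = TD -> z \in Gset t n -> (outer_index z < n)%N /\ n%:Z < `|apZ z (outer_index z).+1%:Z|.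
Proof.
move=> tD zG; have [zN zK z_neq _ _] := Gset_Gfun hn zG.
suff has_outer : has (fun i : nat => n%:Z < `|apZ z i.+1%:Z|) (iota 0 n).
  have index_lt : (outer_index z < n)%N by move: has_outer; rewrite has_find size_iota.
  by split=> //; have := nth_find 0%N has_outer; rewrite -/(outer_index z) nth_iota.
apply: contraT => /hasPn no_outer; have := tn tD; rewrite -(size_iota 1 n); apply: contraLR => _.
apply: (even_size_fpf_involution (f := fun i : nat => absz (apZ z i%:Z))); first exact: iota_uniq.
move=> i; rewrite !mem_iota => hi; have := no_outer i.-1; rewrite mem_iota prednK; last by lia.
have := Gfun_neq0 (Gset_Gfun hn zG) (x := i%:Z); have := z_neq i%:Z.
have : apZ z `|apZ z i%:Z| = i%:Z \/ apZ z `|apZ z i%:Z| = - i%:Z.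
  by case: (ltrP (apZ z i%:Z) 0) => zi; rewrite ?(ltr0_norm zi) ?(ger0_norm zi) ?zN zK; [right|left].
have -> : `|apZ z i%:Z| = (absz (apZ z i%:Z))%:Z by [].
by move: (apZ z i%:Z) => y; move: (apZ z (absz y)%:Z) => y'; split; lia.
Qed.

Definition odd_negatives f := odd (count (fun i : nat => f i%:Z < 0) (iota 1 n)).

Definition flip_needed z : bool := if t is TD then odd_negatives (inner_fun (apZ z)) else false.

Definition inner_fun_typed z : int -> int :=
  if flip_needed z then fun x => inner_fun (apZ z) (flip_sign (outer_index z) x) else inner_fun (apZ z).

Lemma inner_fun_flip z : t = TD -> z \in Gset t n ->
  {morph inner_fun (apZ z) : x / flip_sign (outer_index z) x}.
Proof.
move=> tD zG; have zF := Gset_Gfun hn zG; have [index_lt index_out] := outer_indexP tD zG.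
have abs_outer x : `|x| = (outer_index z).+1%:Z -> `|inner_fun (apZ z) x| = (outer_index z).+1%:Z.
  move=> x_abs; have x_le : `|(outer_index z).+1%:Z| <= n%:Z by move: index_lt; clear; lia.
  have inner_abs : `|inner_fun (apZ z) (outer_index z).+1%:Z| = (outer_index z).+1%:Z.
    by apply/eqP; rewrite -[X in _ == X]/(`|(outer_index z).+1%:Z|) inner_fun_fixed.
  have [->|->] : x = (outer_index z).+1%:Z \/ x = - (outer_index z).+1%:Z by move: x_abs; clear; lia.
    exact: inner_abs.
  by rewrite inner_funN // normrN.
move=> x; rewrite /flip_sign; case: eqP => x_abs.
  by rewrite abs_outer // eqxx inner_funN.
by case: eqP => // /abs_outer; rewrite (inner_funK zF) => /x_abs.
Qed.

Lemma odd_count_flip (c : nat -> int -> bool) z : t = TD -> z \in Gset t n ->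
  (forall (i : nat) x, `|x| = i.+1%:Z -> c i.+1 (- x) = ~~ c i.+1 x) ->
  odd (count (fun i : nat => c i (inner_fun (apZ z) (flip_sign (outer_index z) i%:Z))) (iota 1 n)) =
  ~~ odd (count (fun i : nat => c i (inner_fun (apZ z) i%:Z)) (iota 1 n)).
Proof.
move=> tD zG cN; have zF := Gset_Gfun hn zG; have [index_lt index_out] := outer_indexP tD zG.
rewrite -(odd_count_toggle _ (x := (outer_index z).+1)) ?iota_uniq ?mem_iota //.
congr odd; apply: eq_count => i; rewrite /flip_sign.
have -> : (`|i%:Z| == (outer_index z).+1%:Z) = (i == (outer_index z).+1) by [].
case: eqP => [->|_]; last by rewrite addbF.
rewrite inner_funN // cN ?addbT //; apply/eqP.
have index_le : `|(outer_index z).+1%:Z| <= n%:Z by move: index_lt; clear; lia.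
by rewrite -[X in _ == X]/(`|(outer_index z).+1%:Z|) inner_fun_fixed.
Qed.

Lemma inner_fun_typedP z : z \in Gset t n ->
  [/\ {morph inner_fun_typed z : x / - x}, involutive (inner_fun_typed z),
      forall x, n%:Z < `|x| -> inner_fun_typed z x = x &
      forall x, `|x| <= n%:Z -> x != 0 -> (`|inner_fun_typed z x| == `|x|) = (n%:Z < `|apZ z x|)].
Proof.
move=> zG; have zF := Gset_Gfun hn zG; rewrite /inner_fun_typed /flip_needed.
case flip : (if t is TD then _ else _); last first.
  by split=> [x|x|x x_out|x]; [exact: inner_funN | exact: inner_funK | rewrite /inner_fun x_out | exact: inner_fun_fixed].
have tD : t = TD by move: flip; case: (t).
have [index_lt _] := outer_indexP tD zG; have flipE := inner_fun_flip tD zG.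
split=> [x|x|x x_out|x x_le x_neq0].
- by rewrite flip_signN inner_funN.
- by rewrite -flipE flip_signK inner_funK.
- rewrite /flip_sign; case: eqP => [x_abs|_]; last by rewrite /inner_fun x_out.
  by exfalso; move: x_abs x_out index_lt; clear; lia.
- by rewrite flipE flip_sign_abs inner_fun_fixed.
Qed.

Definition inner_perm z : P n := perm_of_fun n.*2 (inner_fun_typed z).

Lemma inner_permE z : z \in Gset t n -> apZ (inner_perm z) =1 inner_fun_typed z.
Proof.
move=> zG; have [_ innerK inner_out _] := inner_fun_typedP zG.
by apply: perm_of_funE => [|x x_out]; [exact: can_inj innerK | apply: inner_out; lia].
Qed.

Lemma inner_perm_involution z : z \in Gset t n -> inner_perm z \in W /\ (inner_perm z)^-1%g = inner_perm z.
Proof.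
move=> zG; have [innerN innerK inner_out _] := inner_fun_typedP zG; have permE := inner_permE zG.
split; last by apply: eq_apZ => x; apply: (@apZ_inj _ (inner_perm z)); rewrite apZKV !permE innerK.
have perm_BC : isBC (inner_perm z) by apply/isBCP => x; rewrite !permE innerN.
have perm_fix : fixBeyond n (inner_perm z) by apply/fixBeyondP => x x_out; rewrite permE inner_out.
rewrite (WW_signed_group hn) /signed_group; case tE : t; rewrite /= !inE perm_BC perm_fix //=.
  apply/allP => i; rewrite mem_iota permE /inner_fun_typed /flip_needed tE => hi.
  have /(GsetP hn)[_] := zG; rewrite tE /= => pos.
  have zi_gt0 : 0 < apZ z i%:Z by apply: pos; move: hi; clear; lia.
  by rewrite /inner_fun; move: zi_gt0 hi; move: (apZ z _) => y; clear; repeat (case: ifP => ?); lia.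
rewrite /evenNeg (eq_count (a2 := fun i : nat => inner_fun_typed z i%:Z < 0)); last by move=> i; rewrite /= permE.
rewrite /inner_fun_typed /flip_needed tE; case odd_neg : (odd_negatives _); last exact: negbT odd_neg.
rewrite (odd_count_flip (c := fun=> (fun x => x < 0)) tE zG) ?negbK; first exact: odd_neg.
by move=> i x; lia.
Qed.

Lemma outer_index_determined z z' : z \in Gset t n -> z' \in Gset t n ->
  inner_fun_typed z =1 inner_fun_typed z' -> outer_index z = outer_index z'.
Proof.
move=> zG zG' inner_eq; apply: eq_in_find => i; rewrite mem_iota => hi.
have [_ _ _ abs_inner] := inner_fun_typedP zG; have [_ _ _ abs_inner'] := inner_fun_typedP zG'.
have i_le : `|i.+1%:Z| <= n%:Z by move: hi; clear; lia.
by rewrite -abs_inner // -abs_inner' // inner_eq.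
Qed.

(* Flipping changes the parity of [#{i | inner_fun i <= - i}], which is even in type D. *)
Lemma flip_needed_determined z z' : z \in Gset t n -> z' \in Gset t n ->
  inner_fun_typed z =1 inner_fun_typed z' -> flip_needed z -> flip_needed z'.
Proof.
have even_lt_opp y : t = TD -> y \in Gset t n -> ~~ odd (count (fun i : nat => inner_fun (apZ y) i%:Z <= - i%:Z) (iota 1 n)).
  move=> tD yG; have /(GsetP hn)[yF] := yG; rewrite tD /type_cond (@eq_in_count _ _ (fun i : nat => inner_fun (apZ y) i%:Z <= - i%:Z)) //.
  by move=> i; rewrite mem_iota => hi; apply: inner_fun_lt_opp => //; move: hi; clear; lia.
move=> zG zG' inner_eq flip; have tD : t = TD by move: flip; rewrite /flip_needed; case: (t).
apply: contraT => /negbTE no_flip; have := even_lt_opp z' tD zG'.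
rewrite (eq_count (a2 := fun i : nat => inner_fun (apZ z) (flip_sign (outer_index z) i%:Z) <= - i%:Z)) => [|i].
  rewrite (odd_count_flip (c := fun (i : nat) x => x <= - i%:Z) tD zG) ?even_lt_opp //.
  by move=> i x; lia.
by have := inner_eq i; rewrite /inner_fun_typed flip no_flip => ->.
Qed.

Lemma inner_perm_inj : {in Gset t n &, injective inner_perm}.
Proof.
move=> z z' zG zG' perm_eq.
have inner_eq x : inner_fun_typed z x = inner_fun_typed z' x by rewrite -inner_permE // perm_eq inner_permE.
have index_eq := outer_index_determined zG zG' inner_eq.
have flip_eq : flip_needed z = flip_needed z'.
  by apply/idP/idP; apply: flip_needed_determined => // x; rewrite inner_eq.
apply: eq_apZ; apply: inner_fun_inj (Gset_Gfun hn zG) (Gset_Gfun hn zG') _ => x.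
move: inner_eq; rewrite /inner_fun_typed -flip_eq -index_eq; case: ifP => _ inner_eq //.
by rewrite -(flip_signK (outer_index z) x) inner_eq.
Qed.

Lemma card_Gset_le : (#|Gset t n| <= #|[set w in W | w^-1%g == w]|)%N.
Proof.
rewrite -(card_in_imset inner_perm_inj); apply: subset_leq_card; apply/subsetP => _ /imsetP[z zG ->].
by rewrite inE; have [-> ->] := inner_perm_involution zG; rewrite eqxx.
Qed.

End InnerInvolution.

(** * The Gelfand models *)

Section SpecializedMatrix.
Variables (t : CoxType) (n : nat).
Notation G := (Gt t n).
Notation V := (Vmod t n).
Notation d := #|{: G}|.
Implicit Types (f g : V -> V) (z y : G).

Definition laurent_map f := forall z y, isLaurent (f (bM t n (val z)) y).

Definition spec_mx f : 'M[rat]_d :=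
  \matrix_(i, j) specialize (f (bM t n (val (enum_val j))) (enum_val i)).

Lemma linear_coef f u y : linear f -> f u y = \sum_(z : G) (u z : K) * f (bM t n (val z)) y.
Proof.
move=> fL; rewrite {1}(bM_expand u) (linear_fun_sum fL) sum_ffunE.
by apply: eq_bigr => z _; rewrite (linear_funZ fL) ffunE.
Qed.

Lemma spec_mx_id : spec_mx id = 1%:M.
Proof.
by apply/matrixP => i j; rewrite !mxE ffunE specialize_bool (inj_eq val_inj) (inj_eq enum_val_inj).
Qed.

Lemma laurent_map_scale k f : isLaurent k -> laurent_map f -> laurent_map (fun v => k *: f v).
Proof. by move=> k_laurent f_laurent z y; rewrite ffunE; exact: laurentM. Qed.

Lemma spec_mx_scale k f : isLaurent k -> laurent_map f -> spec_mx (fun v => k *: f v) = specialize k *: spec_mx f.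
Proof.
move=> k_laurent f_laurent; apply/matrixP => i j; rewrite !mxE ffunE.
exact: (specializeM k_laurent (f_laurent _ _)).
Qed.

Lemma spec_mx_add f g : laurent_map f -> laurent_map g -> spec_mx (fun v => f v + g v) = spec_mx f + spec_mx g.
Proof.
move=> f_laurent g_laurent; apply/matrixP => i j; rewrite !mxE ffunE.
exact: (specializeD (f_laurent _ _) (g_laurent _ _)).
Qed.

Lemma spec_mx_comp f g : linear f -> laurent_map f -> laurent_map g ->
  spec_mx (f \o g) = spec_mx f *m spec_mx g.
Proof.
move=> fL f_laurent g_laurent; apply/matrixP => i j; rewrite !mxE /= linear_coef //.
rewrite specialize_sum => [|z _]; last exact: (laurentM (g_laurent _ _) (f_laurent _ _)).
rewrite (reindex _ (onW_bij _ (enum_val_bij G))) /=; apply: eq_bigr => k _.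
by rewrite !mxE [RHS]mulrC; exact: (specializeM (g_laurent _ _) (f_laurent _ _)).
Qed.

Lemma exists_primitive_multiple f : linear f -> (exists v, f v != 0) ->
  exists c : K, laurent_map (fun v => c *: f v) /\ spec_mx (fun v => c *: f v) != 0.
Proof.
move=> fL [v fv_neq0].
have [zy coef_neq0] : exists zy : G * G, (f (bM t n (val zy.1)) zy.2 : K) != 0.
  apply: contrapT => all0; case/eqP: fv_neq0; apply/ffunP => y; rewrite ffunE linear_coef // big1 // => z _.
  rewrite (_ : f _ y = 0) ?mulr0 //; apply: contrapT => /eqP coef_neq0.
  by apply: all0; exists (z, y).
have [c [_ c_laurent [[z y] cf_neq0]]] :=
  exists_primitive_scaling (a := fun zy : G * G => f (bM t n (val zy.1)) zy.2 : K) coef_neq0.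
exists c; split=> [z' y'|]; first by rewrite ffunE; exact: (c_laurent (z', y')).
apply: contra cf_neq0 => /eqP/matrixP/(_ (enum_rank y) (enum_rank z)).
by rewrite !mxE !enum_rankK ffunE => /eqP.
Qed.

End SpecializedMatrix.

Section GeneratedRepresentation.
Variables (t : CoxType) (n d : nat) (rep : P n -> 'M[rat]_d).
Hypothesis hn : (2 <= n)%N.
Let hnN : (2 <= n <= n.*2)%N. Proof. lia. Qed.
Notation W := (WW t n).
Notation SG := (Sgen t n).
Hypothesis rep1 : rep 1%g = 1%:M.
Hypothesis rep_mul_gen : forall s w, s \in SG -> w \in W -> rep (permc s w) = rep s *m rep w.
Hypothesis trmx_rep_gen : forall s, s \in SG -> (rep s)^T = rep s.

Lemma rep_permc u w : u \in W -> w \in W -> rep (permc u w) = rep u *m rep w.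
Proof.
move=> uW wW; move: u uW; apply: (WW_ind hn) => [|s u sS uW _ IH].
  by rewrite /permc mulg1 rep1 mul1mx.
have suW := WW_mul_gen hn sS uW.
have -> : permc u w = permc s (permc (permc s u) w) by rewrite -{1}(gen_mulK hn u sS) /permc mulgA.
by rewrite (rep_mul_gen sS (WW_permc hn suW wW)) IH mulmxA -(rep_mul_gen sS suW) (gen_mulK hn _ sS).
Qed.

Lemma trmx_rep_inv w : w \in W -> (rep w)^T = rep w^-1%g.
Proof.
move: w; apply: (WW_ind hn) => [|s w sS wW _ IH]; first by rewrite invg1 rep1 trmx1.
have swW := WW_mul_gen hn sS wW; have sW := gen_WW hn sS.
rewrite -{1}(gen_mulK hn w sS) (rep_mul_gen sS swW) trmx_mul IH (trmx_rep_gen sS) -(rep_permc (WW_inv hn swW) sW).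
by congr rep; rewrite /permc invMg (gensV hnN sS) mulgA (gens_invol hnN sS) mul1g.
Qed.

Lemma gen_commutant (c : 'M[rat]_d) : (forall s, s \in SG -> rep s *m c = c *m rep s) ->
  forall w, w \in W -> rep w *m c = c *m rep w.
Proof.
move=> c_gen; apply: (WW_ind hn) => [|s w sS wW _ IH]; first by rewrite rep1 mul1mx mulmx1.
by rewrite -(gen_mulK hn w sS) (rep_mul_gen sS) ?WW_mul_gen // -mulmxA IH mulmxA c_gen // mulmxA.
Qed.

End GeneratedRepresentation.

Section LengthOfConjugates.
Variables (t : CoxType) (n : nat).
Hypothesis hn : (2 <= n)%N.
Let hN : (2 <= n.*2 <= n.*2)%N. Proof. lia. Qed.
Let hnN : (2 <= n <= n.*2)%N. Proof. lia. Qed.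
Notation BG := (gens t n.*2 n.*2).
Notation cj s z := (permc s (permc z s)).

Lemma wordlen_left_ascent s (w : P n) : s \in BG -> w \in <<[set:: BG]>>%g -> left_ascent t n.*2 s w ->
  wordlen BG (permc s w) = (wordlen BG w).+1.
Proof. exact: (wordlen_asc (gens_invol hN) (left_ascent1 hN) (left_ascent_mul hN) (left_ascent_exchange hN)). Qed.

Lemma left_ascent_conj s z : s \in Sgen t n -> z \in Gset t n -> gen_kind t s z = AscLtK ->
  left_ascent t n.*2 s (permc z s).
Proof.
move=> sS zG k; have [p [q [r sE]]] := gen_simple_root hnN sS.
have := gen_kindP hn sS zG; rewrite k => /(AscLtP hn zG r sE sS)[lt nD nA].
have zF := Gset_Gfun hn zG; have [zN _ _ _ _] := zF.
have uV : ((permc z s)^-1)%g = permc s z by rewrite /permc invMg (Gset_invg hn zG) (gensV hN (Sgen_widen hn sS)).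
rewrite (left_ascentE _ (simple_root_widen hn r) sE) uV !apZ_permc !sE ltNge; apply/negP => reversed.
have [p0 q0] := simple_root_neq0 r; have [pn _] := simple_root_le hn r.
have zp0 := Gfun_neq0 zF p0; have zq0 := Gfun_neq0 zF q0.
have [zp_neq _] : apZ z p != p /\ apZ z p != - p by apply: (Gfun_neq zF p0); move: pn; clear; lia.
move: nD; rewrite /is_desEq.
case: (eqVneq (apZ z p) (- apZ z q)) => zpq.
  have [[zp _]|[pE qE]] := stransp_reversal_opp r lt zpq reversed; first by rewrite zp eqxx in zp_neq.
  have : apZ z p = apZ z (- q) by rewrite zN.
  by move/(@apZ_inj _ z); rewrite pE qE.
have [[zp _]|[-> _]] := stransp_reversal r zp0 zq0 lt zpq reversed; first by rewrite zp eqxx in zp_neq.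
by rewrite normrN eqxx.
Qed.

Lemma lenBig_conj s z : s \in Sgen t n -> z \in Gset t n -> gen_kind t s z = AscLtK ->
  lenBig t n (cj s z) = (lenBig t n z).+2.
Proof.
move=> sS zG k; have [p [q [r sE]]] := gen_simple_root hnN sS.
have := gen_kindP hn sS zG; rewrite k => /(AscLtP hn zG r sE sS)[lt _ _].
have sB := Sgen_widen hn sS; have zB := Gset_gens hn zG.
have s_gen : s \in <<[set:: BG]>>%g by apply: mem_gen; rewrite inE.
have zsB : permc z s \in <<[set:: BG]>>%g by rewrite /permc groupM.
have zsV : ((permc z s)^-1)%g = permc s z by rewrite /permc invMg (Gset_invg hn zG) (gensV hN sB).
rewrite /lenBig wordlen_left_ascent ?left_ascent_conj // -(wordlen_invg (gens_invol hN) zsB) zsV.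
by rewrite wordlen_left_ascent // (left_ascent_Gset hn zG r sE).
Qed.

End LengthOfConjugates.

Section GelfandModel.
Variables (t : CoxType) (n : nat).
Hypothesis hn : (2 <= n)%N.
Hypothesis tn : t = TD -> odd n.
Let hnN : (2 <= n <= n.*2)%N. Proof. lia. Qed.
Notation W := (WW t n).
Notation SG := (Sgen t n).
Notation G := (Gt t n).
Notation V := (Vmod t n).
Notation cj s z := (permc s (permc z s)).
Notation d := #|{: G}|.

Variables (eA eD : K) (b : bool).
Hypotheses (lA : isLaurent eA) (lD : isLaurent eD).
Hypotheses (eA1 : specialize eA = - (-1) ^+ b) (eD1 : specialize eD = (-1) ^+ b).
Variable rho : P n -> V -> V.
Hypothesis rho_rep : isHrep t n rho.
Hypothesis rho_rules : eigen_rules eA eD rho.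
Implicit Types s w : P n.

Let rho_hecke : heckeRep W SG (lenW t n) xK rho := rho_rep.1.

Lemma rho_linear w : w \in W -> linear (rho w).
Proof. exact: rho_hecke.1. Qed.

Lemma laurent_rho w : w \in W -> laurent_map (rho w).
Proof.
move=> wW z y; apply: rho_rep.2 => // x; rewrite ffunE; exact: laurent_bool.
Qed.

Lemma rho_genE s (z y : G) : s \in SG -> rho s (bM t n (val z)) y = gen_coef t eA eD s (val z) (val y).
Proof. by move=> sS; have /(eigen_rulesP hn) -> := rho_rules; last exact: valP. Qed.

Definition spec_rep w := spec_mx (rho w).

Lemma spec_rep1 : spec_rep 1%g = 1%:M.
Proof. by rewrite -spec_mx_id; apply/matrixP => i j; rewrite !mxE rho_hecke.2.1. Qed.

Lemma spec_rep_mul_gen s w : s \in SG -> w \in W -> spec_rep (permc s w) = spec_rep s *m spec_rep w.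
Proof.
move=> sS wW; have sW := gen_WW hn sS; have swW := WW_mul_gen hn sS wW.
have lw := laurent_rho wW; have lsw := laurent_rho swW.
rewrite /spec_rep -(spec_mx_comp (rho_linear sW) (laurent_rho sW) lw).
case lt : (lenW t n w < lenW t n (permc s w))%N.
  by apply/matrixP => i j; rewrite !mxE /= rho_hecke.2.2 // lt.
transitivity (spec_mx (fun v => rho (permc s w) v + (xK - xK^-1) *: rho w v)); last first.
  by apply/matrixP => i j; rewrite !mxE /= rho_hecke.2.2 // lt.
have la := laurent_xK_subV; rewrite spec_mx_add // ?spec_mx_scale //; last exact: laurent_map_scale.
by rewrite specialize_xK_subV scale0r addr0.
Qed.

Lemma trmx_spec_rep_gen s : s \in SG -> (spec_rep s)^T = spec_rep s.
Proof.
by move=> sS; apply/matrixP => i j; rewrite !mxE !rho_genE // (gen_coefC hn) //; exact: valP.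
Qed.

Lemma specialize_gen_coef s z y : specialize (gen_coef t eA eD s z y) =
  match gen_kind t s z with
  | DesEqK => (-1) ^+ b * (y == z)%:R
  | AscEqK => - (-1) ^+ b * (y == z)%:R
  | _ => (y == cj s z)%:R
  end.
Proof.
have lb := laurent_bool; have la := laurent_xK_subV; rewrite /gen_coef; case: (gen_kind t s z).
- by rewrite specializeM // eD1 specialize_bool.
- by rewrite specializeM // eA1 specialize_bool.
- by rewrite specialize_bool.
- rewrite specializeD ?specializeM ?specialize_bool ?specialize_xK_subV ?mul0r ?addr0 //; exact: laurentM.
Qed.

(* Twisting by the sign character exchanges the two modules at [x = 1]. *)
Definition conj_sign (z : P n) : rat := (-1) ^+ (b * (lenBig t n z)./2).
Definition length_sign w : rat := (-1) ^+ (b * lenW t n w).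
Definition sign_mx : 'M[rat]_d := diag_mx (Gset_row t conj_sign).
Definition twisted_rep w := length_sign w *: (sign_mx *m spec_rep w *m sign_mx).

Lemma conj_sign_sqr z : conj_sign z * conj_sign z = 1.
Proof. by rewrite -expr2 sqrr_sign. Qed.

Lemma sign_mxK : sign_mx *m sign_mx = 1%:M.
Proof.
apply/matrixP => i j; rewrite mul_diag_mx !mxE.
by case: eqP => [->|_]; rewrite ?mulr0n ?mulr0 // mulr1n conj_sign_sqr.
Qed.

Lemma length_sign1 : length_sign 1%g = 1.
Proof. by rewrite /length_sign /lenW wordlen1 muln0. Qed.

Lemma length_sign_mul_gen s w : s \in SG -> w \in W -> length_sign (permc s w) = (-1) ^+ b * length_sign w.
Proof.
move=> sS wW; have swW := WW_mul_gen hn sS wW; rewrite /length_sign.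
case: (boolP (left_ascent t n s w)) => asc.
  by rewrite (lenW_descent hn sS swW (left_ascent_gen hn sS wW asc)) (gen_mulK hn _ sS) mulnS exprD.
by rewrite [in RHS](lenW_descent hn sS wW asc) mulnS exprD mulrA -expr2 sqrr_sign mul1r.
Qed.

Lemma conj_sign_conj s z : s \in SG -> z \in Gset t n -> moves t s z -> conj_sign (cj s z) = (-1) ^+ b * conj_sign z.
Proof.
move=> sS zG k; have cG := conj_in_Gset hn sS zG k; have [_ des_conj] := gen_kind_conj hn sS zG.
rewrite /conj_sign; case: k => k; first by rewrite (lenBig_conj hn sS zG k) /= mulnS exprD.
have := lenBig_conj hn sS cG (des_conj k); rewrite (conj_genK hn _ sS) => ->.
by rewrite /= mulnS exprD mulrA -expr2 sqrr_sign mul1r.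
Qed.

Lemma twisted_rep1 : twisted_rep 1%g = 1%:M.
Proof. by rewrite /twisted_rep length_sign1 spec_rep1 mulmx1 sign_mxK scale1r. Qed.

Lemma length_sign_gen s : s \in SG -> length_sign s = (-1) ^+ b.
Proof. by move=> sS; have := length_sign_mul_gen sS (WW1 t hn); rewrite length_sign1 mulr1 /permc mul1g. Qed.

Lemma twisted_rep_mul_gen s w : s \in SG -> w \in W -> twisted_rep (permc s w) = twisted_rep s *m twisted_rep w.
Proof.
move=> sS wW; rewrite /twisted_rep spec_rep_mul_gen // length_sign_mul_gen // (length_sign_gen sS).
rewrite -scalemxAl -scalemxAr scalerA; congr (_ *: _).
by rewrite -!mulmxA (mulmxA sign_mx sign_mx) sign_mxK mul1mx.
Qed.

Lemma trmx_twisted_rep_gen s : s \in SG -> (twisted_rep s)^T = twisted_rep s.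
Proof. by move=> sS; rewrite /twisted_rep linearZ /= !trmx_mul tr_diag_mx trmx_spec_rep_gen // mulmxA. Qed.

Lemma twisted_rep_genE s i j : s \in SG -> twisted_rep s i j =
  match gen_kind t s (Gset_enum j) with
  | DesEqK => (Gset_enum i == Gset_enum j)%:R
  | AscEqK => - (Gset_enum i == Gset_enum j)%:R
  | _ => (Gset_enum i == cj s (Gset_enum j))%:R
  end.
Proof.
move=> sS; rewrite /twisted_rep length_sign_gen // mul_mx_diag mul_diag_mx !mxE rho_genE // specialize_gen_coef.
rewrite -/(Gset_enum i) -/(Gset_enum j); set z := Gset_enum j; set y := Gset_enum i.
have b_sqr : (-1) ^+ b * (-1) ^+ b = 1 :> rat by rewrite -expr2 sqrr_sign.
have eta_conj := @conj_sign_conj s z sS (valP _).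
have sandwich r : conj_sign z * r * conj_sign z = r by rewrite mulrAC conj_sign_sqr mul1r.
have conj_case : moves t s z -> (-1) ^+ b * (conj_sign y * (y == cj s z)%:R * conj_sign z) = (y == cj s z)%:R.
  move/eta_conj => eta; case: eqP => [->|_]; last by rewrite mulr0 mul0r mulr0.
  by rewrite eta -!mulrA mulrCA mulrA b_sqr mul1r mul1r conj_sign_sqr.
case k : (gen_kind t s z) conj_case => conj_case; [| | by apply: conj_case; left | by apply: conj_case; right];
  case: eqP => [->|_]; rewrite ?mulr0 ?mul0r ?mulr0 ?oppr0 // mulr1 sandwich.
- exact: b_sqr.
- by rewrite mulrN b_sqr.
Qed.

Lemma twisted_rep_gen_row s Phi j : s \in SG -> (Gset_row t Phi *m twisted_rep s) 0 j =
  match gen_kind t s (Gset_enum j) with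
  | DesEqK => Phi (Gset_enum j)
  | AscEqK => - Phi (Gset_enum j)
  | _ => Phi (cj s (Gset_enum j))
  end.
Proof.
move=> sS; rewrite mxE; under eq_bigr do rewrite mxE twisted_rep_genE //; have zG := valP (enum_val j).
have sum_at (y : P n) r : y \in Gset t n ->
    \sum_(i < d) Phi (Gset_enum i) * (r * (Gset_enum i == y)%:R) = r * Phi y.
  move=> yG; pose k := enum_rank (Gset_elt yG); have kE : Gset_enum k = y by rewrite /Gset_enum enum_rankK.
  rewrite (bigD1 k) //= kE eqxx mulr1 big1 ?addr0 1?mulrC // => i ik.
  by rewrite -kE (inj_eq val_inj) (inj_eq enum_val_inj) (negbTE ik) !mulr0.
case k : (gen_kind t s (Gset_enum j)).
- by rewrite -[RHS]mul1r -sum_at //; apply: eq_bigr => i _; rewrite mul1r.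
- by rewrite -[RHS]mulN1r -sum_at //; apply: eq_bigr => i _; rewrite mulN1r.
- by rewrite -[RHS]mul1r -sum_at ?(conj_in_Gset hn) //; [apply: eq_bigr => i _; rewrite mul1r | left].
- by rewrite -[RHS]mul1r -sum_at ?(conj_in_Gset hn) //; [apply: eq_bigr => i _; rewrite mul1r | right].
Qed.

Lemma spec_rep_faithful (v : {ffun P n -> rat^o}) : annihilating spec_rep v -> v = 0.
Proof.
move=> [v_out v_sum].
have length_sign_sqr w : length_sign w * length_sign w = 1 by rewrite -expr2 sqrr_sign.
pose v' : {ffun P n -> rat^o} := [ffun w => (v w : rat) * length_sign w].
suff /ffunP v'0 : v' = 0.
  apply/ffunP => w; have := v'0 w; rewrite !ffunE => vw0.
  by rewrite -[LHS]mulr1 -(length_sign_sqr w) mulrA vw0 mul0r.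
have twM := rep_permc hn twisted_rep1 twisted_rep_mul_gen.
have tw_tr := trmx_rep_inv hn twisted_rep1 twisted_rep_mul_gen trmx_twisted_rep_gen.
apply: (specialized_faithful hn tn twisted_rep1 twM tw_tr twisted_rep_gen_row); split=> [w wW|].
  by rewrite ffunE v_out // mul0r.
transitivity (sign_mx *m (\sum_(w in W) (v w : rat) *: spec_rep w) *m sign_mx); last first.
  by rewrite v_sum mulmx0 mul0mx.
rewrite mulmx_sumr mulmx_suml; apply: eq_bigr => w _.
by rewrite ffunE /twisted_rep scalerA -mulrA length_sign_sqr mulr1 -scalemxAr -scalemxAl.
Qed.

Lemma spec_rep_free (a : P n -> rat) : \sum_(w in W) a w *: spec_rep w = 0 -> {in W, forall w, a w = 0}.
Proof.
move=> a_sum w wW; pose v : {ffun P n -> rat^o} := [ffun w => if w \in W then a w else 0].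
suff /ffunP/(_ w) : v = 0 by rewrite !ffunE wW.
apply: spec_rep_faithful; split=> [u uW|]; first by rewrite ffunE (negbTE uW).
by rewrite -[RHS]a_sum; apply: eq_bigr => u uW; rewrite ffunE uW.
Qed.

Lemma spec_rep_commutant (C : 'M[rat]_d) : (forall s, s \in SG -> spec_rep s *m C = C *m spec_rep s) -> C^T = C.
Proof.
move=> C_gen; have C_comm := gen_commutant hn spec_rep1 spec_rep_mul_gen C_gen.
have repM := rep_permc hn spec_rep1 spec_rep_mul_gen.
have rep_tr := trmx_rep_inv hn spec_rep1 spec_rep_mul_gen trmx_spec_rep_gen.
have rep_free := spec_rep_free; have few_dims : (d <= #|[set w in W | w^-1%g == w]|)%N.
  by rewrite (leq_trans _ (card_Gset_le hn tn)) // card_sig subset_leq_card //; apply/subsetP.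
move: C_comm repM rep_tr rep_free few_dims; rewrite (WWE t hn) => C_comm repM rep_tr rep_free few_dims.
by apply: (commutant_rep_symmetric _ rep_tr rep_free few_dims) C_comm => u w uG wG; exact: repM.
Qed.

Lemma rho_faithful (f : P n -> K) : (forall v, \sum_(w in W) f w *: rho w v = 0) -> forall w, w \in W -> f w = 0.
Proof.
move=> f_sum w wW; apply: contrapT => /eqP fw_neq0.
pose g u := if u \in W then f u else 0.
have [|c [_ cg_laurent [u cgu_neq0]]] := @exists_primitive_scaling _ g w; first by rewrite /g wW.
suff /ffunP/(_ u) : [ffun u => specialize (c * g u)] = 0 :> {ffun P n -> rat^o}.
  by rewrite !ffunE => cgu0; rewrite cgu0 eqxx in cgu_neq0.
apply: spec_rep_faithful; split=> [u' u'W|].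
  by rewrite ffunE /g (negbTE u'W) mulr0 (specialize_bool false).
apply/matrixP => i j; rewrite summxE mxE.
have := congr1 (fun v : V => specialize (c * v (enum_val i))) (f_sum (bM t n (val (enum_val j)))).
rewrite sum_ffunE ffunE mulr0 (specialize_bool false) mulr_sumr specialize_sum => [|u' u'W]; last first.
  rewrite ffunE mulrA; apply: laurentM; last exact: laurent_rho.
  by have := cg_laurent u'; rewrite /g u'W.
move=> sum0; rewrite -[RHS]sum0; apply: eq_bigr => u' u'W; rewrite !mxE !ffunE mulrA /g u'W.
by symmetry; apply: specializeM; [have := cg_laurent u'; rewrite /g u'W | exact: laurent_rho].
Qed.

Lemma rho_selfadjoint s (u v : V) : s \in SG -> ffun_dot (rho s u) v = ffun_dot u (rho s v).
Proof.
move=> sS; have sL := rho_linear (gen_WW hn sS); rewrite /ffun_dot.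
under eq_bigr do rewrite (linear_coef _ _ sL) mulr_suml.
under [RHS]eq_bigr do rewrite (linear_coef _ _ sL) mulr_sumr.
rewrite exchange_big; apply: eq_bigr => z _; apply: eq_bigr => y _.
by rewrite !rho_genE // (gen_coefC hn) ?(valP y) ?(valP z) // -!mulrA; congr (_ * _); rewrite mulrC.
Qed.

(* A nonzero antisymmetric intertwiner would specialize, after rescaling, to a nonzero
   antisymmetric matrix commuting with [spec_rep], but such matrices are symmetric. *)
Lemma no_antisymmetric_intertwiner (k : {linear V -> V}) :
  (forall s v, s \in SG -> k (rho s v) = rho s (k v)) ->
  (forall u v, ffun_dot (k u) v = - ffun_dot u (k v)) -> forall v, k v = 0.
Proof.
move=> k_comm k_anti v0; apply: contrapT => /eqP kv_neq0.
have [c [ck_laurent /eqP]] := exists_primitive_multiple (linearP k) (ex_intro _ v0 kv_neq0).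
set ck := fun v => c *: k v in ck_laurent *; apply.
have ckL : linear ck by move=> e u w; rewrite /ck linearP scalerDr !scalerA mulrC.
have dot_bM (u : V) (z : G) : ffun_dot u (bM t n (val z)) = u z.
  rewrite /ffun_dot (bigD1 z) //= ffunE eqxx mulr1 big1 ?addr0 // => y yz.
  by rewrite ffunE (inj_eq val_inj) (negbTE yz) mulr0.
have mx_sym : (spec_mx ck)^T = spec_mx ck.
  apply: spec_rep_commutant => s sS; have sW := gen_WW hn sS.
  have ls := laurent_rho sW; rewrite -(spec_mx_comp (rho_linear sW) ls ck_laurent) -(spec_mx_comp ckL ck_laurent ls).
  by apply/matrixP => i j; rewrite !mxE /= /ck (linear_funZ (rho_linear sW)) k_comm.
have mx_anti : (spec_mx ck)^T = - spec_mx ck.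
  have ck_anti (u v : V) : ffun_dot (ck u) v = - ffun_dot u (ck v).
    by rewrite /ck linearZl linearZr /= k_anti mulrN.
  apply/matrixP => i j; rewrite !mxE -(specializeN (ck_laurent _ _)); congr specialize.
  rewrite -[LHS]dot_bM ck_anti ffun_dotC; congr (- _); exact: dot_bM.
have : spec_mx ck + spec_mx ck = 0 by rewrite -{2}mx_sym mx_anti subrr.
by rewrite -mulr2n -scaler_nat => /eqP; rewrite scaler_eq0 pnatr_eq0 => /eqP.
Qed.

Theorem gelfand_of_eigen_rules : gelfandModel W SG (lenW t n) xK rho.
Proof.
apply: (@gelfand_criterion _ _ _ _ _ _ _ _ _ _ _ _ {ffun G -> K^o} rho (@ffun_dot K G)).
- exact: WW1.
- move=> Q Q1 QS; apply: (WW_ind hn) => // s w sS wW desc Qsw.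
  have swW := WW_mul_gen hn sS wW; rewrite -(gen_mulK hn w sS); apply: QS => //.
  by rewrite (lenW_ascent hn sS swW) (left_descent_gen hn sS wW desc).
- by move=> s; exact: gen_WW.
- by move=> s w sS; rewrite (WW_permcE hn) // (gen_WW hn).
- by move=> s w sS; exact: (gen_mulK hn w sS).
- exact: K_sum_sqr_eq0.
- exact: rho_hecke.
- exact: (ffun_dot_anisotropic K_sum_sqr_eq0).
- exact: rho_selfadjoint.
- exact: no_antisymmetric_intertwiner.
- exact: rho_faithful.
Qed.

End GelfandModel.

Theorem mainTheorem2 (t : CoxType) (n : nat) (hn : (2 <= n)%N) :
  (forall s z : P n, s \in Sgen t n -> z \in Gset t n ->
     AscLt t n s z \/ DesLt t n s z -> permc s (permc z s) \in Gset t n) /\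
  ((exists rho, modM t n rho) /\
   (forall rho1 rho2, modM t n rho1 -> modM t n rho2 ->
      forall w, w \in WW t n -> rho1 w =1 rho2 w)) /\
  ((exists rho, modN t n rho) /\
   (forall rho1 rho2, modN t n rho1 -> modN t n rho2 ->
      forall w, w \in WW t n -> rho1 w =1 rho2 w)) /\
  (~ (t = TD /\ ~~ odd n) ->
     (forall rho, modM t n rho -> gelfandModel (WW t n) (Sgen t n) (lenW t n) xK rho) /\
     (forall rho, modN t n rho -> gelfandModel (WW t n) (Sgen t n) (lenW t n) xK rho)).
Proof.
have quadV := mulr_neg_invr_quadratic xK_neq0; have quad := mulr_quadratic xK_neq0.
have laurentV := laurentN laurent_xKV; have laurent := laurent_xK.
split; [|split; [|split]].
- move=> s z sS zG kind; apply: (conj_in_Gset hn sS zG).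
  by case: kind => [/gen_kind_ascLt|/gen_kind_desLt]; [left | right].
- split; first exact: (module_exists t hn quadV quad laurentV laurent).
  by move=> rho1 rho2 [rep1 rules1] [rep2 rules2]; exact: (module_unique hn rep1 rules1 rep2 rules2).
- split; first exact: (module_exists t hn quad quadV laurent laurentV).
  by move=> rho1 rho2 [rep1 rules1] [rep2 rules2]; exact: (module_unique hn rep1 rules1 rep2 rules2).
move=> not_even_D; have odd_D : t = TD -> odd n by move=> tD; apply: contrapT => /negP even_n; apply: not_even_D.
have specializeV : specialize (- xK^-1) = -1 by rewrite (specializeN laurent_xKV) specialize_xKV.
split=> rho [rep rules].
  by apply: (gelfand_of_eigen_rules (b := false) hn odd_D laurentV laurent _ _ rep rules); rewrite ?specialize_xK.
by apply: (gelfand_of_eigen_rules (b := true) hn odd_D laurent laurentV _ _ rep rules); rewrite ?opprK ?specialize_xK.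
Qed.
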